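(* Let $\mathcal G$ be a Beurling system satisfying Axiom A with parameters $\kappa,A,\theta$, and assume $\theta_0=1$. Let $0<\varepsilon<0.01(1-\theta)$. Then there is $x_0(\mathcal G,\varepsilon)$ such that for every $x>x_0$ there exists $\tilde x\in[x^{1-\varepsilon},x]$ with $$|\Delta(\tilde x)|\ge \tilde x\exp\big(-(1+\varepsilon)\omega(\tilde x)\big).$$
   Context: Beurling system: commutative unitary semigroup $\mathcal G$ freely generated by countably many primes, with multiplicative norm $|\cdot|$ such that $\mathcal N(x)=\#\{g:|g|\le x\}$ is finite. Axiom A ($\kappa,A>0$, $0<\theta<1$): $|\mathcal N(x)-\kappa(x-1)|\le Ax^\theta$ for $x\ge1$. $\zeta_{\mathcal G}(s)=\sum_g|g|^{-s}$ extends meromorphically to $\Re s>\theta$ with only a simple pole at $1$; zeroes are taken with real part $>\theta$. $\Delta(x)=\psi(x)-x$, $\psi(x)=\sum_{|g|\le x}\Lambda(g)$, $\Lambda(p^k)=\log|p|$ for primes $p$, $k\ge1$, $\Lambda=0$ otherwise. $\theta_0:=\max(\theta,\sup\{\beta:\zeta_{\mathcal G}(\beta+i\gamma)=0,\theta<\beta<1\})$. $\omega(x):=\inf\{(1-\beta)\log x+\log|\rho|:\ \zeta_{\mathcal G}(\rho)=0,\ \rho=\beta+i\gamma,\ \beta>\theta\}$. *)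

(* Defs.v *)
From HB Require Import structures.
From mathcomp Require Export all_boot all_order all_algebra.
From mathcomp Require Export finmap complex.
From mathcomp Require Export all_classical all_reals all_analysis.
From mathcomp.analysis.showcase Require Import summability.

Set Implicit Arguments.
Unset Strict Implicit.
Unset Printing Implicit Defensive.

Export Order.TTheory GRing.Theory Num.Theory.
Export numFieldNormedType.Exports.

Local Open Scope classical_set_scope.
Local Open Scope ring_scope.

Record beurlingSystem (R : realType) := BeurlingSystem {
  bcarrier :> monoidType;
  bmulC : commutative (fun g h : bcarrier => (g * h)%g);
  bprime : set bcarrier;
  bprime_countable : countable bprime;
  bfactor_exists : forall g : bcarrier, exists2 s : seq bcarrier,
    (forall p, p \in s -> bprime p) & g = (\prod_(p <- s) p)%g;
  bfactor_unique : forall s t : seq bcarrier,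
    (forall p, p \in s -> bprime p) -> (forall p, p \in t -> bprime p) ->
    (\prod_(p <- s) p = \prod_(p <- t) p)%g -> perm_eq s t;
  bnorm : bcarrier -> R;
  bnorm_gt0 : forall g, 0 < bnorm g;
  bnorm1 : bnorm 1%g = 1;
  bnormM : forall g h, bnorm (g * h)%g = bnorm g * bnorm h;
  bnorm_finite : forall x : R, finite_set [set g | bnorm g <= x] }.

Section Beurling.
Variables (R : realType) (G : beurlingSystem R).

Definition bcount (x : R) : nat := #|` fset_set [set g : G | bnorm g <= x]|.

Definition axiomA (kappa A theta : R) : Prop :=
  [/\ 0 < kappa, 0 < A, 0 < theta < 1 &
      forall x, 1 <= x ->
        `|(bcount x)%:R - kappa * (x - 1)| <= A * x `^ theta].

(* Unique factorization makes [p] unique whenever [g = p ^+ k] with [0 < k];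
   when there is none, [xget] returns [1] and the value is [ln 1 = 0]. *)
Definition mangoldt (g : G) : R :=
  ln (bnorm (xget 1%g
    [set p : G | bprime p /\ exists2 k : nat, (0 < k)%N & g = (p ^+ k)%g])).

Definition psi (x : R) : R :=
  \sum_(g \in [set g : G | bnorm g <= x]) mangoldt g.

Definition Delta (x : R) : R := psi x - x.

(* [x ^ s = e ^ (s log x)] for [0 < x]. *)
Definition cpow (x : R) (s : R[i]) : R[i] :=
  let t := complex.Im s * ln x in
  (x `^ complex.Re s)%:C%C * Complex (cos t) (sin t).

(* The convergence in the first clause is unconditional (along the finite
   subsets of the semigroup). The last clause says that the isolated
   singularity at [1] is a simple pole. By the identity theorem these clauses
   determine [Z] at every [s <> 1] with [theta < Re s]; [Z] is unconstrained
   elsewhere, including at the pole, which is why [zeta_zero] excludes [1]. *)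
Definition is_zeta (theta : R) (Z : R[i] -> R[i]) : Prop :=
  [/\ forall s : R[i], 1 < complex.Re s ->
        partial_sum (fun g : G => cpow (bnorm g) (- s)) @ totally
          --> (Z s : R[i]^o),
      forall s : R[i], theta < complex.Re s -> s != 1 ->
        derivable (Z : R[i]^o -> R[i]^o) s 1 &
      exists2 r : R[i], r != 0 &
        (fun s : R[i]^o => (s - 1) * Z s : R[i]^o) @ (1 : R[i]^o)^' --> (r : R[i]^o)].

Definition zeta (theta : R) : R[i] -> R[i] :=
  xget (fun=> 0) [set Z | is_zeta theta Z].

Definition zeta_zero (theta : R) (rho : R[i]) : Prop :=
  [/\ theta < complex.Re rho, rho != 1 & zeta theta rho = 0].

(* When there is no zero in the strip, [sup set0 = 0] and the value is [theta]
   for [0 < theta]. *)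
Definition theta0 (theta : R) : R :=
  Num.max theta
    (sup [set beta | exists2 gamma : R,
       theta < beta < 1 & zeta_zero theta (Complex beta gamma)]).

Definition omega (theta x : R) : R :=
  inf [set (1 - complex.Re rho) * ln x + ln (Normc.normc rho) |
        rho in [set rho : R[i] | zeta_zero theta rho]].

End Beurling.

(* Main.v *)
(* Suppose that Delta is small on [X^(1-eps), X], and write U = log X and
   W = omega X. Take a zero rho with (1 - Re rho) U + log |rho| <= W + 1 and
   expand zeta around s = rho + d, where Re s = 1 + delta and delta = K W / U for
   a large constant K. The coefficient p_j of -zeta'/zeta at s is
   sum_g Lambda(g) (log|g|)^j / j! * |g|^(-s), and for j slightly below K W its
   mass sits on the |g| in [X^(1-eps/4), X]; there summation by parts against
   Delta makes p_j negligible, while the remaining |g| contribute little by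
   Chernoff bounds. On the other hand the Taylor polynomial of zeta at s of
   degree n, with n a small multiple of W, almost vanishes at rho, because
   d = o(1) is small compared to the radius of convergence 1 - theta. A
   polynomial of degree n is not too small on some circle of radius slightly
   larger than d, and on that circle the smallness of the p_j makes its
   logarithmic derivative close to a polynomial; the argument principle then
   forbids the root in the disc. Working with n = o(W) makes every loss of the
   form C^n harmless. *)

(* [omega] enters through one product. Summation by parts costs [|s|], comparable to [|rho|], and
   comparing [d^j] with [delta^j], where [d = delta + (1 - Re rho)] and [j <= K W], costs
   [exp ((1 - Re rho) U)]: together at most [exp (W + 1)] up to constants, against the saving
   [exp (- (1 + eps/2) W)] from [Delta]. Concavity of [omega] in [log x] replaces [omega] on the
   window by [W]. The margin left is a fixed power of [y = exp (sigma W)], [sigma = eps/32], which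
   absorbs powers of [W] and [C^n]. Constants are chosen in the order [a = eps/64]; [K = 40/a^2], so
   that Chernoff saves [exp (- 40 W)]; [tau], the relative width of the annulus; [nu], with [n]
   about [nu W]; only then the bound on [delta]. The crude bound [(32/delta)^(j+1)] for the other
   [p_j] loses [128^m = exp (O (K W))], too much for [y]; but the Taylor terms beyond [n] gain
   [(4 delta/r)^n], and this wins because [theta0 = 1] makes [W/U], hence [delta], tend to 0. As
   [zeta] is a chosen function, an explicit continuation is built and identified with it. *)
Require Import Defs.
From mathcomp Require Import ring lra.
From mathcomp Require Import cyclic separable cyclotomic.
From mathcomp.analysis.showcase Require Import summability.

Set Implicit Arguments.
Unset Strict Implicit.
Unset Printing Implicit Defensive.

Local Open Scope classical_set_scope.
Local Open Scope ring_scope.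

(** * Complex moduli *)

Notation cabs := Normc.normc.

Section ComplexModulus.
Variable R : realType.
Implicit Types (z w : R[i]) (x : R).

Lemma cabsE z : `|z| = (cabs z)%:C%C.
Proof. by rewrite normc_def; case: z. Qed.

Lemma cabs_ge0 z : 0 <= cabs z.
Proof. by case: z => a b /=; rewrite sqrtr_ge0. Qed.

Lemma cabsM z w : cabs (z * w) = cabs z * cabs w.
Proof. exact: Normc.normcM. Qed.

Lemma cabsD z w : cabs (z + w) <= cabs z + cabs w.
Proof. exact: le_normcD. Qed.

Lemma cabsN z : cabs (- z) = cabs z.
Proof. exact: normcN. Qed.

Lemma cabsV z : cabs z^-1 = (cabs z)^-1.
Proof. exact: Normc.normcV. Qed.

Lemma cabs0 : cabs 0 = 0 :> R.
Proof. exact: Normc.normc0. Qed.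

Lemma cabs1 : cabs 1 = 1 :> R.
Proof. exact: Normc.normc1. Qed.

Lemma cabs_real x : cabs x%:C%C = `|x|.
Proof. by rewrite /= expr0n /= addr0 sqrtr_sqr. Qed.

Lemma cabs_eq0 z : (cabs z == 0) = (z == 0).
Proof. by apply/eqP/eqP => [/Normc.eq0_normc|->]; rewrite ?cabs0. Qed.

Lemma cabs_gt0 z : (0 < cabs z) = (z != 0).
Proof. by rewrite lt_def cabs_eq0 cabs_ge0 andbT. Qed.

Lemma cabsX z n : cabs (z ^+ n) = cabs z ^+ n.
Proof. by elim: n => [|n IH]; rewrite ?cabs1// !exprS cabsM IH. Qed.

Lemma cabsB z w : cabs (z - w) = cabs (w - z).
Proof. by rewrite -cabsN opprB. Qed.

Lemma cabs_nat n : cabs n%:R = n%:R :> R.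
Proof. by rewrite -[n%:R](rmorph_nat (real_complex R)) cabs_real ger0_norm. Qed.

Lemma Re_le_cabs z : `|complex.Re z| <= cabs z.
Proof.
case: z => a b /=; rewrite -sqrtr_sqr ler_sqrt ?addr_ge0 ?sqr_ge0//.
by rewrite lerDl sqr_ge0.
Qed.

Lemma Im_le_cabs z : `|complex.Im z| <= cabs z.
Proof.
case: z => a b /=; rewrite -sqrtr_sqr ler_sqrt ?addr_ge0 ?sqr_ge0//.
by rewrite lerDr sqr_ge0.
Qed.

Lemma cabs_le_ReIm z : cabs z <= `|complex.Re z| + `|complex.Im z|.
Proof.
case: z => a b; have -> : Complex a b = Complex a 0 + Complex 0 b.
  by apply/eqP; rewrite eq_complex /= addr0 add0r !eqxx.
by apply: le_trans (cabsD _ _) _; rewrite /= !expr0n /= !(addr0, add0r) !sqrtr_sqr.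
Qed.

Lemma cabs_sub_lb z w : cabs z - cabs w <= cabs (z - w).
Proof. by rewrite lerBlDr -{1}(subrK w z) cabsD. Qed.

Lemma cabs_sum (I : Type) (r : seq I) (P : pred I) (F : I -> R[i]) :
  cabs (\sum_(i <- r | P i) F i) <= \sum_(i <- r | P i) cabs (F i).
Proof.
apply: (big_ind2 (fun z x => cabs z <= x)) => [|z x w y hz hw|//].
  by rewrite cabs0.
by apply: le_trans (cabsD _ _) _; apply: lerD.
Qed.

Lemma cabs_prod (I : Type) (r : seq I) (P : pred I) (F : I -> R[i]) :
  cabs (\prod_(i <- r | P i) F i) = \prod_(i <- r | P i) cabs (F i).
Proof. by apply: (big_morph _ cabsM cabs1). Qed.

Lemma ReD z w : complex.Re (z + w) = complex.Re z + complex.Re w.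
Proof. by case: z; case: w. Qed.
Lemma ImD z w : complex.Im (z + w) = complex.Im z + complex.Im w.
Proof. by case: z; case: w. Qed.
Lemma ReN z : complex.Re (- z) = - complex.Re z.
Proof. by case: z. Qed.
Lemma ImN z : complex.Im (- z) = - complex.Im z.
Proof. by case: z. Qed.
Lemma ReB z w : complex.Re (z - w) = complex.Re z - complex.Re w.
Proof. by rewrite ReD ReN. Qed.
Lemma ImB z w : complex.Im (z - w) = complex.Im z - complex.Im w.
Proof. by rewrite ImD ImN. Qed.
Lemma ReM z w : complex.Re (z * w) =
  complex.Re z * complex.Re w - complex.Im z * complex.Im w.
Proof. by case: z; case: w. Qed.
Lemma ImM z w : complex.Im (z * w) =
  complex.Re z * complex.Im w + complex.Im z * complex.Re w.
Proof. by case: z => a b; case: w => c d. Qed.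

Lemma complex_ext z w : complex.Re z = complex.Re w ->
  complex.Im z = complex.Im w -> z = w.
Proof. by case: z; case: w => a b c d /= -> ->. Qed.

Lemma Re_sum (I : Type) (r : seq I) (P : pred I) (F : I -> R[i]) :
  complex.Re (\sum_(i <- r | P i) F i) = \sum_(i <- r | P i) complex.Re (F i).
Proof. exact: (big_morph (@complex.Re R) ReD). Qed.

Lemma Im_sum (I : Type) (r : seq I) (P : pred I) (F : I -> R[i]) :
  complex.Im (\sum_(i <- r | P i) F i) = \sum_(i <- r | P i) complex.Im (F i).
Proof. exact: (big_morph (@complex.Im R) ImD). Qed.

End ComplexModulus.

Arguments Normc.normc : simpl never.

(** * A discrete argument principle *)

Section ArgumentPrinciple.
Variable R : realType.
Implicit Types (z w : R[i]) (r x : R).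

(** [X^n - 1] splits over the algebraically closed field and is separable in characteristic 0, so
    there are [n] distinct roots, among which one has exact order [n]. *)
Lemma complex_prim_root n : (0 < n)%N -> exists z : R[i], n.-primitive_root z.
Proof.
move=> n_gt0; pose p : {poly R[i]} := 'X^n - 1.
have [r Dp] := closed_field_poly_normal p.
move: Dp; rewrite (monicP _) ?monicXnsubC // scale1r => Dp.
have rn1: all n.-unity_root r.
  by apply/allP => z; rewrite unity_rootE -root_prod_XsubC -Dp rootE !hornerE subr_eq0.
have sz_r: (n < (size r).+1)%N by rewrite -(size_prod_XsubC r id) -Dp size_XnsubC.
have [|z] := hasP (has_prim_root n_gt0 rn1 _ sz_r); last by exists z.
by rewrite -separable_prod_XsubC -Dp separable_Xn_sub_1 // pnatr_eq0 -lt0n.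
Qed.

Lemma sum_unity_root_exp n (u : R[i]) : u ^+ n = 1 -> u != 1 ->
  \sum_(l < n) u ^+ l = 0.
Proof.
move=> un u1; apply: (mulfI (x := u - 1)); first by rewrite subr_eq0.
by rewrite mulr0 -subrX1 un subrr.
Qed.

(* Logarithmic derivative of [X ^ n - r ^ n], evaluated at [w]. *)
Lemma sum_prim_root_frac n (z r w : R[i]) : n.-primitive_root z -> r != 0 ->
  w ^+ n != r ^+ n ->
  \sum_(l < n) r * z ^+ l / (r * z ^+ l - w) = n%:R / (1 - (w / r) ^+ n).
Proof.
move=> zn r0 wr.
have n0 := prim_order_gt0 zn.
have z0 l : r * z ^+ l - w != 0.
  apply: contra wr; rewrite subr_eq0 => /eqP <-.
  by rewrite exprMn exprAC (prim_expr_order zn) expr1n mulr1.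
have [u uE] : exists u, u = w / r by exists (w / r).
rewrite -uE.
have u1 : 1 - u ^+ n != 0.
  rewrite subr_eq0 eq_sym uE expr_div_n; apply: contra wr => /eqP e.
  by rewrite -[w ^+ n](divfK (expf_neq0 n r0)) e mul1r.
(* geometric expansion: 1/(1 - u z^-l) = sum_k u^k z^(-lk) / (1 - u^n) *)
have E l : r * z ^+ l / (r * z ^+ l - w) =
    (\sum_(k < n) u ^+ k * ((z ^+ l)^-1) ^+ k) / (1 - u ^+ n).
  have zl0 : z ^+ l != 0.
    by rewrite expf_neq0// (prim_root_eq0 zn) -lt0n.
  apply: (mulIf u1); rewrite divfK//.
  have -> : r * z ^+ l / (r * z ^+ l - w) = (1 - u * (z ^+ l)^-1)^-1.
    have h : 1 - u / z ^+ l = (r * z ^+ l - w) / (r * z ^+ l).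
      by rewrite uE; field; rewrite r0 zl0.
    by rewrite h invf_div.
  have v1 : 1 - u / z ^+ l != 0.
    have h : 1 - u / z ^+ l = (r * z ^+ l - w) / (r * z ^+ l).
      by rewrite uE; field; rewrite r0 zl0.
    by rewrite h mulf_neq0// invr_eq0 mulf_neq0.
  apply: (mulfI v1); rewrite mulrA divff// mul1r.
  rewrite (eq_bigr (fun k : 'I_n => (u / z ^+ l) ^+ k)); last first.
    by move=> k _; rewrite exprMn.
  rewrite -[LHS]opprK -[RHS]opprK; congr (- _).
  rewrite -mulNr !opprB -subrX1 exprMn exprVn exprAC (prim_expr_order zn).
  by rewrite expr1n invr1 mulr1.
under eq_bigr do rewrite E.
rewrite -mulr_suml; congr (_ / _).
(* Orthogonality of the roots of unity: after the exchange only the exponent [k = 0] survives. *)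
rewrite exchange_big /= (bigD1 (Ordinal n0)) //= [X in _ + X]big1 ?addr0; last first.
  move=> k kn0; rewrite -mulr_sumr.
  have k0 : (0 < k)%N by rewrite lt0n.
  rewrite (eq_bigr (fun l : 'I_n => ((z ^+ k)^-1) ^+ l)); last first.
    by move=> l _; rewrite -!exprVn -!exprM mulnC.
  rewrite sum_unity_root_exp ?mulr0// ?exprVn 1?exprAC ?(prim_expr_order zn).
    by rewrite expr1n invr1.
  by rewrite invr_eq1 -(prim_order_dvd zn) gtnNdvd.
by under eq_bigr do rewrite !expr0 mulr1; rewrite sumr_const card_ord.
Qed.


Lemma deriv_over_prod_XsubC (s : seq R[i]) z : z \notin s ->
  (\prod_(w <- s) ('X - w%:P))^`().[z] =
  (\prod_(w <- s) ('X - w%:P)).[z] * \sum_(w <- s) (z - w)^-1.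
Proof.
elim: s => [|w s IH]; first by rewrite !big_nil -polyC1 derivC horner0 mulr0.
rewrite inE negb_or => /andP[zw zs].
rewrite !big_cons derivM derivXsubC !hornerE IH//.
have zw0 : z - w != 0 by rewrite subr_eq0.
by field.
Qed.

(** Meant for the ratios [|w| / r] of the roots to the radius of the circle, none of which is 1. The
    growing case is Bernoulli's inequality; the decaying one follows by inversion. *)
Lemma expr_eventually_far (a eta : R) : 0 <= a -> a != 1 -> 0 < eta ->
  exists N0, forall N, (N0 <= N)%N -> a ^+ N <= eta \/ eta^-1 <= a ^+ N.
Proof.
move=> a0 a1 eta0.
have H b : 1 < b -> exists N0, forall N, (N0 <= N)%N -> eta^-1 <= b ^+ N.
  move=> b1; pose x := eta^-1 / (b - 1).
  have x0 : 0 <= x by rewrite divr_ge0 ?invr_ge0 ?ltW// subr_gt0.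
  exists (Num.truncn x).+1 => N hN.
  have h : x <= N%:R.
    by apply: le_trans (ltW (truncnS_gt x)) _; rewrite ler_nat.
  have bern n : 1 + n%:R * (b - 1) <= b ^+ n.
    elim: n => [|n IH]; first by rewrite mul0r addr0.
    rewrite exprS; apply: (@le_trans _ _ (b * (1 + n%:R * (b - 1)))).
      rewrite -natr1; have := mulr_ge0 (ler0n R n) (sqr_ge0 (b - 1)).
      by rewrite expr2; lra.
    by rewrite ler_wpM2l//; lra.
  apply: le_trans (bern N); apply: (@le_trans _ _ (x * (b - 1))).
    by rewrite /x divfK// subr_eq0 gt_eqF.
  have : x * (b - 1) <= N%:R * (b - 1) by rewrite ler_wpM2r// subr_ge0 ltW.
  by move=> ?; lra.
have [a_eq0|a_neq0] := eqVneq a 0.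
  by exists 1%N => N hN; left; rewrite a_eq0 expr0n gtn_eqF//= ltW.
have a_gt0 : 0 < a by rewrite lt_def a_neq0.
have [lt1|gt1|] := ltgtP a 1; last by move/eqP; rewrite (negbTE a1).
  have [|N0 HN0] := H a^-1; first by rewrite invf_gt1.
  exists N0 => N /HN0 h; left.
  by rewrite -lef_pV2 ?posrE ?exprn_gt0// -exprVn.
by have [N0 HN0] := H a gt1; exists N0 => N /HN0; right.
Qed.

Lemma exprs_eventually_far (s : seq R) (eta : R) :
  (forall a, a \in s -> 0 <= a /\ a != 1) -> 0 < eta ->
  exists N0, forall N, (N0 <= N)%N -> forall a, a \in s ->
    a ^+ N <= eta \/ eta^-1 <= a ^+ N.
Proof.
move=> + eta0; elim: s => [|a s IH] hs; first by exists 0%N.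
have [|N0 HN0] := IH.
  by move=> b bs; apply: hs; rewrite inE bs orbT.
have [a0 a1] := hs a (mem_head _ _).
have [N1 HN1] := expr_eventually_far a0 a1 eta0.
exists (maxn N0 N1) => N; rewrite geq_max => /andP[h0 h1] b.
by rewrite inE => /orP[/eqP ->|bs]; [exact: HN1|exact: HN0].
Qed.

(* A discrete argument principle: the mean over [N]-th roots of [r ^ N] of
   [z P'(z) / P(z)] tends to the number of roots in the disc, while the mean of
   [z c(z)] vanishes. *)
Lemma no_root_in_disc (P c : {poly R[i]}) (r : R) w0 : 0 < r ->
  (forall z, cabs z = r -> P.[z] != 0) ->
  (forall z, cabs z = r ->
    r * cabs (P^`().[z] - P.[z] * c.[z]) <= cabs P.[z] / 2) ->
  cabs w0 < r -> P.[w0] != 0.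
Proof.
move=> r0 Pn0 hE w0r; apply/negP => /eqP Pw0.
have rC0 : r%:C%C != 0 :> R[i] by rewrite -cabs_eq0 cabs_real normr_eq0 gt_eqF.
have [s Ps] := closed_field_poly_normal P.
have P0 : P != 0.
  by apply: contraNneq (Pn0 r%:C%C _) => [->|]; rewrite ?horner0// cabs_real gtr0_norm.
have lc0 : lead_coef P != 0 by rewrite lead_coef_eq0.
have w0s : w0 \in s.
  move: Pw0; rewrite Ps hornerZ => /eqP; rewrite mulf_eq0 (negbTE lc0) /=.
  by rewrite -rootE root_prod_XsubC.
have sr w : w \in s -> cabs w != r.
  move=> ws; apply/eqP => /Pn0; rewrite Ps hornerZ mulf_eq0 negb_or => /andP[_].
  by rewrite -rootE root_prod_XsubC ws.
(* Each root will contribute its limit 0 or 1 up to [1 / M], and [M] is taken so that all these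
   errors sum to at most 1/4; [eta = 1 / (M + 1)] is the size of [(w / r)^N] that guarantees
   this. *)
pose M : R := 4 * (size s).+1%:R; pose eta := (M + 1)^-1.
have M0 : 4 <= M.
  by rewrite /M -natr1; have : 0 <= (size s)%:R :> R by []; lra.
have eta0 : 0 < eta by rewrite invr_gt0; lra.
have [|N0 HN0] := @exprs_eventually_far [seq cabs w / r | w <- s] eta _ eta0.
  move=> _ /mapP[w ws ->]; rewrite divr_ge0 ?cabs_ge0 ?(ltW r0)//; split=> //.
  apply: contraNneq (sr _ ws) => h.
  by rewrite (divr1_eq h).
(* [N] also exceeds the number of coefficients of [c], so that [z c(z)] has exact mean 0 over the
   [N]-th roots of [r^N]. *)
pose N := (maxn N0 (size c)).+2.
have N_gt0 : (0 < N)%N by [].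
have NN0 : (N0 <= N)%N by rewrite /N -addn2; apply: leq_trans (leq_maxl _ (size c)) (leq_addr _ _).
have Nc : (size c < N)%N by rewrite /N ltnS; apply: leq_trans (leq_maxr N0 _) (leqnSn _).
have [z zN] := complex_prim_root N_gt0.
pose y (l : nat) := r%:C%C * z ^+ l.
have cabsz l : cabs (z ^+ l) = 1.
  apply/eqP; rewrite -(@pexpr_eq1 _ _ N) ?cabs_ge0// -cabsX.
  by rewrite exprAC (prim_expr_order zN) expr1n cabs1.
have cabsy l : cabs (y l) = r by rewrite /y cabsM cabs_real cabsz mulr1 gtr0_norm.
have ys l : y l \notin s by apply/negP => /sr; rewrite cabsy eqxx.
have PE l : P^`().[y l] = P.[y l] * \sum_(w <- s) (y l - w)^-1.
  rewrite Ps derivZ !hornerZ deriv_over_prod_XsubC//; ring.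
(* The contribution of a root: near 1 for [|w| < r], near 0 for [|w| > r]. *)
pose T w := (1 - (w / r%:C%C) ^+ N)^-1.
have sumT : \sum_(l < N) y l * (P^`().[y l] / P.[y l]) = N%:R * \sum_(w <- s) T w.
  under eq_bigr => l _.
    rewrite PE [P.[_] * _]mulrC mulfK ?Pn0// mulr_sumr; over.
  rewrite exchange_big mulr_sumr /=; apply: eq_big_seq => w ws.
  rewrite /y (sum_prim_root_frac zN) //.
  apply/eqP => /(congr1 (@Normc.normc R)); rewrite !cabsX cabs_real gtr0_norm// => /eqP.
  by rewrite eqrXn2 ?cabs_ge0 ?(ltW r0)// (negbTE (sr _ ws)).
have sumc : \sum_(l < N) y l * c.[y l] = 0.
  under eq_bigr do rewrite horner_coef mulr_sumr.
  rewrite exchange_big big1 //= => k _.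
  under eq_bigr => l _.
    rewrite mulrCA -exprS /y exprMn exprAC mulrA; over.
  rewrite -mulr_sumr.
  rewrite (eq_bigr (fun l : 'I_N => (z ^+ k.+1) ^+ l)); last first.
    by move=> l _; rewrite -!exprM mulnC.
  rewrite sum_unity_root_exp ?mulr0 1?exprAC ?(prim_expr_order zN) ?expr1n//.
  rewrite -(prim_order_dvd zN) gtnNdvd//.
  by apply: leq_trans Nc; rewrite ltnS.
have NR0 : N%:R != 0 :> R[i] by rewrite pnatr_eq0.
have up : cabs (\sum_(w <- s) T w) <= 1 / 2.
  have -> : \sum_(w <- s) T w =
      N%:R^-1 * \sum_(l < N) y l * ((P^`().[y l] - P.[y l] * c.[y l]) / P.[y l]).
    apply: (mulfI NR0); rewrite mulrA divff// mul1r -sumT.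
    transitivity (\sum_(l < N) y l * (P^`().[y l] / P.[y l]) -
      \sum_(l < N) y l * c.[y l]); first by rewrite sumc subr0.
    rewrite -sumrB.
    apply: eq_bigr => l _; rewrite -mulrBr; congr (_ * _).
    by rewrite mulrBl [P.[_] * c.[_]]mulrC mulfK// Pn0.
  rewrite cabsM cabsV cabs_nat ler_pdivrMl ?ltr0n//.
  apply: le_trans (cabs_sum _ _ _) _.
  apply: (@le_trans _ _ (\sum_(l < N) 1 / 2)); last first.
    by rewrite sumr_const card_ord [leRHS]mulr_natl.
  apply: ler_sum => l _; rewrite cabsM cabsy cabsM cabsV mulrA.
  rewrite ler_pdivrMr ?cabs_gt0 ?Pn0//.
  by have := hE (y l) (cabsy l); lra.
have lowT w : w \in s -> - (1 / M) <= complex.Re (T w) /\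
    (cabs w < r -> 1 - 1 / M <= complex.Re (T w)).
  move=> ws; set x := (w / r%:C%C) ^+ N.
  have cx : cabs x = (cabs w / r) ^+ N by rewrite cabsX cabsM cabsV cabs_real gtr0_norm.
  have := HN0 N NN0 _ (map_f (fun w => cabs w / r) ws); rewrite -cx => hx.
  have M1 : (M + 1)^-1 < 1 by rewrite invf_lt1; lra.
  have x1 : 0 < cabs (1 - x).
    rewrite cabs_gt0 subr_eq0; apply/eqP => /(congr1 (@Normc.normc R)); rewrite cabs1 => e.
    by case: hx; rewrite -e /eta; lra.
  have small : cabs x <= eta -> 1 - 1 / M <= complex.Re (T w).
    move=> xs.
    have -> : T w = 1 + x / (1 - x) by rewrite /T -/x; field; rewrite -cabs_gt0.
    have h : cabs (x / (1 - x)) <= 1 / M.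
      rewrite cabsM cabsV ler_pdivrMr//.
      have : 1 - cabs x <= cabs (1 - x) by have := cabs_sub_lb 1 x; rewrite cabs1.
      have hM : eta * (M + 1) = 1 by rewrite /eta mulVf//; lra.
      move=> h; rewrite mulrC mulrA ler_pdivlMr; last by lra.
      nra.
    have := Re_le_cabs (x / (1 - x)); rewrite ler_norml => /andP[h1 _].
    by rewrite ReD /=; lra.
  have large : eta^-1 <= cabs x -> - (1 / M) <= complex.Re (T w).
    rewrite /eta invrK => xl.
    have h : cabs (T w) <= 1 / M.
      rewrite /T -/x cabsV div1r lef_pV2 ?posrE//; last by lra.
      by have := cabs_sub_lb x 1; rewrite cabs1 cabsB; lra.
    have := Re_le_cabs (T w); rewrite ler_norml => /andP[h1 _]; lra.
  have M4 : 1 / M <= 1 / 4 by rewrite !div1r lef_pV2 ?posrE//; lra.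
  split; first by case: hx => [/small|/large]; lra.
  move=> wr; case: hx => [/small //|]; rewrite /eta invrK cx => h.
  exfalso; have : (cabs w / r) ^+ N <= 1.
    by rewrite exprn_ile1 ?divr_ge0 ?cabs_ge0 ?(ltW r0)// ler_pdivrMr// mul1r ltW.
  by lra.
(* The root [w0] alone pushes the sum to at least 3/4, against the bound 1/2 in [up]. *)
have : 3 / 4 <= complex.Re (\sum_(w <- s) T w).
  rewrite (big_rem w0)//= ReD Re_sum.
  have [_ /(_ w0r) h0] := lowT _ w0s.
  have : - ((size s)%:R * (1 / M)) <= \sum_(w <- rem w0 s) complex.Re (T w).
    apply: (@le_trans _ _ (\sum_(w <- rem w0 s) (- (1 / M)))); last first.
      rewrite big_seq [leRHS]big_seq; apply: ler_sum => w /mem_rem ws.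
      by case: (lowT _ ws).
    rewrite big_const_seq count_predT iter_addr_0 mulNrn lerN2 -[leLHS]mulr_natl.
    rewrite ler_wpM2r//; first by rewrite divr_ge0//; lra.
    by rewrite ler_nat size_rem// leq_pred.
  have : (size s).+1%:R * (1 / M) = 1 / 4.
    have : (size s).+1%:R != 0 :> R by rewrite pnatr_eq0.
    by rewrite /M; move: (_.+1%:R) => t t0; field.
  by rewrite -natr1 mulrDl mul1r; lra.
have := Re_le_cabs (\sum_(w <- s) T w); rewrite ler_norml => /andP[_ h].
by lra.
Qed.

End ArgumentPrinciple.

(** * Polynomials on circles *)

Section CircleLowerBound.
Variable R : realType.
Implicit Types (r x h d tau : R).

Lemma coef_XaddC_exp (h : R) i k :
  (('X + h%:P) ^+ i : {poly R})`_k = h ^+ (i - k) *+ 'C(i, k).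
Proof.
rewrite addrC exprDn coef_sum.
under eq_bigr do rewrite -polyC_exp coefMn coefCM coefXn.
have [ki|ik] := ltnP k i.+1; last first.
  rewrite bin_small// mulr0n big1// => j _.
  by rewrite (gtn_eqF (leq_trans (ltn_ord j) ik)) mulr0 mul0rn.
rewrite (bigD1 (Ordinal ki))//= eqxx mulr1 big1 ?addr0// => j jk.
rewrite (_ : (k == j) = false) ?mulr0 ?mul0rn//.
by apply: contra_neqF jk => /eqP kj; apply: val_inj.
Qed.

(** The [n]-th finite difference with step [h] of a polynomial of degree [n] is [n! h^n] times its
    leading coefficient, and each difference at most doubles the bound on the grid. *)
Lemma finite_difference_coef n (q : {poly R}) (x h B : R) :
  (size q <= n.+1)%N -> (forall i, (i <= n)%N -> `|q.[x + i%:R * h]| <= B) ->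
  `|q`_n| * (n`!%:R * `|h| ^+ n) <= 2 ^+ n * B.
Proof.
elim: n q B => [|n IH] q B sq hB.
  have := hB 0%N (leqnn 0); rewrite mul0r addr0 (size1_polyC sq) hornerC coefC /=.
  by rewrite fact0 !expr0 !mulr1 mul1r.
pose q1 := q \Po ('X + h%:P) - q.
have q1E k : q1`_k = \sum_(i < n.+2) q`_i * (h ^+ (i - k) *+ 'C(i, k)) - q`_k.
  rewrite /q1 coefB comp_polyE coef_sum; congr (_ - _).
  rewrite (big_ord_widen n.+2 (fun i => (q`_i *: ('X + h%:P) ^+ i)`_k) sq) big_mkcond /=.
  apply: eq_bigr => i _; rewrite coefZ coef_XaddC_exp; case: ltnP => // si.
  by rewrite nth_default ?mul0r.
have q1n : q1`_n = n.+1%:R * h * q`_n.+1.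
  rewrite q1E 2!big_ord_recr /= big1 ?add0r; last first.
    by move=> i _; rewrite bin_small// mulr0n mulr0.
  rewrite binn subnn expr0 mulr1n mulr1 binSn subSnn expr1 -mulr_natl; ring.
have sq1 : (size q1 <= n.+1)%N.
  apply/leq_sizeP => j nj; rewrite q1E.
  rewrite big_ord_recr /= big1 ?add0r; last first.
    by move=> i _; rewrite bin_small ?mulr0n ?mulr0// (leq_trans (ltn_ord i)).
  move: nj; rewrite leq_eqVlt => /orP[/eqP <-|nj].
    by rewrite binn subnn expr0 mulr1n mulr1 subrr.
  by rewrite bin_small// mulr0n mulr0 nth_default ?subr0// (leq_trans sq).
have hq1 i : (i <= n)%N -> `|q1.[x + i%:R * h]| <= 2 * B.
  move=> ni; rewrite /q1 hornerD hornerN horner_comp !hornerE.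
  have -> : x + i%:R * h + h = x + i.+1%:R * h by rewrite -natr1; ring.
  apply: le_trans (ler_normB _ _) _.
  by have := hB _ (leqW ni); have := hB i.+1 ni; lra.
have := IH q1 (2 * B) sq1 hq1; rewrite q1n factS natrM !exprS !normrM normr_nat.
move=> H; rewrite [leRHS](_ : _ = 2 ^+ n * (2 * B)); last by ring.
by apply: le_trans H; rewrite le_eqVlt; apply/orP; left; apply/eqP; ring.
Qed.

(** A weak form of Stirling's formula; the induction step is [(1 + 1/(n+1))^(n+1) <= e]. *)
Lemma expn_le_fact_expR n : (n.+1%:R) ^+ n <= n`!%:R * expR (1 : R) ^+ n.+1.
Proof.
elim: n => [|n IH]; first by rewrite expr0 fact0 mul1r expr1 -expR0 ler_expR.
have n0 : 0 < n.+1%:R :> R by [].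
have -> : n.+2%:R = n.+1%:R * (1 + n.+1%:R^-1) :> R.
  by rewrite mulrDr mulr1 divff ?gt_eqF// natr1.
rewrite exprMn exprS factS natrM [_ ^+ n.+2]exprSr.
have h : (1 + n.+1%:R^-1) ^+ n.+1 <= expR (1 : R).
  have -> : expR (1 : R) = expR n.+1%:R^-1 ^+ n.+1.
    by rewrite -expRM_natl mulfV// gt_eqF.
  by rewrite lerXn2r ?nnegrE ?expR_ge0 ?addr_ge0 ?expR_ge1Dx// invr_ge0.
rewrite -!mulrA ler_pM2l// mulrA; apply: ler_pM => //.
Qed.

(** A monic polynomial cannot be small at [n + 1] equidistant points, because its [n]-th difference
    is [n! h^n]. *)
Lemma prod_dist_grid n (a : seq R) (x h : R) : size a = n -> 0 < h ->
  exists2 i, (i <= n)%N &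
    n`!%:R * (h / 2) ^+ n <= \prod_(y <- a) `|x + i%:R * h - y|.
Proof.
move=> an h0; apply: contrapT => hN.
pose q : {poly R} := \prod_(y <- a) ('X - y%:P).
have sq : size q = n.+1 by rewrite size_prod_XsubC an.
have qn : q`_n = 1.
  by have := monic_prod_XsubC a predT id; rewrite monicE lead_coefE sq => /eqP.
have hq (z : R) : `|q.[z]| = \prod_(y <- a) `|z - y|.
  rewrite horner_prod normr_prod; apply: eq_bigr => y _.
  by rewrite !hornerE.
pose B := \big[Order.max/0]_(i < n.+1) `|q.[x + i%:R * h]|.
have B1 : B < n`!%:R * (h / 2) ^+ n.
  have p0 : 0 < n`!%:R * (h / 2) ^+ n by rewrite mulr_gt0 ?ltr0n ?fact_gt0// exprn_gt0// divr_gt0.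
  rewrite /B; elim/big_ind : _ => // [u v|i _]; first by rewrite gt_max => -> ->.
  rewrite hq ltNge; apply/negP => hi; apply: hN; exists i => //.
  by rewrite -ltnS.
have qB i : (i <= n)%N -> `|q.[x + i%:R * h]| <= B.
  move=> ni; have := @le_bigmax _ R 'I_n.+1 0 (fun i => `|q.[x + i%:R * h]|) (Ordinal (ni : (i < n.+1)%N)).
  exact.
have := @finite_difference_coef n q x h B _ qB; rewrite sq => /(_ (leqnn _)).
rewrite qn normr1 mul1r (gtr0_norm h0) leNgt => /negP; apply.
rewrite -ltr_pdivlMl ?exprn_gt0//; apply: lt_le_trans B1 _.
by rewrite expr_div_n le_eqVlt; apply/orP; left; apply/eqP; ring.
Qed.

(** A Cartan-type estimate. On [|z| = r] each factor is at least [| r - |w| |], so it suffices to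
    find one radius in a short interval at which the real polynomial with roots [|w|] is not small.
    The loss depends on [n] and [tau] only, not on [d]. *)
Lemma circle_lower_bound (P : {poly R[i]}) n d tau : (size P <= n.+1)%N ->
  P.[0] != 0 -> 0 < d -> 0 < tau <= 1 ->
  exists2 r, d < r <= d * (1 + tau) & forall z, cabs z = r ->
    cabs P.[0] * (expR (-1) * (tau / 8 * expR (-1)) ^+ n) <= cabs P.[z].
Proof.
move=> sP P0 d0 /andP[tau0 tau1].
have [s Ps] := closed_field_poly_normal P.
have Pn0 : P != 0 by apply: contraNneq P0 => ->; rewrite horner0.
have lc0 : lead_coef P != 0 by rewrite lead_coef_eq0.
pose m := size s.
have mn : (m <= n)%N.
  by have := sP; rewrite Ps size_scale// size_prod_XsubC ltnS.
have s0 w : w \in s -> 0 < cabs w.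
  move=> ws; rewrite cabs_gt0; apply: contraNneq P0 => w0.
  by rewrite -rootE Ps rootZ// root_prod_XsubC -w0.
(* Moduli are cut off at [4 d]: a root farther out satisfies [|z - w| >= |w| (4 d - r) / (4 d)],
   hence is covered by the same normalized factor, and remote roots cost no more than near ones. *)
pose a := [seq Num.min (cabs w) (4 * d) | w <- s].
(* The grid is [d + h, ..., d + (m + 1) h = d (1 + tau)]; its first point lies strictly beyond
   [d]. *)
pose h := d * tau / m.+1%:R.
have m0 : 0 < m.+1%:R :> R by [].
have h0 : 0 < h by rewrite divr_gt0// mulr_gt0.
have [i im hi] := @prod_dist_grid m a (d + h) h (size_map _ _) h0.
pose r := d + h + i%:R * h.
have r1 : d < r by rewrite /r -addrA ltrDl ltr_wpDr// mulr_ge0// ltW.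
have r2 : r <= d * (1 + tau).
  have -> : r = d + i.+1%:R * h by rewrite /r -natr1; ring.
  rewrite mulrDr mulr1 lerD2l; have -> : d * tau = m.+1%:R * h.
    by rewrite /h [RHS]mulrC divfK// gt_eqF.
  by rewrite ler_pM2r// ler_nat.
exists r; first by rewrite r1.
move=> z zr.
have Pz y : cabs P.[y] = cabs (lead_coef P) * \prod_(w <- s) cabs (y - w).
  rewrite {1}Ps hornerZ cabsM horner_prod cabs_prod; congr (_ * _).
  by apply: eq_bigr => w _; rewrite !hornerE.
have key : \prod_(w <- s) cabs (0 - w) * \prod_(y <- a) (`|r - y| / (4 * d)) <=
    \prod_(w <- s) cabs (z - w).
  rewrite /a big_map -big_split /= big_seq [leRHS]big_seq.
  apply: ler_prod => w ws; rewrite sub0r cabsN.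
  have w0 := s0 w ws.
  rewrite mulr_ge0 ?cabs_ge0 ?divr_ge0 ?mulr_ge0 ?(ltW d0)//=.
  have d4 : 0 < 4 * d by rewrite mulr_gt0.
  rewrite mulrA ler_pdivrMr//.
  have h1 : `|r - cabs w| <= cabs (z - w).
    rewrite -zr ler_norml cabs_sub_lb andbT lerNl opprB.
    by rewrite (le_trans (cabs_sub_lb _ _))// cabsB.
  have rd : r <= 2 * d by apply: le_trans r2 _; nra.
  case: (leP (cabs w) (4 * d)) => wd.
    apply: (@le_trans _ _ (cabs w * cabs (z - w))); first by rewrite ler_pM2l.
    by rewrite mulrC ler_wpM2l ?cabs_ge0.
  have : cabs w - r <= cabs (z - w).
    by apply: le_trans h1; rewrite -normrN opprB ler_norm.
  by rewrite ler0_norm ?subr_le0; [nra|lra].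
have big : expR (-1) * (tau / 8 * expR (-1)) ^+ n <= \prod_(y <- a) (`|r - y| / (4 * d)).
  rewrite big_split /= big_const_seq count_predT iter_mulr_1 size_map -/m.
  have d4 : 0 < (4 * d)^-1 by rewrite invr_gt0 mulr_gt0.
  apply: (@le_trans _ _ (m`!%:R * (h / 2) ^+ m * (4 * d)^-1 ^+ m)); last first.
    by rewrite ler_pM2r ?exprn_gt0.
  have -> : m`!%:R * (h / 2) ^+ m * (4 * d)^-1 ^+ m =
      m`!%:R / m.+1%:R ^+ m * (tau / 8) ^+ m.
    rewrite -mulrA -exprMn.
    have -> : h / 2 / (4 * d) = (m.+1%:R)^-1 * (tau / 8).
      by rewrite /h; field; rewrite (gt_eqF d0) gt_eqF// addrC natr1.
    by rewrite exprMn exprVn mulrA.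
  have f1 : expR (-1 : R) * expR (-1) ^+ m <= m`!%:R / m.+1%:R ^+ m.
    rewrite ler_pdivlMr ?exprn_gt0// -exprS expRN exprVn.
    by rewrite ler_pdivrMl ?exprn_gt0 ?expR_gt0// mulrC expn_le_fact_expR.
  apply: (@le_trans _ _ (expR (-1) * (tau / 8 * expR (-1)) ^+ m)).
    rewrite ler_pM2l ?expR_gt0// ler_wiXn2l//.
      by rewrite mulr_ge0 ?expR_ge0 ?divr_ge0 ?(ltW tau0).
    by rewrite mulr_ile1 ?expR_ge0 ?expR_le1//; lra.
  rewrite exprMn [(tau / 8) ^+ m * _]mulrC mulrA ler_wpM2r//.
  by rewrite exprn_ge0//; lra.
rewrite !Pz -mulrA ler_pM2l ?cabs_gt0//.
apply: le_trans key; rewrite ler_wpM2l//.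
by apply: prodr_ge0 => w _; exact: cabs_ge0.
Qed.

End CircleLowerBound.

(** * Cauchy theory on squares *)

Section Primitive.
Variable R : realType.
Implicit Types (f g G : R -> R) (a b c x t : R).

Lemma continuous_eps f t :
  (forall e, 0 < e -> exists2 eta, 0 < eta &
     forall s, `|s - t| < eta -> `|f s - f t| <= e) -> {for t, continuous f}.
Proof.
move=> H; apply/cvgrPdist_le => e e0; have [eta eta0 He] := H e e0.
near=> s; rewrite distrC; apply: He; rewrite distrC.
by near: s; apply/nbhs_ballP; exists eta.
Unshelve. all: end_near. Qed.

Lemma eps_continuous f t e : {for t, continuous f} -> 0 < e ->
  exists2 eta, 0 < eta & forall s, `|s - t| < eta -> `|f s - f t| <= e.
Proof.
move=> /cvgrPdist_le H e0; have /nbhs_ballP[eta /= eta0 He] := H e e0.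
by exists eta => // s hs; rewrite distrC; apply: He; rewrite /ball /= distrC.
Qed.

Definition is_prim f a b G := forall t, a <= t <= b -> is_derive t (1 : R) G (f t).

(** Clamping the argument to [[a, b]] yields a continuous function on the whole line, so the
    fundamental theorem of calculus gives two-sided derivatives also at the end points. *)
Lemma prim_exists f a b : (forall t, a <= t <= b -> {for t, continuous f}) ->
  exists G, is_prim f a b G.
Proof.
move=> fc; have [ab|ba] := leP a b; last first.
  by exists (fun=> 0) => t /andP[at' tb]; have := le_lt_trans (le_trans at' tb) ba; rewrite ltxx.
pose cl t := Num.max a (Num.min b t).
have clab t : a <= cl t <= b by rewrite le_max lexx ge_max ab ge_min lexx.
have cllip s t : `|cl s - cl t| <= `|s - t|.
  rewrite /cl !maxEle !minEle; do ! case: ifP; move=> *; rewrite ler_norml;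
  have := ler_norm (s - t); have := ler_norm (t - s); rewrite (distrC t s); lra.
pose h := f \o cl.
have hc : continuous h.
  move=> t; apply: continuous_eps => e e0.
  have [eta eta0 He] := eps_continuous (fc _ (clab t)) e0.
  by exists eta => // s st; apply: He; apply: le_lt_trans st; exact: cllip.
pose F x := \int[lebesgue_measure]_(t in `[(a - 1), x]) h t.
exists F => t /andP[at' tb].
have tb1 : t < b + 1 by lra.
have ab1 : a - 1 <= b + 1 by lra.
have ih : lebesgue_measure.-integrable `[(a - 1), (b + 1)] (EFin \o h).
  apply: continuous_compact_integrable; first exact: segment_compact.
  exact: continuous_subspaceT.
have at1 : a - 1 < t by lra.
have [dF FE] := continuous_FTC1_closed tb1 ih at1 (hc t).
apply: DeriveDef; first exact: dF.
rewrite -derive1E; apply: etrans FE _; rewrite /h /= /cl.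
by rewrite (min_idPr _) ?tb// (max_idPr _).
Qed.

(** Integration is defined through an arbitrary primitive: differences of primitives agree by the
    mean value theorem, and splitting, linearity and the mean value form become immediate. *)
Definition pint f a b : R := let G := xget (fun=> 0) [set G | is_prim f a b G] in
  G b - G a.

Lemma prim_mvt f a b G : a <= b -> is_prim f a b G ->
  exists2 c, a <= c <= b & G b - G a = f c * (b - a).
Proof.
move=> ab hG.
have [x xab|x|c + ->] := @MVT_segment R G f a b ab.
- by apply: hG; move: xab; rewrite in_itv /= => /andP[/ltW -> /ltW ->].
- apply: continuous_in_subspaceT => y /set_mem /= yab.
  apply: differentiable_continuous; apply/derivable1_diffP.
  by have [] := hG y; first by rewrite in_itv /= in yab.
by rewrite in_itv /= => cab; exists c.
Qed.

Lemma is_prim_lin f g a b G H p q : is_prim f a b G -> is_prim g a b H ->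
  is_prim (fun t => p * f t + q * g t) a b (fun t => p * G t + q * H t).
Proof.
move=> hG hH t tab; have dG := hG t tab; have dH := hH t tab.
by apply: is_deriveD; apply: is_deriveZ.
Qed.

Lemma pintE f a b G : a <= b -> is_prim f a b G -> pint f a b = G b - G a.
Proof.
move=> ab hG; rewrite /pint; case: xgetP => [H _ /= hH|]; last by move/(_ G hG).
have [c _] := prim_mvt ab (is_prim_lin 1 (-1) hH hG).
by rewrite /= (_ : 1 * f c + -1 * f c = 0) ?mul0r; [lra|ring].
Qed.

Definition rcont f a b := forall t, a <= t <= b -> {for t, continuous f}.

Lemma pint_mvt f a b : a <= b -> rcont f a b ->
  exists2 c, a <= c <= b & pint f a b = f c * (b - a).
Proof.
move=> ab /prim_exists[G hG]; rewrite (pintE ab hG).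
by have [c cab ->] := prim_mvt ab hG; exists c.
Qed.

Lemma pint_split f a c b : a <= c <= b -> rcont f a b ->
  pint f a b = pint f a c + pint f c b.
Proof.
move=> /andP[ac cb] /prim_exists[G hG]; have ab := le_trans ac cb.
rewrite (pintE ab hG) (@pintE f a c G)// ?(@pintE f c b G)//; first lra.
  by move=> t /andP[ta tb]; apply: hG; rewrite tb (le_trans ac).
by move=> t /andP[ta tb]; apply: hG; rewrite ta (le_trans tb).
Qed.

Lemma pint_lin f g a b p q : a <= b -> rcont f a b -> rcont g a b ->
  pint (fun t => p * f t + q * g t) a b = p * pint f a b + q * pint g a b.
Proof.
move=> ab /prim_exists[G hG] /prim_exists[H hH].
rewrite (pintE ab hG) (pintE ab hH) (pintE ab (is_prim_lin p q hG hH)); ring.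
Qed.

Lemma pint_affine p q a b : a <= b ->
  pint (fun t => p + q * t) a b = p * (b - a) + q * (b ^+ 2 - a ^+ 2) / 2.
Proof.
move=> ab; rewrite (@pintE _ a b (fun t => p * t + q / 2 * t ^+ 2))//; first by field.
move=> t _; have d1 := is_derive_id t (1 : R).
have := is_deriveD (is_deriveZ p d1) (is_deriveZ (q / 2) (is_deriveX 2 d1)).
set H := (X in is_derive _ _ X _) => d.
rewrite (_ : (fun _ => _) = H); last by apply/funext => u; rewrite /H !fctE.
by apply: is_derive_eq d _; rewrite /GRing.scale /=; field.
Qed.

End Primitive.

(** * Contour integrals over the boundary of a square *)

Section ContourIntegral.
Variable R : realType.
Implicit Types (F G : R -> R[i]) (f g : R[i] -> R[i]) (a b c x y h t : R) (z w : R[i]).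

Definition ccont F a b := rcont (fun t => complex.Re (F t)) a b /\
  rcont (fun t => complex.Im (F t)) a b.

Definition cpint F a b : R[i] :=
  Complex (pint (fun t => complex.Re (F t)) a b) (pint (fun t => complex.Im (F t)) a b).

Lemma cpint_split F a c b : a <= c <= b -> ccont F a b ->
  cpint F a b = cpint F a c + cpint F c b.
Proof.
move=> acb [hr hi]; rewrite /cpint (pint_split acb hr) (pint_split acb hi).
by apply: complex_ext.
Qed.

(** The factor 2 comes from applying the mean value theorem separately to the real and imaginary
    parts. *)
Lemma cpint_norm F a b M : a <= b -> ccont F a b ->
  (forall t, a <= t <= b -> cabs (F t) <= M) -> cabs (cpint F a b) <= 2 * (M * (b - a)).
Proof.
move=> ab [hr hi] hM; apply: le_trans (cabs_le_ReIm _) _ => /=.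
have [c cab ->] := pint_mvt ab hr; have [d dab ->] := pint_mvt ab hi.
have b0 : 0 <= b - a by rewrite subr_ge0.
rewrite !normrM (ger0_norm b0) -mulrDl mulrA ler_wpM2r//.
have := le_trans (Re_le_cabs _) (hM c cab); have := le_trans (Im_le_cabs _) (hM d dab).
by lra.
Qed.

Lemma cpint_axpy F G a b w : a <= b -> ccont F a b -> ccont G a b ->
  cpint (fun t => F t + w * G t) a b = cpint F a b + w * cpint G a b.
Proof.
move=> ab [Fr Fi] [Gr Gi].
have cl (u v : R -> R) p q : rcont u a b -> rcont v a b ->
    rcont (fun t => p * u t + q * v t) a b.
  by move=> hu hv t tab; apply: cvgD; apply: cvgMr; [exact: hu|exact: hv].
apply: complex_ext => /=; rewrite ?ReD ?ImD ?ReM ?ImM /=.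
  transitivity (pint (fun t => 1 * complex.Re (F t) + 1 *
    (complex.Re w * complex.Re (G t) + - complex.Im w * complex.Im (G t))) a b).
    by congr pint; apply/funext => t; rewrite ReD ReM; ring.
  by rewrite pint_lin ?pint_lin//; [ring|exact: cl].
transitivity (pint (fun t => 1 * complex.Im (F t) + 1 *
    (complex.Re w * complex.Im (G t) + complex.Im w * complex.Re (G t))) a b).
  by congr pint; apply/funext => t; rewrite ImD ImM; ring.
by rewrite pint_lin ?pint_lin//; [ring|exact: cl].
Qed.

Lemma cpint_affine u v a b : a <= b ->
  cpint (fun t => u + v * t%:C%C) a b =
  u * (b - a)%:C%C + v * ((b ^+ 2 - a ^+ 2) / 2)%:C%C.
Proof.
move=> ab; apply: complex_ext => /=; rewrite !(ReD, ImD, ReM, ImM) /=.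
  rewrite (_ : (fun t => _) = (fun t => complex.Re u + complex.Re v * t)).
    by rewrite pint_affine//; ring.
  by apply/funext => t; rewrite ReD ReM /=; ring.
rewrite (_ : (fun t => _) = (fun t => complex.Im u + complex.Im v * t)).
  by rewrite pint_affine//; ring.
by apply/funext => t; rewrite ImD ImM /=; ring.
Qed.

Definition has_cderiv f z l := forall e : R, 0 < e -> exists2 eta, 0 < eta &
  forall w, cabs (w - z) < eta -> cabs (f w - f z - l * (w - z)) <= e * cabs (w - z).

Definition cdiff f z := exists l, has_cderiv f z l.

Definition ceps_cont f z := forall e : R, 0 < e -> exists2 eta, 0 < eta &
  forall w, cabs (w - z) < eta -> cabs (f w - f z) <= e.

Lemma cdiff_cont f z : cdiff f z -> ceps_cont f z.
Proof.
move=> [l H] e e0; have [eta eta0 He] := H 1 ltr01.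
have l0 : 0 < cabs l + 1 by rewrite ltr_wpDl ?cabs_ge0.
exists (Num.min eta (e / (cabs l + 1))) => [|w].
  by rewrite lt_min eta0 divr_gt0.
rewrite lt_min => /andP[/He h1]; rewrite ltr_pdivlMr// => h2.
rewrite -(subrK (l * (w - z)) (f w - f z)); apply: le_trans (cabsD _ _) _.
have : cabs (w - z) * (cabs l + 1) = cabs l * cabs (w - z) + cabs (w - z) by ring.
by move: h1 h2; rewrite cabsM mul1r; lra.
Qed.

Lemma ceps_cont_horizontal f z : ceps_cont f z ->
  {for complex.Re z, continuous (fun t => complex.Re (f (Complex t (complex.Im z))))} /\
  {for complex.Re z, continuous (fun t => complex.Im (f (Complex t (complex.Im z))))}.
Proof.
case: z => x y H; split; apply: continuous_eps => e e0; have [eta eta0 He] := H e e0;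
exists eta => //= s hs; rewrite -?ReB -?ImB;
[apply: le_trans (Re_le_cabs _) _|apply: le_trans (Im_le_cabs _) _]; apply: He;
by rewrite (_ : _ - _ = (s - x)%:C%C) ?cabs_real//; apply: complex_ext; rewrite ?ReB ?ImB /= ?subrr.
Qed.

Lemma ceps_cont_vertical f z : ceps_cont f z ->
  {for complex.Im z, continuous (fun t => complex.Re (f (Complex (complex.Re z) t)))} /\
  {for complex.Im z, continuous (fun t => complex.Im (f (Complex (complex.Re z) t)))}.
Proof.
case: z => x y H; split; apply: continuous_eps => e e0; have [eta eta0 He] := H e e0;
exists eta => //= s hs; rewrite -?ReB -?ImB;
[apply: le_trans (Re_le_cabs _) _|apply: le_trans (Im_le_cabs _) _]; apply: He;
by rewrite (_ : _ - _ = Complex 0 (s - y)) /Normc.normc /= ?expr0n /= ?add0r ?sqrtr_sqr//;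
   apply: complex_ext; rewrite ?ReB ?ImB /= ?subrr.
Qed.

Definition square x y h : set R[i] :=
  [set z | x <= complex.Re z <= x + h /\ y <= complex.Im z <= y + h].

(** The boundary is traversed counterclockwise; the vertical edges carry the factor of
    [dz = i dt]. *)
Definition sqint f x y h : R[i] :=
  cpint (fun t => f (Complex t y)) x (x + h) + 'i%C * cpint (fun t => f (Complex (x + h) t)) y (y + h)
  - cpint (fun t => f (Complex t (y + h))) x (x + h) - 'i%C * cpint (fun t => f (Complex x t)) y (y + h).

Lemma ccont_horizontal f y a b :
  (forall t, a <= t <= b -> ceps_cont f (Complex t y)) -> ccont (fun t => f (Complex t y)) a b.
Proof. by move=> H; split=> t tab; have [] := ceps_cont_horizontal (H t tab). Qed.

Lemma ccont_vertical f x a b :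
  (forall t, a <= t <= b -> ceps_cont f (Complex x t)) -> ccont (fun t => f (Complex x t)) a b.
Proof. by move=> H; split=> t tab; have [] := ceps_cont_vertical (H t tab). Qed.

Lemma edges_cont f x y h : 0 <= h -> (forall z, square x y h z -> 
    complex.Re z = x \/ complex.Re z = x + h \/ complex.Im z = y \/ complex.Im z = y + h ->
    ceps_cont f z) ->
  [/\ ccont (fun t => f (Complex t y)) x (x + h),
      ccont (fun t => f (Complex (x + h) t)) y (y + h),
      ccont (fun t => f (Complex t (y + h))) x (x + h) &
      ccont (fun t => f (Complex x t)) y (y + h)].
Proof.
move=> h0 H; have xh : x <= x + h by rewrite lerDl.
have yh : y <= y + h by rewrite lerDl.
split; [apply: ccont_horizontal|apply: ccont_vertical|apply: ccont_horizontal|apply: ccont_vertical];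
move=> t tab; apply: H => /=; (try by auto);
by split=> //; rewrite lexx ?xh ?yh.
Qed.

Lemma sqint_split f x y h : 0 <= h -> (forall z, square x y h z -> ceps_cont f z) ->
  sqint f x y h = sqint f x y (h / 2) + sqint f (x + h / 2) y (h / 2) +
    sqint f x (y + h / 2) (h / 2) + sqint f (x + h / 2) (y + h / 2) (h / 2).
Proof.
move=> h0 H; have E u : u + h / 2 + h / 2 = u + h by field.
have M u : u <= u + h / 2 <= u + h by apply/andP; split; lra.
have L u : u <= u by [].
have I u : u <= u <= u + h by apply/andP; split; lra.
have J u : u <= u + h <= u + h by apply/andP; split; lra.
rewrite /sqint !E.
have hor v : y <= v <= y + h -> ccont (fun t => f (Complex t v)) x (x + h).
  by move=> hv; apply: ccont_horizontal => t tx; apply: H.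
have ver v : x <= v <= x + h -> ccont (fun t => f (Complex v t)) y (y + h).
  by move=> hv; apply: ccont_vertical => t tx; apply: H.
rewrite (cpint_split (M x) (hor y (I y))) (cpint_split (M x) (hor (y + h) (J y))).
rewrite (cpint_split (M y) (ver x (I x))) (cpint_split (M y) (ver (x + h) (J x))).
by ring.
Qed.

Definition square_boundary x y h : set R[i] := [set z | square x y h z /\
  (complex.Re z = x \/ complex.Re z = x + h \/ complex.Im z = y \/ complex.Im z = y + h)].

Lemma cabsi : cabs ('i%C : R[i]) = 1.
Proof. by rewrite /Normc.normc /= expr0n /= add0r expr1n sqrtr1. Qed.

Lemma sqint_norm f x y h M : 0 <= h ->
  (forall z, square_boundary x y h z -> ceps_cont f z /\ cabs (f z) <= M) ->
  cabs (sqint f x y h) <= 8 * (M * h).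
Proof.
move=> h0 H; have [|c1 c2 c3 c4] := @edges_cont f x y h h0.
  by move=> z zs zb; have [] := H z (conj zs zb).
have xh : x <= x + h by rewrite lerDl.
have yh : y <= y + h by rewrite lerDl.
have E u : u + h - u = h by ring.
have b1 := cpint_norm xh c1 (M := M); have b2 := cpint_norm yh c2 (M := M).
have b3 := cpint_norm xh c3 (M := M); have b4 := cpint_norm yh c4 (M := M).
rewrite !(E x) in b1 b3; rewrite !(E y) in b2 b4.
have D (u v w t : R[i]) : cabs (u + 'i%C * v - w - 'i%C * t : R[i]) <= cabs u + cabs v + cabs w + cabs t.
  apply: le_trans (cabsD _ _) _; rewrite cabsN cabsM cabsi mul1r lerD2r.
  apply: le_trans (cabsD _ _) _; rewrite cabsN lerD2r.
  by apply: le_trans (cabsD _ _) _; rewrite cabsM cabsi mul1r.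
apply: le_trans (D _ _ _ _) _.
have B z : square x y h z -> (complex.Re z = x \/ complex.Re z = x + h \/
    complex.Im z = y \/ complex.Im z = y + h) -> cabs (f z) <= M.
  by move=> zs zb; have [] := H z (conj zs zb).
have a1 : cabs (cpint (fun t => f (Complex t y)) x (x + h)) <= 2 * (M * h).
  by apply: b1 => t tab; apply: B => /=; [split; rewrite /= ?tab ?lexx ?xh ?yh|auto].
have a2 : cabs (cpint (fun t => f (Complex (x + h) t)) y (y + h)) <= 2 * (M * h).
  by apply: b2 => t tab; apply: B => /=; [split; rewrite /= ?tab ?lexx ?xh ?yh|auto].
have a3 : cabs (cpint (fun t => f (Complex t (y + h))) x (x + h)) <= 2 * (M * h).
  by apply: b3 => t tab; apply: B => /=; [split; rewrite /= ?tab ?lexx ?xh ?yh|auto].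
have a4 : cabs (cpint (fun t => f (Complex x t)) y (y + h)) <= 2 * (M * h).
  by apply: b4 => t tab; apply: B => /=; [split; rewrite /= ?tab ?lexx ?xh ?yh|auto].
lra.
Qed.

Lemma sqint_axpy f g w x y h : 0 <= h ->
  (forall z, square_boundary x y h z -> ceps_cont f z /\ ceps_cont g z) ->
  sqint (fun z => f z + w * g z) x y h = sqint f x y h + w * sqint g x y h.
Proof.
move=> h0 H.
have [|c1 c2 c3 c4] := @edges_cont f x y h h0.
  by move=> z zs zb; have [] := H z (conj zs zb).
have [|d1 d2 d3 d4] := @edges_cont g x y h h0.
  by move=> z zs zb; have [] := H z (conj zs zb).
have xh : x <= x + h by rewrite lerDl.
have yh : y <= y + h by rewrite lerDl.
rewrite /sqint (cpint_axpy w xh c1 d1) (cpint_axpy w yh c2 d2) (cpint_axpy w xh c3 d3).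
by rewrite (cpint_axpy w yh c4 d4); ring.
Qed.

Lemma sqint_affine u v x y h : 0 <= h -> sqint (fun z => u + v * z) x y h = 0.
Proof.
move=> h0; have xh : x <= x + h by rewrite lerDl.
have yh : y <= y + h by rewrite lerDl.
have Eh s : (fun t : R => u + v * Complex t s) =
    (fun t => (u + v * Complex 0 s) + v * t%:C%C).
  apply/funext => t; apply: complex_ext; rewrite !(ReD, ImD, ReM, ImM) /=; ring.
have Ev s : (fun t : R => u + v * Complex s t) =
    (fun t => (u + v * Complex s 0) + (v * 'i%C) * t%:C%C).
  apply/funext => t; apply: complex_ext; rewrite !(ReD, ImD, ReM, ImM) /=; ring.
rewrite /sqint !Eh !Ev !cpint_affine//.
by apply: complex_ext; rewrite !(ReD, ImD, ReM, ImM, ReN, ImN) /=; field.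
Qed.

End ContourIntegral.

(** * Goursat's theorem *)

Section Goursat.
Variable R : realType.
Implicit Types (f g : R[i] -> R[i]) (x y h : R) (z w : R[i]).

Lemma nested_intervals (u v : nat -> R) : (forall n, u n <= u n.+1) ->
  (forall n, v n.+1 <= v n) -> (forall n, u n <= v n) ->
  exists p, forall n, u n <= p <= v n.
Proof.
move=> hu hv huv.
have um m n : (m <= n)%N -> u m <= u n.
  by move=> /subnK <-; elim: (n - m)%N => // k IH; rewrite addSn (le_trans IH).
have vm m n : (m <= n)%N -> v n <= v m.
  by move=> /subnK <-; elim: (n - m)%N => // k IH; rewrite addSn (le_trans _ IH).
have uv m n : u m <= v n.
  apply: le_trans (um m (maxn m n) (leq_maxl _ _)) _.
  by apply: le_trans (huv _) _; exact: vm (leq_maxr _ _).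
pose S : set R := range u.
have Sub n : ubound S (v n) by move=> _ [m _ <-].
exists (sup S) => n; apply/andP; split.
  by apply: ub_le_sup; [exists (v 0%N); exact: Sub|exists n].
by apply: ge_sup => //; exists (u 0%N); exists 0%N.
Qed.

Lemma exp2_small (h e : R) : 0 < e -> exists n, h / 2 ^+ n < e.
Proof.
move=> e0; exists (Num.truncn (h / e)).+1; rewrite ltr_pdivrMr ?exprn_gt0//.
rewrite mulrC -ltr_pdivrMr//; apply: lt_le_trans (truncnS_gt _) _.
by rewrite -natrX ler_nat ltnW// ltn_expl.
Qed.

Lemma cabs_square x y h z w : square x y h z -> square x y h w -> cabs (w - z) <= 2 * h.
Proof.
move=> [/andP[a1 a2] /andP[a3 a4]] [/andP[b1 b2] /andP[b3 b4]].
apply: le_trans (cabs_le_ReIm _) _; rewrite ReB ImB.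
have : `|complex.Re w - complex.Re z| <= h by rewrite ler_norml; apply/andP; split; lra.
have : `|complex.Im w - complex.Im z| <= h by rewrite ler_norml; apply/andP; split; lra.
lra.
Qed.

(** Repeated division into four. [c] is the ratio of the integral to the area [h^2], and some
    quarter always keeps a ratio at least [c]. Around the common point of the nested squares [f] is
    affine up to [o(|w - z|)], and the affine part integrates to 0. *)
Lemma goursat f x y h : 0 < h -> (forall z, square x y h z -> cdiff f z) ->
  sqint f x y h = 0.
Proof.
move=> h0 hf; apply/eqP; apply: contrapT => /negP T0.
pose c := cabs (sqint f x y h) / h ^+ 2.
have c0 : 0 < c by rewrite divr_gt0 ?cabs_gt0// exprn_gt0.
pose P (q : R * R * R) := [/\ 0 < q.2, square q.1.1 q.1.2 q.2 `<=` square x y h &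
  c * q.2 ^+ 2 <= cabs (sqint f q.1.1 q.1.2 q.2)].
pose S (q p : R * R * R) := [/\ p.2 = q.2 / 2,
  q.1.1 <= p.1.1 /\ p.1.1 + p.2 <= q.1.1 + q.2 &
  q.1.2 <= p.1.2 /\ p.1.2 + p.2 <= q.1.2 + q.2].
have step q : exists p, P q -> P p /\ S q p.
  have [[q0 qs qc]|] := pselect (P q); last by exists q.
  have sub p : S q p -> square p.1.1 p.1.2 p.2 `<=` square x y h.
    move=> [p2 [p1 p3] [p4 p5]] z [/andP[z1 z2] /andP[z3 z4]]; apply: qs.
    by split; apply/andP; split; lra.
  have E := @sqint_split R f q.1.1 q.1.2 q.2 (ltW q0) (fun z zs => cdiff_cont (hf z (qs z zs))).
  have q20 : 0 < q.2 / 2 by rewrite divr_gt0.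
  have : exists p, S q p /\ c * p.2 ^+ 2 <= cabs (sqint f p.1.1 p.1.2 p.2).
    apply: contrapT => N.
    have N' p : S q p -> cabs (sqint f p.1.1 p.1.2 p.2) < c * p.2 ^+ 2.
      by move=> Sp; rewrite ltNge; apply/negP => h'; apply: N; exists p.
    have n1 := N' (q.1.1, q.1.2, q.2 / 2); have n2 := N' (q.1.1 + q.2 / 2, q.1.2, q.2 / 2).
    have n3 := N' (q.1.1, q.1.2 + q.2 / 2, q.2 / 2).
    have n4 := N' (q.1.1 + q.2 / 2, q.1.2 + q.2 / 2, q.2 / 2).
    move: n1 n2 n3 n4 => /=; rewrite /S /= => n1 n2 n3 n4.
    have {}n1 := n1 ltac:(by split=> //; split; lra).
    have {}n2 := n2 ltac:(by split=> //; split; lra).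
    have {}n3 := n3 ltac:(by split=> //; split; lra).
    have {}n4 := n4 ltac:(by split=> //; split; lra).
    have e4 : c * q.2 ^+ 2 = 4 * (c * (q.2 / 2) ^+ 2) by field.
    move: qc; rewrite E leNgt => /negP; apply; rewrite e4.
    apply: le_lt_trans (cabsD _ _) _.
    have := cabsD (sqint f q.1.1 q.1.2 (q.2 / 2) + sqint f (q.1.1 + q.2 / 2) q.1.2 (q.2 / 2))
      (sqint f q.1.1 (q.1.2 + q.2 / 2) (q.2 / 2)).
    have := cabsD (sqint f q.1.1 q.1.2 (q.2 / 2)) (sqint f (q.1.1 + q.2 / 2) q.1.2 (q.2 / 2)).
    lra.
  move=> [p [Sp pc]]; exists p => _; split=> //; split=> //; last exact: sub.
  by case: Sp => -> _ _.
have [F HF] := choice step.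
pose Q n := iter n F (x, y, h).
have PQ n : P (Q n).
  elim: n => [|n IH]; last by have [] := HF _ IH.
  by split=> //=; rewrite /c divfK// expf_neq0// gt_eqF.
have SQ n : S (Q n) (Q n.+1) by have [] := HF _ (PQ n).
have Qh n : (Q n).2 = h / 2 ^+ n.
  elim: n => [|n IH]; first by rewrite expr0 divr1.
  by have [-> _ _] := SQ n; rewrite IH exprS; field; rewrite expf_neq0.
have [||n|px Hx] := @nested_intervals (fun n => (Q n).1.1) (fun n => (Q n).1.1 + (Q n).2).
- by move=> n; have [_ [] ] := SQ n.
- by move=> n; have [_ [] ] := SQ n.
- by rewrite lerDl; have [/ltW] := PQ n.
have [||n|py Hy] := @nested_intervals (fun n => (Q n).1.2) (fun n => (Q n).1.2 + (Q n).2).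
- by move=> n; have [_ _ [] ] := SQ n.
- by move=> n; have [_ _ [] ] := SQ n.
- by rewrite lerDl; have [/ltW] := PQ n.
pose z := Complex px py.
have zQ n : square (Q n).1.1 (Q n).1.2 (Q n).2 z by split; [exact: Hx|exact: Hy].
have [l Hl] := hf z (zQ 0%N).
(* On a square of side [H] the error is at most [(c / 17) 2 H], so the integral is at most
   [8 (c / 17) 2 H^2 = (16 / 17) c H^2], short of the [c H^2] kept by the construction. *)
have c17 : 0 < c / 17 by rewrite divr_gt0.
have [eta eta0 He] := Hl _ c17.
have [n hn] := exp2_small (2 * h) eta0.
have [Q0 Qs Qc] := PQ n.
set X := (Q n).1.1 in Qs Qc; set Y := (Q n).1.2 in Qs Qc; set H := (Q n).2 in Q0 Qs Qc.
have fc w : square X Y H w -> cdiff f w by move=> /Qs; exact: hf.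
pose A w := f z - l * z + l * w.
have Ac w : ceps_cont A w.
  move=> e e0; have l0 : 0 < cabs l + 1 by rewrite ltr_wpDl ?cabs_ge0.
  exists (e / (cabs l + 1)); first by rewrite divr_gt0.
  move=> u; rewrite ltr_pdivlMr// => hu.
  have -> : A u - A w = l * (u - w) by rewrite /A; ring.
  by rewrite cabsM; have := cabs_ge0 (u - w); nra.
have Dc w : square X Y H w -> ceps_cont (fun w => f w + -1 * A w) w.
  move=> ws e e0; have e2 : 0 < e / 2 by rewrite divr_gt0.
  have [e1 e10 H1] := cdiff_cont (fc w ws) e2; have [e3 e30 H3] := Ac w _ e2.
  exists (Num.min e1 e3); first by rewrite lt_min e10.
  move=> u; rewrite lt_min => /andP[/H1 h1 /H3 h3].
  have -> : f u + -1 * A u - (f w + -1 * A w) = (f u - f w) - (A u - A w) by ring.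
  by apply: le_trans (cabsD _ _) _; rewrite cabsN; lra.
have T1 : sqint (fun w => f w + -1 * A w) X Y H = sqint f X Y H.
  rewrite sqint_axpy ?(ltW Q0)//; last first.
    by move=> w [ws _]; split; [apply: cdiff_cont; exact: fc|exact: Ac].
  by rewrite /A sqint_affine ?(ltW Q0)// mulr0 addr0.
have zs : square X Y H z := zQ n.
have Hn : 2 * H < eta by rewrite /H Qh mulrA.
have := @sqint_norm R (fun w => f w + -1 * A w) X Y H (c / 17 * (2 * H)) (ltW Q0).
rewrite T1 => /(_ _)/(le_trans Qc) Hc.
have : c * H ^+ 2 <= 8 * (c / 17 * (2 * H) * H).
  apply: Hc => w [ws _]; split; first exact: Dc.
  have -> : f w + -1 * A w = f w - f z - l * (w - z) by rewrite /A; ring.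
  have wz := cabs_square zs ws.
  apply: le_trans (He w _) _; first by apply: le_lt_trans wz Hn.
  by rewrite ler_wpM2l// ltW.
have : 0 < c * H ^+ 2 by rewrite mulr_gt0// exprn_gt0.
rewrite expr2; lra.
Qed.

End Goursat.

(** * Removable singularities and Cauchy's estimate *)

Section CauchyEstimate.
Variable R : realType.
Implicit Types (f g : R[i] -> R[i]) (x y h : R) (z w : R[i]).

Lemma cdiffM f g z : cdiff f z -> cdiff g z -> cdiff (fun w => f w * g w) z.
Proof.
move=> df dg; have cg := cdiff_cont dg; move: df dg => [l Hl] [k Hk].
exists (l * g z + f z * k) => e e0.
pose A := cabs (g z) + 1; pose B := cabs (f z) + 1; pose C := cabs l + 1.
have A0 : 0 < A by rewrite ltr_wpDl ?cabs_ge0.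
have B0 : 0 < B by rewrite ltr_wpDl ?cabs_ge0.
have C0 : 0 < C by rewrite ltr_wpDl ?cabs_ge0.
have eA : 0 < Num.min 1 (e / (3 * A)) by rewrite lt_min ltr01 divr_gt0// mulr_gt0.
have eB : 0 < e / (3 * B) by rewrite divr_gt0// mulr_gt0.
have eC : 0 < Num.min 1 (e / (3 * C)) by rewrite lt_min ltr01 divr_gt0// mulr_gt0.
have [e1 e10 H1] := Hl _ eA; have [e2 e20 H2] := Hk _ eB; have [e3 e30 H3] := cg _ eC.
exists (Num.min e1 (Num.min e2 e3)); first by rewrite !lt_min e10 e20.
move=> w; rewrite !lt_min => /and3P[/H1 h1 /H2 h2 /H3].
rewrite le_min => /andP[h3 h4].
have -> : f w * g w - f z * g z - (l * g z + f z * k) * (w - z) =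
  (f w - f z - l * (w - z)) * g w + l * (w - z) * (g w - g z) + f z * (g w - g z - k * (w - z)).
  by ring.
set d := cabs (w - z) in h1 h2 *; have d0 : 0 <= d := cabs_ge0 _.
apply: le_trans (cabsD _ _) _; rewrite [cabs (f z * _)]cabsM.
have : cabs (f z) * cabs (g w - g z - k * (w - z)) <= e / 3 * d.
  apply: (@le_trans _ _ (B * (e / (3 * B) * d))).
    by apply: ler_pM => //; rewrite ?cabs_ge0// /B lerDl.
  by rewrite le_eqVlt; apply/orP; left; apply/eqP; field; rewrite gt_eqF.
have : cabs (l * (w - z) * (g w - g z)) <= e / 3 * d.
  rewrite !cabsM -/d; apply: (@le_trans _ _ (C * d * (e / (3 * C)))).
    apply: ler_pM; rewrite ?cabs_ge0 ?mulr_ge0 ?cabs_ge0//.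
    by rewrite ler_wpM2r// /C lerDl.
  by rewrite le_eqVlt; apply/orP; left; apply/eqP; field; rewrite gt_eqF.
have gw : cabs (g w) <= A.
  by rewrite /A; have := cabs_sub_lb (g w) (g z); lra.
have : cabs ((f w - f z - l * (w - z)) * g w) <= e / 3 * d.
  rewrite cabsM; apply: (@le_trans _ _ (e / (3 * A) * d * A)).
    apply: ler_pM; rewrite ?cabs_ge0//; apply: le_trans h1 _.
    by rewrite ler_wpM2r// ge_min lexx orbT.
  by rewrite le_eqVlt; apply/orP; left; apply/eqP; field; rewrite gt_eqF.
have := cabsD ((f w - f z - l * (w - z)) * g w) (l * (w - z) * (g w - g z)).
lra.
Qed.

Lemma cdiff_affine u v z : cdiff (fun w => u + v * w) z.
Proof.
exists v => e e0; exists 1 => // w _.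
rewrite (_ : _ - _ - _ = 0); last by ring.
by rewrite cabs0 mulr_ge0 ?cabs_ge0// ltW.
Qed.

Lemma cdiff_eps f g z eta : 0 < eta -> (forall w, cabs (w - z) < eta -> f w = g w) ->
  cdiff f z -> cdiff g z.
Proof.
move=> eta0 H [l Hl]; exists l => e e0; have [e1 e10 He] := Hl e e0.
exists (Num.min eta e1); first by rewrite lt_min eta0.
by move=> w; rewrite lt_min => /andP[h1 h2]; rewrite -!H ?subrr ?cabs0//; exact: He.
Qed.

Lemma has_cderiv_inv c z : z != c -> has_cderiv (fun w => (w - c)^-1) z (- (z - c)^-2).
Proof.
move=> zc e e0.
have zc0 : z - c != 0 by rewrite subr_eq0.
pose d := cabs (z - c); have d0 : 0 < d by rewrite cabs_gt0.
exists (Num.min (d / 2) (e * d ^+ 3 / 2)).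
  by rewrite lt_min !divr_gt0// mulr_gt0// exprn_gt0.
move=> w; rewrite lt_min => /andP[h1 h2].
have wd : d / 2 <= cabs (w - c).
  have -> : w - c = (z - c) - (z - w) by ring.
  by have := cabs_sub_lb (z - c) (z - w); rewrite [cabs (z - w)]cabsB -/d; lra.
have wc0 : w - c != 0 by rewrite -cabs_gt0; apply: lt_le_trans wd; rewrite divr_gt0.
have -> : (w - c)^-1 - (z - c)^-1 - - (z - c)^-2 * (w - z) =
  (w - z) * (w - z) / ((z - c) ^+ 2 * (w - c)) by field; rewrite zc0 wc0.
rewrite !cabsM cabsV cabsM cabsX -/d -mulrA mulrC ler_wpM2r ?cabs_ge0//.
rewrite ler_pdivrMr; last by rewrite mulr_gt0 ?exprn_gt0// cabs_gt0.
apply: le_trans (ltW h2) _.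
have -> : e * d ^+ 3 / 2 = e * (d ^+ 2 * (d / 2)) by rewrite [d ^+ 3]exprS expr2; ring.
by rewrite ler_pM2l// ler_pM2l// exprn_gt0.
Qed.

Lemma cdiff_inv c z : z != c -> cdiff (fun w => (w - c)^-1) z.
Proof. by move=> zc; exists (- (z - c)^-2); exact: has_cderiv_inv. Qed.

Lemma cdiff_exp f z n : cdiff f z -> cdiff (fun w => f w ^+ n) z.
Proof.
move=> df; elim: n => [|n IH].
  by apply: (@cdiff_eps (fun w => 1 + 0 * w) _ _ 1) => [//|w _|]; rewrite ?mul0r ?addr0//; exact: cdiff_affine.
by apply: (@cdiff_eps (fun w => f w * f w ^+ n) _ _ 1) => [//|w _|]; rewrite ?exprS//; exact: cdiffM.
Qed.

(* [rho] stays at relative position 1/3 or 2/3 under bisection, so that it is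
   never on the boundary of a subsquare. *)
Lemma sqint_shrink g x y h : 0 < h ->
  (forall z, square x y h z -> z != Complex (x + h / 3) (y + h / 3) -> cdiff g z) ->
  ceps_cont g (Complex (x + h / 3) (y + h / 3)) ->
  sqint g x y h = sqint g (x + h / 4) (y + h / 4) (h / 4).
Proof.
move=> h0 hg hc; set rho := Complex _ _ in hg hc.
have gc z : square x y h z -> ceps_cont g z.
  move=> zs; have [->|zr] := eqVneq z rho; first exact: hc.
  by apply: cdiff_cont; exact: hg.
have h2 : 0 < h / 2 by rewrite divr_gt0.
have h4 : 0 < h / 2 / 2 by rewrite divr_gt0.
have z0 u v k : 0 < k -> square u v k `<=` square x y h ->
    (x + h / 3 < u \/ u + k < x + h / 3 \/ y + h / 3 < v \/ v + k < y + h / 3) ->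
    sqint g u v k = 0.
  move=> k0 sub out; apply: goursat => // z zs; apply: hg; first exact: sub.
  apply/eqP => zr; move: zs; rewrite zr => -[/= /andP[a b] /andP[c d]].
  by case: out => [|[|[|]]]; lra.
have sub u v k : x <= u -> u + k <= x + h -> y <= v -> v + k <= y + h ->
    square u v k `<=` square x y h.
  by move=> a b c d z [/andP[z1 z2] /andP[z3 z4]]; split; apply/andP; split; lra.
rewrite sqint_split ?(ltW h0)//.
rewrite (z0 (x + h / 2) y)//; [|by apply: sub; lra|by left; lra].
rewrite (z0 x (y + h / 2))//; [|by apply: sub; lra|by right; right; left; lra].
rewrite (z0 (x + h / 2) (y + h / 2))//; [|by apply: sub; lra|by left; lra].
rewrite !addr0 sqint_split ?(ltW h2)//; last first.
  by move=> z zs; apply: gc; move: z zs; apply: sub; lra.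
rewrite (z0 (x + h / 2 / 2) y)//; [|by apply: sub; lra|by right; right; right; lra].
rewrite (z0 x (y + h / 2 / 2))//; [|by apply: sub; lra|by right; left; lra].
rewrite (z0 x y)//; [|by apply: sub; lra|by right; left; lra].
by rewrite !add0r; have -> : h / 2 / 2 = h / 4 by field.
Qed.

(** Iterating the shrinking step reduces the contour to arbitrarily small squares around the
    exceptional point, near which continuity keeps [g] bounded. *)
Lemma sqint_removable g x y h : 0 < h ->
  (forall z, square x y h z -> z != Complex (x + h / 3) (y + h / 3) -> cdiff g z) ->
  ceps_cont g (Complex (x + h / 3) (y + h / 3)) ->
  sqint g x y h = 0.
Proof.
move=> h0 hg hc; set rho := Complex _ _ in hg hc.
have key n : exists u v k, [/\ 0 < k, k <= h / 2 ^+ n,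
    square u v k `<=` square x y h, Complex (u + k / 3) (v + k / 3) = rho &
    sqint g x y h = sqint g u v k].
  elim: n => [|n [u [v [k [k0 kh sub E ->]]]]].
    by exists x, y, h; split; rewrite ?expr0 ?divr1.
  exists (u + k / 4), (v + k / 4), (k / 4); split.
  - by rewrite divr_gt0.
  - by rewrite exprS invfM mulrCA; move: kh; set X := _ / _; lra.
  - by move=> z [/andP[a b] /andP[c d]]; apply: sub; split; apply/andP; split; lra.
  - by rewrite -E; congr Complex; field.
  - apply: sqint_shrink => //; rewrite E// => z zs zr.
    by apply: hg => //; exact: sub.
have [eta eta0 He] := hc 1 ltr01; pose B := cabs (g rho) + 1.
have B0 : 0 < B by rewrite ltr_wpDl ?cabs_ge0.
apply/eqP; rewrite -cabs_eq0; apply/eqP/le_anti; rewrite cabs_ge0 andbT.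
apply/ler_addgt0Pr => e e0; rewrite add0r.
have e1 : 0 < Num.min (e / (8 * B)) (eta / 2) by rewrite lt_min !divr_gt0// mulr_gt0.
have [n] := exp2_small h e1; rewrite lt_min => /andP[n1 n2].
have [u [v [k [k0 kh sub E ->]]]] := key n.
apply: le_trans (@sqint_norm _ _ _ _ _ B (ltW k0) _) _.
  move=> z [zs _]; split.
    have [->|zr] := eqVneq z rho; first exact: hc.
    by apply: cdiff_cont; apply: hg => //; exact: sub.
  have rs : square u v k rho.
    by rewrite -E; split => /=; apply/andP; split; lra.
  have zr : cabs (z - rho) < eta.
    by apply: le_lt_trans (cabs_square rs zs) _; move: kh n2; set X := _ / _; lra.
  by rewrite /B; have := He z zr; have := cabs_sub_lb (g z) (g rho); lra.
have : k <= e / (8 * B) by apply: le_trans kh (ltW n1).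
by rewrite ler_pdivlMr ?mulr_gt0//; lra.
Qed.

(** Stands in for the value [2 pi i]. All four edges contribute nonnegatively to the imaginary part,
    and the bottom edge, where the squared distance to the pole is at most [5 (h / 3)^2], already
    gives 3/5. *)
Lemma sqint_inv_gt x y h : 0 < h ->
  3 / 5 <= cabs (sqint (fun z => (z - Complex (x + h / 3) (y + h / 3))^-1) x y h).
Proof.
move=> h0; set rho := Complex _ _; set F := fun z => _.
have hne u v : u - (x + h / 3) != 0 \/ v - (y + h / 3) != 0 -> Complex u v != rho.
  move=> H; apply/eqP => -[e1 e2].
  by case: H => /eqP; apply; rewrite ?e1 ?e2 subrr.
have [|c1 c2 c3 c4] := @edges_cont _ F x y h (ltW h0).
  move=> [u v] _ /= H; apply: cdiff_cont; apply: cdiff_inv; apply: hne.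
  by case: H => [|[|[|]]] ->; [left|left|right|right]; apply/eqP; lra.
have xh : x <= x + h by rewrite lerDl ltW.
have yh : y <= y + h by rewrite lerDl ltW.
have FE u v : F (Complex u v) = Complex
    ((u - (x + h / 3)) / ((u - (x + h / 3)) ^+ 2 + (v - (y + h / 3)) ^+ 2))
    (- ((v - (y + h / 3)) / ((u - (x + h / 3)) ^+ 2 + (v - (y + h / 3)) ^+ 2))) by [].
have [a1 /andP[u1 u2] E1] := pint_mvt xh c1.2.
have [a2 /andP[v1 v2] E2] := pint_mvt yh c2.1.
have [a3 /andP[w1 w2] E3] := pint_mvt xh c3.2.
have [a4 /andP[t1 t2] E4] := pint_mvt yh c4.1.
apply: le_trans (Im_le_cabs _); apply: le_trans (ler_norm _).
rewrite /sqint /cpint !ImB ImD !ImM /= !mul0r !mul1r !add0r E1 E2 E3 E4 !FE /=.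
have N : y - (y + h / 3) = - (h / 3) by ring.
have N2 : x - (x + h / 3) = - (h / 3) by ring.
have N3 : x + h - (x + h / 3) = 2 * h / 3 by field.
have N4 : y + h - (y + h / 3) = 2 * h / 3 by field.
have L u : u + h - u = h by ring.
rewrite N N2 N3 N4 !L sqrrN !mulNr !opprK.
have d s (k : R) : 0 < k -> 0 < s ^+ 2 + k ^+ 2.
  by move=> k0; rewrite ltr_wpDl ?sqr_ge0// exprn_gt0.
have h3 : 0 < h / 3 by rewrite divr_gt0.
have h23 : 0 < 2 * h / 3 by rewrite divr_gt0// mulr_gt0.
have p1 : 3 / 5 <= h / 3 / ((a1 - (x + h / 3)) ^+ 2 + (h / 3) ^+ 2) * h.
  rewrite mulrAC ler_pdivlMr ?d//.
  have : (a1 - (x + h / 3)) ^+ 2 <= 4 * (h / 3) ^+ 2.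
    by rewrite !expr2; nra.
  by rewrite !expr2; nra.
have p2 : 0 <= 2 * h / 3 / ((2 * h / 3) ^+ 2 + (a2 - (y + h / 3)) ^+ 2) * h.
  by rewrite mulr_ge0 ?(ltW h0)// divr_ge0 ?(ltW h23)// ltW// addrC d.
have p3 : 0 <= 2 * h / 3 / ((a3 - (x + h / 3)) ^+ 2 + (2 * h / 3) ^+ 2) * h.
  by rewrite mulr_ge0 ?(ltW h0)// divr_ge0 ?(ltW h23)// ltW// d.
have p4 : 0 <= h / 3 / ((h / 3) ^+ 2 + (a4 - (y + h / 3)) ^+ 2) * h.
  by rewrite mulr_ge0 ?(ltW h0)// divr_ge0 ?(ltW h3)// ltW// addrC d.
lra.
Qed.

(** The difference quotient [g] has a removable singularity at [rho], hence integral 0, so the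
    integral of [f / (z - rho)] is [f rho] times that of [1 / (z - rho)]. The first is at most
    [8 (3 M / h) h = 24 M], the second at least 3/5, and [24 / (3/5) = 40]. *)
Lemma cauchy_estimate f x y h M : 0 < h ->
  (forall z, square x y h z -> cdiff f z) ->
  (forall z, square_boundary x y h z -> cabs (f z) <= M) ->
  cabs (f (Complex (x + h / 3) (y + h / 3))) <= 40 * M.
Proof.
move=> h0 hf hM; set rho := Complex _ _.
have rs : square x y h rho by split => /=; apply/andP; split; lra.
have [l Hl] := hf rho rs.
pose g z := if z == rho then l else (f z - f rho) / (z - rho).
have fB z : cdiff f z -> cdiff (fun w => f w - f rho) z.
  move=> [k Hk]; exists k => e e0; have [eta eta0 He] := Hk e e0; exists eta => // w /He.
  by rewrite (_ : f w - f rho - (f z - f rho) = f w - f z)//; ring.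
have dg z : square x y h z -> z != rho -> cdiff g z.
  move=> zs zr; apply: (@cdiff_eps (fun w => (f w - f rho) * (w - rho)^-1) _ _ (cabs (z - rho))).
  - by rewrite cabs_gt0 subr_eq0.
  - move=> w hw; rewrite /g; case: eqP => // wr; move: hw.
    by rewrite wr cabsB ltxx.
  - by apply: cdiffM; [apply: fB; exact: hf|exact: cdiff_inv].
have gc : ceps_cont g rho.
  move=> e e0; have [eta eta0 He] := Hl e e0; exists eta => // w /He hw.
  rewrite /g eqxx; case: eqP => [_|/eqP wr]; first by rewrite subrr cabs0 ltW.
  have wr0 : w - rho != 0 by rewrite subr_eq0.
  have -> : (f w - f rho) / (w - rho) - l = (f w - f rho - l * (w - rho)) / (w - rho) by field.
  by rewrite cabsM cabsV ler_pdivrMr// cabs_gt0.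
have Tg := sqint_removable h0 dg gc.
have bnd z : square_boundary x y h z -> h / 3 <= cabs (z - rho).
  move=> [[/andP[z1 z2] /andP[z3 z4]] H].
  have A := Re_le_cabs (z - rho); have B := Im_le_cabs (z - rho).
  rewrite ReB /= in A; rewrite ImB /= in B.
  by case: H => [|[|[|]]] H; [apply: le_trans A|apply: le_trans A|apply: le_trans B|
    apply: le_trans B]; rewrite H ler_normr; apply/orP; [right|left|right|left]; lra.
have bne z : square_boundary x y h z -> z != rho.
  by move=> /bnd H; rewrite -subr_eq0 -cabs_gt0; apply: lt_le_trans H; lra.
have ax := @sqint_axpy _ g (fun z => (z - rho)^-1) (f rho) x y h (ltW h0).
have ci z : square_boundary x y h z -> ceps_cont g z /\ ceps_cont (fun z => (z - rho)^-1) z.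
  move=> zb; split; apply: cdiff_cont; last by apply: cdiff_inv; exact: bne.
  by apply: dg; [case: zb|exact: bne].
have {}ax := ax ci; rewrite Tg add0r in ax.
have M0 : 0 <= M.
  apply: le_trans (hM (Complex x y) _); first exact: cabs_ge0.
  by split; [split; apply/andP => /=; split; lra|left].
have up : cabs (sqint (fun z => g z + f rho * (z - rho)^-1) x y h) <= 8 * (M / (h / 3) * h).
  apply: sqint_norm; first exact: ltW.
  move=> z zb; have [gz iz] := ci z zb; have zr := bne z zb; split.
    apply: cdiff_cont; apply: (@cdiff_eps (fun w => f w * (w - rho)^-1) _ _ (cabs (z - rho))).
    - by rewrite cabs_gt0 subr_eq0.
    - move=> w hw; rewrite /g; case: eqP => [wr|/eqP wr].
        by move: hw; rewrite wr cabsB ltxx.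
      by field; rewrite subr_eq0.
    - by apply: cdiffM; [apply: hf; case: zb|exact: cdiff_inv].
  rewrite /g (negbTE zr).
  have -> : (f z - f rho) / (z - rho) + f rho / (z - rho) = f z / (z - rho).
    by field; rewrite subr_eq0.
  rewrite cabsM cabsV; apply: ler_pM; rewrite ?cabs_ge0 ?invr_ge0 ?cabs_ge0 ?hM//.
  by rewrite lef_pV2 ?posrE ?bnd ?cabs_gt0 ?subr_eq0//; lra.
have low := sqint_inv_gt x y h0.
move: up; rewrite ax cabsM.
have -> : 8 * (M / (h / 3) * h) = 24 * M by field; rewrite gt_eqF.
move=> up; have := ler_wpM2l (cabs_ge0 (f rho)) low; lra.
Qed.

End CauchyEstimate.

(** * The identity theorem for half-planes *)

Section IdentityTheorem.
Variable R : realType.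
Implicit Types (f g H : R[i] -> R[i]) (x y h : R) (z w : R[i]).

Lemma rcont_bounded (f : R -> R) a b : a <= b -> rcont f a b ->
  exists M, forall t, a <= t <= b -> `|f t| <= M.
Proof.
move=> ab hf.
have fc : {within `[a, b], continuous f}.
  apply: continuous_in_subspaceT => t /set_mem /= tab.
  by apply: hf; rewrite in_itv /= in tab.
have [u _ Hu] := EVT_max ab fc; have [v _ Hv] := EVT_min ab fc.
exists (`|f u| + `|f v|) => t tab.
have {}Hu := Hu t; have {}Hv := Hv t; rewrite !in_itv /= in Hu Hv.
have := Hu tab; have := Hv tab; have := ler_norm (f u); have := ler_norm (- f v).
have := normr_ge0 (f u); have := normr_ge0 (f v).
by rewrite normrN => *; rewrite ler_norml; apply/andP; split; lra.
Qed.

Lemma ccont_bounded (F : R -> R[i]) a b : a <= b -> ccont F a b ->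
  exists M, forall t, a <= t <= b -> cabs (F t) <= M.
Proof.
move=> ab [hr hi]; have [M HM] := rcont_bounded ab hr; have [N HN] := rcont_bounded ab hi.
exists (M + N) => t tab; apply: le_trans (cabs_le_ReIm _) _.
by have := HM t tab; have := HN t tab; lra.
Qed.

Lemma boundary_bounded f x y h : 0 <= h -> (forall z, square x y h z -> ceps_cont f z) ->
  exists M, forall z, square_boundary x y h z -> cabs (f z) <= M.
Proof.
move=> h0 hf; have [|c1 c2 c3 c4] := @edges_cont _ f x y h h0.
  by move=> z zs _; exact: hf.
have xh : x <= x + h by rewrite lerDl.
have yh : y <= y + h by rewrite lerDl.
have [M1 H1] := ccont_bounded xh c1; have [M2 H2] := ccont_bounded yh c2.
have [M3 H3] := ccont_bounded xh c3; have [M4 H4] := ccont_bounded yh c4.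
exists (Num.max (Num.max M1 M2) (Num.max M3 M4)) => -[u v] [[/= uu vv]] zb.
rewrite !le_max; case: zb => [|[|[|]]] ->; rewrite ?H1 ?H2 ?H3 ?H4 ?orbT//.
Qed.

(** Cauchy's estimate for [H z / (z - p)^n], with [p] placed where [H] already vanishes. On the part
    of the boundary where [H] may be nonzero, [|z - p| >= 9 D / 25], while the point in question is
    closer than [D / 3] to [p]; the ratio 25/27 to the power [n] tends to 0. *)
Lemma vanish_step H (theta a : R) : theta < a ->
  (forall z, theta < complex.Re z -> cdiff H z) ->
  (forall z, a < complex.Re z -> H z = 0) ->
  forall z, a - (a - theta) / 6 < complex.Re z -> H z = 0.
Proof.
move=> ta dH H0 [b c] /= hb; have [ab|ba] := ltP a b; first exact: H0.
pose D := a - theta; have D0 : 0 < D by rewrite subr_gt0.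
have hD : a - D / 6 < b by [].
have Da : theta = a - D by rewrite /D; ring.
pose x := b - D / 3; pose y := c - D / 3; pose p := Complex (a + D / 6) c.
have rE : Complex b c = Complex (x + D / 3) (y + D / 3).
  by rewrite /x /y; congr Complex; ring.
have sub z : square x y D z -> theta < complex.Re z.
  by move=> [/andP[+ _] _]; rewrite /x Da; lra.
have dH' z : square x y D z -> cdiff H z by move=> /sub; exact: dH.
have [M HM] := boundary_bounded (ltW D0) (fun z zs => cdiff_cont (dH' z zs)).
pose X := a + D / 6 - b; have X0 : 0 < X by rewrite /X; lra.
have XD : X < D / 3 by rewrite /X; lra.
(* Chosen between [D / 3] and [sqrt 5 D / 6], the latter bounding the distance to [p] from below on
   the relevant part of the top and bottom edges. *)
pose r := D * (9 / 25); have r0 : 0 < r by rewrite mulr_gt0.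
have far z : square_boundary x y D z -> complex.Re z <= a -> r <= cabs (z - p).
  case: z => u v [[/= /andP[u1 u2] /andP[v1 v2]] zb] ua.
  have E : (a + D / 6 - u) ^+ 2 + (v - c) ^+ 2 >= r ^+ 2.
    have u3 : D / 6 <= a + D / 6 - u by lra.
    have hu : (D / 6) ^+ 2 <= (a + D / 6 - u) ^+ 2 by rewrite lerXn2r ?nnegrE//; lra.
    have R2 : r ^+ 2 = 81 / 625 * D ^+ 2 by rewrite /r; field.
    have D2 : 0 < D ^+ 2 by rewrite exprn_gt0.
    have hv : (D / 3) ^+ 2 <= (v - c) ^+ 2 -> r ^+ 2 <= (a + D / 6 - u) ^+ 2 + (v - c) ^+ 2.
      by rewrite R2; move: hu; rewrite !expr2; rewrite !expr2 in D2; lra.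
    case: zb => [uE|[uE|[vE|vE]]].
    - have h1 : (D / 2) ^+ 2 <= (a + D / 6 - x) ^+ 2.
        by rewrite lerXn2r ?nnegrE// /x; lra.
      have := sqr_ge0 (v - c); rewrite R2 uE; move: h1.
      have -> : (D / 2) ^+ 2 = D ^+ 2 / 4 by field.
      lra.
    - by move: ua; rewrite uE /x; lra.
    - apply: hv; rewrite vE /y; have -> : c - D / 3 - c = - (D / 3) by ring.
      by rewrite sqrrN.
    - apply: hv; rewrite vE /y; have -> : c - D / 3 + D - c = 2 * (D / 3) by field.
      by rewrite lerXn2r ?nnegrE//; lra.
  rewrite -(@ler_pXn2r _ 2) ?nnegrE ?cabs_ge0 ?(ltW r0)//.
  apply: le_trans E _; rewrite le_eqVlt; apply/orP; left; apply/eqP.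
  rewrite /Normc.normc /= sqr_sqrtr ?addr_ge0 ?sqr_ge0//; ring.
pose K := 40 * `|M|.
have key n : cabs (H (Complex b c)) <= K * (25 / 27) ^+ n.
  pose f z := H z * ((z - p)^-1) ^+ n.
  have df z : square x y D z -> cdiff f z.
    move=> zs; have [zp|zp] := eqVneq z p.
      apply: (@cdiff_eps _ (fun w => 0 + 0 * w) _ _ (D / 6)); first by rewrite divr_gt0.
        move=> w; rewrite zp => hw; rewrite /f H0 ?mul0r ?addr0//.
        have := le_lt_trans (Re_le_cabs _) hw; rewrite ReB /= ltr_norml => /andP[+ _]; lra.
      exact: cdiff_affine.
    by apply: cdiffM; [exact: dH'|apply: cdiff_exp; exact: cdiff_inv].
  have fM z : square_boundary x y D z -> cabs (f z) <= `|M| * (r^-1) ^+ n.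
    move=> zb; have [za|az] := leP (complex.Re z) a; last first.
      by rewrite /f H0// mul0r cabs0 mulr_ge0// exprn_ge0// invr_ge0 ltW.
    rewrite /f cabsM cabsX cabsV; apply: ler_pM; rewrite ?cabs_ge0 ?exprn_ge0 ?invr_ge0 ?cabs_ge0//.
      by apply: le_trans (HM z zb) _; exact: ler_norm.
    have := far z zb za => h; have c0 : 0 < cabs (z - p) := lt_le_trans r0 h.
    by rewrite lerXn2r ?nnegrE ?invr_ge0 ?(ltW r0) ?cabs_ge0// lef_pV2 ?posrE.
  have := cauchy_estimate D0 df fM; rewrite -rE /f cabsM cabsX cabsV.
  have -> : cabs (Complex b c - p) = X.
    rewrite (_ : _ - p = (- X)%:C%C); first by rewrite cabs_real normrN gtr0_norm.
    by apply: complex_ext; rewrite ?ReB ?ImB /= /X; ring.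
  rewrite [X^-1 ^+ n]exprVn ler_pdivrMr ?exprn_gt0// => h; apply: le_trans h _.
  rewrite /K -!mulrA ler_wpM2l// ler_wpM2l// -exprMn.
  rewrite lerXn2r ?nnegrE ?mulr_ge0 ?invr_ge0 ?(ltW r0) ?(ltW X0)//.
  by rewrite mulrC ler_pdivrMr// /r; lra.
apply/eqP; rewrite -cabs_eq0; apply/eqP/le_anti; rewrite cabs_ge0 andbT.
have cv : K * (25 / 27) ^+ n @[n --> \oo] --> K * 0.
  by apply: cvgMr; apply: cvg_expr; rewrite ger0_norm//; lra.
rewrite mulr0 in cv.
apply/ler_addgt0Pr => e e0; rewrite add0r.
have /cvgrPdist_lt/(_ e e0)[N _ /(_ N (leqnn N))] := cv.
rewrite sub0r normrN => /ltW h; apply: le_trans (key N) (le_trans (ler_norm _) h).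
Qed.

(** Each step shrinks the distance of the line to [theta] by the factor 5/6. *)
Lemma vanish_half_plane H (theta a : R) : theta < a ->
  (forall z, theta < complex.Re z -> cdiff H z) ->
  (forall z, a < complex.Re z -> H z = 0) ->
  forall z, theta < complex.Re z -> H z = 0.
Proof.
move=> ta dH H0 z hz.
have key n : forall w, theta + (a - theta) * (5 / 6) ^+ n < complex.Re w -> H w = 0.
  elim: n => [|n IH].
    by move=> w hw; apply: H0; move: hw; rewrite expr0 mulr1; lra.
  have b0 : theta < theta + (a - theta) * (5 / 6) ^+ n.
    by rewrite ltrDl mulr_gt0 ?subr_gt0// exprn_gt0//; lra.
  move=> w hw; apply: (vanish_step b0 dH IH).
  by apply: le_lt_trans hw; rewrite exprS; set q := _ ^+ n; lra.
have cv : (a - theta) * (5 / 6) ^+ n @[n --> \oo] --> (a - theta) * 0.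
  by apply: cvgMr; apply: cvg_expr; rewrite ger0_norm//; lra.
rewrite mulr0 in cv.
have e0 : 0 < complex.Re z - theta by rewrite subr_gt0.
have /cvgrPdist_lt/(_ _ e0)[N _ /(_ N (leqnn N))] := cv.
rewrite sub0r normrN => /(le_lt_trans (ler_norm _)) h.
by apply: (key N); lra.
Qed.

End IdentityTheorem.

(** * Comparison with derivability and punctured limits over the complex field *)

Section ComplexDerivable.
Variable R : realType.
Implicit Types (f : R[i] -> R[i]) (z w l : R[i]) (e eta : R).

Lemma complex_gt0P (e : R[i]) : 0 < e -> exists2 x : R, 0 < x & e = x%:C%C.
Proof.
case: e => a b; rewrite ltcE /= => /andP[/eqP -> a0]; exists a => //.
Qed.

Lemma cball (z w : R[i]^o) (x : R) : ball z (x%:C%C) w <-> cabs (w - z) < x.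
Proof. by rewrite /ball /= cabsE ltcR cabsB. Qed.

Lemma derivable_cdiff f z : derivable (f : R[i]^o -> R[i]^o) z 1 <-> cdiff f z.
Proof.
split.
  move=> /cvg_ex[l /cvgrPdist_le H]; exists l => e e0.
  have eC : 0 < e%:C%C :> R[i] by rewrite ltcR.
  have := H _ eC; rewrite /dnbhs => /nbhs_ballP[d /= d0 Hd].
  have [eta eta0 dE] := complex_gt0P d0; exists eta => // w hw.
  have [->|wz] := eqVneq w z; first by rewrite !subrr mulr0 subrr cabs0 mulr0.
  have wz0 : w - z != 0 by rewrite subr_eq0.
  have := Hd (w - z); rewrite dE => /(_ _ wz0).
  rewrite cball subr0 => /(_ hw); rewrite cabsE lecR.
  rewrite /= [(w - z) *: 1]mulr1 subrK => h.
  have -> : f w - f z - l * (w - z) = - (l - (w - z)^-1 *: (f w - f z)) * (w - z).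
    by rewrite /GRing.scale /=; field.
  by rewrite cabsM cabsN ler_wpM2r ?cabs_ge0.
move=> [l H]; apply/cvg_ex; exists l; apply/cvgrPdist_le => e' /complex_gt0P[e e0 ->].
have [eta eta0 He] := H e e0; rewrite /dnbhs; apply/nbhs_ballP.
exists eta%:C%C; first by rewrite /= ltcR.
move=> h /=; rewrite cball subr0 => hh h0; rewrite cabsE lecR.
have := He (h + z); rewrite addrK => /(_ hh) hE.
rewrite [h *: 1]mulr1.
have -> : l - h^-1 *: (f (h + z) - f z) = - ((f (h + z) - f z - l * h) / h).
  by rewrite /GRing.scale /=; field.
by rewrite cabsN cabsM cabsV ler_pdivrMr ?cabs_gt0.
Qed.

Lemma cvg_dnbhs_eps f (z l : R[i]) :
  ((f : R[i]^o -> R[i]^o) @ (z : R[i]^o)^' --> (l : R[i]^o)) <->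
  (forall e, 0 < e -> exists2 eta, 0 < eta & forall w, w != z -> cabs (w - z) < eta ->
    cabs (f w - l) <= e).
Proof.
split.
  move=> /cvgrPdist_le H e e0.
  have eC : 0 < e%:C%C :> R[i] by rewrite ltcR.
  have := H _ eC; rewrite /dnbhs => /nbhs_ballP[d /= d0 Hd].
  have [eta eta0 dE] := complex_gt0P d0; exists eta => // w wz hw.
  have := Hd w; rewrite dE => /(_ _ wz); rewrite cball => /(_ hw).
  by rewrite cabsE lecR cabsB.
move=> H; apply/cvgrPdist_le => e' /complex_gt0P[e e0 ->].
have [eta eta0 He] := H e e0; rewrite /dnbhs; apply/nbhs_ballP.
exists eta%:C%C; first by rewrite /= ltcR.
by move=> w /=; rewrite cball => hw wz; rewrite cabsE lecR cabsB; exact: He.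
Qed.

End ComplexDerivable.

(** * Arithmetic of the semigroup *)

Section BeurlingArithmetic.
Variables (R : realType) (G : beurlingSystem R).
Implicit Types (g h d p q : G) (s t : seq G) (T x : R) (j k n : nat).

Definition primes s := forall p, p \in s -> bprime (b := G) p.

Local Notation "\pi s" := (\prod_(p <- s) p)%g (at level 10, s at level 8).

Lemma prod_rem p s : p \in s -> (\pi s = p * \pi (rem p s))%g.
Proof.
elim: s => // q s IH; have [<-|pq] := eqVneq p q; first by rewrite /= eqxx big_cons.
rewrite inE (negbTE pq) /= eq_sym (negbTE pq) => ps; rewrite !big_cons (IH ps) !mulgA.
by rewrite (@bmulC R G q p).
Qed.

Lemma prod_perm s t : perm_eq s t -> (\pi s = \pi t)%g.
Proof.
elim: s t => [|p s IH] t; first by move=> /perm_size/esym/size0nil ->.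
move=> st; have pt : p \in t by rewrite -(perm_mem st) mem_head.
rewrite big_cons (prod_rem pt); congr (_ * _)%g; apply: IH.
by rewrite -(perm_cons p) (perm_trans st (perm_to_rem pt)).
Qed.

Lemma prod_nseq j p : (\pi (nseq j p) = p ^+ j)%g.
Proof. by elim: j => [|j IH]; rewrite ?big_nil ?expg0//= big_cons IH expgS. Qed.

Lemma primes_nseq j p : bprime p -> primes (nseq j p).
Proof. by move=> pp q; rewrite mem_nseq => /andP[_ /eqP ->]. Qed.

Lemma primes_cat s t : primes s -> primes t -> primes (s ++ t).
Proof. by move=> hs ht p; rewrite mem_cat => /orP[/hs|/ht]. Qed.

Lemma prime_exp_inj p q j k : bprime p -> bprime q -> (0 < j)%N ->
  (p ^+ j = q ^+ k)%g -> p = q /\ j = k.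
Proof.
move=> pp pq j0; rewrite -!prod_nseq => /(@bfactor_unique R G).
move=> /(_ (primes_nseq pp) (primes_nseq pq)) pe; split.
  have : p \in nseq k q by rewrite -(perm_mem pe) mem_nseq j0 eqxx.
  by rewrite mem_nseq => /andP[_ /eqP].
by have := perm_size pe; rewrite !size_nseq.
Qed.

Lemma mulgI_beurling h g d : (h * d = g * d)%g -> h = g.
Proof.
have [s hs ->] := bfactor_exists h; have [t ht ->] := bfactor_exists g.
have [u hu ->] := bfactor_exists d; rewrite -!big_cat /= => /(@bfactor_unique R G).
move=> /(_ (primes_cat hs hu) (primes_cat ht hu)).
by rewrite perm_cat2r => /prod_perm.
Qed.

Definition gle T : seq G := fset_set [set g : G | bnorm g <= T].

Lemma mem_gle T g : (g \in gle T) = (bnorm g <= T).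
Proof.
rewrite /gle in_fset_set; last exact: bnorm_finite.
by apply/idP/idP => [/set_mem|h]; [|exact: mem_set].
Qed.

Lemma uniq_gle T : uniq (gle T).
Proof. exact: fset_uniq. Qed.

Lemma bnormX p j : bnorm (p ^+ j)%g = bnorm p ^+ j.
Proof. by elim: j => [|j IH]; rewrite ?expg0 ?bnorm1// expgS bnormM IH exprS. Qed.

(** Otherwise the powers of [p], distinct by unique factorization, would form an infinite set of
    elements of norm at most 1. *)
Lemma prime_norm_gt1 p : bprime p -> 1 < bnorm p.
Proof.
move=> pp; rewrite ltNge; apply/negP => p1.
have inj : injective (fun j : nat => (p ^+ j.+1)%g : G).
  by move=> j k /prime_exp_inj -/(_ pp pp isT)[_ [] ].
have mem j : (p ^+ j.+1)%g \in gle 1.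
  by rewrite mem_gle bnormX exprn_ile1// ltW// bnorm_gt0.
pose n := size (gle 1).
have := @uniq_leq_size _ [seq (p ^+ j.+1)%g | j <- iota 0 n.+1] (gle 1).
rewrite map_inj_uniq// iota_uniq => /(_ isT).
move=> /(_ _); rewrite size_map size_iota ltnn => h.
by have := h (fun g => ltac:(by move=> /mapP[j _ ->]; exact: mem)).
Qed.

Lemma bnorm_ge1 g : 1 <= bnorm g.
Proof.
have [s hs ->] := bfactor_exists g.
elim: s hs => [|p s IH] hs; first by rewrite big_nil bnorm1.
rewrite big_cons bnormM mulr_ege1//.
  by apply/ltW/prime_norm_gt1/hs; rewrite mem_head.
by apply: IH => q qs; apply: hs; rewrite inE qs orbT.
Qed.

Lemma bnorm_gt1 g : g != 1%g -> 1 < bnorm g.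
Proof.
have [s hs ->] := bfactor_exists g; case: s hs => [|p s] hs.
  by rewrite big_nil eqxx.
move=> _; rewrite big_cons bnormM.
apply: lt_le_trans (prime_norm_gt1 (hs p (mem_head _ _))) _.
by rewrite ler_peMr ?bnorm_ge1// ltW// bnorm_gt0.
Qed.

Lemma mangoldt_prime_power p k : bprime p -> (0 < k)%N ->
  mangoldt (p ^+ k)%g = ln (bnorm p).
Proof.
move=> pp k0; rewrite /mangoldt; case: xgetP => [q _ /= [pq [j j0 e]]|].
  by have [-> _] := prime_exp_inj pp pq k0 e.
by move/(_ p) => /= H; exfalso; apply: H; split=> //; exists k.
Qed.

Lemma mangoldt_neq0 g : mangoldt g != 0 ->
  exists p k, [/\ bprime p, (0 < k)%N & g = (p ^+ k)%g].
Proof.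
rewrite /mangoldt; case: xgetP => [q _ /= [pq [j j0 e]] _|]; first by exists q, j.
by rewrite bnorm1 ln1 eqxx.
Qed.

Lemma mangoldt_ge0 g : 0 <= mangoldt g.
Proof. by rewrite /mangoldt ln_ge0// bnorm_ge1. Qed.

Definition bdvd d g := `[< exists h, g = (h * d)%g >].

(** Unique factorization turns divisibility into a comparison of multiplicities. *)
Lemma bdvd_prime_power q j s : bprime q -> primes s ->
  bdvd (q ^+ j)%g (\pi s) = (j <= count_mem q s)%N.
Proof.
move=> pq hs; apply/asboolP/idP => [[h]|].
  have [t ht ->] := bfactor_exists h.
  rewrite -prod_nseq -big_cat /= => /(@bfactor_unique R G).
  move=> /(_ hs (primes_cat ht (primes_nseq pq))) /permP /(_ (pred1 q)) ->.
  by rewrite count_cat count_nseq /= eqxx mul1n leq_addl.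
elim: j s hs => [|j IH] s hs js.
  by exists (\pi s)%g; rewrite expg0 mulg1.
have qs : q \in s by rewrite -has_pred1 has_count (leq_trans _ js).
have cs : count_mem q s = (count_mem q (rem q s)).+1.
  by rewrite (permP (perm_to_rem qs)) /= eqxx.
have [||h Eh] := IH (rem q s).
- by move=> r /mem_rem; exact: hs.
- by rewrite -ltnS -cs.
by exists h; rewrite (prod_rem qs) Eh expgS mulgA (@bmulC R G q h) -mulgA.
Qed.

(** The identity [Lambda * 1 = log], by induction on the prime factors: adjoining [p] to a
    factorization in which it occurs [v] times creates exactly one new prime power divisor,
    [p^(v+1)], of weight [log |p|]. *)
Lemma sum_mangoldt_dvd T g : bnorm g <= T ->
  \sum_(d <- gle T | bdvd d g) mangoldt d = ln (bnorm g).
Proof.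
have [s hs ->] := bfactor_exists g; elim: s hs T => [|p s IH] hs T hT.
  rewrite big_nil bnorm1 ln1 big1// => d /asboolP[h e].
  apply/eqP; apply: contrapT => /negP/mangoldt_neq0[q [k [pq k0 dE]]].
  move: e; rewrite dE -prod_nseq; have [t ht ->] := bfactor_exists h.
  have E0 : (1%g : G) = (\pi [::])%g by rewrite big_nil.
  have p0 : primes [::] by [].
  rewrite -big_cat {1}E0 => /(@bfactor_unique R G).
  move=> /(_ p0 (primes_cat ht (primes_nseq pq)))/perm_size.
  by rewrite size_cat size_nseq addnC; case: k k0 {dE}.
have pp : bprime p by apply: hs; rewrite mem_head.
have hs' : primes s by move=> q qs; apply: hs; rewrite inE qs orbT.
have ps1 : bnorm (\pi s)%g <= T.
  apply: le_trans hT; rewrite big_cons bnormM ler_peMl ?ltW ?prime_norm_gt1//.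
  by rewrite bnorm_gt0.
set v := count_mem p s.
have d0T : (p ^+ v.+1)%g \in gle T.
  rewrite mem_gle; apply: le_trans hT.
  have /asboolP[h ->] : bdvd (p ^+ v.+1)%g (\pi (p :: s)).
    by rewrite bdvd_prime_power//= eqxx.
  by rewrite bnormM ler_peMl ?bnorm_ge1// ltW// bnorm_gt0.
have E d : mangoldt d != 0 ->
    bdvd d (\pi (p :: s))%g = bdvd d (\pi s)%g || (d == (p ^+ v.+1)%g).
  move=> /mangoldt_neq0[q [j [pq j0 ->]]]; rewrite !bdvd_prime_power//=.
  have [<-|qp] := eqVneq p q.
    rewrite add1n leq_eqVlt ltnS orbC; congr (_ || _).
    by apply/eqP/eqP => [->//|/prime_exp_inj -/(_ pp pp j0)[] ].
  rewrite add0n; case: eqP => [/prime_exp_inj -/(_ pq pp j0)[e _]|_]; last by rewrite orbF.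
  by rewrite e eqxx in qp.
have Nd : bdvd (p ^+ v.+1)%g (\pi s)%g = false by rewrite bdvd_prime_power// ltnn.
have Yd : bdvd (p ^+ v.+1)%g (\pi (p :: s))%g by rewrite bdvd_prime_power//= eqxx.
rewrite big_mkcond (bigD1_seq (p ^+ v.+1)%g) ?uniq_gle//= Yd.
rewrite mangoldt_prime_power// [in RHS]big_cons bnormM lnM ?posrE ?bnorm_gt0//; congr (_ + _).
rewrite -(IH hs' T ps1) big_mkcond [RHS]big_mkcond; apply: eq_bigr => d _.
have [d0|d0] := eqVneq (mangoldt d) 0; first by rewrite d0 !if_same.
rewrite E//; have [->|dn] := eqVneq d (p ^+ v.+1)%g; first by rewrite Nd ?eqxx.
by rewrite ?orbF ?(negbTE dn) ?orbF.
Qed.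

End BeurlingArithmetic.

(** * Complex-valued functions and sequences *)

Section ComplexExp.
Variable R : realType.
Implicit Types (z w s : R[i]) (v x b : R).

Definition cexp z : R[i] := Complex (expR (complex.Re z) * cos (complex.Im z))
  (expR (complex.Re z) * sin (complex.Im z)).

Lemma cexp0 : cexp 0 = 1.
Proof. by rewrite /cexp /= expR0 cos0 sin0 mulr1 mulr0. Qed.

Lemma cexpD z w : cexp (z + w) = cexp z * cexp w.
Proof.
rewrite /cexp ReD ImD expRD cosD sinD.
by apply: complex_ext; rewrite ?ReM ?ImM /=; ring.
Qed.

Lemma cabs_cexp z : cabs (cexp z) = expR (complex.Re z).
Proof.
rewrite /cexp /Normc.normc /= !exprMn -mulrDr cos2Dsin2 mulr1 sqrtr_sqr.
by rewrite ger0_norm// expR_ge0.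
Qed.

Lemma cexp_real x : cexp x%:C%C = (expR x)%:C%C.
Proof. by rewrite /cexp /= cos0 sin0 mulr1 mulr0. Qed.

Lemma cpowE x s : 0 < x -> cpow x s = cexp (s * (ln x)%:C%C).
Proof.
move=> x0; rewrite /cpow /cexp ReM ImM /= !mulr0 subr0 add0r /powR gt_eqF//.
by apply: complex_ext; rewrite ?ReM ?ImM /=; ring.
Qed.

Definition cderiv (F : R -> R[i]) v l :=
  is_derive v (1 : R) (fun t => complex.Re (F t)) (complex.Re l) /\
  is_derive v (1 : R) (fun t => complex.Im (F t)) (complex.Im l).

Lemma cderiv_eq F G v l k : F =1 G -> l = k -> cderiv F v l -> cderiv G v k.
Proof. by move=> /funext -> ->. Qed.

Lemma cderiv_real (f : R -> R) v x : is_derive v (1 : R) f x ->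
  cderiv (fun t => (f t)%:C%C) v x%:C%C.
Proof. by move=> h; split=> //=; exact: is_derive_cst. Qed.

Lemma cderiv_cst z v : cderiv (fun=> z) v 0.
Proof. by split; exact: is_derive_cst. Qed.

Lemma cderivD F G v l k : cderiv F v l -> cderiv G v k ->
  cderiv (fun t => F t + G t) v (l + k).
Proof.
move=> [Fr Fi] [Gr Gi]; split.
  rewrite ReD (_ : (fun t => _) = (fun t => complex.Re (F t)) + (fun t => complex.Re (G t))).
    exact: is_deriveD.
  by apply/funext => t; rewrite ReD !fctE.
rewrite ImD (_ : (fun t => _) = (fun t => complex.Im (F t)) + (fun t => complex.Im (G t))).
  exact: is_deriveD.
by apply/funext => t; rewrite ImD !fctE.
Qed.

Lemma cderivM F G v l k : cderiv F v l -> cderiv G v k ->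
  cderiv (fun t => F t * G t) v (l * G v + F v * k).
Proof.
move=> [Fr Fi] [Gr Gi]; split.
  rewrite (_ : (fun t => _) = (fun t => complex.Re (F t)) * (fun t => complex.Re (G t)) -
    (fun t => complex.Im (F t)) * (fun t => complex.Im (G t))).
    apply: (is_derive_eq (is_deriveB (is_deriveM Fr Gr) (is_deriveM Fi Gi))).
    by rewrite /GRing.scale /= ReD !ReM; ring.
  by apply/funext => t; rewrite ReM !fctE.
rewrite (_ : (fun t => _) = (fun t => complex.Re (F t)) * (fun t => complex.Im (G t)) +
    (fun t => complex.Im (F t)) * (fun t => complex.Re (G t))).
  apply: (is_derive_eq (is_deriveD (is_deriveM Fr Gi) (is_deriveM Fi Gr))).
  by rewrite /GRing.scale /= ImD !ImM; ring.
by apply/funext => t; rewrite ImM !fctE.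
Qed.

Lemma cderivZ z F v l : cderiv F v l -> cderiv (fun t => z * F t) v (z * l).
Proof.
move=> h; apply: (cderiv_eq _ _ (cderivM (cderiv_cst z v) h)) => //.
by rewrite mul0r add0r.
Qed.

Lemma cderivN F v l : cderiv F v l -> cderiv (fun t => - F t) v (- l).
Proof.
by move=> /(cderivZ (-1)); apply: cderiv_eq => [t|]; rewrite mulN1r.
Qed.

Lemma cderivB F G v l k : cderiv F v l -> cderiv G v k ->
  cderiv (fun t => F t - G t) v (l - k).
Proof. by move=> hF /cderivN; exact: cderivD. Qed.

Lemma cderiv_cexp s v : cderiv (fun t => cexp (s * t%:C%C)) v (s * cexp (s * v%:C%C)).
Proof.
have d1 (c : R) : is_derive v (1 : R) (fun t => c * t) c.
  have := is_deriveZ c (is_derive_id v (1 : R)); rewrite [c *: 1]mulr1.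
  by rewrite (_ : (fun t => c * t) = c \*: (@id R))//; apply/funext => t; rewrite !fctE.
have E t : cexp (s * t%:C%C) = (expR (complex.Re s * t))%:C%C *
    Complex (cos (complex.Im s * t)) (sin (complex.Im s * t)).
  rewrite /cexp ReM ImM /= !mulr0 subr0 add0r.
  by apply: complex_ext; rewrite ?ReM ?ImM /=; ring.
have de : is_derive v (1 : R) (fun t => expR (complex.Re s * t)) (expR (complex.Re s * v) * complex.Re s).
  exact: (is_derive1_comp (is_derive_expR _) (d1 _)).
have dc : is_derive v (1 : R) (fun t => cos (complex.Im s * t)) (- sin (complex.Im s * v) * complex.Im s).
  exact: (is_derive1_comp (is_derive_cos _) (d1 _)).
have ds : is_derive v (1 : R) (fun t => sin (complex.Im s * t)) (cos (complex.Im s * v) * complex.Im s).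
  exact: (is_derive1_comp (is_derive_sin _) (d1 _)).
have dC : cderiv (fun t => Complex (cos (complex.Im s * t)) (sin (complex.Im s * t))) v
    (Complex (- sin (complex.Im s * v) * complex.Im s) (cos (complex.Im s * v) * complex.Im s)) by [].
apply: (cderiv_eq _ _ (cderivM (cderiv_real de) dC)) => [t|]; rewrite E//.
by apply: complex_ext; rewrite !(ReD, ImD, ReM, ImM) /=; ring.
Qed.

Lemma cderiv_mvt (F F' : R -> R[i]) (v w B : R) : v <= w ->
  (forall t, v <= t <= w -> cderiv F t (F' t) /\ cabs (F' t) <= B) ->
  cabs (F w - F v) <= 2 * B * (w - v).
Proof.
move=> vw h.
have [|c cvw e1] := @prim_mvt _ (fun t => complex.Re (F' t)) v w (fun t => complex.Re (F t)) vw.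
  by move=> t /h[[] ].
have [|d dvw e2] := @prim_mvt _ (fun t => complex.Im (F' t)) v w (fun t => complex.Im (F t)) vw.
  by move=> t /h[[] ].
apply: le_trans (cabs_le_ReIm _) _; rewrite ReB ImB e1 e2 !normrM.
have b0 : 0 <= w - v by rewrite subr_ge0.
rewrite (ger0_norm b0) -mulrDl ler_wpM2r//.
have [_ h1] := h c cvw; have [_ h2] := h d dvw.
by have := le_trans (Re_le_cabs _) h1; have := le_trans (Im_le_cabs _) h2; lra.
Qed.

Lemma cexp_sub1 z : cabs (cexp z - 1) <= 2 * (cabs z * expR (cabs z)).
Proof.
have := @cderiv_mvt (fun t => cexp (z * t%:C%C)) (fun t => z * cexp (z * t%:C%C)) 0 1
  (cabs z * expR (cabs z)) ler01.
rewrite mulr1 mulr0 cexp0 subr0 mulr1; apply => t /andP[t0 t1]; split; first exact: cderiv_cexp.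
rewrite cabsM cabs_cexp ler_wpM2l ?cabs_ge0// ler_expR ReM /= mulr0 subr0.
apply: le_trans (ler_norm _) _; rewrite normrM (ger0_norm t0).
by have := Re_le_cabs z; have := normr_ge0 (complex.Re z); nra.
Qed.

Lemma cexp_sub1B z : cabs (cexp z - 1 - z) <= 4 * (cabs z ^+ 2 * expR (cabs z)).
Proof.
have := @cderiv_mvt (fun t => cexp (z * t%:C%C) - z * t%:C%C) (fun t => z * cexp (z * t%:C%C) - z * 1) 0 1
  (2 * (cabs z ^+ 2 * expR (cabs z))) ler01.
rewrite !(mulr1, mulr0, cexp0, subr0).
have -> : cexp z - z - 1 = cexp z - 1 - z by ring.
move=> H; apply: le_trans (H _) _; last by lra.
move=> t /andP[t0 t1]; split.
  apply: cderivB; first exact: cderiv_cexp.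
  apply: (cderiv_eq (fun=> erefl) (mulr1 z)).
  by apply: cderivZ; apply: cderiv_real; exact: is_derive_id.
have -> : z * cexp (z * t%:C%C) - z = z * (cexp (z * t%:C%C) - 1) by ring.
rewrite cabsM expr2 -mulrA mulrCA ler_wpM2l ?cabs_ge0//.
apply: le_trans (cexp_sub1 _) _; rewrite ler_wpM2l//.
have h : cabs (z * t%:C%C) <= cabs z.
  by rewrite cabsM cabs_real (ger0_norm t0) ler_piMr ?cabs_ge0.
by apply: ler_pM; rewrite ?cabs_ge0 ?expR_ge0 ?ler_expR.
Qed.

End ComplexExp.

(** * Limits and series of complex numbers *)

Section ComplexLimit.
Variable R : realType.
Implicit Types (u w : nat -> R[i]) (l k z : R[i]) (e B : R).

Definition ccvg u l := forall e, 0 < e -> exists N, forall n, (N <= n)%N ->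
  cabs (u n - l) <= e.

Lemma ccvg_bound u l B N : ccvg u l -> (forall n, (N <= n)%N -> cabs (u n) <= B) -> cabs l <= B.
Proof.
move=> h hB; apply/ler_addgt0Pr => e e0; have [M HM] := h e e0.
have := HM (maxn M N) (leq_maxl _ _); have := hB (maxn M N) (leq_maxr _ _).
by have := cabs_sub_lb l (u (maxn M N)); rewrite cabsB; lra.
Qed.

Lemma ccvg_unique u l k : ccvg u l -> ccvg u k -> l = k.
Proof.
move=> hl hk; apply/eqP; rewrite -subr_eq0 -cabs_eq0; apply/eqP/le_anti; rewrite cabs_ge0 andbT.
apply/ler_addgt0Pr => e e0; rewrite add0r; have e2 : 0 < e / 2 by rewrite divr_gt0.
have [M HM] := hl _ e2; have [N HN] := hk _ e2.
have := HM (maxn M N) (leq_maxl _ _); have := HN (maxn M N) (leq_maxr _ _).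
have -> : l - k = (u (maxn M N) - k) - (u (maxn M N) - l) by ring.
by move=> a b; apply: le_trans (cabsD _ _) _; rewrite cabsN; lra.
Qed.

Lemma ccvg_cst l : ccvg (fun=> l) l.
Proof. by move=> e e0; exists 0%N => n _; rewrite subrr cabs0 ltW. Qed.

Lemma ccvgD u w l k : ccvg u l -> ccvg w k -> ccvg (fun n => u n + w n) (l + k).
Proof.
move=> hl hk e e0; have e2 : 0 < e / 2 by rewrite divr_gt0.
have [M HM] := hl _ e2; have [N HN] := hk _ e2; exists (maxn M N) => n.
rewrite geq_max => /andP[/HM h1 /HN h2].
have -> : u n + w n - (l + k) = (u n - l) + (w n - k) by ring.
by apply: le_trans (cabsD _ _) _; lra.
Qed.

Lemma ccvgZ z u l : ccvg u l -> ccvg (fun n => z * u n) (z * l).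
Proof.
move=> h e e0; have z0 : 0 < cabs z + 1 by rewrite ltr_wpDl ?cabs_ge0.
have [N HN] := h _ (divr_gt0 e0 z0); exists N => n /HN.
by rewrite ler_pdivlMr// -mulrBr cabsM; have := cabs_ge0 (u n - l); nra.
Qed.

Lemma ccvgN u l : ccvg u l -> ccvg (fun n => - u n) (- l).
Proof.
by move=> h e /h[N HN]; exists N => n /HN; rewrite -opprD cabsN.
Qed.

Lemma ccvgB u w l k : ccvg u l -> ccvg w k -> ccvg (fun n => u n - w n) (l - k).
Proof. by move=> hl /ccvgN; exact: ccvgD. Qed.

Lemma ccvgM u w l k : ccvg u l -> ccvg w k -> ccvg (fun n => u n * w n) (l * k).
Proof.
move=> hl hk.
have h1 : ccvg (fun n => (u n - l) * (w n - k)) 0.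
  move=> e e0; have e1 : 0 < Num.min 1 e by rewrite lt_min ltr01.
  have [M HM] := hl _ e1; have [N HN] := hk _ e1; exists (maxn M N) => n.
  rewrite geq_max => /andP[/HM + /HN +]; rewrite !le_min => /andP[a b] /andP[c d].
  by rewrite subr0 cabsM; have := cabs_ge0 (u n - l); have := cabs_ge0 (w n - k); nra.
have h2 := ccvgD h1 (ccvgD (ccvgZ l hk) (ccvgZ k hl)).
have h3 := ccvgB h2 (ccvg_cst (k * l)).
move=> e /h3[N HN]; exists N => n /HN.
by apply: le_trans; rewrite le_eqVlt; apply/orP; left; apply/eqP; congr cabs; ring.
Qed.

Lemma ccvg_ext u w l N : (forall n, (N <= n)%N -> u n = w n) -> ccvg u l -> ccvg w l.
Proof.
move=> h hu e /hu[M HM]; exists (maxn M N) => n; rewrite geq_max => /andP[a b].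
by rewrite -h//; exact: HM.
Qed.

Lemma ccvg_sum (I : Type) (r : seq I) (u : I -> nat -> R[i]) (l : I -> R[i]) :
  (forall i, ccvg (u i) (l i)) ->
  ccvg (fun n => \sum_(i <- r) u i n) (\sum_(i <- r) l i).
Proof.
move=> h; elim: r => [|i r IH].
  by apply: (ccvg_ext (N := 0) (u := fun=> 0)) => [n _|]; rewrite big_nil//; exact: ccvg_cst.
apply: (ccvg_ext (N := 0) (u := fun n => u i n + \sum_(j <- r) u j n)) => [n _|].
  by rewrite big_cons.
by rewrite big_cons; exact: ccvgD.
Qed.

Lemma ccvg_squeeze u (b : nat -> R) : (forall n, cabs (u n) <= b n) ->
  b n @[n --> \oo] --> (0 : R) -> ccvg u 0.
Proof.
move=> h /cvgrPdist_le hb e /hb[N _ HN]; exists N => n Nn; rewrite subr0.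
apply: le_trans (h n) _; apply: le_trans (HN n Nn).
by rewrite sub0r normrN ler_norm.
Qed.

Lemma ccvg_series u (b : nat -> R) B : (forall n, cabs (u n) <= b n) ->
  (forall N, \sum_(0 <= n < N) b n <= B) ->
  exists2 l, ccvg (fun N => \sum_(0 <= n < N) u n) l & cabs l <= B.
Proof.
move=> h hB.
have real_case (f : nat -> R) : (forall n, `|f n| <= b n) ->
    exists l : R, (fun N => \sum_(0 <= n < N) f n) @ \oo --> l.
  move=> hf; apply/cvg_ex; apply: normed_cvg => /=.
  apply: (@series_le_cvg _ (fun n => `|f n|) b) => // [n|].
    exact: le_trans (hf n).
  apply: (@nondecreasing_is_cvgn _ _ _ _).
    apply/nondecreasing_seqP => n; rewrite /series /= big_nat_recr//= lerDl.
    exact: le_trans (hf n).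
  by exists B => _ [N _ <-]; exact: hB.
have [lr Hr] := real_case _ (fun n => le_trans (Re_le_cabs _) (h n)).
have [li Hi] := real_case _ (fun n => le_trans (Im_le_cabs _) (h n)).
have cl : ccvg (fun N => \sum_(0 <= n < N) u n) (Complex lr li).
  move=> e e0; have e2 : 0 < e / 2 by rewrite divr_gt0.
  have /cvgrPdist_le/(_ _ e2)[M _ HM] := Hr; have /cvgrPdist_le/(_ _ e2)[N _ HN] := Hi.
  exists (maxn M N) => n; rewrite geq_max => /andP[/HM h1 /HN h2].
  apply: le_trans (cabs_le_ReIm _) _; rewrite ReB ImB Re_sum Im_sum /=.
  by rewrite /= in h1 h2; rewrite distrC [X in _ + X]distrC; lra.
exists (Complex lr li) => //; apply: (ccvg_bound (N := 0) cl) => n _.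
apply: le_trans (cabs_sum _ _ _) (le_trans _ (hB n)).
by apply: ler_sum => i _.
Qed.

End ComplexLimit.

(** * Summation by parts *)

Section SumOverNorms.
Variables (R : realType) (G : beurlingSystem R).
Implicit Types (g h d : G) (T x : R) (j k n m : nat).

Lemma sum_gle_split (V : nmodType) (F : G -> V) T x : x <= T ->
  \sum_(g <- gle G T) F g =
  \sum_(g <- gle G x) F g + \sum_(g <- gle G T | x < bnorm g) F g.
Proof.
move=> xT; rewrite (bigID (fun g => bnorm g <= x)) /=; congr (_ + _); last first.
  by apply: eq_bigl => g; rewrite ltNge.
rewrite -big_filter; apply: perm_big; apply: uniq_perm; rewrite ?filter_uniq ?uniq_gle//.
move=> g; rewrite mem_filter !mem_gle; case: (leP (bnorm g) x) => //= gx.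
exact: le_trans xT.
Qed.

Lemma ln_succ_sub n : (0 < n)%N ->
  0 <= ln (n.+1%:R : R) - ln n%:R <= n%:R^-1.
Proof.
move=> n0; have nR : 0 < n%:R :> R by rewrite ltr0n.
rewrite subr_ge0 ler_ln ?posrE ?ltr0n// ler_nat leqnSn /=.
rewrite -ln_div ?posrE ?ltr0n// -natr1 mulrDl divff ?gt_eqF// mul1r.
by apply: le_trans (le_ln1Dx _) _ => //; rewrite (lt_le_trans (ltrN10 _))// invr_ge0 ler0n.
Qed.

Section Blocks.
Variables (a : G -> R) (alpha : R) (r : nat -> R) (F Phi : R -> R[i]).

Definition wsum T : R[i] := \sum_(g <- gle G T) (a g)%:C%C * F (ln (bnorm g)).
Definition wcount T : R := \sum_(g <- gle G T) a g.

(** The error made on norms in [(n, n+1]] when the sum is replaced by [alpha] times the integral of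
    [e^t F t], with primitive [Phi], and by boundary terms in the discrepancy [r]. Cutting at
    integers makes Abel summation an exact finite identity, without Stieltjes integrals. *)
Definition blk n : R[i] :=
  \sum_(g <- gle G n.+1%:R | n%:R < bnorm g)
     (a g)%:C%C * (F (ln (bnorm g)) - F (ln n.+1%:R))
  - alpha%:C%C * (Phi (ln n.+1%:R) - Phi (ln n%:R) - F (ln n.+1%:R))
  - (r n)%:C%C * (F (ln n.+1%:R) - F (ln n%:R)).

Hypothesis rE : forall n, r n.+1 - r n = wcount n.+1%:R - wcount n%:R - alpha.

Lemma wsum_step n : wsum n.+1%:R = wsum n%:R
  + alpha%:C%C * (Phi (ln n.+1%:R) - Phi (ln n%:R))
  + (r n.+1)%:C%C * F (ln n.+1%:R) - (r n)%:C%C * F (ln n%:R) + blk n.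
Proof.
have nn : n%:R <= n.+1%:R :> R by rewrite ler_nat.
pose D := \sum_(g <- gle G n.+1%:R | n%:R < bnorm g) a g.
have -> : r n.+1 = r n + D - alpha.
  by have := rE n; rewrite /wcount (sum_gle_split _ nn) -/D; lra.
rewrite /wsum (sum_gle_split _ nn) /blk.
have -> : \sum_(g <- gle G n.+1%:R | n%:R < bnorm g)
    (a g)%:C%C * (F (ln (bnorm g)) - F (ln n.+1%:R)) =
    \sum_(g <- gle G n.+1%:R | n%:R < bnorm g) (a g)%:C%C * F (ln (bnorm g)) -
    D%:C%C * F (ln n.+1%:R).
  rewrite /D rmorph_sum /= mulr_suml -sumrB; apply: eq_bigr => g _.
  by rewrite mulrBr.
by rewrite !(rmorphD, rmorphN) /=; ring.
Qed.

Lemma wsum_range m n : (m <= n)%N -> wsum n%:R = wsum m%:R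
  + alpha%:C%C * (Phi (ln n%:R) - Phi (ln m%:R))
  + (r n)%:C%C * F (ln n%:R) - (r m)%:C%C * F (ln m%:R) + \sum_(m <= i < n) blk i.
Proof.
move=> /subnK <-; elim: (n - m)%N => [|k IH].
  by rewrite add0n big_geq//; ring.
by rewrite addSn wsum_step IH big_nat_recr ?leq_addl//=; ring.
Qed.

(** Over [[ln n, ln (n+1)]], of length at most [1 / n], [F] varies by at most [2 B / n]; every part
    of the block is such a variation times a weight. *)
Lemma blk_bound (F' : R -> R[i]) n B : (0 < n)%N -> (forall g, 0 <= a g) -> 0 <= alpha ->
  (forall t, ln n%:R <= t <= ln n.+1%:R -> cderiv F t (F' t) /\ cabs (F' t) <= B) ->
  (forall t, ln n%:R <= t <= ln n.+1%:R -> cderiv Phi t ((expR t)%:C%C * F t)) ->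
  cabs (blk n) <= (wcount n.+1%:R - wcount n%:R + 4 * alpha + `|r n|) * (2 * B / n%:R).
Proof.
move=> n0 a0 alpha0 hF hPhi.
have nR : 0 < n%:R :> R by rewrite ltr0n.
have nn : n%:R <= n.+1%:R :> R by rewrite ler_nat.
have /andP[l0 l1] := ln_succ_sub n0.
have B0 : 0 <= B.
  apply: le_trans (cabs_ge0 _) (hF (ln n%:R) _).2.
  by rewrite lexx -subr_ge0.
pose L := 2 * B / n%:R; have L0 : 0 <= L by rewrite divr_ge0 ?mulr_ge0 ?(ltW nR).
have osc t t' : ln n%:R <= t <= t' -> t' <= ln n.+1%:R -> cabs (F t' - F t) <= L.
  move=> /andP[t1 tt] t2; apply: le_trans (cderiv_mvt tt (F' := F') (B := B) _) _.
    by move=> s /andP[s1 s2]; apply: hF; rewrite (le_trans t1)// (le_trans s2).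
  by rewrite /L ler_wpM2l ?mulr_ge0//; lra.
have p1 : cabs (\sum_(g <- gle G n.+1%:R | n%:R < bnorm g)
     (a g)%:C%C * (F (ln (bnorm g)) - F (ln n.+1%:R))) <= (wcount n.+1%:R - wcount n%:R) * L.
  apply: le_trans (cabs_sum _ _ _) _.
  have -> : wcount n.+1%:R - wcount n%:R = \sum_(g <- gle G n.+1%:R | n%:R < bnorm g) a g.
    by rewrite /wcount (sum_gle_split _ nn) addrC addKr.
  rewrite mulr_suml big_seq_cond [leRHS]big_seq_cond; apply: ler_sum => g /andP[].
  rewrite mem_gle => g1 g2; rewrite cabsM cabs_real ger0_norm// ler_wpM2l// cabsB.
  have g0 : 0 < bnorm g := bnorm_gt0 g.
  by apply: osc; rewrite ?lexx// !ler_ln ?posrE ?ltr0n// (ltW g2).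
have p3 : cabs (F (ln n.+1%:R) - F (ln n%:R)) <= L.
  by apply: osc => //; rewrite lexx -subr_ge0.
have p2 : cabs (Phi (ln n.+1%:R) - Phi (ln n%:R) - F (ln n.+1%:R)) <= 4 * L.
  (* [Phi - c e^t] has derivative [e^t (F t - c)], and [c e^t] grows by exactly [c] between [ln n]
     and [ln (n+1)], so the bracket is an increment of [Psi]. *)
  pose c := F (ln n.+1%:R); pose Psi t := Phi t - c * (expR t)%:C%C.
  have -> : Phi (ln n.+1%:R) - Phi (ln n%:R) - F (ln n.+1%:R) = Psi (ln n.+1%:R) - Psi (ln n%:R).
    have en : (n.+1%:R)%:C%C = (n%:R)%:C%C + 1 :> R[i] by rewrite -natr1 rmorphD rmorph1.
    by rewrite /Psi !lnK ?posrE ?ltr0n// en /c; ring.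
  have ll : ln n%:R <= ln n.+1%:R :> R by rewrite -subr_ge0.
  apply: le_trans (cderiv_mvt ll (F' := fun t => (expR t)%:C%C * F t - c * (expR t)%:C%C)
    (B := n.+1%:R * L) _) _.
    move=> t tt; split.
      by apply: cderivB; [exact: hPhi|apply: cderivZ; apply: cderiv_real; exact: is_derive_expR].
    have -> : (expR t)%:C%C * F t - c * (expR t)%:C%C = (expR t)%:C%C * (F t - c) by ring.
    rewrite cabsM cabs_real ger0_norm ?expR_ge0//; apply: ler_pM; rewrite ?expR_ge0 ?cabs_ge0//.
      by case/andP: tt => _ t2; rewrite -[leRHS](@lnK R) ?posrE ?ltr0n// ler_expR.
    by rewrite cabsB /c; case/andP: tt => t1 t2; apply: osc; rewrite ?t1 ?t2.
  have n1 : n.+1%:R * (ln n.+1%:R - ln n%:R) <= 2 :> R.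
    apply: (@le_trans _ _ (n.+1%:R * n%:R^-1)); first by rewrite ler_wpM2l.
    rewrite ler_pdivrMr// -natr1; have : 1 <= n%:R :> R by rewrite ler1n.
    lra.
  by have := ler_wpM2r L0 n1; lra.
rewrite /blk -/L; apply: le_trans (cabsD _ _) _; rewrite cabsN cabsM cabs_real.
have := cabsD (\sum_(g <- gle G n.+1%:R | n%:R < bnorm g)
     (a g)%:C%C * (F (ln (bnorm g)) - F (ln n.+1%:R)))
  (- (alpha%:C%C * (Phi (ln n.+1%:R) - Phi (ln n%:R) - F (ln n.+1%:R)))).
rewrite cabsN cabsM cabs_real (ger0_norm alpha0) => h.
have := ler_wpM2l alpha0 p2; have := ler_wpM2l (normr_ge0 (r n)) p3.
lra.
Qed.

End Blocks.

End SumOverNorms.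

(** * Remainders of the exponential series and sums over integers *)

Section ExpRemainder.
Variable R : realType.
Implicit Types (x y t q eta : R) (n k : nat).

Definition exprem n x : R := expR x - \sum_(i < n) x ^+ i / i`!%:R.

Lemma exprem0n x : exprem 0 x = expR x.
Proof. by rewrite /exprem big_ord0 subr0. Qed.

Lemma exprem_at0 n : exprem n.+1 0 = 0.
Proof.
rewrite /exprem expR0 big_ord_recl expr0 fact0 divr1 big1 ?addr0 ?subrr// => i _.
by rewrite expr0n mul0r.
Qed.

Lemma is_derive_expfact n x :
  is_derive x (1 : R) (fun y => y ^+ n.+1 / n.+1`!%:R) (x ^+ n / n`!%:R).
Proof.
have := is_deriveZ (n.+1`!%:R^-1) (is_deriveX n.+1 (is_derive_id x (1 : R))).
set H := (X in is_derive _ _ X _) => d.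
rewrite (_ : (fun _ => _) = H); last by apply/funext => y; rewrite /H !fctE /= mulrC.
apply: is_derive_eq d _; rewrite /GRing.scale /= factS natrM mulr1.
by rewrite -natr1; field; rewrite natr1 !pnatr_eq0 -lt0n fact_gt0.
Qed.

Lemma is_derive_exprem n x : is_derive x (1 : R) (exprem n.+1) (exprem n x).
Proof.
elim: n => [|n IH].
  have -> : exprem 1 = expR \- cst 1.
    by apply/funext => y; rewrite /exprem big_ord1 expr0 fact0 divr1.
  apply: is_derive_eq; rewrite exprem0n subr0//.
have -> : exprem n.+2 = exprem n.+1 \- (fun y => y ^+ n.+1 / n.+1`!%:R).
  by apply/funext => y; rewrite /exprem big_ord_recr /=; ring.
have -> : exprem n.+1 x = exprem n x - x ^+ n / n`!%:R.
  by rewrite /exprem big_ord_recr /=; ring.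
exact: (is_deriveB IH (is_derive_expfact n x)).
Qed.

Lemma exprem_ge0 n x : 0 <= x -> 0 <= exprem n x.
Proof.
elim: n x => [|n IH] x x0; first by rewrite exprem0n expR_ge0.
have [|c /andP[c0 _]] := @prim_mvt _ (exprem n) 0 x (exprem n.+1) x0.
  by move=> t _; exact: is_derive_exprem.
rewrite exprem_at0 !subr0 => ->; rewrite mulr_ge0//; exact: IH.
Qed.

(** On the level of series this is [x^i <= q^(-n) (q x)^i] for [i >= n]; the proof compares
    derivatives by induction. The free [q] trades geometric smallness in [n] against exponential
    growth in [x]. *)
Lemma exprem_le n x q : 0 <= x -> 1 <= q -> exprem n x <= q^-1 ^+ n * expR (q * x).
Proof.
move=> + q1; have q0 : 0 < q := lt_le_trans ltr01 q1.
elim: n x => [|n IH] x x0.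
  by rewrite exprem0n expr0 mul1r ler_expR; nra.
have dq t : is_derive t (1 : R) (fun y => q^-1 ^+ n.+1 * expR (q * y)) (q^-1 ^+ n * expR (q * t)).
  have d1 : is_derive t (1 : R) (fun y => q * y) q.
    have := is_deriveZ q (is_derive_id t (1 : R)); rewrite [q *: 1]mulr1.
    by rewrite (_ : (fun y => q * y) = q \*: (@id R))//; apply/funext => y; rewrite !fctE.
  have d2 := is_derive1_comp (is_derive_expR (q * t)) d1.
  have := is_deriveZ (q^-1 ^+ n.+1) d2; set H := (X in is_derive _ _ X _) => d.
  rewrite (_ : (fun _ => _) = H); last by apply/funext => y; rewrite /H !fctE.
  by apply: is_derive_eq d _; rewrite /GRing.scale /= exprS; field; rewrite gt_eqF.
have [|c /andP[c0 _]] := @prim_mvt _ (fun t => q^-1 ^+ n * expR (q * t) - exprem n t) 0 x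
    (fun t => q^-1 ^+ n.+1 * expR (q * t) - exprem n.+1 t) x0.
  by move=> t _; exact: (is_deriveB (dq t) (is_derive_exprem n t)).
rewrite exprem_at0 mulr0 expR0 mulr1 !subr0 => e.
have : 0 <= (q^-1 ^+ n * expR (q * c) - exprem n c) * x.
  by rewrite mulr_ge0// subr_ge0 IH.
rewrite -e; have : 0 <= q^-1 ^+ n.+1 by rewrite exprn_ge0// invr_ge0 ltW.
by lra.
Qed.

Lemma sum_expfact_le n x : 0 <= x -> \sum_(i < n) x ^+ i / i`!%:R <= expR x.
Proof. by move=> x0; rewrite -subr_ge0; exact: exprem_ge0. Qed.

(** The bound on one term of the series of [exp (q t)]. The freedom in [q] is what gives the later
    estimates their Chernoff form. *)
Lemma expfact_le k t q : 0 <= t -> 0 < q -> t ^+ k / k`!%:R <= q^-1 ^+ k * expR (q * t).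
Proof.
move=> t0 q0; have qt : 0 <= q * t by rewrite mulr_ge0// ltW.
have := sum_expfact_le k.+1 qt; rewrite big_ord_recr /= => h.
have : 0 <= \sum_(i < k) (q * t) ^+ i / i`!%:R.
  by apply: sumr_ge0 => i _; rewrite divr_ge0 ?exprn_ge0.
move=> h0; have h1 : (q * t) ^+ k / k`!%:R <= expR (q * t) by lra.
have -> : t ^+ k / k`!%:R = q^-1 ^+ k * ((q * t) ^+ k / k`!%:R).
  by rewrite exprMn exprVn !mulrA mulVf ?mul1r// expf_neq0// gt_eqF.
by rewrite ler_wpM2l// exprn_ge0// invr_ge0 ltW.
Qed.

(** A telescoping substitute for the integral test applied to the sum of [n^(- 1 - eta)]. *)
Lemma inv_mul_expln_le n eta : (0 < n)%N -> 0 < eta ->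
  n.+1%:R^-1 * expR (- eta * ln n.+1%:R) <=
  eta^-1 * (expR (- eta * ln n%:R) - expR (- eta * ln n.+1%:R)).
Proof.
move=> n0 eta0; have nR : 0 < n%:R :> R by rewrite ltr0n.
have h : n.+1%:R^-1 <= ln n.+1%:R - ln n%:R :> R.
  rewrite -lerN2 opprB -ln_div ?posrE//.
  have -> : n%:R / n.+1%:R = 1 + - n.+1%:R^-1 :> R.
    by rewrite -natr1; field; rewrite natr1 pnatr_eq0.
  by apply: le_ln1Dx; rewrite ltrN2 invf_lt1// ltr1n.
rewrite ler_pdivlMl//.
have -> : expR (- eta * ln n%:R) = expR (- eta * ln n.+1%:R) * expR (eta * (ln n.+1%:R - ln n%:R)).
  by rewrite -expRD; congr expR; ring.
have := expR_ge1Dx (eta * (ln n.+1%:R - ln n%:R : R)).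
have E := expR_gt0 (- eta * ln n.+1%:R).
set X := expR (eta * _) => h2; have h3 : 1 + eta * n.+1%:R^-1 <= X.
  by apply: le_trans h2; rewrite lerD2l ler_pM2l.
have := ler_wpM2l (ltW E) h3; move: (expR (- eta * _)) (n.+1%:R^-1) => e i.
rewrite mulrDr mulr1 (_ : e * (eta * i) = eta * (i * e)); last by ring.
by move: (eta * (i * e)) => u; lra.
Qed.

Lemma sum_inv_mul_expln_le N eta : 0 < eta ->
  \sum_(0 <= n < N) n.+1%:R^-1 * expR (- eta * ln n.+1%:R) <= 1 + eta^-1 :> R.
Proof.
move=> eta0; suff : \sum_(0 <= n < N) n.+1%:R^-1 * expR (- eta * ln n.+1%:R) <=
    1 + eta^-1 * (1 - expR (- eta * ln (maxn N 1)%:R)).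
  move=> h; apply: le_trans h _; by rewrite lerD2l ler_piMr ?invr_ge0 ?(ltW eta0)//.
elim: N => [|N IH].
  by rewrite big_geq// maxnE /= ln1 mulr0 expR0 subrr mulr0 addr0.
rewrite big_nat_recr//=; case: N IH => [|N] IH.
  by rewrite big_geq// invr1 ln1 mulr0 expR0 subrr mulr0 add0r mul1r addr0.
rewrite (maxn_idPl _)// in IH; rewrite (maxn_idPl _)//.
have K (S b k c i : R) : S <= 1 + i * (1 - b) -> k <= i * (b - c) -> S + k <= 1 + i * (1 - c).
  by rewrite !mulrBr; lra.
exact: K IH (inv_mul_expln_le _ eta0).
Qed.

Lemma cvg_expln eta : 0 < eta -> expR (- eta * ln n.+1%:R) @[n --> \oo] --> (0 : R).
Proof.
move=> eta0; apply/cvgrPdist_le => e e0.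
near=> n; rewrite sub0r normrN ger0_norm ?expR_ge0//.
rewrite -[leRHS](@lnK R) ?posrE// ler_expR mulNr lerNl -ler_pdivrMl//.
rewrite -[leLHS]expRK ler_ln ?posrE ?expR_gt0//.
apply: (@le_trans _ _ n%:R); last by rewrite ler_nat.
by near: n; exact: nbhs_infty_ger.
Unshelve. all: end_near. Qed.

End ExpRemainder.

(** * Regularized sums over the semigroup *)

Section Regularization.
Variables (R : realType) (G : beurlingSystem R) (kappa A theta : R).
Hypothesis hA : axiomA G kappa A theta.
Implicit Types (F Phi : R -> R[i]) (b sigma t x : R) (n N k : nat).

Let kappa0 : 0 < kappa. Proof. by case: hA. Qed.
Let A0 : 0 < A. Proof. by case: hA. Qed.
Let theta0 : 0 < theta. Proof. by case: hA => _ _ /andP[]. Qed.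
Let theta1 : theta < 1. Proof. by case: hA => _ _ /andP[]. Qed.

Definition unit_weight (g : G) : R := 1.

Definition discrepancy n : R := (bcount G n%:R)%:R - kappa * (n%:R - 1).

Lemma wcount_unit x : wcount unit_weight x = (bcount G x)%:R.
Proof.
rewrite /wcount /unit_weight big_const_seq count_predT iter_addr_0.
by rewrite /bcount cardfE.
Qed.

Lemma discrepancy_step n : discrepancy n.+1 - discrepancy n =
  wcount unit_weight n.+1%:R - wcount unit_weight n%:R - kappa.
Proof. by rewrite !wcount_unit /discrepancy -natr1; ring. Qed.

Lemma discrepancy_le n : (0 < n)%N -> `|discrepancy n| <= A * expR (theta * ln n%:R).
Proof.
move=> n0; case: hA => _ _ _ /(_ n%:R); rewrite ler1n => /(_ n0).
by rewrite /powR pnatr_eq0 gtn_eqF.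
Qed.

Lemma perm_gle1 : perm_eq (gle G 1) [:: 1%g].
Proof.
apply: uniq_perm; rewrite ?uniq_gle// => g; rewrite mem_gle inE.
apply/idP/eqP => [g1|->]; last by rewrite bnorm1.
by apply: contrapT => /eqP/bnorm_gt1; rewrite ltNge g1.
Qed.

Lemma wsum1 (a : G -> R) F : wsum a F 1%:R = (a 1%g)%:C%C * F 0.
Proof. by rewrite /wsum (perm_big _ perm_gle1) big_seq1 bnorm1 ln1. Qed.

Lemma discrepancy1 : discrepancy 1 = 1.
Proof.
rewrite /discrepancy -wcount_unit subrr mulr0 subr0.
by rewrite /wcount (perm_big _ perm_gle1) big_seq1.
Qed.

(** The decay rate of [F'] has only to exceed [theta], not 1, because Axiom A bounds the discrepancy
    by a multiple of [n^theta]. *)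
Definition regdata F (F' : R -> R[i]) Phi b sigma := [/\ 0 <= b, theta < sigma,
  forall t, 0 <= t -> cderiv F t (F' t),
  forall t, 0 <= t -> cabs (F' t) <= b * expR (- sigma * t) &
  forall t, 0 <= t -> cderiv Phi t ((expR t)%:C%C * F t)].

Definition rblk F Phi n := blk unit_weight kappa discrepancy F Phi n.

(** In [4 A + 5 kappa] the jump of the count gives [3 A] (twice at [n + 1], once at [n]) and
    [kappa], the boundary term another [A], the integral term [4 kappa]; the factor 2 is that of the
    oscillation [2 B / n]. *)
Definition regC : R := 2 * (4 * A + 5 * kappa).

Lemma regC_gt0 : 0 < regC.
Proof. by rewrite /regC; have := A0; have := kappa0; lra. Qed.

Lemma rblk_le F (F' : R -> R[i]) Phi b sigma n : (0 < n)%N -> regdata F F' Phi b sigma ->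
  cabs (rblk F Phi n) <= regC * b * (n%:R^-1 * expR (- (sigma - theta) * ln n%:R)).
Proof.
move=> n0 [b0 ts hF hF' hPhi].
have nR : 0 < n%:R :> R by rewrite ltr0n.
have ln0 : 0 <= ln n%:R :> R by rewrite ln_ge0 ?ler1n.
have sg0 : 0 < sigma := lt_trans theta0 ts.
pose B := b * expR (- sigma * ln n%:R).
have B0 : 0 <= B by rewrite mulr_ge0 ?expR_ge0.
apply: le_trans (@blk_bound _ _ unit_weight kappa discrepancy F Phi F' n B n0
  (fun=> ler01) (ltW kappa0) _ _) _.
- move=> t /andP[t1 _]; have t0 := le_trans ln0 t1; split; first exact: hF.
  apply: le_trans (hF' t t0) _; rewrite /B ler_wpM2l// ler_expR !mulNr lerN2.
  by rewrite ler_pM2l.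
- by move=> t /andP[t1 _]; apply: hPhi; exact: le_trans t1.
set e := expR (theta * ln n%:R).
have e1 : 1 <= e by rewrite -expR0 ler_expR mulr_ge0// ltW.
have d1 : `|discrepancy n| <= A * e := discrepancy_le n0.
have d2 : `|discrepancy n.+1| <= 2 * (A * e).
  apply: le_trans (discrepancy_le (ltn0Sn n)) _; rewrite mulrCA ler_pM2l//.
  have -> : 2 = expR (ln 2%:R) :> R by rewrite lnK ?posrE.
  rewrite -expRD ler_expR.
  have : ln n.+1%:R <= ln 2 + ln n%:R :> R.
    rewrite -lnM ?posrE// ler_ln ?posrE ?mulr_gt0// -natrM ler_nat mul2n -addnn.
    by rewrite -addn1 leq_add2l.
  have : 0 <= ln 2 :> R by rewrite ln_ge0// ler1n.
  by have := theta0; have := theta1; nra.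
have st := discrepancy_step n.
have main : wcount unit_weight n.+1%:R - wcount unit_weight n%:R + 4 * kappa + `|discrepancy n| <=
    (4 * A + 5 * kappa) * e.
  have := ler_norm (discrepancy n.+1); have := ler_norm (- discrepancy n); rewrite normrN.
  have := ler_wpM2l (ltW kappa0) e1; lra.
apply: le_trans (ler_wpM2r _ main) _; first by rewrite divr_ge0 ?mulr_ge0 ?(ltW nR).
rewrite /regC /B.
have -> : expR (- (sigma - theta) * ln n%:R) = e * expR (- sigma * ln n%:R).
  by rewrite /e -expRD; congr expR; ring.
rewrite le_eqVlt; apply/orP; left; apply/eqP; ring.
Qed.

(** The sum of [F (log |g|)] over the semigroup minus [kappa] times the integral of [e^t F t]. It
    makes sense also where neither of the two converges, which is the source of the continuation of
    zeta to [Re s > theta]. *)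
Definition reg F Phi : R[i] := xget 0 [set l |
  ccvg (fun N => \sum_(0 <= n < N) rblk F Phi n.+1) l].

Lemma regP F (F' : R -> R[i]) Phi b sigma : regdata F F' Phi b sigma ->
  ccvg (fun N => \sum_(0 <= n < N) rblk F Phi n.+1) (reg F Phi) /\
  cabs (reg F Phi) <= regC * b * (1 + (sigma - theta)^-1).
Proof.
move=> h; have [b0 ts _ _ _] := h.
have [l cl lB] : exists2 l, ccvg (fun N => \sum_(0 <= n < N) rblk F Phi n.+1) l &
    cabs l <= regC * b * (1 + (sigma - theta)^-1).
  apply: (@ccvg_series _ _ (fun n => regC * b * (n.+1%:R^-1 * expR (- (sigma - theta) * ln n.+1%:R)))).
    by move=> n; exact: rblk_le h.
  move=> N; rewrite -mulr_sumr ler_wpM2l//.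
    by rewrite mulr_ge0// ltW// regC_gt0.
  by apply: sum_inv_mul_expln_le; rewrite subr_gt0.
rewrite /reg; case: xgetP => [k _ /= ck|/(_ l)]; last by [].
by rewrite (ccvg_unique ck cl).
Qed.

Lemma reg_unique F Phi l :
  ccvg (fun N => \sum_(0 <= n < N) rblk F Phi n.+1) l -> reg F Phi = l.
Proof.
move=> cl; rewrite /reg; case: xgetP => [k _ /= ck|/(_ l)]; last by [].
exact: ccvg_unique ck cl.
Qed.

Lemma rblk_axpy (z : R[i]) F Phi (F2 Phi2 : R -> R[i]) n :
  rblk (fun t => F t + z * F2 t) (fun t => Phi t + z * Phi2 t) n =
  rblk F Phi n + z * rblk F2 Phi2 n.
Proof.
rewrite /rblk /blk.
have -> : \sum_(g <- gle G n.+1%:R | n%:R < bnorm g) (unit_weight g)%:C%C *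
    (F (ln (bnorm g)) + z * F2 (ln (bnorm g)) - (F (ln n.+1%:R) + z * F2 (ln n.+1%:R))) =
  \sum_(g <- gle G n.+1%:R | n%:R < bnorm g) (unit_weight g)%:C%C *
    (F (ln (bnorm g)) - F (ln n.+1%:R)) +
  z * \sum_(g <- gle G n.+1%:R | n%:R < bnorm g) (unit_weight g)%:C%C *
    (F2 (ln (bnorm g)) - F2 (ln n.+1%:R)).
  by rewrite mulr_sumr -big_split; apply: eq_bigr => g _ /=; ring.
by ring.
Qed.

Lemma reg_axpy (z : R[i]) F (F' : R -> R[i]) Phi b sigma (F2 F2' Phi2 : R -> R[i]) b2 sigma2 :
  regdata F F' Phi b sigma -> regdata F2 F2' Phi2 b2 sigma2 ->
  reg (fun t => F t + z * F2 t) (fun t => Phi t + z * Phi2 t) = reg F Phi + z * reg F2 Phi2.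
Proof.
move=> /regP[h1 _] /regP[h2 _]; apply: reg_unique.
apply: (@ccvg_ext _ _ _ _ 0%N _ (ccvgD h1 (ccvgZ z h2))) => n _.
by rewrite mulr_sumr -big_split; apply: eq_bigr => i _; rewrite rblk_axpy.
Qed.

(* Abel summation: convergent sums over G agree with the regularized ones. *)
Lemma wsum_cvg F (F' : R -> R[i]) Phi b sigma c eta : regdata F F' Phi b sigma -> 0 < eta ->
  (forall t, 0 <= t -> cabs (F t) <= c * expR (- (theta + eta) * t)) ->
  (forall t, 0 <= t -> cabs (Phi t) <= c * expR (- eta * t)) ->
  ccvg (fun N => wsum unit_weight F N.+1%:R) (- kappa%:C%C * Phi 0 + reg F Phi).
Proof.
move=> h eta0 hF hPhi; have [hr _] := regP h.
have lnS N : 0 <= ln N.+1%:R :> R by rewrite ln_ge0 ?ler1n.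
have c0 : 0 <= c.
  by have := hPhi 0 (lexx 0); rewrite mulr0 expR0 mulr1; apply: le_trans; exact: cabs_ge0.
have z1 : ccvg (fun N => Phi (ln N.+1%:R)) 0.
  apply: (@ccvg_squeeze _ _ (fun N => c * expR (- eta * ln N.+1%:R))) => [N|].
    exact: hPhi.
  by rewrite -[X in _ --> X](mulr0 c); apply: cvgMr; exact: cvg_expln.
have z2 : ccvg (fun N => (discrepancy N.+1)%:C%C * F (ln N.+1%:R)) 0.
  apply: (@ccvg_squeeze _ _ (fun N => A * c * expR (- eta * ln N.+1%:R))) => [N|].
    rewrite cabsM cabs_real.
    have -> : A * c * expR (- eta * ln N.+1%:R) =
        A * expR (theta * ln N.+1%:R) * (c * expR (- (theta + eta) * ln N.+1%:R)).
      have -> : expR (- eta * ln N.+1%:R) = expR (theta * ln N.+1%:R) * expR (- (theta + eta) * ln N.+1%:R).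
        by rewrite -expRD; congr expR; ring.
      ring.
    by apply: ler_pM; rewrite ?cabs_ge0 ?discrepancy_le ?hF.
  by rewrite -[X in _ --> X](mulr0 (A * c)); apply: cvgMr; exact: cvg_expln.
have := ccvgD (ccvgD (ccvgZ kappa%:C%C z1) z2) (ccvgB hr (ccvg_cst (kappa%:C%C * Phi 0))).
rewrite (_ : kappa%:C%C * 0 + 0 + _ = - kappa%:C%C * Phi 0 + reg F Phi); last by ring.
apply: (@ccvg_ext _ _ _ _ 0%N) => N _.
rewrite (@wsum_range _ _ unit_weight kappa discrepancy F Phi discrepancy_step 1 N.+1)//.
(* At 1 only the identity counts: its term [F 0] cancels the boundary term, [discrepancy 1] being
   1. *)
rewrite wsum1 discrepancy1 ln1 big_add1 /= /rblk /unit_weight; ring.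
Qed.

End Regularization.

(** * Continuation of zeta *)

Section TaylorFamily.
Variable R : realType.
Implicit Types (s w z : R[i]) (t q : R) (k n : nat).

Definition expfact k t : R := t ^+ k / k`!%:R.

(* Up to the sign (-1)^k, the Taylor coefficients in [s] of [exp (- s t)]. *)
Definition tay k s t : R[i] := (expfact k t)%:C%C * cexp (- s * t%:C%C).

Definition tay_der k s t : R[i] :=
  (if k is k'.+1 then tay k' s t else 0) - s * tay k s t.

(** Repeated integration by parts of [e^t t^k / k! e^(- s t)], normalized to vanish at infinity when
    [Re s > 1]; its value at 0 supplies the polar part [(s - 1)^(- k - 1)]. *)
Fixpoint tay_prim k s t : R[i] := if k is k'.+1
  then (tay_prim k' s t - (expfact k t)%:C%C * cexp ((1 - s) * t%:C%C)) / (s - 1)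
  else cexp ((1 - s) * t%:C%C) / (1 - s).

Lemma expfact0 t : expfact 0 t = 1.
Proof. by rewrite /expfact expr0 fact0 divr1. Qed.

Lemma expfact1 t : expfact 1 t = t.
Proof. by rewrite /expfact expr1 (_ : 1`!%:R = 1 :> R) ?divr1. Qed.

Lemma expfact_ge0 k t : 0 <= t -> 0 <= expfact k t.
Proof. by move=> t0; rewrite divr_ge0 ?exprn_ge0. Qed.

Lemma tay0 s t : tay 0 s t = cexp (- s * t%:C%C).
Proof. by rewrite /tay expfact0 mul1r. Qed.

Lemma cderiv_expfact k t : cderiv (fun t => (expfact k t)%:C%C) t
  (if k is k'.+1 then (expfact k' t)%:C%C else 0).
Proof.
case: k => [|k]; last by apply: cderiv_real; exact: is_derive_expfact.
by apply: (cderiv_eq _ _ (cderiv_cst 1 t)) => // u; rewrite expfact0.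
Qed.

Lemma cderiv_tay k s t : cderiv (tay k s) t (tay_der k s t).
Proof.
apply: (cderiv_eq _ _ (cderivM (cderiv_expfact k t) (cderiv_cexp (- s) t))) => //.
rewrite /tay_der /tay; case: k => [|k]; ring.
Qed.

Lemma cexp_shift s t : cexp ((1 - s) * t%:C%C) = (expR t)%:C%C * cexp (- s * t%:C%C).
Proof. by rewrite -cexp_real -cexpD; congr cexp; ring. Qed.

Lemma cderiv_tay_prim k s t : s != 1 ->
  cderiv (tay_prim k s) t ((expR t)%:C%C * tay k s t).
Proof.
move=> s1; have s10 : s - 1 != 0 by rewrite subr_eq0.
have s11 : 1 - s != 0 by rewrite subr_eq0 eq_sym.
elim: k => [|k IH].
  apply: (cderiv_eq _ _ (cderivZ (1 - s)^-1 (cderiv_cexp (1 - s) t))) => [u|].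
    by rewrite /= mulrC.
  by rewrite tay0 -cexp_shift mulrA mulVf// mul1r.
have dE := cderivM (cderiv_expfact k.+1 t) (cderiv_cexp (1 - s) t).
apply: (cderiv_eq _ _ (cderivZ (s - 1)^-1 (cderivB IH dE))) => [u|].
  by rewrite [RHS]/= mulrC.
by rewrite cexp_shift /tay; field.
Qed.

Lemma cabs_cexpN s t : cabs (cexp (- s * t%:C%C)) = expR (- complex.Re s * t).
Proof. by rewrite cabs_cexp ReM /= mulr0 subr0 ReN. Qed.

Lemma tay_le k s t q : 0 <= t -> 0 < q ->
  cabs (tay k s t) <= q^-1 ^+ k * expR (- (complex.Re s - q) * t).
Proof.
move=> t0 q0; rewrite /tay cabsM cabs_real ger0_norm ?expfact_ge0// cabs_cexpN.
have -> : - (complex.Re s - q) * t = q * t + - complex.Re s * t by ring.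
by rewrite expRD mulrA ler_wpM2r ?expR_ge0// expfact_le.
Qed.

Lemma tay_der_le k s t q : 0 <= t -> 0 < q ->
  cabs (tay_der k s t) <= (cabs s + q) * q^-1 ^+ k * expR (- (complex.Re s - q) * t).
Proof.
move=> t0 q0; rewrite /tay_der; apply: le_trans (cabsD _ _) _.
rewrite cabsN cabsM; have h := ler_wpM2l (cabs_ge0 s) (tay_le k s t0 q0).
set e := expR _ in h *; have e0 : 0 <= e by rewrite expR_ge0.
case: k h => [|k] h.
  rewrite cabs0; move: h; rewrite !expr0 => h.
  by have := mulr_ge0 (ltW q0) e0; lra.
have h2 := tay_le k s t0 q0; rewrite -/e in h2.
have -> : (cabs s + q) * q^-1 ^+ k.+1 * e = cabs s * (q^-1 ^+ k.+1 * e) + q^-1 ^+ k * e.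
  by rewrite exprS; field; rewrite gt_eqF.
lra.
Qed.

Lemma tay_prim_at0 k s : s != 1 -> tay_prim k s 0 = - (s - 1)^-1 ^+ k.+1.
Proof.
move=> s1; have s10 : s - 1 != 0 by rewrite subr_eq0.
have s11 : 1 - s != 0 by rewrite subr_eq0 eq_sym.
elim: k => [|k IH]; first by rewrite /= mulr0 cexp0 expr1; field; rewrite s10 s11.
by rewrite /= IH /expfact expr0n mul0r mul0r subr0 [in RHS]exprS mulrC mulrN.
Qed.

Lemma tay_prim_le k s t q : s != 1 -> 0 <= t -> 0 < q ->
  cabs (tay_prim k s t) <=
  (\sum_(i < k.+1) q^-1 ^+ i * (cabs (s - 1))^-1 ^+ (k.+1 - i)) *
  expR (- (complex.Re s - 1 - q) * t).
Proof.
move=> s1 t0 q0; have s10 : 0 < cabs (s - 1) by rewrite cabs_gt0 subr_eq0.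
have E j : cabs ((expfact j t)%:C%C * cexp ((1 - s) * t%:C%C)) <=
    q^-1 ^+ j * expR (- (complex.Re s - 1 - q) * t).
  rewrite cabsM cabs_real ger0_norm ?expfact_ge0// cabs_cexp ReM /= mulr0 subr0 ReB /=.
  have -> : - (complex.Re s - 1 - q) * t = q * t + (1 - complex.Re s) * t by ring.
  by rewrite expRD mulrA ler_wpM2r ?expR_ge0// expfact_le.
elim: k => [|k IH].
  rewrite big_ord1 /= expr0 mul1r expr1 cabsM cabsV [cabs (1 - s)]cabsB mulrC.
  rewrite ler_wpM2l ?invr_ge0 ?(ltW s10)//.
  by have := E 0%N; rewrite expfact0 !mul1r.
rewrite /= cabsM cabsV big_ord_recr /= subSnn expr1.
have -> : \sum_(i < k.+1) q^-1 ^+ i * (cabs (s - 1))^-1 ^+ (k.+2 - i) =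
    (\sum_(i < k.+1) q^-1 ^+ i * (cabs (s - 1))^-1 ^+ (k.+1 - i)) * (cabs (s - 1))^-1.
  rewrite mulr_suml; apply: eq_bigr => i _; rewrite -mulrA -exprSr subSn//.
  by rewrite ltnW.
rewrite -mulrDl mulrAC ler_wpM2r ?invr_ge0 ?(ltW s10)//.
apply: le_trans (cabsD _ _) _; rewrite cabsN [leRHS]mulrDl.
exact: lerD IH (E k.+1).
Qed.

End TaylorFamily.

Section Zeta.
Variables (R : realType) (G : beurlingSystem R) (kappa A theta : R).
Hypothesis hA : axiomA G kappa A theta.
Implicit Types (s w z : R[i]) (t q : R) (k n : nat).

Let theta0 : 0 < theta. Proof. by case: hA => _ _ /andP[]. Qed.
Let theta1 : theta < 1. Proof. by case: hA => _ _ /andP[]. Qed.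

Local Notation reg := (reg G kappa).
Local Notation regdata := (regdata theta).

Lemma regdata_tay k s q : s != 1 -> 0 < q -> theta < complex.Re s - q ->
  regdata (tay k s) (tay_der k s) (tay_prim k s)
    ((cabs s + q) * q^-1 ^+ k) (complex.Re s - q).
Proof.
move=> s1 q0 sq; split=> //.
- by rewrite mulr_ge0 ?addr_ge0 ?cabs_ge0 ?exprn_ge0 ?invr_ge0 ?(ltW q0).
- by move=> t _; exact: cderiv_tay.
- by move=> t t0; exact: tay_der_le.
- by move=> t _; exact: cderiv_tay_prim.
Qed.

(* Up to the sign (-1)^k, the Taylor coefficients of zeta at [s]. *)
Definition zcoef k s : R[i] :=
  kappa%:C%C * (s - 1)^-1 ^+ k.+1 + reg (tay k s) (tay_prim k s).

Definition Z s : R[i] := zcoef 0 s.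

Lemma zcoef_cvg k s : 1 < complex.Re s ->
  ccvg (fun N => wsum (@unit_weight R G) (tay k s) N.+1%:R) (zcoef k s).
Proof.
move=> sr; have s1 : s != 1 by apply: contraTneq sr => ->; rewrite ltxx.
pose q := (complex.Re s - 1) / 2; have q0 : 0 < q by rewrite divr_gt0// subr_gt0.
have sq : theta < complex.Re s - q by rewrite /q; have := theta1; lra.
pose c := q^-1 ^+ k + \sum_(i < k.+1) q^-1 ^+ i * (cabs (s - 1))^-1 ^+ (k.+1 - i).
have qk : 0 <= q^-1 ^+ k by rewrite exprn_ge0// invr_ge0 ltW.
have sk : 0 <= \sum_(i < k.+1) q^-1 ^+ i * (cabs (s - 1))^-1 ^+ (k.+1 - i).
  by apply: sumr_ge0 => i _; rewrite mulr_ge0// exprn_ge0// invr_ge0 ?cabs_ge0// ltW.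
have c0 : 0 <= c by rewrite addr_ge0.
have := @wsum_cvg _ _ _ _ _ hA _ _ _ _ _ c q (regdata_tay k s1 q0 sq) q0.
rewrite tay_prim_at0// /zcoef mulNr mulrN opprK; apply => t t0.
  apply: le_trans (tay_le k s t0 q0) _; apply: ler_pM; rewrite ?expR_ge0//.
    by rewrite /c lerDl.
  by rewrite ler_expR !mulNr lerN2 ler_wpM2r// /q; have := theta1; lra.
apply: le_trans (tay_prim_le k s1 t0 q0) _; apply: ler_pM; rewrite ?expR_ge0//.
  by rewrite /c lerDr.
by rewrite ler_expR !mulNr lerN2 ler_wpM2r// /q; lra.
Qed.

Lemma zcoef_le k s q : s != 1 -> 0 < q -> theta < complex.Re s - q ->
  cabs (zcoef k s) <= kappa * (cabs (s - 1))^-1 ^+ k.+1 +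
    regC kappa A * (cabs s + q) * q^-1 ^+ k * (1 + (complex.Re s - q - theta)^-1).
Proof.
move=> s1 q0 sq; have [_ h] := regP hA (regdata_tay k s1 q0 sq).
apply: le_trans (cabsD _ _) _; rewrite cabsM cabs_real cabsX cabsV ger0_norm.
  by rewrite lerD2l; apply: le_trans h _; rewrite !mulrA.
by case: hA => /ltW.
Qed.

(** By linearity of [reg] the error of the linear approximation is [reg] of [e^(- u t) - e^(- s t) +
    (u - s) t e^(- s t)], whose derivative in [t] is of second order in [u - s] with slightly weaker
    decay. No limits are interchanged. *)
Lemma has_cderiv_reg s : theta < complex.Re s -> s != 1 ->
  has_cderiv (fun s => reg (tay 0 s) (tay_prim 0 s)) s (- reg (tay 1 s) (tay_prim 1 s)).
Proof.
(* A quarter of the margin: the rate drops by [q] once for the powers of [t] and once for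
   [|u - s| <= q], and [Re s - 2 q] still exceeds [theta]. *)
move=> sr s1; pose q := (complex.Re s - theta) / 4.
have q0 : 0 < q by rewrite divr_gt0// subr_gt0.
move=> e e0.
pose b := 8 * cabs s * q^-2 + 2 * q^-1.
have b0 : 0 <= b by rewrite addr_ge0 ?mulr_ge0 ?cabs_ge0 ?exprn_ge0 ?invr_ge0 ?(ltW q0)// exprn_ge0// ltW.
pose sg := complex.Re s - 2 * q.
have sgt : theta < sg by rewrite /sg /q; lra.
pose C := regC kappa A * b * (1 + (sg - theta)^-1) + 1.
have rC := @regC_gt0 _ _ _ _ _ hA.
have i0 : 0 <= 1 + (sg - theta)^-1 by rewrite addr_ge0// invr_ge0 subr_ge0 ltW.
have C0 : 0 < C by rewrite ltr_wpDl// mulr_ge0// mulr_ge0// ltW.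
exists (Num.min (Num.min q (cabs (s - 1))) (e / C)).
  by rewrite !lt_min q0 cabs_gt0 subr_eq0 s1 divr_gt0.
move=> u; rewrite !lt_min => /andP[/andP[uq us] ue].
pose w := u - s; have uE : u = s + w by rewrite /w; ring.
rewrite -/w in uq us ue *.
have u1 : u != 1 by apply/eqP => u1; move: us; rewrite /w u1 cabsB ltxx.
have wq : cabs w <= q := ltW uq.
have Ru : complex.Re u = complex.Re s + complex.Re w by rewrite uE ReD.
have Rw : `|complex.Re w| <= q := le_trans (Re_le_cabs w) wq.
have uq2 : theta < complex.Re u - q.
  by move: Rw; rewrite ler_norml Ru /q => /andP[]; have := sr; lra.
have sq2 : theta < complex.Re s - q by rewrite /q; lra.
have d1 := regdata_tay 0 u1 q0 uq2; have d2 := regdata_tay 0 s1 q0 sq2.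
have d3 := regdata_tay 1 s1 q0 sq2.
pose F t := (tay 0 u t + -1 * tay 0 s t) + w * tay 1 s t.
pose F' t := (tay_der 0 u t + -1 * tay_der 0 s t) + w * tay_der 1 s t.
pose P t := (tay_prim 0 u t + -1 * tay_prim 0 s t) + w * tay_prim 1 s t.
have DF t : cderiv F t (F' t).
  by apply: cderivD; [apply: cderivD; [|apply: cderivZ]|apply: cderivZ]; exact: cderiv_tay.
have DP t : cderiv P t ((expR t)%:C%C * F t).
  have h := cderivD (cderivD (cderiv_tay_prim 0 t u1) (cderivZ (-1) (cderiv_tay_prim 0 t s1)))
    (cderivZ w (cderiv_tay_prim 1 t s1)).
  by apply: (cderiv_eq _ _ h) => //; rewrite /F; ring.
have BF t : 0 <= t -> cabs (F' t) <= cabs w ^+ 2 * b * expR (- sg * t).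
  move=> t0; pose E := cexp (- s * t%:C%C); pose x := - w * t%:C%C.
  have Eu : cexp (- u * t%:C%C) = E * cexp x by rewrite -cexpD /x uE; congr cexp; ring.
  have -> : F' t = - s * (E * (cexp x - 1 - x)) - w * (E * (cexp x - 1)).
    rewrite /F' /tay_der !tay0 /tay Eu -/E expfact1 /x uE; ring.
  have cx : cabs x = cabs w * t by rewrite cabsM cabsN cabs_real ger0_norm.
  have xe : expR (cabs x) <= expR (q * t) by rewrite ler_expR cx ler_wpM2r.
  have E1 : cabs E = expR (- complex.Re s * t) by rewrite cabs_cexpN.
  have t1 := expfact_le 1 t0 q0; have t2 := expfact_le 2 t0 q0.
  rewrite -/(expfact 1 t) expfact1 expr1 in t1; rewrite (_ : 2`! = 2%N)// in t2.
  have eE : expR (- sg * t) = expR (- complex.Re s * t) * expR (q * t) * expR (q * t).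
    by rewrite -!expRD; congr expR; rewrite /sg; ring.
  set a := expR (q * t) in xe t1 t2 eE; have a0 : 0 <= a by rewrite expR_ge0.
  set c := expR (- complex.Re s * t) in E1 eE; have c0 : 0 <= c by rewrite expR_ge0.
  have cw := cabs_ge0 w.
  have t22 : t ^+ 2 <= 2 * q^-2 * a.
    by move: t2; rewrite ler_pdivrMr ?ltr0n// exprVn => h; apply: le_trans h _; lra.
  have p1 : cabs (E * (cexp x - 1 - x)) <= c * (8 * (cabs w ^+ 2 * q^-2 * (a * a))).
    rewrite cabsM E1 ler_wpM2l//; apply: le_trans (cexp_sub1B _) _.
    have -> : 8 * (cabs w ^+ 2 * q^-2 * (a * a)) = 4 * (cabs w ^+ 2 * (2 * q^-2 * a) * a) by ring.
    rewrite ler_wpM2l// cx exprMn; apply: ler_pM; rewrite ?mulr_ge0 ?exprn_ge0 ?expR_ge0//.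
      by rewrite ler_wpM2l ?exprn_ge0.
    by rewrite -cx.
  have p2 : cabs (E * (cexp x - 1)) <= c * (2 * (cabs w * q^-1 * (a * a))).
    rewrite cabsM E1 ler_wpM2l//; apply: le_trans (cexp_sub1 _) _.
    rewrite ler_wpM2l//.
    have -> : cabs w * q^-1 * (a * a) = cabs w * (q^-1 * a) * a by ring.
    apply: ler_pM; rewrite ?cabs_ge0 ?expR_ge0// cx ler_wpM2l//.
  apply: le_trans (cabsD _ _) _; rewrite cabsN !(cabsM _ (E * _)) cabsN.
  have := ler_wpM2l (cabs_ge0 s) p1; have := ler_wpM2l cw p2.
  move=> h1 h2; apply: le_trans (lerD h2 h1) _.
  by rewrite eE /b le_eqVlt; apply/orP; left; apply/eqP; ring.
have DD : regdata F F' P (cabs w ^+ 2 * b) sg.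
  by split=> //; rewrite mulr_ge0// exprn_ge0// cabs_ge0.
have [_ B] := regP hA DD.
have d12 : regdata (fun t => tay 0 u t + -1 * tay 0 s t)
    (fun t => tay_der 0 u t + -1 * tay_der 0 s t)
    (fun t => tay_prim 0 u t + -1 * tay_prim 0 s t)
    (((cabs u + q) + (cabs s + q))) (complex.Re s - 2 * q).
  split=> //.
  - by rewrite !addr_ge0 ?cabs_ge0 ?(ltW q0).
  - by move=> t _; apply: cderivD; [|apply: cderivZ]; exact: cderiv_tay.
  - move=> t t0; apply: le_trans (cabsD _ _) _; rewrite mulN1r cabsN.
    have := tay_der_le 0 u t0 q0; have := tay_der_le 0 s t0 q0; rewrite !expr0 !mulr1.
    have m1 : expR (- (complex.Re s - q) * t) <= expR (- (complex.Re s - 2 * q) * t).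
      by rewrite ler_expR !mulNr lerN2 ler_wpM2r//; have := q0; lra.
    have m2 : expR (- (complex.Re u - q) * t) <= expR (- (complex.Re s - 2 * q) * t).
      rewrite ler_expR !mulNr lerN2 ler_wpM2r// Ru.
      by move: Rw; rewrite ler_norml => /andP[]; lra.
    have su : 0 <= cabs u + q by rewrite addr_ge0 ?cabs_ge0 ?(ltW q0).
    have ss : 0 <= cabs s + q by rewrite addr_ge0 ?cabs_ge0 ?(ltW q0).
    have := ler_wpM2l su m2; have := ler_wpM2l ss m1; lra.
  - move=> t _; have h := cderivD (cderiv_tay_prim 0 t u1) (cderivZ (-1) (cderiv_tay_prim 0 t s1)).
    by apply: (cderiv_eq _ _ h) => //; ring.
have E : reg F P = reg (tay 0 u) (tay_prim 0 u) - reg (tay 0 s) (tay_prim 0 s) -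
    - reg (tay 1 s) (tay_prim 1 s) * w.
  rewrite /F /P (reg_axpy hA w d12 d3) (reg_axpy hA (-1) d1 d2); ring.
rewrite -E; apply: le_trans B _.
have -> : regC kappa A * (cabs w ^+ 2 * b) * (1 + (sg - theta)^-1) = (C - 1) * cabs w * cabs w.
  by rewrite /C; ring.
rewrite ler_wpM2r ?cabs_ge0//; move: ue; rewrite ltr_pdivlMr//.
by have := cabs_ge0 w; lra.
Qed.

Lemma has_cderivD (f g : R[i] -> R[i]) (z l m : R[i]) : has_cderiv f z l -> has_cderiv g z m ->
  has_cderiv (fun w => f w + g w) z (l + m).
Proof.
move=> Hl Hk e e0; have e2 : 0 < e / 2 by rewrite divr_gt0.
have [a a0 Ha] := Hl _ e2; have [b b0 Hb] := Hk _ e2.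
exists (Num.min a b); first by rewrite lt_min a0.
move=> w; rewrite lt_min => /andP[/Ha h1 /Hb h2].
have -> : f w + g w - (f z + g z) - (l + m) * (w - z) =
  (f w - f z - l * (w - z)) + (g w - g z - m * (w - z)) by ring.
by apply: le_trans (cabsD _ _) _; lra.
Qed.

Lemma has_cderivZ (c : R[i]) (f : R[i] -> R[i]) z l : has_cderiv f z l ->
  has_cderiv (fun w => c * f w) z (c * l).
Proof.
move=> Hl e e0; have c0 : 0 < cabs c + 1 by rewrite ltr_wpDl ?cabs_ge0.
have [a a0 Ha] := Hl _ (divr_gt0 e0 c0); exists a => // w /Ha h.
have -> : c * f w - c * f z - c * l * (w - z) = c * (f w - f z - l * (w - z)) by ring.
rewrite cabsM; apply: le_trans (ler_wpM2l (cabs_ge0 c) h) _.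
rewrite mulrA ler_wpM2r ?cabs_ge0// mulrA ler_pdivrMr// mulrC ler_wpM2l ?(ltW e0)//; lra.
Qed.

Lemma cdiffD (f g : R[i] -> R[i]) z : cdiff f z -> cdiff g z -> cdiff (fun w => f w + g w) z.
Proof. by move=> [l Hl] [k Hk]; exists (l + k); exact: has_cderivD. Qed.

Lemma has_cderiv_Z s : theta < complex.Re s -> s != 1 -> has_cderiv Z s (- zcoef 1 s).
Proof.
move=> sr s1; have h := has_cderivD (has_cderivZ kappa%:C%C (has_cderiv_inv s1)) (has_cderiv_reg sr s1).
have -> : - zcoef 1 s = kappa%:C%C * - (s - 1)^-2 + - reg (tay 1 s) (tay_prim 1 s).
  by rewrite /zcoef exprVn; ring.
exact: h.
Qed.

Lemma cdiff_Z s : theta < complex.Re s -> s != 1 -> cdiff Z s.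
Proof. by move=> sr s1; exists (- zcoef 1 s); exact: has_cderiv_Z. Qed.

End Zeta.

(** * Sums of nonnegative terms over the semigroup *)

Section PositiveSums.
Variables (R : realType) (G : beurlingSystem R).
Implicit Types (f : G -> R) (T x e C : R) (N M : nat).

Lemma sum_gle_mono f T x : (forall g, 0 <= f g) -> x <= T ->
  \sum_(g <- gle G x) f g <= \sum_(g <- gle G T) f g.
Proof.
move=> f0 xT; rewrite (sum_gle_split f xT) lerDl; exact: sumr_ge0.
Qed.

Lemma sum_gle_limit f l T : (forall g, 0 <= f g) ->
  ccvg (fun N => (\sum_(g <- gle G N.+1%:R) f g)%:C%C) l ->
  \sum_(g <- gle G T) f g <= complex.Re l.
Proof.
move=> f0 cl; apply/ler_addgt0Pr => e e0; have [N HN] := cl e e0.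
pose M := maxn N (Num.truncn T).+1.
have TM : T <= M.+1%:R.
  apply: le_trans (ltW (truncnS_gt T)) _; rewrite ler_nat /M.
  by apply: leq_trans (leq_maxr _ _) _.
have := le_trans (Re_le_cabs _) (HN M (leq_maxl _ _)); rewrite ReB /= ler_norml => /andP[_ h].
by have := sum_gle_mono f0 TM; lra.
Qed.

Lemma sum_gle_tail f C : (forall g, 0 <= f g) -> (forall T, \sum_(g <- gle G T) f g <= C) ->
  forall e, 0 < e -> exists N, forall T, N%:R <= T ->
    \sum_(g <- gle G T | N%:R < bnorm g) f g <= e.
Proof.
move=> f0 hC e e0; pose S := range (fun N => \sum_(g <- gle G N%:R) f g).
have hS : has_sup S by split; [exists (\sum_(g <- gle G 0%:R) f g); exists 0%N|exists C => _ [N _ <-]].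
have [_ [N _ <-] hN] := sup_adherent e0 hS.
exists N => T NT; have := sum_gle_split f NT.
pose M := (Num.truncn T).+1.
have h1 := sum_gle_mono f0 (ltW (truncnS_gt T)).
have h2 : \sum_(g <- gle G M%:R) f g <= sup S.
  by apply: ub_le_sup; [case: hS|exists M].
by rewrite /M in h2; lra.
Qed.

(** [is_zeta] asks for convergence along arbitrary finite subsets, so tails over norm balls must be
    turned into bounds over any finite set of elements of large norm. *)
Lemma sum_seq_le_gle f (B : seq G) N e : (forall g, 0 <= f g) ->
  (forall T, N%:R <= T -> \sum_(g <- gle G T | N%:R < bnorm g) f g <= e) ->
  uniq B -> (forall g, g \in B -> N%:R < bnorm g) -> \sum_(g <- B) f g <= e.
Proof.
move=> f0 h uB hB.
have [T BT] : exists T, forall g, g \in B -> bnorm g <= T.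
  elim: B {uB hB} => [|b B [T HT]]; first by exists 0.
  exists (Num.max (bnorm b) T) => g; rewrite inE le_max => /orP[/eqP ->|/HT ->].
    by rewrite lexx.
  by rewrite orbT.
pose U := Num.max T N%:R.
have NU : N%:R <= U by rewrite /U le_max lexx orbT.
apply: le_trans (h U NU); rewrite -[leRHS]big_filter.
have uF : uniq [seq g <- gle G U | N%:R < bnorm g] by rewrite filter_uniq// uniq_gle.
have sub g : g \in B -> g \in [seq g <- gle G U | N%:R < bnorm g].
  by move=> gB; rewrite mem_filter hB// mem_gle /U le_max BT.
have -> : \sum_(g <- B) f g = \sum_(g <- [seq g <- gle G U | N%:R < bnorm g] | g \in B) f g.
  rewrite -[RHS]big_filter; apply: perm_big; apply: uniq_perm; rewrite ?filter_uniq ?uniq_gle//.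
  by move=> g; rewrite [RHS]mem_filter; case: (boolP (g \in B)) => // /sub ->.
by rewrite [leRHS](bigID (mem B)) /= lerDl; exact: sumr_ge0.
Qed.

End PositiveSums.

(** * Identification of zeta with its explicit continuation *)

Section ZetaUnique.
Variables (R : realType) (G : beurlingSystem R) (kappa A theta : R).
Hypothesis hA : axiomA G kappa A theta.
Implicit Types (s w z : R[i]) (t q : R) (k n : nat).

Let theta0 : 0 < theta. Proof. by case: hA => _ _ /andP[]. Qed.
Let theta1 : theta < 1. Proof. by case: hA => _ _ /andP[]. Qed.

Local Notation Z := (@Z R G kappa).

Lemma wsum_unit (F : R -> R[i]) T : wsum (@unit_weight R G) F T = \sum_(g <- gle G T) F (ln (bnorm g)).
Proof. by apply: eq_bigr => g _; rewrite mul1r. Qed.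

Lemma cpow_tay s (g : G) : cpow (bnorm g) (- s) = tay 0 s (ln (bnorm g)).
Proof. by rewrite cpowE ?bnorm_gt0// tay0. Qed.

Lemma ln_bnorm_ge0 (g : G) : 0 <= ln (bnorm g).
Proof. by rewrite ln_ge0// bnorm_ge1. Qed.

Lemma sum_norm_le (x T : R) : 1 < x ->
  \sum_(g <- gle G T) expR (- x * ln (bnorm g)) <= complex.Re (Z x%:C%C).
Proof.
move=> x1; apply: sum_gle_limit => [g|]; first exact: expR_ge0.
have := @zcoef_cvg _ _ _ _ _ hA 0 x%:C%C x1; apply: (@ccvg_ext _ _ _ _ 0%N) => N _.
rewrite wsum_unit rmorph_sum; apply: eq_bigr => g _.
rewrite /= tay0 -cexp_real; congr cexp; rewrite rmorphM rmorphN; ring.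
Qed.

Lemma cabs_tay0 s (g : G) : cabs (tay 0 s (ln (bnorm g))) = expR (- complex.Re s * ln (bnorm g)).
Proof. by rewrite tay0 cabs_cexpN. Qed.

Lemma Z_sum s : 1 < complex.Re s ->
  partial_sum (fun g : G => cpow (bnorm g) (- s)) @ totally --> (Z s : R[i]^o).
Proof.
move=> s1; have FP := @totally_filter G; have FF : Filter (@totally G) by apply: filter_filter.
apply: (proj2 (@cvgrPdist_le _ R[i]^o _ _ FF
  (partial_sum (fun g : G => cpow (bnorm g) (- s)) : _ -> R[i]^o) (Z s))) => e' /complex_gt0P[e e0 ->].
have e2 : 0 < e / 2 by rewrite divr_gt0.
have [N HN] := sum_gle_tail (fun g => expR_ge0 _) (fun T => sum_norm_le T s1) e2.
have [M HM] := zcoef_cvg hA 0 s1 e2.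
pose K := maxn N M; exists (fset_set [set g : G | bnorm g <= K.+1%:R]) => //= B /fsubsetP KB.
rewrite cabsE lecR cabsB /partial_sum -(big_seq_fsetE _ _ predT (fun g => cpow (bnorm g) (- s))) /=.
under eq_bigr do rewrite cpow_tay.
have := HM K (leq_maxr _ _); rewrite wsum_unit => h1.
have -> : \sum_(g <- B) tay 0 s (ln (bnorm g)) = \sum_(g <- gle G K.+1%:R) tay 0 s (ln (bnorm g))
    + \sum_(g <- B | K.+1%:R < bnorm g) tay 0 s (ln (bnorm g)).
  rewrite (bigID (fun g => bnorm g <= K.+1%:R)) /=; congr (_ + _); last first.
    by apply: eq_bigl => g; rewrite ltNge.
  rewrite -big_filter; apply: perm_big; apply: uniq_perm; rewrite ?filter_uniq ?uniq_gle ?fset_uniq//.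
  move=> g; rewrite mem_filter mem_gle andb_idr// => gK; apply: KB.
  by rewrite -mem_gle in gK.
rewrite addrAC; apply: le_trans (cabsD _ _) _.
have : cabs (\sum_(g <- B | K.+1%:R < bnorm g) tay 0 s (ln (bnorm g))) <= e / 2.
  apply: le_trans (cabs_sum _ _ _) _; under eq_bigr do rewrite cabs_tay0.
  rewrite -big_filter; apply: (sum_seq_le_gle _ HN); rewrite ?filter_uniq ?fset_uniq//.
  move=> g; rewrite mem_filter => /andP[h _]; apply: le_lt_trans h.
  by rewrite ler_nat; apply: leq_trans (leq_maxl N M) _.
by move: h1; rewrite /(@Z); lra.
Qed.

Lemma Z_bounded_near1 : exists2 C, 0 <= C & forall s, s != 1 -> cabs (s - 1) < (1 - theta) / 4 ->
  cabs (Z s - kappa%:C%C / (s - 1)) <= C.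
Proof.
pose q := (1 - theta) / 4; have q0 : 0 < q by rewrite divr_gt0// subr_gt0.
have rC := @regC_gt0 _ _ _ _ _ hA.
exists (regC kappa A * (2 + q) * (1 + q^-1)).
  have i0 : 0 <= 1 + q^-1 by rewrite addr_ge0// invr_ge0 ltW.
  have j0 : 0 <= 2 + q by rewrite addr_ge0// ltW.
  by rewrite mulr_ge0// mulr_ge0// ltW.
move=> s s1 hs; have Rs : 1 - q < complex.Re s.
  have := le_lt_trans (Re_le_cabs _) hs; rewrite ReB /= ltr_norml => /andP[+ _].
  by rewrite /q; lra.
have sq : theta < complex.Re s - q by rewrite /q in Rs *; have := theta1; lra.
have [_ h] := regP hA (regdata_tay 0 s1 q0 sq).
have -> : Z s - kappa%:C%C / (s - 1) = reg G kappa (tay 0 s) (tay_prim 0 s).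
  by rewrite /(@Z) /zcoef expr1; ring.
apply: le_trans h _; move: (regC kappa A) rC => c c0; rewrite expr0 mulr1 -!mulrA.
apply: ler_wpM2l; first exact: ltW.
have u0 : 0 <= cabs s + q by rewrite addr_ge0 ?cabs_ge0// ltW.
have v0 : 0 <= 1 + (complex.Re s - q - theta)^-1.
  by rewrite addr_ge0// invr_ge0 subr_ge0 ltW.
apply: ler_pM => //.
- rewrite lerD2r; have := cabsD (s - 1) 1; rewrite subrK cabs1.
  by move: hs; rewrite -/q /q; have := theta0; have := theta1; lra.
- rewrite lerD2l lef_pV2 ?posrE ?subr_gt0//; rewrite /q in Rs *; have := theta1; lra.
Qed.

Lemma is_zeta_Z : is_zeta G theta Z.
Proof.
split=> [s|s sr s1|]; first exact: Z_sum.
  by apply/derivable_cdiff; exact: (cdiff_Z hA).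
exists kappa%:C%C; first by rewrite -cabs_eq0 cabs_real normr_eq0 gt_eqF//; case: hA.
apply/cvg_dnbhs_eps => e e0; have [C C0 HC] := Z_bounded_near1.
have C1 : 0 < C + 1 by rewrite ltr_wpDl.
exists (Num.min ((1 - theta) / 4) (e / (C + 1))).
  by rewrite lt_min !divr_gt0// subr_gt0.
move=> w w1; rewrite lt_min => /andP[h1]; rewrite ltr_pdivlMr// => h2.
have -> : (w - 1) * Z w - kappa%:C%C = (w - 1) * (Z w - kappa%:C%C / (w - 1)).
  by field; rewrite subr_eq0.
rewrite cabsM; have := ler_wpM2l (cabs_ge0 (w - 1)) (HC w w1 h1); have := cabs_ge0 (w - 1); lra.
Qed.

(** [zeta] is whatever function [xget] selects; by the identity theorem any function satisfying
    [is_zeta] agrees with [Z] here. *)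
Lemma zetaE s : theta < complex.Re s -> s != 1 -> zeta G theta s = Z s.
Proof.
move=> sr s1; rewrite /zeta; case: xgetP => [Y _ /= hY|/(_ Z)]; last first.
  by move=> N; exfalso; exact: N is_zeta_Z.
have [Y1 Y2 [r _ /cvg_dnbhs_eps Y3]] := hY; have [Z1 Z2 [r2 _ /cvg_dnbhs_eps Z3]] := is_zeta_Z.
(* One factor [w - 1] removes both poles; the second makes [H] vanish at 1 whatever the
   unconstrained values there, with derivative the difference of the residues. *)
pose H w := (w - 1) * (w - 1) * (Y w - Z w).
have dW w : cdiff (fun w => w - 1 : R[i]) w.
  by apply: (@cdiff_eps _ (fun w => -1 + 1 * w) _ _ 1) => // [u _|]; [ring|exact: cdiff_affine].
have dH w : theta < complex.Re w -> cdiff H w.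
  move=> wr; have [->|w1] := eqVneq w 1; last first.
    apply: cdiffM; first exact: cdiffM.
    apply: (@cdiff_eps _ (fun w => Y w + (-1 + 0 * w) * Z w) _ _ 1) => // [u _|]; first by ring.
    apply: cdiffD; first by apply/derivable_cdiff; exact: Y2.
    by apply: cdiffM; [exact: cdiff_affine|exact: (cdiff_Z hA)].
  exists (r - r2) => e e0; have e2 : 0 < e / 2 by rewrite divr_gt0.
  have [a a0 Ha] := Y3 _ e2; have [b b0 Hb] := Z3 _ e2.
  exists (Num.min a b); first by rewrite lt_min a0.
  move=> u; rewrite lt_min => /andP[ua ub].
  have [->|u1] := eqVneq u 1; first by rewrite !subrr mulr0 subrr cabs0 mulr0.
  have -> : H u - H 1 - (r - r2) * (u - 1) =
      (((u - 1) * Y u - r) - ((u - 1) * Z u - r2)) * (u - 1) by rewrite /H; ring.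
  rewrite cabsM ler_wpM2r ?cabs_ge0//; apply: le_trans (cabsD _ _) _; rewrite cabsN.
  by have := Ha u u1 ua; have := Hb u u1 ub; lra.
have H0 w : 1 < complex.Re w -> H w = 0.
  move=> w1; rewrite /H; have -> : Y w = Z w; last by rewrite subrr mulr0.
  have FP := @totally_filter G.
  exact: (@cvg_unique R[i]^o (@norm_hausdorff _ R[i]^o) _
    (@fmap_proper_filter _ _ (partial_sum (fun g : G => cpow (bnorm g) (- w)) : _ -> R[i]^o) _ FP)
    _ _ (Y1 w w1) (Z1 w w1)).
have := vanish_half_plane theta1 dH H0 sr; rewrite /H => /eqP.
rewrite !mulf_eq0 subr_eq0 (negbTE s1) /= subr_eq0 => /eqP//.
Qed.

End ZetaUnique.

(** * The logarithmic derivative *)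

Section Convolution.
Variables (R : realType) (G : beurlingSystem R).
Implicit Types (g h d : G) (T x e C : R) (N M k : nat).

(** Pairs [(h, d)] are grouped by the product [g = h d]; cancellation makes [h] unique, and summing
    [mangoldt] over the divisors of [g] yields [log |g|]. *)
Lemma sum_conv_mangoldt T (F : G -> R[i]) :
  \sum_(h <- gle G T) \sum_(d <- gle G T | bnorm (h * d)%g <= T)
     (mangoldt d)%:C%C * F (h * d)%g =
  \sum_(g <- gle G T) (ln (bnorm g))%:C%C * F g.
Proof.
have E d : \sum_(h <- gle G T | bnorm (h * d)%g <= T) F (h * d)%g =
    \sum_(g <- gle G T | bdvd d g) F g.
  rewrite -big_filter -[RHS]big_filter.
  rewrite -[LHS](big_map (fun h => (h * d)%g) predT F); apply: perm_big.
  have inj : injective (fun h => (h * d)%g) by move=> g h /mulgI_beurling.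
  apply: uniq_perm; rewrite ?map_inj_uniq ?filter_uniq ?uniq_gle// => g.
  rewrite mem_filter mem_gle; apply/mapP/andP => [[h + ->]|[/asboolP[h ->] hT]].
    by rewrite mem_filter => /andP[hd _]; split=> //; apply/asboolP; exists h.
  exists h => //; rewrite mem_filter hT mem_gle; apply: le_trans hT.
  by rewrite bnormM ler_peMr ?bnorm_ge1// ltW// bnorm_gt0.
under eq_bigr do rewrite big_mkcond /=.
rewrite exchange_big /=.
under eq_bigr => d _ do rewrite -big_mkcond -mulr_sumr E mulr_sumr big_mkcond /=.
rewrite exchange_big /= big_seq [RHS]big_seq; apply: eq_bigr => g.
rewrite mem_gle => gT; rewrite -(sum_mangoldt_dvd gT) rmorph_sum mulr_suml [RHS]big_mkcond /=.
by apply: eq_bigr => d _; case: ifP.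
Qed.

(** The region [|h d| <= N^2] contains the square [|h|, |d| <= N], and a pair outside the square has
    a coordinate exceeding [N], so the error consists of tails. *)
Lemma sum_pairs_diff (a b : G -> R[i]) N T : N%:R ^+ 2 = T ->
  cabs (\sum_(h <- gle G T) \sum_(d <- gle G T | bnorm (h * d)%g <= T) a h * b d -
    (\sum_(h <- gle G N%:R) a h) * (\sum_(d <- gle G N%:R) b d)) <=
  (\sum_(h <- gle G T | N%:R < bnorm h) cabs (a h)) * (\sum_(d <- gle G T) cabs (b d)) +
  (\sum_(h <- gle G T) cabs (a h)) * (\sum_(d <- gle G T | N%:R < bnorm d) cabs (b d)).
Proof.
move=> NT.
have restr (c : G -> R[i]) : \sum_(h <- gle G N%:R) c h = \sum_(h <- gle G T | bnorm h <= N%:R) c h.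
  have [N0|N0] := posnP N.
    rewrite !big1_seq// => g.
      by move=> /andP[+ _]; rewrite N0 leNgt bnorm_gt0.
    by rewrite mem_gle N0 leNgt bnorm_gt0.
  have NT' : N%:R <= T.
    by rewrite -NT expr2 ler_peMr ?ler1n// ler0n.
  rewrite -[RHS]big_filter; apply: perm_big; apply: uniq_perm; rewrite ?filter_uniq ?uniq_gle//.
  move=> g; rewrite mem_filter !mem_gle; case: (leP (bnorm g) N%:R) => //= gN.
  by rewrite (le_trans gN).
rewrite !restr mulr_suml [X in X - _](_ : _ = \sum_(h <- gle G T) \sum_(d <- gle G T)
  (if bnorm (h * d)%g <= T then a h * b d else 0)); last first.
  by apply: eq_bigr => h _; rewrite -big_mkcond.
rewrite [X in _ - X](_ : _ = \sum_(h <- gle G T) \sum_(d <- gle G T)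
  (if (bnorm h <= N%:R) && (bnorm d <= N%:R) then a h * b d else 0)); last first.
  rewrite [LHS]big_mkcond; apply: eq_bigr => h _; case: (bnorm h <= N%:R) => /=.
    by rewrite mulr_sumr -big_mkcond.
  by rewrite big1.
rewrite -sumrB; under eq_bigr do rewrite -sumrB.
have -> : (\sum_(h <- gle G T | N%:R < bnorm h) cabs (a h)) * (\sum_(d <- gle G T) cabs (b d)) =
    \sum_(h <- gle G T) \sum_(d <- gle G T) (if N%:R < bnorm h then cabs (a h) * cabs (b d) else 0).
  rewrite big_mkcond mulr_suml; apply: eq_bigr => h _; case: ifP => _.
    by rewrite mulr_sumr.
  by rewrite mul0r big1.
have -> : (\sum_(h <- gle G T) cabs (a h)) * (\sum_(d <- gle G T | N%:R < bnorm d) cabs (b d)) =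
    \sum_(h <- gle G T) \sum_(d <- gle G T) (if N%:R < bnorm d then cabs (a h) * cabs (b d) else 0).
  rewrite mulr_suml; apply: eq_bigr => h _; rewrite big_mkcond mulr_sumr; apply: eq_bigr => d _.
  by case: ifP; rewrite ?mulr0.
rewrite -big_split /=; apply: le_trans (cabs_sum _ _ _) _; apply: ler_sum => h _.
rewrite -big_split /=; apply: le_trans (cabs_sum _ _ _) _; apply: ler_sum => d _.
have p : 0 <= cabs (a h) * cabs (b d) by rewrite mulr_ge0 ?cabs_ge0.
have nn : 0 <= N%:R :> R by [].
rewrite !ltNge; case: (leP (bnorm h) N%:R) => hN; case: (leP (bnorm d) N%:R) => dN /=;
  rewrite ?subr0 ?addr0 ?add0r.
- rewrite bnormM -NT expr2 ler_pM ?subrr ?cabs0// ltW ?bnorm_gt0//.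
- by case: ifP; rewrite ?cabs0 ?cabsM.
- by case: ifP; rewrite ?cabs0 ?cabsM.
- by case: ifP; rewrite ?cabs0 ?cabsM; lra.
Qed.

Lemma abs_ccvg (F : G -> R[i]) C : (forall T, \sum_(g <- gle G T) cabs (F g) <= C) ->
  exists2 l, ccvg (fun N => \sum_(g <- gle G N.+1%:R) F g) l & cabs l <= C.
Proof.
move=> hC; pose b n := \sum_(g <- gle G n.+1%:R | n%:R < bnorm g) cabs (F g).
pose u n := \sum_(g <- gle G n.+1%:R | n%:R < bnorm g) F g.
have nn n : n%:R <= n.+1%:R :> R by rewrite ler_nat.
have tele (V : zmodType) (f : G -> V) N :
    \sum_(0 <= n < N) \sum_(g <- gle G n.+1%:R | n%:R < bnorm g) f g = \sum_(g <- gle G N%:R) f g.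
  elim: N => [|N IH].
    rewrite big_geq// big1_seq// => g.
    by rewrite mem_gle leNgt bnorm_gt0.
  by rewrite big_nat_recr//= IH [RHS](sum_gle_split f (nn N)).
have [|N|l cl lC] := @ccvg_series _ u b C.
- by move=> n; exact: cabs_sum.
- by rewrite tele.
exists l => // e /cl[N HN]; exists N => n Nn; have := HN n.+1 (leqW Nn).
by rewrite /u tele.
Qed.

End Convolution.

Section LogDerivative.
Variables (R : realType) (G : beurlingSystem R) (kappa A theta : R).
Hypothesis hA : axiomA G kappa A theta.
Implicit Types (s w z : R[i]) (g h d : G) (t q x T : R) (k n j N : nat).

(** All terms are nonnegative, and two elements of norm at most [T] have a product of norm at most
    [T^2], so the product of partial sums is part of the convolution sum. *)
Lemma sum_mul_le_conv x T : 0 <= x -> 1 <= T ->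
  (\sum_(h <- gle G T) expR (- x * ln (bnorm h))) *
  (\sum_(d <- gle G T) mangoldt d * expR (- x * ln (bnorm d))) <=
  \sum_(g <- gle G (T ^+ 2)) ln (bnorm g) * expR (- x * ln (bnorm g)).
Proof.
move=> x0 T1; have T2 : T <= T ^+ 2 by rewrite expr2 ler_peMr// (le_trans ler01).
pose F (g : G) := (expR (- x * ln (bnorm g)))%:C%C : R[i].
have := sum_conv_mangoldt (T ^+ 2) F => /(congr1 (@complex.Re R)).
have -> : complex.Re (\sum_(g <- gle G (T ^+ 2)) (ln (bnorm g))%:C%C * F g) =
    \sum_(g <- gle G (T ^+ 2)) ln (bnorm g) * expR (- x * ln (bnorm g)).
  by rewrite Re_sum; apply: eq_bigr => g _; rewrite /F ReM /= mulr0 subr0.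
move=> <-; rewrite Re_sum mulr_suml.
have f0 (h d : G) : 0 <= mangoldt d * expR (- x * ln (bnorm (h * d)%g)).
  by rewrite mulr_ge0 ?mangoldt_ge0 ?expR_ge0.
have E h : complex.Re (\sum_(d <- gle G (T ^+ 2) | bnorm (h * d)%g <= T ^+ 2)
    (mangoldt d)%:C%C * F (h * d)%g) =
    \sum_(d <- gle G (T ^+ 2) | bnorm (h * d)%g <= T ^+ 2)
      mangoldt d * expR (- x * ln (bnorm (h * d)%g)).
  by rewrite Re_sum; apply: eq_bigr => d _; rewrite /F ReM /= mulr0 subr0.
under [leRHS]eq_bigr do rewrite E.
apply: (@le_trans _ _ (\sum_(h <- gle G T) \sum_(d <- gle G (T ^+ 2) | bnorm (h * d)%g <= T ^+ 2)
      mangoldt d * expR (- x * ln (bnorm (h * d)%g)))); last first.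
  by apply: sum_gle_mono => // h; exact: sumr_ge0.
rewrite big_seq [leRHS]big_seq; apply: ler_sum => h; rewrite mem_gle => hT.
rewrite mulr_sumr; apply: (@le_trans _ _ (\sum_(d <- gle G T)
    (if bnorm (h * d)%g <= T ^+ 2 then mangoldt d * expR (- x * ln (bnorm (h * d)%g)) else 0))).
  rewrite big_seq [leRHS]big_seq; apply: ler_sum => d; rewrite mem_gle => dT.
  rewrite bnormM expr2 ler_pM ?(ltW (bnorm_gt0 _))//.
  by rewrite lnM ?posrE ?bnorm_gt0// mulrDr expRD; lra.
rewrite [leRHS]big_mkcond /=.
by apply: sum_gle_mono => // d; case: ifP.
Qed.

(** [t <= (2 / al) e^(al t / 2)]: half of [al] absorbs the logarithm. *)
Lemma sum_ln_le al T : 0 < al ->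
  \sum_(g <- gle G T) ln (bnorm g) * expR (- (1 + al) * ln (bnorm g)) <=
  2 / al * complex.Re (Z G kappa (1 + al / 2)%:C%C).
Proof.
move=> al0; have a2 : 0 < al / 2 by rewrite divr_gt0.
have a1 : 1 < 1 + al / 2 by lra.
apply: le_trans (ler_wpM2l _ (sum_norm_le hA T a1)); last by rewrite divr_ge0// ltW.
rewrite mulr_sumr; apply: ler_sum => g _.
have := expfact_le 1 (ln_bnorm_ge0 g) a2.
rewrite -/(expfact 1 _) expfact1 expr1 invf_div => h.
have -> : expR (- (1 + al / 2) * ln (bnorm g)) =
    expR (al / 2 * ln (bnorm g)) * expR (- (1 + al) * ln (bnorm g)).
  by rewrite -expRD; congr expR; field.
by rewrite mulrA ler_wpM2r ?expR_ge0.
Qed.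

Lemma mangoldt_sum_mul_le al T x : 0 < al ->
  (\sum_(h <- gle G x) expR (- (1 + al) * ln (bnorm h))) *
  (\sum_(d <- gle G T) mangoldt d * expR (- (1 + al) * ln (bnorm d))) <=
  2 / al * complex.Re (Z G kappa (1 + al / 2)%:C%C).
Proof.
move=> al0; pose U := Num.max 1 (Num.max x T).
have U1 : 1 <= U by rewrite /U le_max lexx.
have xU : x <= U by rewrite /U !le_max lexx !orbT.
have TU : T <= U by rewrite /U !le_max lexx !orbT.
have a0 : 0 <= 1 + al by lra.
apply: le_trans (sum_ln_le (U ^+ 2) al0); apply: le_trans (sum_mul_le_conv a0 U1).
have e0 (g : G) : 0 <= expR (- (1 + al) * ln (bnorm g)) by exact: expR_ge0.
have m0 (g : G) : 0 <= mangoldt g * expR (- (1 + al) * ln (bnorm g)).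
  by rewrite mulr_ge0 ?mangoldt_ge0.
by apply: ler_pM; rewrite ?sumr_ge0//; exact: sum_gle_mono.
Qed.

Lemma mangoldt_sum_bounded al : 0 < al -> exists C, forall T,
  \sum_(d <- gle G T) mangoldt d * expR (- (1 + al) * ln (bnorm d)) <= C.
Proof.
move=> al0; exists (2 / al * complex.Re (Z G kappa (1 + al / 2)%:C%C)) => T.
have := mangoldt_sum_mul_le T 1 al0.
by rewrite (perm_big _ (perm_gle1 G)) big_seq1 bnorm1 ln1 mulr0 expR0 mul1r.
Qed.

Lemma Z_real_near1 : exists2 a0, 0 < a0 <= 1 & forall al, 0 < al <= a0 ->
  kappa / (2 * al) <= complex.Re (Z G kappa (1 + al)%:C%C) <= 2 * kappa / al.
Proof.
have [C C0 HC] := Z_bounded_near1 hA.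
have [k0 _ /andP[_ th1] _] := hA.
exists (Num.min 1 (Num.min ((1 - theta) / 8) (kappa / (2 * (C + 1))))).
  by rewrite !lt_min ltr01 !divr_gt0 ?subr_gt0//= ?mulr_gt0 ?ltr_wpDl// ge_min lexx.
move=> al; rewrite !le_min => /andP[al0 /and3P[_ a1 a2]].
have C2 : 0 < 2 * (C + 1) by lra.
have s1 : (1 + al)%:C%C != 1 :> R[i].
  by apply/eqP => /(congr1 (@complex.Re R)) /=; lra.
have sE : (1 + al)%:C%C - 1 = al%:C%C :> R[i].
  by rewrite rmorphD rmorph1 addrC addKr.
have := HC _ s1; rewrite sE cabs_real (gtr0_norm al0) => /(_ _)/(le_trans (Re_le_cabs _)).
have -> : al < (1 - theta) / 4 by lra.
move=> /(_ isT); rewrite ReB.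
have -> : complex.Re (kappa%:C%C / al%:C%C : R[i]) = kappa / al.
  by rewrite -fmorphV -rmorphM.
rewrite ler_norml => /andP[l1 l2].
have : C <= kappa / (2 * al).
  rewrite ler_pdivlMr ?mulr_gt0//; move: a2; rewrite ler_pdivlMr//; nra.
have E1 : kappa / al = 2 * (kappa / (2 * al)) by field; rewrite gt_eqF.
rewrite E1 in l1 l2.
have -> : 2 * kappa / al = 4 * (kappa / (2 * al)) by field; rewrite gt_eqF.
by move=> *; apply/andP; split; lra.
Qed.

(* A Chebyshev bound with no Tauberian input: compare the simple pole of zeta at
   [1 + al] and [1 + al / 2]. *)
Lemma mangoldt_sum_le : exists2 a0, 0 < a0 <= 1 & forall al T, 0 < al <= a0 ->
  \sum_(d <- gle G T) mangoldt d * expR (- (1 + al) * ln (bnorm d)) <= 16 / al.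
Proof.
have [a0 a01 H] := Z_real_near1; have [k0 _ _ _] := hA.
exists a0 => // al T /andP[al0 ala].
set P := \sum_(d <- _) _.
have P0 : 0 <= P by apply: sumr_ge0 => d _; rewrite mulr_ge0 ?mangoldt_ge0 ?expR_ge0.
have al1 : 1 < 1 + al by lra.
have [/andP[h1 _] /andP[_ h2]] : kappa / (2 * al) <= complex.Re (Z G kappa (1 + al)%:C%C) <= 2 * kappa / al
    /\ kappa / (2 * (al / 2)) <= complex.Re (Z G kappa (1 + al / 2)%:C%C) <= 2 * kappa / (al / 2).
  by split; apply: H; apply/andP; split; lra.
have cl : ccvg (fun N => (\sum_(g <- gle G N.+1%:R) expR (- (1 + al) * ln (bnorm g)))%:C%C)
    (Z G kappa (1 + al)%:C%C).
  have := @zcoef_cvg _ _ _ _ _ hA 0 (1 + al)%:C%C al1; apply: (@ccvg_ext _ _ _ _ 0%N) => N _.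
  rewrite wsum_unit rmorph_sum; apply: eq_bigr => g _.
  by rewrite /= tay0 -cexp_real; congr cexp; rewrite rmorphM rmorphN; ring.
(* The bound on the product of partial sums is uniform in the cutoff of the first factor, which may
   therefore be replaced by its limit, the value of [Z]. *)
have up : kappa / (2 * al) * P <= 2 / al * (2 * kappa / (al / 2)).
  apply: (@le_trans _ _ (complex.Re (Z G kappa (1 + al)%:C%C) * P)); first by rewrite ler_wpM2r.
  apply: (@le_trans _ _ (2 / al * complex.Re (Z G kappa (1 + al / 2)%:C%C))); last first.
    by rewrite ler_wpM2l// divr_ge0// ltW.
  apply/ler_addgt0Pr => e e0; have P1 : 0 < P + 1 by lra.
  have [N /(_ N (leqnn N)) hN] := cl _ (divr_gt0 e0 P1).
  have := le_trans (Re_le_cabs _) hN; rewrite ReB /= ler_norml => /andP[h3 _].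
  have := mangoldt_sum_mul_le T N.+1%:R al0; rewrite -/P.
  set S := \sum_(h <- _) _ in h3 *; move=> h4.
  have : (complex.Re (Z G kappa (1 + al)%:C%C) - S) * P <= e / (P + 1) * P.
    by rewrite ler_wpM2r//; lra.
  have : e / (P + 1) * P <= e.
    by rewrite mulrAC ler_pdivrMr// ler_wpM2l ?(ltW e0)//; lra.
  by rewrite mulrBl; lra.
have -> : 16 / al = (2 / al * (2 * kappa / (al / 2))) / (kappa / (2 * al)).
  by field; rewrite !gt_eqF.
by rewrite ler_pdivlMr ?divr_gt0 ?mulr_gt0// mulrC.
Qed.

End LogDerivative.

(** * Taylor coefficients of the logarithmic derivative *)

Section LogDerivativeCoefficients.
Variables (R : realType) (G : beurlingSystem R) (kappa A theta : R).
Hypothesis hA : axiomA G kappa A theta.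
Implicit Types (s w z : R[i]) (g h d : G) (t q x y T : R) (k n j N : nat).

Lemma expfactD k x y :
  expfact k (x + y) = \sum_(i < k.+1) expfact i x * expfact (k - i) y.
Proof.
rewrite /expfact addrC exprDn mulr_suml; apply: eq_bigr => i _.
have ik : (i <= k)%N by rewrite -ltnS.
have F n : n`!%:R != 0 :> R by rewrite pnatr_eq0 -lt0n fact_gt0.
have := congr1 (fun n : nat => n%:R : R) (bin_fact ik); rewrite natrM natrM => <-.
have B : 'C(k, i)%:R != 0 :> R by rewrite pnatr_eq0 -lt0n bin_gt0.
by rewrite -mulr_natr; field; rewrite B !F.
Qed.

Lemma tayD k s x y : tay k s (x + y) = \sum_(i < k.+1) tay i s x * tay (k - i) s y.
Proof.
rewrite /tay expfactD rmorph_sum mulr_suml; apply: eq_bigr => i _.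
have -> : cexp (- s * (x + y)%:C%C) = cexp (- s * x%:C%C) * cexp (- s * y%:C%C).
  by rewrite -cexpD; congr cexp; rewrite rmorphD /=; ring.
by rewrite rmorphM /=; ring.
Qed.

Lemma tay_succ k s t : t%:C%C * tay k s t = k.+1%:R * tay k.+1 s t.
Proof.
have E : t * expfact k t = k.+1%:R * expfact k.+1 t.
  have F n : n`!%:R != 0 :> R by rewrite pnatr_eq0 -lt0n fact_gt0.
  have k0 : k.+1%:R != 0 :> R by rewrite pnatr_eq0.
  rewrite /expfact factS natrM exprS; move: (k.+1%:R) k0 (k`!%:R) (F k) => u u0 v v0.
  by field; rewrite u0 v0.
have EC : t%:C%C * (expfact k t)%:C%C = k.+1%:R * (expfact k.+1 t)%:C%C :> R[i].
  by rewrite -rmorphM E rmorphM /= rmorph_nat.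
by rewrite /tay mulrA EC mulrA.
Qed.

(** Up to the sign [(-1)^k], the [k]-th Taylor coefficient of [- zeta' / zeta] at [s]; expanding in
    [x] at [s - x] keeps the factors [t^k / k!] positive. *)
Definition pcoef k s : R[i] := xget 0 [set l |
  ccvg (fun N => wsum (@mangoldt R G) (tay k s) N.+1%:R) l].

Lemma sum_mangoldt_tay_le k s q T : 0 < q ->
  \sum_(d <- gle G T) cabs ((mangoldt d)%:C%C * tay k s (ln (bnorm d))) <=
  q^-1 ^+ k * \sum_(d <- gle G T) mangoldt d * expR (- (complex.Re s - q) * ln (bnorm d)).
Proof.
move=> q0; rewrite mulr_sumr; apply: ler_sum => d _.
rewrite cabsM cabs_real ger0_norm ?mangoldt_ge0// mulrCA ler_wpM2l ?mangoldt_ge0//.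
exact: tay_le (ln_bnorm_ge0 d) q0.
Qed.

Lemma sum_tay_le k s q T : 1 < complex.Re s - q -> 0 < q ->
  \sum_(d <- gle G T) cabs (tay k s (ln (bnorm d))) <=
  q^-1 ^+ k * complex.Re (Z G kappa (complex.Re s - q)%:C%C).
Proof.
move=> sq q0; apply: le_trans (ler_wpM2l _ (sum_norm_le hA T sq)); last first.
  by rewrite exprn_ge0// invr_ge0 ltW.
by rewrite mulr_sumr; apply: ler_sum => d _; exact: tay_le (ln_bnorm_ge0 d) q0.
Qed.

Lemma sum_mangoldt_tay_bounded k s : 1 < complex.Re s -> exists C, forall T,
  \sum_(d <- gle G T) cabs ((mangoldt d)%:C%C * tay k s (ln (bnorm d))) <= C.
Proof.
move=> s1; pose q := (complex.Re s - 1) / 2; have q0 : 0 < q by rewrite divr_gt0// subr_gt0.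
have [C HC] := mangoldt_sum_bounded hA q0.
exists (q^-1 ^+ k * C) => T; apply: le_trans (sum_mangoldt_tay_le k s T q0) _.
rewrite ler_wpM2l ?exprn_ge0 ?invr_ge0 ?(ltW q0)//.
by have -> : complex.Re s - q = 1 + q by rewrite /q; field.
Qed.

Lemma sum_tay_bounded k s : 1 < complex.Re s -> exists C, forall T,
  \sum_(d <- gle G T) cabs (tay k s (ln (bnorm d))) <= C.
Proof.
move=> s1; pose q := (complex.Re s - 1) / 2; have q0 : 0 < q by rewrite divr_gt0// subr_gt0.
have sq : 1 < complex.Re s - q by rewrite /q; lra.
by eexists => T; exact: sum_tay_le sq q0.
Qed.

Lemma pcoef_cvg k s : 1 < complex.Re s ->
  ccvg (fun N => wsum (@mangoldt R G) (tay k s) N.+1%:R) (pcoef k s).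
Proof.
move=> s1; have [C HC] := sum_mangoldt_tay_bounded k s1.
have [l cl _] := abs_ccvg HC.
by rewrite /pcoef; case: xgetP => [m _ //|/(_ l)/(_ cl)].
Qed.

(** The coefficient form of [f' = f p], obtained on the level of sums: multiplying [t^k / k!] by
    [t = log |g|] raises the index, [Lambda * 1 = log] resolves this logarithm into pairs, and the
    binomial theorem splits the weight at [log |h d|]. *)
Lemma pcoef_recursion k s : 1 < complex.Re s ->
  k.+1%:R * zcoef G kappa k.+1 s =
  \sum_(i < k.+1) zcoef G kappa i s * pcoef (k - i) s.
Proof.
move=> s1.
pose a i (h : G) := tay i s (ln (bnorm h)).
pose b j (d : G) := (mangoldt d)%:C%C * tay j s (ln (bnorm d)).
pose SA i T := \sum_(h <- gle G T) a i h; pose SB j T := \sum_(d <- gle G T) b j d.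
have cA i : ccvg (fun N => SA i N.+1%:R) (zcoef G kappa i s).
  apply: (@ccvg_ext _ _ _ _ 0%N _ (zcoef_cvg hA i s1)) => N _; exact: wsum_unit.
have cB j : ccvg (fun N => SB j N.+1%:R) (pcoef j s) by exact: pcoef_cvg.
have c1 := ccvg_sum (index_enum 'I_k.+1) (fun i : 'I_k.+1 => ccvgM (cA i) (cB (k - i)%N)).
apply: (ccvg_unique _ c1).
pose full T := \sum_(h <- gle G T) \sum_(d <- gle G T | bnorm (h * d)%g <= T)
  (mangoldt d)%:C%C * tay k s (ln (bnorm (h * d)%g)).
have fullE T : full T = k.+1%:R * SA k.+1 T.
  rewrite /full (sum_conv_mangoldt T (fun g => tay k s (ln (bnorm g)))) mulr_sumr.
  by apply: eq_bigr => g _; rewrite tay_succ.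
have fullS T : full T = \sum_(i < k.+1) \sum_(h <- gle G T)
    \sum_(d <- gle G T | bnorm (h * d)%g <= T) a i h * b (k - i)%N d.
  rewrite exchange_big; apply: eq_bigr => h _; rewrite exchange_big; apply: eq_bigr => d _.
  rewrite bnormM lnM ?posrE ?bnorm_gt0// tayD mulr_sumr; apply: eq_bigr => i _.
  by rewrite /a /b; ring.
have c2 : ccvg (fun N => full (N.+1%:R ^+ 2)) (k.+1%:R * zcoef G kappa k.+1 s).
  have h := ccvgZ k.+1%:R (cA k.+1); move=> e /h[N HN]; exists N => n Nn.
  have := HN ((n.+1 ^ 2).-1)%N; rewrite prednK ?expn_gt0// natrX -fullE; apply.
  apply: leq_trans Nn _; rewrite -ltnS prednK ?expn_gt0//.
  exact: (@leq_pexp2l n.+1 1 2).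
(* The pairs fill [|h d| <= N^2], whereas the product of partial sums fills a square; absolute
   convergence makes the difference negligible. *)
have diff i : ccvg (fun N => \sum_(h <- gle G (N.+1%:R ^+ 2))
    \sum_(d <- gle G (N.+1%:R ^+ 2) | bnorm (h * d)%g <= N.+1%:R ^+ 2) a i h * b (k - i)%N d -
    SA i N.+1%:R * SB (k - i)%N N.+1%:R) 0.
  have [Ca HCa] := sum_tay_bounded i s1; have [Cb HCb] := sum_mangoldt_tay_bounded (k - i) s1.
  have na (f : G -> R[i]) T : 0 <= \sum_(h <- gle G T) cabs (f h).
    by apply: sumr_ge0 => h _; exact: cabs_ge0.
  have Ca0 : 0 <= Ca by apply: le_trans (na (a i) 0) (HCa 0).
  have Cb0 : 0 <= Cb by apply: le_trans (na (b (k - i)%N) 0) (HCb 0).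
  move=> e e0; have C0 : 0 < 2 * (Ca + Cb + 1) by lra.
  have e1 := divr_gt0 e0 C0.
  have [Na HNa] := sum_gle_tail (fun h => cabs_ge0 (a i h)) HCa e1.
  have [Nb HNb] := sum_gle_tail (fun h => cabs_ge0 (b (k - i)%N h)) HCb e1.
  exists (maxn Na Nb) => N; rewrite geq_max => /andP[hNa hNb]; rewrite subr0.
  apply: le_trans (sum_pairs_diff _ _ erefl) _.
  have N1 : 1 <= N.+1%:R :> R by rewrite ler1n.
  have N2 : N.+1%:R <= N.+1%:R ^+ 2 :> R by rewrite expr2 ler_peMr// (le_trans ler01).
  have mono (f : G -> R[i]) M : (M <= N)%N -> \sum_(h <- gle G (N.+1%:R ^+ 2) | N.+1%:R < bnorm h) cabs (f h) <=
      \sum_(h <- gle G (N.+1%:R ^+ 2) | M%:R < bnorm h) cabs (f h).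
    move=> MN; rewrite big_mkcond [leRHS]big_mkcond; apply: ler_sum => h _.
    case: (ltP N.+1%:R (bnorm h)) => [hN|_]; last by case: ifP => // _; exact: cabs_ge0.
    by rewrite (le_lt_trans _ hN)// ler_nat (leq_trans MN).
  have le2 M : (M <= N)%N -> M%:R <= N.+1%:R ^+ 2 :> R.
    by move=> MN; apply: le_trans N2; rewrite ler_nat (leq_trans MN).
  have ta := le_trans (mono (a i) Na hNa) (HNa _ (le2 _ hNa)).
  have tb := le_trans (mono (b (k - i)%N) Nb hNb) (HNb _ (le2 _ hNb)).
  set X := e / _ in ta tb e1.
  have XE : X * (2 * (Ca + Cb + 1)) = e by rewrite /X divfK// gt_eqF.
  apply: (@le_trans _ _ (X * Cb + Ca * X)).
    have ga (f : G -> R[i]) T M : 0 <= \sum_(h <- gle G T | M%:R < bnorm h) cabs (f h).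
      by apply: sumr_ge0 => h _; exact: cabs_ge0.
    by apply: lerD; apply: ler_pM; rewrite ?na ?ga.
  by rewrite -XE; nra.
have c3 := ccvg_sum (index_enum 'I_k.+1) (fun i : 'I_k.+1 => diff i).
rewrite big1 // in c3; have := ccvgB c2 c3; rewrite subr0.
apply: (@ccvg_ext _ _ _ _ 0%N) => N _.
by rewrite sumrB -fullS; ring.
Qed.

(** The distance [Re s - 1] is shared: [q] pays for [t^k / k!], the rest feeds the Chebyshev
    bound. *)
Lemma pcoef_le : exists2 a0, 0 < a0 <= 1 & forall k s q, 0 < q ->
  0 < complex.Re s - 1 - q <= a0 ->
  cabs (pcoef k s) <= q^-1 ^+ k * (16 / (complex.Re s - 1 - q)).
Proof.
have [a0 a01 H] := mangoldt_sum_le hA; exists a0 => // k s q q0 sq.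
have s1 : 1 < complex.Re s by case/andP: sq; lra.
apply: (ccvg_bound (N := 0) (pcoef_cvg k s1)) => N _.
apply: le_trans (cabs_sum _ _ _) _; apply: le_trans (sum_mangoldt_tay_le k s _ q0) _.
rewrite ler_wpM2l ?exprn_ge0 ?invr_ge0 ?(ltW q0)//.
have := H _ N.+1%:R sq; have -> : 1 + (complex.Re s - 1 - q) = complex.Re s - q by ring.
exact.
Qed.

End LogDerivativeCoefficients.

(** * Zero-free half-plane *)

Section LineDerivative.
Variable R : realType.
Implicit Types (f : R[i] -> R[i]) (x t e : R) (z l : R[i]).

Lemma is_derive_eps (f : R -> R) (x l : R) : (forall e, 0 < e -> exists2 eta, 0 < eta &
    forall h, h != 0 -> `|h| < eta -> `|(f (h + x) - f x) / h - l| <= e) ->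
  is_derive x (1 : R) f l.
Proof.
move=> H; have cv : (fun h : R => h^-1 *: (f (h *: (1 : R) + x) - f x)) @ 0^' --> l.
  apply/cvgrPdist_le => e e0; have [eta eta0 He] := H e e0.
  rewrite /dnbhs; apply/nbhs_ballP; exists eta => // h /=.
  rewrite /ball /= sub0r normrN => hh h0; rewrite distrC [h *: 1]mulr1.
  by rewrite [_ *: _]mulrC; exact: He.
by apply: DeriveDef; [apply/cvg_ex; exists l|apply: cvg_lim].
Qed.

Lemma has_cderiv_line f x t l : has_cderiv f (Complex x t) l ->
  cderiv (fun y => f (Complex y t)) x l.
Proof.
move=> H.
have E e : 0 < e -> exists2 eta, 0 < eta & forall h, h != 0 -> `|h| < eta ->
    cabs ((f (Complex (h + x) t) - f (Complex x t)) * (h^-1)%:C%C - l) <= e.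
  move=> e0; have [eta eta0 He] := H e e0; exists eta => // h h0 hh.
  have hE : Complex (h + x) t - Complex x t = h%:C%C.
    by apply: complex_ext; rewrite ?ReB ?ImB /=; ring.
  have := He (Complex (h + x) t); rewrite hE cabs_real => /(_ hh) h1.
  have hC0 : h%:C%C != 0 :> R[i] by rewrite -cabs_eq0 cabs_real normr_eq0.
  have -> : (f (Complex (h + x) t) - f (Complex x t)) * (h^-1)%:C%C - l =
    (f (Complex (h + x) t) - f (Complex x t) - l * h%:C%C) * (h^-1)%:C%C.
    by rewrite fmorphV; field.
  by rewrite cabsM cabs_real normrV ?unitfE// ler_pdivrMr// normr_gt0.
split; apply: is_derive_eps => e e0; have [eta eta0 He] := E e e0; exists eta => // h h0 hh;
  have := He h h0 hh.
- by move=> /(le_trans (Re_le_cabs _)); rewrite ReB ReM /= mulr0 subr0 ReB.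
- by move=> /(le_trans (Im_le_cabs _)); rewrite ImB ImM /= mulr0 add0r ImB.
Qed.

Definition sqmod z : R := complex.Re z ^+ 2 + complex.Im z ^+ 2.

Lemma sqmodE z : sqmod z = cabs z ^+ 2.
Proof. by case: z => a b; rewrite /Normc.normc sqr_sqrtr// addr_ge0 ?sqr_ge0. Qed.

(** The squared modulus is differentiable also at zeros, so nonvanishing, which is yet to be proved,
    is not presupposed as it would be for [log |F|]. *)
Lemma is_derive_sqmod (F : R -> R[i]) x (p : R[i]) : cderiv F x (- p * F x) ->
  is_derive x (1 : R) (fun y => sqmod (F y)) (- 2 * complex.Re p * sqmod (F x)).
Proof.
move=> [dr di]; have := is_deriveD (is_deriveX 2 dr) (is_deriveX 2 di).
set H := (X in is_derive _ _ X _) => d.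
rewrite (_ : (fun _ => _) = H); last by apply/funext => y; rewrite /H !fctE.
apply: is_derive_eq d _; rewrite /GRing.scale /= /sqmod !(ReM, ImM, ReN, ImN); ring.
Qed.

End LineDerivative.

(** * The 3-4-1 inequality and nonvanishing for [Re s >= 1] *)

Section ThreeFourOne.
Variables (R : realType) (G : beurlingSystem R) (kappa A theta : R).
Hypothesis hA : axiomA G kappa A theta.
Implicit Types (s w z : R[i]) (g h d : G) (t q x y T : R) (k n j N : nat).

Let theta1 : theta < 1. Proof. by case: hA => _ _ /andP[]. Qed.

Local Notation Z := (@Z R G kappa).
Local Notation p0 := (@pcoef R G 0).

Lemma cderiv_Z_line x t : 1 < x -> cderiv (fun y => Z (Complex y t)) x
  (- p0 (Complex x t) * Z (Complex x t)).
Proof.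
move=> x1; have s1 : Complex x t != 1 by apply/eqP => -[e _]; move: x1; rewrite e ltxx.
have xt : theta < x := lt_trans theta1 x1.
have := has_cderiv_line (has_cderiv_Z hA (s := Complex x t) xt s1).
have := @pcoef_recursion _ _ _ _ _ hA 0 (Complex x t) x1.
by rewrite big_ord1 mul1r subn0 => -> ; rewrite mulNr mulrC.
Qed.

Lemma ccvg_Re_ge0 (u : nat -> R[i]) l : ccvg u l -> (forall n, 0 <= complex.Re (u n)) -> 0 <= complex.Re l.
Proof.
move=> cl hu; apply/ler_addgt0Pr => e e0; have [N /(_ N (leqnn N)) h] := cl e e0.
have := le_trans (Re_le_cabs _) h; rewrite ReB ler_norml => /andP[_ h2].
by have := hu N; lra.
Qed.

Lemma trig341 x : 0 <= 3 + 4 * cos x + cos (2 * x).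
Proof.
have -> : 2 * x = x *+ 2 by rewrite mulr_natl.
rewrite cosD; have := cos2Dsin2 x; have := sqr_ge0 (1 + cos x); rewrite !expr2; nra.
Qed.

Lemma pcoef341 x t : 1 < x ->
  0 <= 3 * complex.Re (p0 (Complex x 0)) + 4 * complex.Re (p0 (Complex x t)) +
    complex.Re (p0 (Complex x (2 * t))).
Proof.
move=> x1; have c y := @pcoef_cvg _ _ _ _ _ hA 0 (Complex x y) x1.
have L (r : R) z : complex.Re (r%:C%C * z) = r * complex.Re z by rewrite ReM /= mul0r subr0.
have := ccvg_Re_ge0 (ccvgD (ccvgD (ccvgZ 3%:C%C (c 0)) (ccvgZ 4%:C%C (c t))) (c (2 * t))).
rewrite !ReD !L; apply => N; rewrite !ReD !L /wsum !Re_sum !mulr_sumr -!big_split.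
apply: sumr_ge0 => g _.
have E y : complex.Re ((mangoldt g)%:C%C * tay 0 (Complex x y) (ln (bnorm g))) =
    mangoldt g * expR (- x * ln (bnorm g)) * cos (y * ln (bnorm g)).
  rewrite L tay0 /cexp /= !mulr0 subr0 add0r.
  by rewrite [X in cos X]mulNr cosN mulrA.
have m0 : 0 <= mangoldt g * expR (- x * ln (bnorm g)) by rewrite mulr_ge0 ?mangoldt_ge0 ?expR_ge0.
have := mulr_ge0 m0 (trig341 (t * ln (bnorm g))).
rewrite !E mul0r cos0 -[2 * t * _]mulrA; set a := _ * expR _.
by move: (cos (t * _)) (cos (2 * _)) => u v /=; lra.
Qed.

Definition prod341 t x : R :=
  sqmod (Z (Complex x 0)) ^+ 3 * sqmod (Z (Complex x t)) ^+ 4 * sqmod (Z (Complex x (2 * t))).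

(* Minus the logarithmic derivative is a sum weighted by [3 + 4 cos u + cos (2 u) >= 0]. *)
Lemma prod341_nincr t x y : 1 < x -> x <= y -> prod341 t y <= prod341 t x.
Proof.
move=> x1 xy.
pose D u := (3 * complex.Re (p0 (Complex u 0)) + 4 * complex.Re (p0 (Complex u t)) +
    complex.Re (p0 (Complex u (2 * t)))) * (- 2 * prod341 t u).
have [|c /andP[xc _]] := @prim_mvt _ D x y (prod341 t) xy.
  move=> u /andP[xu _]; have u1 := lt_le_trans x1 xu.
  have d v := is_derive_sqmod (cderiv_Z_line v u1).
  have := is_deriveM (is_deriveM (is_deriveX 3 (d 0)) (is_deriveX 4 (d t))) (d (2 * t)).
  set H := (X in is_derive _ _ X _) => dH.
  rewrite (_ : prod341 t = H); last by apply/funext => v; rewrite /H !fctE.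
  apply: is_derive_eq dH _; rewrite /D /prod341 /GRing.scale /= !fctE; ring.
move=> e; rewrite -subr_le0 e /D.
have := pcoef341 t (lt_le_trans x1 xc).
have : 0 <= prod341 t c.
  by rewrite /prod341 !sqmodE !mulr_ge0 ?exprn_ge0 ?cabs_ge0.
set a := _ + _; set b := prod341 t c => b0 a0.
have : 0 <= a * b * (y - x) by apply: mulr_ge0; [exact: mulr_ge0|rewrite subr_ge0].
lra.
Qed.

(** Only finitely many elements have norm at most 2, so the norms other than 1 stay away from 1. *)
Lemma norm_gap : exists2 L, 0 < L & forall g : G, g != 1%g -> L <= ln (bnorm g).
Proof.
have [L L0 HL] : exists2 L, 0 < L & forall g, g \in gle G 2 -> g != 1%g -> L <= ln (bnorm g).
  elim: (gle G 2) => [|h r [L L0 HL]]; first by exists 1.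
  have [h1|h1] := eqVneq h 1%g.
    by exists L => // g; rewrite inE => /orP[/eqP ->|/HL//]; rewrite h1 eqxx.
  exists (Num.min L (ln (bnorm h))); first by rewrite lt_min L0 ln_gt0// bnorm_gt1.
  by move=> g; rewrite inE ge_min => /orP[/eqP -> _|/HL H /H ->//]; rewrite lexx orbT.
exists (Num.min L (ln 2)); first by rewrite lt_min L0 ln_gt0// ltr1n.
move=> g g1; rewrite ge_min; have [g2|g2] := leP (bnorm g) 2.
  by rewrite HL// mem_gle.
by rewrite ler_ln ?posrE ?bnorm_gt0// (ltW g2) orbT.
Qed.

(** Far to the right the identity dominates: compared with their size at 2, the other terms shrink
    at least by [e^(- L (Re s - 2))], where [L] is the gap in [log |g|]. *)
Lemma Z_far_right : exists2 x1, 2 <= x1 & forall s, x1 <= complex.Re s -> 1 / 2 <= cabs (Z s).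
Proof.
have [L L0 HL] := norm_gap; pose C := `|complex.Re (Z 2%:C%C)| + 1.
have C0 : 0 < C by rewrite ltr_wpDl.
exists (2 + Num.max 0 (ln (2 * C) / L)); first by rewrite lerDl le_max lexx.
move=> s hs; have s2 : 2 <= complex.Re s by apply: le_trans hs; rewrite lerDl le_max lexx.
have sL : ln (2 * C) <= (complex.Re s - 2) * L.
  rewrite -ler_pdivrMr//.
  have : ln (2 * C) / L <= Num.max 0 (ln (2 * C) / L) by rewrite le_max lexx orbT.
  lra.
have s1 : 1 < complex.Re s by lra.
have h : cabs (Z s - 1) <= 1 / 2.
  apply: (ccvg_bound (N := 0) (ccvgB (zcoef_cvg hA 0 s1) (ccvg_cst 1))) => N _.
  have one : 1%g \in gle G N.+1%:R by rewrite mem_gle bnorm1 ler1n.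
  rewrite wsum_unit (bigD1_seq 1%g)//= ?uniq_gle// bnorm1 ln1 tay0 mulr0 cexp0 addrAC subrr add0r.
  apply: le_trans (cabs_sum _ _ _) _.
  apply: (@le_trans _ _ (\sum_(g <- gle G N.+1%:R) (2 * C)^-1 * expR (- 2 * ln (bnorm g)))).
    rewrite big_mkcond; apply: ler_sum => g _; case: ifP => g1; last first.
      by rewrite mulr_ge0 ?expR_ge0// invr_ge0 mulr_ge0// ltW.
    rewrite cabs_tay0.
    have -> : (2 * C)^-1 = expR (- ln (2 * C)) by rewrite expRN lnK// posrE mulr_gt0.
    rewrite -expRD ler_expR.
    have : (complex.Re s - 2) * L <= (complex.Re s - 2) * ln (bnorm g).
      by rewrite ler_wpM2l ?HL// subr_ge0.
    lra.
  rewrite -mulr_sumr invfM -mulrA div1r ler_piMr ?invr_ge0//.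
  rewrite ler_pdivrMl// mulr1.
  have two1 : 1 < 2 :> R by rewrite ltr1n.
  apply: le_trans (sum_norm_le hA N.+1%:R two1) _.
  by rewrite /C; have := ler_norm (complex.Re (Z 2%:C%C)); lra.
have := cabs_sub_lb 1 (1 - Z s); have -> : 1 - (1 - Z s) = Z s by ring.
by rewrite cabs1 cabsB; lra.
Qed.

(** Monotonicity carries the bound at [x1] down to [x] near 1; [3 + 4 + 1 = 8] squared moduli occur,
    each at least 1/4. *)
Lemma Z341 : exists x1, [/\ 2 <= x1, forall s, x1 <= complex.Re s -> 1 / 2 <= cabs (Z s) &
  forall x t, 1 < x <= x1 -> (1 / 4) ^+ 8 <= prod341 t x].
Proof.
have [x1 x12 H] := Z_far_right; exists x1; split=> // x t /andP[x0 xx].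
apply: le_trans (prod341_nincr t x0 xx); rewrite /prod341 !sqmodE.
have h v : 1 / 4 <= cabs (Z (Complex x1 v)) ^+ 2.
  have := H (Complex x1 v) (lexx _); rewrite expr2; nra.
have -> : (1 / 4) ^+ 8 = (1 / 4) ^+ 3 * (1 / 4) ^+ 4 * (1 / 4) :> R by field.
have q : 0 <= 1 / 4 :> R by lra.
have p v m : (1 / 4) ^+ m <= (cabs (Z (Complex x1 v)) ^+ 2) ^+ m.
  by apply: lerXn2r; rewrite ?nnegrE ?exprn_ge0 ?cabs_ge0.
by apply: ler_pM (h _); rewrite ?mulr_ge0 ?exprn_ge0//; apply: ler_pM (p _ _) (p _ _); rewrite exprn_ge0.
Qed.

Lemma cabs_Z_le s : 1 < complex.Re s -> cabs (Z s) <= complex.Re (Z (complex.Re s)%:C%C).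
Proof.
move=> s1; apply: (ccvg_bound (N := 0) (zcoef_cvg hA 0 s1)) => N _; rewrite wsum_unit.
apply: le_trans (cabs_sum _ _ _) _; under eq_bigr do rewrite cabs_tay0.
exact: (sum_norm_le hA _ s1).
Qed.

(** The 3-4-1 product is at most [(M |Z s|)^8], where [M] is the value at the real part and
    dominates the two companion values. Together with the simple pole this gives
    [|Z s| >= c (Re s - 1)] near the line. *)
Lemma Z_lower_bound : exists2 x1, 2 <= x1 & forall s, 1 < complex.Re s <= x1 ->
  1 / 4 <= complex.Re (Z (complex.Re s)%:C%C) * cabs (Z s).
Proof.
have [x1 [x12 _ H]] := Z341; exists x1 => // -[x t] /= xx.
have x0 : 1 < x by case/andP: xx.
have := H x t xx; rewrite /prod341 !sqmodE.
set M := complex.Re _; set a := cabs (Z (Complex x t)).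
have h0 : cabs (Z (Complex x 0)) <= M := @cabs_Z_le (Complex x 0) x0.
have h2 : cabs (Z (Complex x (2 * t))) <= M := @cabs_Z_le (Complex x (2 * t)) x0.
have M0 : 0 <= M := le_trans (cabs_ge0 _) h0.
have a0 : 0 <= a := cabs_ge0 _.
move=> h; rewrite -(@ler_pXn2r _ 8) ?nnegrE ?mulr_ge0//.
apply: le_trans h _; rewrite [leRHS](_ : _ = (M ^+ 2) ^+ 3 * (a ^+ 2) ^+ 4 * M ^+ 2); last by ring.
have p u m : 0 <= u <= M -> (u ^+ 2) ^+ m <= (M ^+ 2) ^+ m.
  move=> /andP[u0 uM].
  by do 2 (apply: lerXn2r; rewrite ?nnegrE ?exprn_ge0//).
apply: ler_pM; rewrite ?mulr_ge0 ?exprn_ge0 ?cabs_ge0//.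
  by rewrite ler_wpM2r ?exprn_ge0// p// cabs_ge0.
by have := p (cabs (Z (Complex x (2 * t)))) 1%N; rewrite !expr1 => ->//; rewrite cabs_ge0.
Qed.

Lemma Z_neq0_right s : 1 < complex.Re s -> Z s != 0.
Proof.
have [x1 [x12 H1 H2]] := Z341; case: s => x t /= s1; apply/eqP => Z0.
have [xx|xx] := leP x x1.
  have := H2 x t; rewrite s1 xx => /(_ isT).
  by rewrite /prod341 [sqmod (Z (Complex x t))]sqmodE Z0 cabs0 expr0n expr0n mulr0 mul0r leNgt exprn_gt0.
have := H1 (Complex x t) (ltW xx); rewrite Z0 cabs0; lra.
Qed.

(* |Z(1+h)|^3 |Z(1+h+it)|^4 |Z(1+h+2it)| would be O(h) at a zero 1 + it. *)
Lemma Z_neq0_line t : t != 0 -> Z (Complex 1 t) != 0.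
Proof.
move=> t0; apply/eqP => Z0; have [x1 [x12 _ H]] := Z341.
have th : theta < 1 by exact: theta1.
have s1 : Complex 1 t != 1 by apply/eqP => -[e]; move: t0; rewrite e eqxx.
have s2 : Complex 1 (2 * t) != 1.
  by apply/eqP => -[e]; move: t0; rewrite -(mulrI_eq0 t (x := 2)) ?e ?eqxx//; apply: mulfI.
have [l /(_ 1 ltr01)[e1 e10 He1]] := cdiff_Z hA (s := Complex 1 t) th s1.
have [e2 e20 He2] := cdiff_cont (cdiff_Z hA (s := Complex 1 (2 * t)) th s2) ltr01.
have [a0 /andP[a00 a01] Ha] := Z_real_near1 hA.
have [k0 _ _ _] := hA.
pose B := cabs l + 1; pose C := cabs (Z (Complex 1 (2 * t))) + 1.
have B0 : 0 < B by rewrite ltr_wpDl ?cabs_ge0.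
have C0 : 0 < C by rewrite ltr_wpDl ?cabs_ge0.
(* The product at [1 + h] is at most [(2 kappa / h)^6 (B h)^8 C^2], that is [(W - 1) h^2]. *)
pose W := (2 * kappa) ^+ 6 * B ^+ 8 * C ^+ 2 + 1.
have W0 : 0 < W by rewrite ltr_wpDl// !mulr_ge0 ?exprn_ge0 ?mulr_ge0 ?(ltW k0) ?(ltW B0) ?(ltW C0).
pose m := Num.min (Num.min a0 ((1 / 4) ^+ 8 / W)) (Num.min e1 e2).
have m0 : 0 < m by rewrite !lt_min a00 e10 e20 divr_gt0.
have [h [h0 hm]] : exists h : R, 0 < h /\ h < m.
  by exists (m / 2); rewrite divr_gt0// ltr_pdivrMr// ltr_pMr// ltr1n.
have : h < m := hm; rewrite !lt_min => /andP[/andP[ha hW] /andP[h1 h2]].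
have near u : Complex (1 + h) u - Complex 1 u = h%:C%C.
  by apply: complex_ext; rewrite ?ReB ?ImB /=; ring.
have q1 : cabs (Z (Complex (1 + h) t)) <= B * h.
  have := He1 (Complex (1 + h) t); rewrite near cabs_real gtr0_norm// => /(_ h1).
  rewrite Z0 subr0; have := cabs_sub_lb (Z (Complex (1 + h) t)) (l * h%:C%C).
  by rewrite cabsM cabs_real gtr0_norm// /B; lra.
have q2 : cabs (Z (Complex (1 + h) (2 * t))) <= C.
  have := He2 (Complex (1 + h) (2 * t)); rewrite near cabs_real gtr0_norm// => /(_ h2).
  by have := cabs_sub_lb (Z (Complex (1 + h) (2 * t))) (Z (Complex 1 (2 * t))); rewrite /C; lra.
have hh : 1 < 1 + h by lra.
have q3 : cabs (Z (Complex (1 + h) 0)) <= 2 * kappa / h.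
  apply: le_trans (@cabs_Z_le (Complex (1 + h) 0) hh) _.
  by have /andP[_] := Ha h ltac:(by apply/andP; split; lra).
have := H (1 + h) t; have -> : 1 < 1 + h <= x1 by apply/andP; split; lra.
move=> /(_ isT); rewrite leNgt => /negP; apply.
rewrite /prod341 !sqmodE.
apply: (@le_lt_trans _ _ (((2 * kappa / h) ^+ 2) ^+ 3 * ((B * h) ^+ 2) ^+ 4 * C ^+ 2)).
  have kh : 0 <= 2 * kappa / h by apply: divr_ge0; [apply: mulr_ge0 => //; exact: ltW|exact: ltW].
  have bh : 0 <= B * h by apply: mulr_ge0; exact: ltW.
  have p (u v : R) (r : nat) : 0 <= u <= v -> (u ^+ 2) ^+ r <= (v ^+ 2) ^+ r.
    move=> /andP[u0 uv]; have v0 := le_trans u0 uv.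
    by do 2 (apply: lerXn2r; rewrite ?nnegrE ?exprn_ge0//).
  apply: ler_pM; rewrite ?mulr_ge0 ?exprn_ge0 ?cabs_ge0//.
    apply: ler_pM; rewrite ?exprn_ge0 ?cabs_ge0//; apply: p; rewrite cabs_ge0//.
  by have := p (cabs (Z (Complex (1 + h) (2 * t)))) C 1%N; rewrite !expr1 => ->//; rewrite cabs_ge0.
have -> : ((2 * kappa / h) ^+ 2) ^+ 3 * ((B * h) ^+ 2) ^+ 4 * C ^+ 2 = (W - 1) * h ^+ 2.
  by rewrite /W; field; rewrite gt_eqF.
have hh1 : h ^+ 2 <= h by rewrite expr2 ler_piMr ?(ltW h0)//; lra.
apply: (@le_lt_trans _ _ (W * h)).
  apply: ler_pM; rewrite ?exprn_ge0 ?(ltW h0)//; last by lra.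
  by rewrite /W addrK !mulr_ge0 ?exprn_ge0 ?mulr_ge0 ?(ltW k0) ?(ltW B0) ?(ltW C0).
by move: hW; rewrite ltr_pdivlMr// mulrC.
Qed.

End ThreeFourOne.

(** * Zeros and omega *)

Section Zeros.
Variables (R : realType) (G : beurlingSystem R) (kappa A theta : R).
Hypothesis hA : axiomA G kappa A theta.
Implicit Types (s rho : R[i]) (t x y B T eta : R).

Let th0 : 0 < theta. Proof. by case: hA => _ _ /andP[]. Qed.
Let th1 : theta < 1. Proof. by case: hA => _ _ /andP[]. Qed.

Local Notation Z := (@Z R G kappa).
Local Notation zero := (zeta_zero G theta).

Lemma zero_Z rho : zero rho -> Z rho = 0.
Proof. by move=> [r1 r2 r3]; rewrite -(zetaE hA r1 r2). Qed.

Lemma zero_Re_gt rho : zero rho -> theta < complex.Re rho.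
Proof. by case. Qed.

Lemma zero_Re_lt1 rho : zero rho -> complex.Re rho < 1.
Proof.
move=> hz; have Z0 := zero_Z hz; case: hz => [_ r1 _]; rewrite ltNge le_eqVlt.
apply/negP => /orP[/eqP e|h]; last by move/eqP: Z0; rewrite (negbTE (Z_neq0_right hA h)).
case: rho e Z0 r1 => b t /= <- Z0 r1.
have t0 : t != 0 by apply: contraNneq r1 => ->.
by move/eqP: Z0; rewrite (negbTE (Z_neq0_line hA t0)).
Qed.

Lemma zero_ln_ge rho : zero rho -> ln theta <= ln (cabs rho).
Proof.
move=> hz; have h := zero_Re_gt hz; have r0 := lt_trans th0 h.
have hc : complex.Re rho <= cabs rho by apply: le_trans (Re_le_cabs rho); exact: ler_norm.
by rewrite ler_ln ?posrE ?(lt_le_trans r0 hc)// (le_trans (ltW h)).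
Qed.

(** For [t = 0] the pole keeps [Z] large near 1; elsewhere continuity keeps it near a nonzero
    value. *)
Lemma zero_far_from_line t : exists2 e : R, 0 < e &
  forall rho, zero rho -> e <= cabs (rho - Complex 1 t).
Proof.
have [->|t0] := eqVneq t 0.
  have [C C0 HC] := Z_bounded_near1 hA; have [k0 _ _ _] := hA.
  have C1 : 0 < C + 1 by lra.
  exists (Num.min ((1 - theta) / 4) (kappa / (C + 1))).
    by rewrite lt_min !divr_gt0// subr_gt0.
  move=> rho hz; rewrite leNgt; apply/negP; rewrite lt_min => /andP[h1 h2].
  have [_ r1 _] := hz; have := HC rho r1 h1.
  rewrite zero_Z// sub0r cabsN cabsM cabsV cabs_real gtr0_norm//.
  have r0 : 0 < cabs (rho - 1) by rewrite cabs_gt0 subr_eq0.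
  rewrite ler_pdivrMr//; move: h2; rewrite ltr_pdivlMr// => h2 h3.
  have : cabs (rho - Complex 1 0) = cabs (rho - 1) by [].
  by move=> e; rewrite e in h2; lra.
have s1 : Complex 1 t != 1 by apply/eqP => -[e]; move: t0; rewrite e eqxx.
have Z0 := Z_neq0_line hA t0; have z0 : 0 < cabs (Z (Complex 1 t)) / 2 by rewrite divr_gt0 ?cabs_gt0.
have [e e0 He] := cdiff_cont (cdiff_Z hA (s := Complex 1 t) th1 s1) z0.
exists e => // rho hz; rewrite leNgt; apply/negP => /He.
by rewrite zero_Z// sub0r cabsN; lra.
Qed.

(** Compactness as a supremum argument: if a gap exists up to heights near the supremum, the local
    gap at that height extends it slightly beyond, so [B] is reached. *)
Lemma zero_gap B : exists2 eta, 0 < eta & forall rho, zero rho ->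
  `|complex.Im rho| <= B -> eta <= 1 - complex.Re rho.
Proof.
pose S : set R := [set T | T <= B /\ exists2 eta, 0 < eta & forall rho, zero rho ->
  - B <= complex.Im rho <= T -> eta <= 1 - complex.Re rho].
have [B0|B0] := ltP B 0.
  by exists 1 => // rho _ h; have := le_trans (normr_ge0 _) h; lra.
have S0 : S (- B - 1) by split; [lra|exists 1 => // rho _ /andP[]; lra].
have hS : has_sup S by split; [exists (- B - 1)|exists B => T []].
have [e e0 He] := zero_far_from_line (sup S).
have e2 : 0 < e / 2 by rewrite divr_gt0.
have [T [TB [eta eta0 HT]] hT] := sup_adherent e2 hS.
pose U := Num.min B (sup S + e / 4).
have SU : S U.
  split; first by rewrite /U ge_min lexx.
  exists (Num.min eta (e / 4)); first by rewrite lt_min eta0 divr_gt0.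
  move=> rho hz /andP[h1 h2]; rewrite ge_min.
  have [iT|iT] := leP (complex.Im rho) T; first by rewrite HT// h1.
  apply/orP; right; have r1 := zero_Re_lt1 hz; rewrite leNgt; apply/negP => h3.
  have := He rho hz; rewrite leNgt => /negP; apply.
  apply: le_lt_trans (cabs_le_ReIm _) _; rewrite ReB ImB /=.
  have i1 : `|complex.Im rho - sup S| <= e / 2.
    move: h2; rewrite /U le_min => /andP[_ h2]; rewrite ler_norml; apply/andP; split; lra.
  have i2 : `|complex.Re rho - 1| <= e / 4 by rewrite ler_norml; apply/andP; split; lra.
  lra.
have SB : S B.
  have : U <= sup S by apply: ub_le_sup => //; case: hS.
  rewrite /U ge_min => /orP[h|]; last by have := e2; lra.
  by move: SU; rewrite /U (min_idPl _)//; lra.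
have [_ [eta' eta'0 H]] := SB; exists eta' => // rho hz; rewrite ler_norml => h.
exact: H.
Qed.

Definition phi rho u : R := (1 - complex.Re rho) * u + ln (cabs rho).

Let Phi x : set R := [set phi rho (ln x) | rho in [set rho | zero rho]].

Lemma phi_ge rho u : 0 <= u -> zero rho -> ln theta <= phi rho u.
Proof.
move=> u0 hz; have := zero_ln_ge hz; have := zero_Re_lt1 hz; rewrite /phi => h1 h2.
have : 0 <= (1 - complex.Re rho) * u by rewrite mulr_ge0// subr_ge0 ltW.
lra.
Qed.

Hypothesis htheta0 : theta0 G theta = 1.

Lemma zero_near_line eta : 0 < eta -> exists2 rho, zero rho & 1 - eta < complex.Re rho.
Proof.
move=> eta0; move: htheta0; rewrite /theta0; set S := [set beta | _] => hmax.
have S1 : sup S = 1.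
  by move: hmax; rewrite maxEle; case: ifP => // _ e; move: th1; rewrite e ltxx.
have hS : has_sup S.
  split; last by exists 1 => b [g /andP[_ /ltW]].
  (* An empty set would have the default supremum 0, not 1. *)
  have [S0|/set0P//] := eqVneq S set0; move: S1; rewrite S0 sup0 => /eqP.
  by rewrite eq_sym oner_eq0.
have [b [g _ hz] hb] := sup_adherent eta0 hS.
by exists (Complex b g) => //=; rewrite -S1.
Qed.

Lemma has_inf_Phi x : 1 <= x -> has_inf (Phi x).
Proof.
move=> x1; split.
  by have [rho hz _] := zero_near_line ltr01; exists (phi rho (ln x)); exists rho.
by exists (ln theta) => _ [rho hz <-]; apply: phi_ge; rewrite ?ln_ge0.
Qed.

Lemma omega_le x rho : 1 <= x -> zero rho -> omega G theta x <= phi rho (ln x).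
Proof.
by move=> x1 hz; apply: ge_inf; [case: (has_inf_Phi x1)|exists rho].
Qed.

Lemma omega_attained x : 1 <= x -> exists2 rho, zero rho & phi rho (ln x) <= omega G theta x + 1.
Proof.
move=> x1; have [_ [rho hz <-] h] := inf_adherent ltr01 (has_inf_Phi x1).
by exists rho => //; exact: ltW.
Qed.

(* [omega] is an infimum of affine functions of [ln x]. *)
Lemma omega_concave x y : 1 < x -> 1 <= y <= x ->
  ln y / ln x * omega G theta x + (1 - ln y / ln x) * ln theta <= omega G theta y.
Proof.
move=> x1 /andP[y1 yx]; have lx : 0 < ln x by rewrite ln_gt0.
apply: lb_le_inf; first by case: (has_inf_Phi y1).
move=> _ [rho hz <-]; have h := omega_le (ltW x1) hz.
pose r := ln y / ln x; have r0 : 0 <= r by apply: divr_ge0; [exact: ln_ge0|exact: ltW].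
have r1 : r <= 1.
  by rewrite ler_pdivrMr// mul1r ler_ln ?posrE ?(lt_le_trans ltr01)// ltW// (lt_trans ltr01).
have yE : ln y = r * ln x by rewrite /r divfK// gt_eqF.
have -> : (1 - complex.Re rho) * ln y + ln (cabs rho) =
    r * phi rho (ln x) + (1 - r) * ln (cabs rho) by rewrite /phi yE; ring.
rewrite -/r; apply: lerD; first by rewrite ler_wpM2l.
by rewrite ler_wpM2l ?subr_ge0// zero_ln_ge.
Qed.

(** A single zero close enough to the line suffices, and [theta0 = 1] provides it. This is what
    makes [delta = K W / U] tend to 0. *)
Lemma omega_small eta : 0 < eta -> exists x0, forall x, x0 < x -> omega G theta x <= eta * ln x.
Proof.
move=> eta0; have e2 : 0 < eta / 2 by rewrite divr_gt0.
have [rho hz hr] := zero_near_line e2.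
exists (Num.max 1 (expR (ln (cabs rho) / (eta / 2)))) => x; rewrite gt_max => /andP[x1 hx].
have x0 : 0 < x := lt_trans ltr01 x1.
apply: le_trans (omega_le (ltW x1) hz) _; rewrite /phi.
have lx : 0 <= ln x by rewrite ln_ge0// ltW.
have : ln (cabs rho) <= ln x * (eta / 2).
  by rewrite -ler_pdivrMr// -[leLHS]expRK ler_ln ?posrE ?expR_gt0// ltW.
have : (1 - complex.Re rho) * ln x <= eta / 2 * ln x by rewrite ler_wpM2r//; lra.
lra.
Qed.

(** Zeros of bounded height stay away from the line, so their terms grow with [ln x]; the others
    have large [ln |rho|]. *)
Lemma omega_large B : exists x0, forall x, x0 < x -> B <= omega G theta x.
Proof.
have [eta eta0 H] := zero_gap (expR B).
exists (Num.max 1 (expR ((B - ln theta) / eta))) => x; rewrite gt_max => /andP[x1 hx].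
have x0 : 0 < x := lt_trans ltr01 x1.
have lx : 0 <= ln x by rewrite ln_ge0// ltW.
apply: lb_le_inf; first by case: (has_inf_Phi (ltW x1)).
move=> _ [rho hz <-]; have r1 := zero_Re_lt1 hz.
have p0 : 0 <= (1 - complex.Re rho) * ln x by rewrite mulr_ge0// subr_ge0 ltW.
have [h|h] := leP `|complex.Im rho| (expR B).
  have := H rho hz h; have := zero_ln_ge hz => h1 h2.
  have : (B - ln theta) <= ln x * eta.
    by rewrite -ler_pdivrMr// -[leLHS]expRK ler_ln ?posrE ?expR_gt0// ltW.
  have : eta * ln x <= (1 - complex.Re rho) * ln x by rewrite ler_wpM2r.
  lra.
have : B <= ln (cabs rho).
  have hh := lt_le_trans h (Im_le_cabs rho).
  by rewrite -[B]expRK ler_ln ?posrE ?expR_gt0 ?(lt_trans (expR_gt0 B))// ltW.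
lra.
Qed.

End Zeros.

(** * Coefficients of the logarithmic derivative *)

Section Window.
Variables (R : realType) (G : beurlingSystem R) (kappa A theta : R).
Hypothesis hA : axiomA G kappa A theta.
Implicit Types (s : R[i]) (g : G) (a b t q x del eta tau T : R) (n m j : nat).

Local Notation mg := (@mangoldt R G).

Lemma psi_wcount x : psi G x = wcount mg x.
Proof. by rewrite /psi fsbig_finite//; exact: bnorm_finite. Qed.

Lemma Delta_step n : Delta G n.+1%:R - Delta G n%:R = wcount mg n.+1%:R - wcount mg n%:R - 1.
Proof. by rewrite /Delta !psi_wcount -natr1; ring. Qed.

Lemma inv1D_le a : 0 <= a -> (1 + a)^-1 <= expR (- (a - a ^+ 2)).
Proof.
move=> a0; have p : 0 < 1 + a by lra.
rewrite -(ler_pM2l p) divff ?gt_eqF//.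
have h := ler_wpM2l (ltW p) (expR_ge1Dx (- (a - a ^+ 2))).
apply: le_trans h; have : 0 <= a ^+ 3 by rewrite exprn_ge0.
by rewrite !exprS expr0; nra.
Qed.

Lemma inv1B_le a : 0 <= a <= 1 / 2 -> (1 - a)^-1 <= expR (a + 2 * a ^+ 2).
Proof.
move=> /andP[a0 a1]; have p : 0 < 1 - a by lra.
rewrite -(ler_pM2l p) divff ?gt_eqF//.
have h := ler_wpM2l (ltW p) (expR_ge1Dx (a + 2 * a ^+ 2)).
apply: le_trans h; have : 0 <= a ^+ 2 * (1 - 2 * a) by rewrite mulr_ge0 ?sqr_ge0//; lra.
by rewrite !exprS expr0; nra.
Qed.

Lemma invX_expR a c (k : R) j : 0 <= a -> a <= expR k -> c = k * j%:R -> a ^+ j <= expR c.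
Proof.
move=> a0 h ->; rewrite expRM_natr.
by apply: lerXn2r; rewrite ?nnegrE ?expR_ge0.
Qed.

(** Chernoff bounds for [t^j / j! e^(- delta t)] on [t <= x] and, for [ehigh], on [t >= x], with
    tilts [q = delta (1 + a)] and [q = delta (1 - a)]. A rate [a^2 delta] is held back so that the
    remaining sum is covered by the Chebyshev bound. *)
Definition elow j del a x : R := del^-1 ^+ j * expR ((a + a ^+ 2) * del * x - (a - a ^+ 2) * j%:R).
Definition ehigh j del a x : R := del^-1 ^+ j * expR ((a + 2 * a ^+ 2) * j%:R - (a - a ^+ 2) * del * x).

Lemma elow_ge0 j del a x : 0 < del -> 0 <= elow j del a x.
Proof. by move=> d0; rewrite mulr_ge0 ?expR_ge0// exprn_ge0// invr_ge0 ltW. Qed.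

Lemma ehigh_ge0 j del a x : 0 < del -> 0 <= ehigh j del a x.
Proof. by move=> d0; rewrite mulr_ge0 ?expR_ge0// exprn_ge0// invr_ge0 ltW. Qed.

Lemma elowE j del a x : 0 < del -> 0 <= a ->
  (del * (1 + a))^-1 ^+ j * expR ((a + a ^+ 2) * del * x) <= elow j del a x.
Proof.
move=> d0 a0; rewrite /elow invfM exprMn -[leLHS]mulrA ler_wpM2l ?exprn_ge0 ?invr_ge0 ?(ltW d0)//.
rewrite expRD mulrC ler_wpM2l ?expR_ge0//.
apply: (invX_expR (k := - (a - a ^+ 2))); last by ring.
  by rewrite invr_ge0; lra.
exact: inv1D_le.
Qed.

Lemma ehighE j del a x : 0 < del -> 0 <= a <= 1 / 2 ->
  (del * (1 - a))^-1 ^+ j * expR (- (a - a ^+ 2) * del * x) <= ehigh j del a x.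
Proof.
move=> d0 /andP[a0 a1]; rewrite /ehigh invfM exprMn -[leLHS]mulrA ler_wpM2l ?exprn_ge0 ?invr_ge0 ?(ltW d0)//.
rewrite expRD !mulNr ler_wpM2r ?expR_ge0//.
apply: (invX_expR (k := a + 2 * a ^+ 2)) => //.
  by rewrite invr_ge0; lra.
by apply: inv1B_le; rewrite a0.
Qed.

(** After tilting, each weight is a common factor times [e^(- (1 + a^2 delta) t)], and the Chebyshev
    bound at [al = a^2 delta] gives [16 / (a^2 delta)]. *)
Lemma low_sum : exists2 a0, 0 < a0 <= 1 & forall j s del a T T' ,
  complex.Re s = 1 + del -> 0 < del <= a0 -> 0 < a <= 1 / 2 -> 1 <= T ->
  cabs (wsum mg (tay j s) T) <= 16 / (a ^+ 2 * del) * elow j del a (ln T) /\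
  cabs (\sum_(g <- gle G T' | T < bnorm g) (mg g)%:C%C * tay j s (ln (bnorm g))) <=
    16 / (a ^+ 2 * del) * ehigh j del a (ln T).
Proof.
have [a0 /andP[a00 a01] H] := mangoldt_sum_le hA; exists a0; rewrite ?a00//.
move=> j s del a T T' sE /andP[d0 da] /andP[ap a1] T1.
have T0 : 0 < T := lt_le_trans ltr01 T1.
have b0 : 0 < a ^+ 2 * del by rewrite mulr_gt0// exprn_gt0.
have b1 : a ^+ 2 * del <= a0.
  apply: le_trans da; rewrite -[leRHS]mul1r ler_wpM2r ?(ltW d0)// exprn_ile1// ?(ltW ap)//; lra.
have HB T2 := H (a ^+ 2 * del) T2; rewrite b0 b1 in HB.
split.
- apply: le_trans (cabs_sum _ _ _) _; rewrite mulrC.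
  apply: le_trans (_ : elow j del a (ln T) * \sum_(g <- gle G T) mg g * expR (- (1 + a ^+ 2 * del) * ln (bnorm g)) <= _); last first.
    by rewrite ler_wpM2l ?elow_ge0 ?HB.
  rewrite mulr_sumr big_seq_cond [leRHS]big_seq_cond; apply: ler_sum => g /andP[]; rewrite mem_gle => gT _.
  rewrite cabsM cabs_real ger0_norm ?mangoldt_ge0// mulrCA ler_wpM2l ?mangoldt_ge0//.
  have dq : 0 < del * (1 + a) by rewrite mulr_gt0//; lra.
  apply: le_trans (tay_le j s (ln_bnorm_ge0 g) dq) _.
  apply: (@le_trans _ _ ((del * (1 + a))^-1 ^+ j * expR ((a + a ^+ 2) * del * ln T) *
    expR (- (1 + a ^+ 2 * del) * ln (bnorm g)))).
    2: by rewrite ler_wpM2r ?expR_ge0// elowE// ltW.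
  rewrite -[leRHS]mulrA -expRD ler_wpM2l ?exprn_ge0 ?invr_ge0 ?(ltW dq)// ler_expR sE.
  have lT : ln (bnorm g) <= ln T by rewrite ler_ln ?posrE ?bnorm_gt0.
  have c0 : 0 <= (a + a ^+ 2) * del by rewrite mulr_ge0 ?addr_ge0 ?sqr_ge0// ltW.
  have := ler_wpM2l c0 lT; lra.
- apply: le_trans (cabs_sum _ _ _) _; rewrite mulrC.
  apply: le_trans (_ : ehigh j del a (ln T) * \sum_(g <- gle G T') mg g * expR (- (1 + a ^+ 2 * del) * ln (bnorm g)) <= _); last first.
    by rewrite ler_wpM2l ?ehigh_ge0 ?HB.
  rewrite mulr_sumr big_mkcond; apply: ler_sum => g _.
  case: ifP => gT; last by rewrite mulr_ge0 ?ehigh_ge0 ?mulr_ge0 ?mangoldt_ge0 ?expR_ge0.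
  rewrite cabsM cabs_real ger0_norm ?mangoldt_ge0// mulrCA ler_wpM2l ?mangoldt_ge0//.
  have dq : 0 < del * (1 - a) by rewrite mulr_gt0//; lra.
  apply: le_trans (tay_le j s (ln_bnorm_ge0 g) dq) _.
  apply: (@le_trans _ _ ((del * (1 - a))^-1 ^+ j * expR (- (a - a ^+ 2) * del * ln T) *
    expR (- (1 + a ^+ 2 * del) * ln (bnorm g)))).
    2: by rewrite ler_wpM2r ?expR_ge0// ehighE// (ltW ap).
  rewrite -[leRHS]mulrA -expRD ler_wpM2l ?exprn_ge0 ?invr_ge0 ?(ltW dq)// ler_expR sE.
  have lT : ln T <= ln (bnorm g) by rewrite ler_ln ?posrE ?bnorm_gt0// ltW.
  have c0 : 0 <= (a - a ^+ 2) * del by rewrite mulr_ge0 ?(ltW d0)//; nra.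
  have := ler_wpM2l c0 lT; lra.
Qed.

Lemma prim_sum_le j t x : 0 < t <= 1 -> 1 <= x ->
  \sum_(i < j.+1) t^-1 ^+ i * x^-1 ^+ (j.+1 - i) <= j.+1%:R * t^-1 ^+ j.
Proof.
move=> /andP[t0 t1] x1; have x0 : 0 < x := lt_le_trans ltr01 x1.
have h1 : x^-1 <= 1 by rewrite invf_le1.
have h2 : 1 <= t^-1 by rewrite invf_ge1.
apply: le_trans (_ : \sum_(i < j.+1) t^-1 ^+ j <= _).
  apply: ler_sum => i _; rewrite -[leRHS]mulr1; apply: ler_pM; rewrite ?exprn_ge0 ?invr_ge0 ?(ltW x0) ?(ltW t0)//.
    by rewrite ler_weXn2l// -ltnS.
  by rewrite exprn_ile1// invr_ge0 ltW.
by rewrite sumr_const card_ord mulr_natl.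
Qed.

(** The boundary values of [tay_prim] obey the same two Chernoff bounds, so they merge with the
    tails. *)
Lemma prim_edge j s del a x : complex.Re s = 1 + del -> 0 < del <= 1 / 2 -> 0 < a <= 1 / 2 ->
  1 <= cabs (s - 1) -> 0 <= x ->
  cabs (tay_prim j s x) <= j.+1%:R * elow j del a x /\
  cabs (tay_prim j s x) <= j.+1%:R * ehigh j del a x.
Proof.
move=> sE /andP[d0 d1] /andP[a0 a1] s1 x0.
have sn1 : s != 1 by rewrite -subr_eq0 -cabs_eq0 gt_eqF// (lt_le_trans ltr01).
have a2 : 0 < a ^+ 2 by rewrite exprn_gt0.
have a3 : 0 <= a ^+ 2 * del * x by rewrite mulr_ge0// mulr_ge0// ltW.
split.
- have t01 : 0 < del * (1 + a) <= 1 by apply/andP; split; nra.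
  have [t0 _] := andP t01.
  apply: le_trans (tay_prim_le j sn1 x0 t0) _.
  apply: le_trans (ler_wpM2r (expR_ge0 _) (prim_sum_le j t01 s1)) _; rewrite -mulrA.
  rewrite ler_wpM2l ?ler0n//; apply: le_trans (elowE _ _ d0 (ltW a0)).
  rewrite ler_wpM2l ?exprn_ge0 ?invr_ge0 ?(ltW t0)// ler_expR sE; lra.
- have t01 : 0 < del * (1 - a) <= 1 by apply/andP; split; nra.
  have [t0 _] := andP t01.
  apply: le_trans (tay_prim_le j sn1 x0 t0) _.
  apply: le_trans (ler_wpM2r (expR_ge0 _) (prim_sum_le j t01 s1)) _; rewrite -mulrA.
  have ah : 0 <= a <= 1 / 2 by rewrite a1 ltW.
  rewrite ler_wpM2l ?ler0n//; apply: le_trans (ehighE _ _ d0 ah).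
  rewrite ler_wpM2l ?exprn_ge0 ?invr_ge0 ?(ltW t0)// ler_expR sE; lra.
Qed.

(** Summation by parts for [mangoldt] with density 1 and discrepancy [Delta]. The tilt
    [delta (1 - tau)] costs [(1 - tau)^(- j)] and leaves the rate [delta tau], which makes the sum
    over blocks converge. *)
Lemma window_sum j s del tau eta n1 n2 : complex.Re s = 1 + del -> 0 < del <= 1 -> 0 < tau < 1 ->
  s != 1 -> (0 < n1 <= n2)%N -> 1 <= eta * n1%:R ->
  (forall n, (n1 <= n <= n2)%N -> `|Delta G n%:R| <= eta * n%:R) ->
  cabs (\sum_(n1 <= i < n2) blk mg 1 (fun n => Delta G n%:R) (tay j s) (tay_prim j s) i) <=
  18 * (eta * (cabs s + 1) * (1 + (del * tau)^-1) * (del * (1 - tau))^-1 ^+ j).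
Proof.
move=> sE /andP[d0 d1] /andP[t0 t1] s1 /andP[n10 n12] en1 hD.
have eta0 : 0 < eta.
  by rewrite -(pmulr_lgt0 (x := n1%:R)) ?ltr0n// (lt_le_trans ltr01).
have dt0 : 0 < del * (1 - tau) by rewrite mulr_gt0//; lra.
have dtau0 : 0 < del * tau by rewrite mulr_gt0.
pose t := del * (1 - tau); pose X := (del * (1 - tau))^-1 ^+ j.
have X0 : 0 <= X by rewrite exprn_ge0// invr_ge0 ltW.
pose c := 18 * (eta * (cabs s + 1) * X).
have c0 : 0 <= c by rewrite !mulr_ge0 ?(ltW eta0) ?addr_ge0 ?cabs_ge0.
apply: (@le_trans _ _ (\sum_(n1 <= i < n2) c * (i%:R^-1 * expR (- (del * tau) * ln i%:R)))).
  apply: le_trans (cabs_sum _ _ _) _; rewrite big_nat_cond [leRHS]big_nat_cond.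
  apply: ler_sum => n; rewrite andbT => /andP[nn1 nn2].
  have n0 : (0 < n)%N := leq_trans n10 nn1.
  have nR : 0 < n%:R :> R by rewrite ltr0n.
  have lnn : 0 <= ln (n%:R : R) by rewrite ln_ge0// ler1n.
  pose B := (cabs s + t) * t^-1 ^+ j * expR (- (complex.Re s - t) * ln n%:R).
  have HB x : ln n%:R <= x <= ln n.+1%:R -> cderiv (tay j s) x (tay_der j s x) /\ cabs (tay_der j s x) <= B.
    move=> /andP[x1 x2]; split; first exact: cderiv_tay.
    apply: le_trans (tay_der_le j s (le_trans lnn x1) dt0) _.
    have tt : 0 <= cabs s + t by rewrite addr_ge0 ?cabs_ge0 ?(ltW dt0).
    rewrite ler_wpM2l ?(mulr_ge0 tt)// ler_expR !mulNr lerN2 ler_wpM2l//.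
    by rewrite sE (_ : 1 + del - t = 1 + del * tau) ?addr_ge0 ?(ltW dtau0)// /t; ring.
  apply: le_trans (blk_bound _ n0 (@mangoldt_ge0 _ _) ler01 HB _) _.
    by move=> x _; apply: cderiv_tay_prim.
  have e1 : 1 <= eta * n%:R by apply: le_trans en1 _; rewrite ler_pM2l// ler_nat.
  have D1 := hD n; have D2 := hD n.+1; rewrite nn1 (ltnW nn2) in D1; rewrite (leq_trans nn1)//= nn2 in D2.
  have {}D1 := D1 isT; have {}D2 := D2 isT.
  (* The jump of [psi] is at most [|Delta n| + |Delta (n+1)| + 1], so the whole weight is at most
     [4 eta n + 5], and [1 <= eta n] turns this into [9 eta n]. *)
  have wB : wcount mg n.+1%:R - wcount mg n%:R + 4 * 1 + `|Delta G n%:R| <= 9 * (eta * n%:R).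
    have D2' : `|Delta G n.+1%:R| <= eta * n%:R + eta by apply: le_trans D2 _; rewrite -natr1 mulrDr mulr1.
    have en : eta <= eta * n%:R by rewrite ler_peMr ?(ltW eta0)// ler1n.
    have := Delta_step n; move: D1 D2' en e1.
    generalize (Delta G n%:R) (Delta G n.+1%:R) (wcount mg n%:R) (wcount mg n.+1%:R) (eta * n%:R).
    move=> u u' w w' en h1 h2 h3 h4 h5.
    have : u' <= `|u'| by exact: ler_norm.
    have : - u <= `|u| by rewrite -normrN ler_norm.
    lra.
  have tt : cabs s + t <= cabs s + 1.
    rewrite lerD2l -[leRHS]mul1r /t; apply: ler_pM; lra.
  have B0 : 0 <= B by rewrite !mulr_ge0 ?expR_ge0 ?addr_ge0 ?cabs_ge0 ?(ltW dt0).
  apply: le_trans (ler_wpM2r _ wB) _; first by rewrite divr_ge0 ?(ltW nR)// mulr_ge0.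
  have -> : 9 * (eta * n%:R) * (2 * B / n%:R) = 18 * eta * B by field; rewrite gt_eqF.
  have -> : n%:R^-1 * expR (- (del * tau) * ln n%:R) = expR (- (complex.Re s - t) * ln n%:R) :> R.
    rewrite -[n%:R in LHS](@lnK R) ?posrE// -expRN -expRD lnK ?posrE//; congr expR; rewrite sE /t; ring.
  have -> : 18 * eta * B = 18 * (eta * ((cabs s + t) * X)) * expR (- (complex.Re s - t) * ln n%:R).
    by rewrite /B /X -/t; ring.
  rewrite ler_wpM2r ?expR_ge0// /c ler_wpM2l//.
  by have := ler_wpM2l (ltW eta0) (ler_wpM2r X0 tt); rewrite !mulrA.
rewrite -mulr_sumr.
have -> : 18 * (eta * (cabs s + 1) * (1 + (del * tau)^-1) * (del * (1 - tau))^-1 ^+ j) =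
   c * (1 + (del * tau)^-1) by rewrite /c /X; ring.
rewrite ler_wpM2l//; apply: le_trans (sum_inv_mul_expln_le n2 dtau0).
rewrite -(prednK n10) big_add1.
rewrite [leRHS](big_cat_nat (n := n1.-1))//=; last by rewrite (leq_trans (leq_pred _)).
rewrite addrC; apply: ler_wpDr.
  by apply: sumr_ge0 => i _; rewrite mulr_ge0 ?expR_ge0.
case: n2 n12 {hD} => [|n2] n12; first by rewrite big_geq// big_geq.
rewrite [leRHS]big_nat_recr /=; last by rewrite -ltnS prednK.
by rewrite lerDl mulr_ge0 ?expR_ge0.
Qed.

(** The sum for [p_j] is cut at [n1] and [n2]: two Chernoff tails, and Abel summation in between.
    The constant 20 is 18 for the blocks plus one for each of the two boundary terms in [Delta]. *)
Lemma pcoef_window : exists2 a0, 0 < a0 <= 1 / 2 & forall j s del a tau eta n1 n2,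
  complex.Re s = 1 + del -> 0 < del <= a0 -> 1 <= cabs (s - 1) -> 0 < a <= 1 / 2 -> 0 < tau < 1 ->
  (0 < n1 <= n2)%N -> 1 <= eta * n1%:R ->
  (forall n, (n1 <= n <= n2)%N -> `|Delta G n%:R| <= eta * n%:R) ->
  cabs (pcoef G j s) <=
    (j.+1%:R + 16 / (a ^+ 2 * del)) * (elow j del a (ln n1%:R) + ehigh j del a (ln n2%:R)) +
    20 * (eta * (cabs s + 1) * (1 + (del * tau)^-1) * (del * (1 - tau))^-1 ^+ j).
Proof.
have [a0 /andP[a00 a01] H] := low_sum; exists (Num.min a0 (1 / 2)).
  by rewrite lt_min a00 ge_min lexx orbT andbT; lra.
move=> j s del a tau eta n1 n2 sE; rewrite le_min => /andP[d0 /andP[da d1]] s1 aa tt nn en hD.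
have sn1 : s != 1 by rewrite -subr_eq0 -cabs_eq0 gt_eqF// (lt_le_trans ltr01).
have [n10 n12] := andP nn; have n20 := leq_trans n10 n12.
have Re1 : 1 < complex.Re s by rewrite sE; lra.
apply: (ccvg_bound (N := n2) (pcoef_cvg hA j Re1)) => N nN.
have n2N : n2%:R <= N.+1%:R :> R by rewrite ler_nat (leq_trans nN).
have n1R : 1 <= n1%:R :> R by rewrite ler1n.
have n2R : 1 <= n2%:R :> R by rewrite ler1n.
have d0a : 0 < del <= a0 by rewrite d0.
have d0h : 0 < del <= 1 / 2 by rewrite d0.
have [hl _] := H j s del a n1%:R 0 sE d0a aa n1R.
have [_ hh] := H j s del a n2%:R N.+1%:R sE d0a aa n2R.
have [pl _] := prim_edge j sE d0h aa s1 (ln_ge0 n1R).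
have [_ ph] := prim_edge j sE d0h aa s1 (ln_ge0 n2R).
have d01 : 0 < del <= 1 by rewrite d0; lra.
have := window_sum j sE d01 tt sn1 nn en hD.
rewrite /wsum (sum_gle_split _ n2N) -/(wsum mg (tay j s) n2%:R).
rewrite (@wsum_range _ _ mg 1 (fun n => Delta G n%:R) (tay j s) (tay_prim j s) Delta_step _ _ n12).
have edge n : (n1 <= n <= n2)%N ->
   cabs ((Delta G n%:R)%:C%C * tay j s (ln n%:R)) <=
   eta * (cabs s + 1) * (1 + (del * tau)^-1) * (del * (1 - tau))^-1 ^+ j.
  move=> hn; have n0 : (0 < n)%N by case/andP: hn => h _; exact: leq_trans h.
  have [tau0 tau1] := andP tt.
  have nR : 1 <= n%:R :> R by rewrite ler1n.
  have t0 : 0 < del * (1 - tau) by rewrite mulr_gt0//; lra.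
  have dtau0 : 0 < del * tau by rewrite mulr_gt0.
  have eta0 : 0 < eta by rewrite -(pmulr_lgt0 (x := n1%:R)) ?ltr0n// (lt_le_trans ltr01).
  rewrite cabsM cabs_real; apply: le_trans (ler_pM _ _ (hD _ hn) (tay_le j s (ln_ge0 nR) t0)) _; rewrite ?cabs_ge0//.
  have X0 : 0 <= (del * (1 - tau))^-1 ^+ j by rewrite exprn_ge0// invr_ge0 ltW.
  rewrite mulrCA mulrC ler_wpM2r//.
  have -> : eta * n%:R * expR (- (complex.Re s - del * (1 - tau)) * ln n%:R) = eta * expR (- (del * tau) * ln n%:R).
    rewrite -mulrA; congr (_ * _); rewrite -[n%:R in LHS](@lnK R) ?posrE ?ltr0n// -expRD expRK sE.
    by congr expR; ring.
  rewrite -mulrA ler_pM2l//; apply: (@le_trans _ _ 1).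
    by rewrite -[leRHS]expR0 ler_expR mulNr oppr_le0 mulr_ge0 ?ln_ge0 ?(ltW dtau0).
  have i0 : 0 <= (del * tau)^-1 by rewrite invr_ge0 ltW.
  have := mulr_ge0 (cabs_ge0 s) i0; have := cabs_ge0 s; lra.
have ed1 := edge n1; rewrite leqnn n12 in ed1; have {}ed1 := ed1 isT.
have ed2 := edge n2; rewrite leqnn n12 in ed2; have {}ed2 := ed2 isT.
move: hl hh pl ph ed1 ed2.
set S := \sum_(i <- _ | _) _; set Bl := \sum_(n1 <= i < n2) _; set w := wsum _ _ _.
set P1 := tay_prim _ _ _; set P2 := tay_prim _ _ _; set F1 := _%:C%C * _; set F2 := _%:C%C * _.
set X := eta * _ * _ * _; set el := elow _ _ _ _; set eh := ehigh _ _ _ _; set D := 16 / _.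
move=> hl hh pl ph e1 e2 hB.
rewrite rmorph1 mul1r.
have el0 : 0 <= el by exact: elow_ge0.
have eh0 : 0 <= eh by exact: ehigh_ge0.
have D0 : 0 <= D by case/andP: aa => ? _; rewrite divr_ge0// mulr_ge0 ?sqr_ge0 ?(ltW d0).
have j0 : 0 <= j.+1%:R :> R by [].
have t1 := cabsD (w + (P2 - P1) + F2 - F1 + Bl) S.
have t2 := cabsD (w + (P2 - P1) + F2 - F1) Bl.
have t3 := cabsD (w + (P2 - P1) + F2) (- F1); rewrite cabsN in t3.
have t4 := cabsD (w + (P2 - P1)) F2.
have t5 := cabsD w (P2 - P1).
have t6 := cabsD P2 (- P1); rewrite cabsN in t6.
nra.
Qed.

End Window.

(** * Power series without small zeros *)

Section MajorantNorm.
Variable R : realType.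
Implicit Types (P Q : {poly R[i]}) (z : R[i]) (D : R) (n m k : nat).

Definition pabs P : {poly R} := \poly_(i < size P) cabs P`_i.

Lemma coef_pabs P k : (pabs P)`_k = cabs P`_k.
Proof.
rewrite coef_poly; case: ltnP => // h; by rewrite nth_default// cabs0.
Qed.

(** The majorant norm: it is submultiplicative and controls values on the disc of radius [D]. *)
Definition mnorm D P := (pabs P).[D].

Lemma horner_mono (A B : {poly R}) D : 0 <= D -> (forall k, A`_k <= B`_k) -> A.[D] <= B.[D].
Proof.
move=> D0 h; rewrite (horner_coef_wide D (leq_maxl (size A) (size B))).
rewrite (horner_coef_wide D (leq_maxr (size A) (size B))).
by apply: ler_sum => i _; rewrite ler_wpM2r// exprn_ge0.
Qed.

Lemma mnorm_le D P Q : 0 <= D -> (forall k, cabs P`_k <= cabs Q`_k) -> mnorm D P <= mnorm D Q.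
Proof. by move=> D0 h; apply: horner_mono => // k; rewrite !coef_pabs. Qed.

Lemma mnormD D P Q : 0 <= D -> mnorm D (P + Q) <= mnorm D P + mnorm D Q.
Proof.
move=> D0; rewrite -hornerD; apply: horner_mono => // k.
by rewrite coefD !coef_pabs coefD cabsD.
Qed.

Lemma mnormN D P : mnorm D (- P) = mnorm D P.
Proof.
congr (_.[_]); apply/polyP => k; by rewrite !coef_pabs coefN cabsN.
Qed.

Lemma mnormM D P Q : 0 <= D -> mnorm D (P * Q) <= mnorm D P * mnorm D Q.
Proof.
move=> D0; rewrite -hornerM; apply: horner_mono => // k.
rewrite coefM coef_pabs coefM; apply: le_trans (cabs_sum _ _ _) _.
by apply: ler_sum => i _; rewrite !coef_pabs cabsM.
Qed.

Lemma mnorm_horner D P z : cabs z <= D -> cabs P.[z] <= mnorm D P.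
Proof.
move=> zD; rewrite horner_coef /mnorm (@horner_coef_wide _ (size P)); last exact: size_poly.
apply: le_trans (cabs_sum _ _ _) _; apply: ler_sum => i _.
rewrite cabsM cabsX coef_pabs ler_wpM2l ?cabs_ge0//.
by apply: lerXn2r; rewrite ?nnegrE ?cabs_ge0// (le_trans (cabs_ge0 z)).
Qed.

Lemma mnorm_poly D n (E : nat -> R[i]) :
  mnorm D (\poly_(i < n) E i) = \sum_(i < n) cabs (E i) * D ^+ i.
Proof.
rewrite /mnorm (@horner_coef_wide _ n); last by rewrite (leq_trans (size_poly _ _))// size_poly.
by apply: eq_bigr => i _; rewrite coef_pabs coef_poly ltn_ord.
Qed.

Lemma mnormC D z : mnorm D z%:P = cabs z.
Proof.
rewrite /mnorm (_ : pabs z%:P = (cabs z)%:P) ?hornerC//.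
by apply/polyP => k; rewrite coef_pabs !coefC; case: eqP; rewrite ?cabs0.
Qed.

Lemma mnorm_deriv D P n : 0 <= D -> (size P <= n.+1)%N ->
  D * mnorm D P^`() <= n%:R * mnorm D P.
Proof.
move=> D0 sP; have -> : D * mnorm D P^`() = ('X * pabs P^`()).[D] by rewrite hornerM hornerX.
have -> : n%:R * mnorm D P = (n%:R *: pabs P).[D] by rewrite hornerZ.
apply: horner_mono => // -[|k]; rewrite coefXM coefZ !coef_pabs/=.
  by rewrite mulr_ge0 ?cabs_ge0.
rewrite coef_deriv -[P`_k.+1 *+ _]mulr_natl cabsM cabs_nat.
have [kn|nk] := leqP k.+1 n; first by rewrite ler_wpM2r ?cabs_ge0// ler_nat.
by rewrite nth_default ?cabs0 ?mulr0// (leq_trans sP).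
Qed.

Definition high m P := P - take_poly m P.

Lemma coef_high m P k : (high m P)`_k = if (k < m)%N then 0 else P`_k.
Proof. by rewrite coefB coef_take_poly; case: ifP; rewrite ?subrr ?subr0. Qed.

Lemma mnorm_high D m P : 0 <= D -> mnorm D (high m P) <= mnorm D P.
Proof.
move=> D0; apply: mnorm_le => // k; rewrite coef_high; case: ifP => // _.
by rewrite cabs0 cabs_ge0.
Qed.

Lemma highD m P Q : high m (P + Q) = high m P + high m Q.
Proof.
by apply/polyP => k; rewrite coefD !coef_high coefD; case: ifP; rewrite ?addr0.
Qed.

Lemma high_small m P : (size P <= m)%N -> high m P = 0.
Proof.
move=> h; apply/polyP => k; rewrite coef_high coef0; case: ltnP => // mk.
by rewrite nth_default// (leq_trans h).
Qed.

(* Cutting at [m] the power series solution [f] of [f' = f p] gives a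
   polynomial whose logarithmic derivative is [p] up to high degree terms; if
   those are small, the argument principle forbids zeros inside the disc. *)
Lemma no_small_root (f p : nat -> R[i]) (d tau : R) n m : (n <= m)%N ->
  0 < d -> 0 < tau <= 1 ->
  (forall k, k.+1%:R * f k.+1 = \sum_(i < k.+1) f i * p (k - i)%N) -> f 0%N != 0 ->
  let D := d * (1 + tau) in
  let v := \sum_(i < n.+1) f i * d%:C%C ^+ i in
  let Af := \sum_(i < n.+1) cabs (f i) * D ^+ i in
  let w := \sum_(j < m | (m - n <= j)%N) cabs (p j) * D ^+ j in
  let S := \sum_(i < m.+1 | (n < i)%N) cabs (f i) * D ^+ i in
  let C := \sum_(j < m) cabs (p j) * D ^+ j in
  cabs v <= cabs (f 0%N) / 2 ->
  D * (Af * w) + m%:R * S + (2 * S + cabs v) * (D * C) <=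
    cabs (f 0%N) / 4 * (expR (-1) * (tau / 8 * expR (-1)) ^+ n) -> False.
Proof.
move=> nm d0 tau01 rec f0 D v Af w S C hv hB; have [tau0 tau1] := andP tau01.
have D0 : 0 <= D by rewrite /D mulr_ge0 ?(ltW d0)//; lra.
pose Fn := \poly_(i < n.+1) f i; pose Fm := \poly_(i < m.+1) f i.
pose T := \poly_(i < m.+1) (if (n < i)%N then f i else 0).
pose c := \poly_(j < m) p j.
pose clo := \poly_(j < m - n) p j.
pose chi := \poly_(j < m) (if (m - n <= j)%N then p j else 0).
have FE : Fm = Fn + T.
  apply/polyP => k; rewrite coefD !coef_poly ltnS ltnS; case: (leqP k n) => kn.
    by rewrite (leq_trans kn nm) addr0.
  by rewrite add0r.
have cE : c = clo + chi.
  apply/polyP => k; rewrite coefD !coef_poly; case: (ltnP k (m - n)) => kn.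
    by rewrite (leq_trans kn (leq_subr _ _)) addr0.
  by rewrite add0r.
have derE : Fm^`() = Fm * c - high m (Fm * c).
  apply/polyP => k; rewrite coefB coef_high coef_deriv -mulr_natl.
  case: ltnP => km; last by rewrite subrr nth_default ?mulr0// (leq_trans (size_poly _ _)).
  rewrite subr0 coefM coef_poly ltnS km rec; apply: eq_bigr => i _.
  have ik : (i < m.+1)%N by rewrite (leq_trans (ltn_ord i))// ltnS ltnW.
  by rewrite !coef_poly ik (leq_ltn_trans (leq_subr _ _) km).
(* [Fn] has degree at most [n] and [clo] degree below [m - n], so with [Fn] only the [p_j] with
   [m - n <= j] reach degree [m]. *)
have hE : high m (Fm * c) = high m (Fn * chi) + high m (T * c).
  rewrite {1}FE mulrDl highD; congr (_ + _); rewrite {1}cE mulrDr highD high_small ?add0r//.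
  apply: leq_trans (size_polyMleq _ _) _.
  have s1 := size_poly n.+1 f; have s2 := size_poly (m - n) p.
  rewrite -/Fn in s1; rewrite -/clo in s2.
  apply: (@leq_trans (n.+1 + (m - n)).-1); last by rewrite addSn /= subnKC.
  by rewrite -!subn1 leq_sub2r// leq_add.
(* Subtracting the small value [v] makes [d] an exact root. *)
pose P := Fn - v%:P.
have P0 : P.[0] = f 0%N - v.
  by rewrite /P !hornerE horner_coef0 coef_poly.
have Pd : P.[d%:C%C] = 0.
  rewrite hornerD hornerN hornerC horner_poly; apply/eqP; rewrite subr_eq0; exact/eqP.
have f00 : 0 < cabs (f 0%N) by rewrite cabs_gt0.
have P0b : cabs (f 0%N) / 2 <= cabs P.[0].
  by rewrite P0; have := cabs_sub_lb (f 0%N) v; lra.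
have P00 : P.[0] != 0 by rewrite -cabs_gt0; lra.
have sP : (size P <= n.+1)%N.
  rewrite (leq_trans (size_polyD _ _))// geq_max size_poly size_polyN.
  by rewrite (leq_trans (size_polyC_leq1 _)).
have [r /andP[dr rD] Hr] := circle_lower_bound sP P00 d0 tau01.
have EE : P^`() - P * c = - (high m (Fn * chi) + high m (T * c)) - T^`() + T * c + v%:P * c.
  have := derE; rewrite {1}FE hE derivD /P derivB derivC => e.
  have -> : Fn^`() = (Fm * c - (high m (Fn * chi) + high m (T * c))) - T^`().
    by rewrite -e; ring.
  by rewrite FE; ring.
have nFn : mnorm D Fn = Af by rewrite mnorm_poly.
have nc : mnorm D c = C by rewrite mnorm_poly.
have nT : mnorm D T = S.
  rewrite mnorm_poly /S [RHS]big_mkcond; apply: eq_bigr => i _; case: ifP => //.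
  by rewrite cabs0 mul0r.
have nchi : mnorm D chi = w.
  rewrite mnorm_poly /w [RHS]big_mkcond; apply: eq_bigr => i _; case: ifP => //.
  by rewrite cabs0 mul0r.
have b1 : mnorm D (high m (Fn * chi)) <= Af * w.
  by rewrite -nFn -nchi; apply: le_trans (mnorm_high _ _ D0) (mnormM _ _ D0).
have b2 : mnorm D (high m (T * c)) <= S * C.
  by rewrite -nT -nc; apply: le_trans (mnorm_high _ _ D0) (mnormM _ _ D0).
have b3 : D * mnorm D T^`() <= m%:R * S.
  by rewrite -nT; apply: mnorm_deriv => //; exact: size_poly.
have b4 : mnorm D (T * c) <= S * C by rewrite -nT -nc; exact: mnormM.
have b5 : mnorm D (v%:P * c) <= cabs v * C by rewrite -nc -(mnormC D v); exact: mnormM.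
have r0 : 0 < r := lt_trans d0 dr.
have Eb z : cabs z = r -> r * cabs (P^`().[z] - P.[z] * c.[z]) <= cabs P.[z] / 2.
  move=> zr; have -> : P^`().[z] - P.[z] * c.[z] = (P^`() - P * c).[z] by rewrite !hornerE.
  have zD : cabs z <= D by rewrite zr.
  have e1 := mnorm_horner (P^`() - P * c) zD.
  have e2 : D * mnorm D (P^`() - P * c) <= D * (Af * w) + m%:R * S + (2 * S + cabs v) * (D * C).
    rewrite EE.
    have m1 := mnormD (- (high m (Fn * chi) + high m (T * c)) - T^`() + T * c) (v%:P * c) D0.
    have m2 := mnormD (- (high m (Fn * chi) + high m (T * c)) - T^`()) (T * c) D0.
    have m3 := mnormD (- (high m (Fn * chi) + high m (T * c))) (- T^`()) D0.
    have m4 := mnormD (high m (Fn * chi)) (high m (T * c)) D0.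
    rewrite !mnormN in m3.
    set N := mnorm D (_ + _ * c) in m1 *.
    have : N <= Af * w + 2 * (S * C) + cabs v * C + mnorm D T^`() by lra.
    move=> /(ler_wpM2l D0); rewrite mulrDr.
    lra.
  apply: (@le_trans _ _ (D * mnorm D (P^`() - P * c))).
    by apply: ler_pM; rewrite ?(ltW r0) ?cabs_ge0.
  apply: le_trans e2 _; apply: le_trans hB _.
  have := Hr z zr; set q := expR (-1) * _ => h.
  have q0 : 0 <= q by rewrite mulr_ge0 ?expR_ge0// exprn_ge0// mulr_ge0 ?expR_ge0//; lra.
  have := ler_wpM2r q0 P0b; lra.
have Pz z : cabs z = r -> P.[z] != 0.
  move=> /Hr h; rewrite -cabs_gt0; apply: lt_le_trans h.
  by rewrite mulr_gt0 ?cabs_gt0// mulr_gt0 ?expR_gt0// exprn_gt0// mulr_gt0 ?expR_gt0//; lra.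
have := no_root_in_disc r0 Pz Eb (w0 := d%:C%C).
by rewrite cabs_real gtr0_norm// dr Pd eqxx => /(_ isT).
Qed.

End MajorantNorm.

(** * Taylor coefficients of zeta *)

Section TaylorRemainder.
Variables (R : realType) (G : beurlingSystem R) (kappa A theta : R).
Hypothesis hA : axiomA G kappa A theta.
Implicit Types (s rho : R[i]) (t q d del : R) (n i j k : nat).

Let theta0 : 0 < theta. Proof. by case: hA => _ _ /andP[]. Qed.
Let theta1 : theta < 1. Proof. by case: hA => _ _ /andP[]. Qed.

Local Notation zc := (@zcoef R G kappa).
Local Notation zfun := (@Z R G kappa).
Local Notation reg := (reg G kappa).
Local Notation regdata := (regdata theta).

Lemma regdata_axpy (z : R[i]) (F F' Phi F2 F2' Phi2 : R -> R[i]) b sigma b2 :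
  regdata F F' Phi b sigma -> regdata F2 F2' Phi2 b2 sigma ->
  regdata (fun t => F t + z * F2 t) (fun t => F' t + z * F2' t) (fun t => Phi t + z * Phi2 t)
    (b + cabs z * b2) sigma.
Proof.
move=> [b0 ts h1 h2 h3] [b20 _ k1 k2 k3]; split=> //.
- by rewrite addr_ge0// mulr_ge0 ?cabs_ge0.
- by move=> t t0; apply: cderivD (h1 t t0) (cderivZ _ (k1 t t0)).
- move=> t t0; apply: le_trans (cabsD _ _) _; rewrite cabsM mulrDl -mulrA lerD ?h2//.
  by rewrite ler_wpM2l ?cabs_ge0// k2.
- move=> t t0; have := cderivD (h3 t t0) (cderivZ z (k3 t t0)).
  by apply: cderiv_eq => //; ring.
Qed.

(** Taylor terms are subtracted one at a time because linearity of [reg] is available for one term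
    at a time. *)
Fixpoint taylor_rem (u : R -> R[i]) (T : nat -> R -> R[i]) (d : R) n : R -> R[i] :=
  if n is n'.+1 then fun t => taylor_rem u T d n' t + - (d%:C%C ^+ n') * T n' t else u.

Section Expansion.
Variables (s rho : R[i]) (d r0 : R).
Hypotheses (sd : s = rho + d%:C%C) (d0 : 0 < d) (dr : d <= r0) (r1 : r0 <= 1).
Hypotheses (s1 : 1 <= cabs (s - 1)) (rho1 : 1 <= cabs (rho - 1)).
Hypothesis sr : theta < complex.Re s - r0.

Let r00 : 0 < r0. Proof. exact: lt_le_trans dr. Qed.

Let sn1 : s != 1.
Proof. by rewrite -subr_eq0 -cabs_eq0 gt_eqF// (lt_le_trans ltr01). Qed.

Let rhon1 : rho != 1.
Proof. by rewrite -subr_eq0 -cabs_eq0 gt_eqF// (lt_le_trans ltr01). Qed.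

Let rem n := taylor_rem (tay 0 rho) (fun k => tay k s) d n.
Let remPhi n := taylor_rem (tay_prim 0 rho) (fun k => tay_prim k s) d n.

Lemma taylor_remE n t : rem n t = (exprem n (d * t))%:C%C * cexp (- s * t%:C%C).
Proof.
elim: n => [|n IH].
  rewrite /rem /= tay0 exprem0n -cexp_real -cexpD; congr cexp.
  by rewrite sd rmorphM /=; ring.
rewrite /rem /= -/(rem n) IH /exprem big_ord_recr /= /tay /expfact.
rewrite !(rmorphB, rmorphD) /= exprMn.
have -> : (d ^+ n * t ^+ n / n`!%:R)%:C%C = d%:C%C ^+ n * (t ^+ n / n`!%:R)%:C%C :> R[i].
  by rewrite -mulrA rmorphM rmorphXn.
ring.
Qed.

(** The rates here are crude and serve linearity alone; sharp data come from the closed form of the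
    remainder. *)
Lemma taylor_rem_reg n : exists F' b sigma, regdata (rem n) F' (remPhi n) b sigma /\
  reg (rem n) (remPhi n) = reg (tay 0 rho) (tay_prim 0 rho) -
    \sum_(i < n) d%:C%C ^+ i * reg (tay i s) (tay_prim i s).
Proof.
pose q := (complex.Re s - r0 - theta) / 2.
have q0 : 0 < q by rewrite /q; have := sr; lra.
have rhoq : theta < complex.Re rho - q.
  by rewrite /q sd ReD /=; have := sr; rewrite sd ReD /=; have := dr; lra.
have sq : theta < complex.Re s - (q + d) by rewrite /q; have := sr; have := dr; lra.
have qd0 : 0 < q + d by rewrite addr_gt0.
have sE : complex.Re rho - q = complex.Re s - (q + d) by rewrite sd ReD /=; ring.
suff : exists F' b, regdata (rem n) F' (remPhi n) b (complex.Re rho - q) /\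
  reg (rem n) (remPhi n) = reg (tay 0 rho) (tay_prim 0 rho) -
    \sum_(i < n) d%:C%C ^+ i * reg (tay i s) (tay_prim i s).
  by move=> [F' [b h]]; exists F', b, (complex.Re rho - q).
elim: n => [|n [F' [b [h1 h2]]]].
  exists (tay_der 0 rho), ((cabs rho + q) * q^-1 ^+ 0); split; first exact: regdata_tay.
  by rewrite big_ord0 subr0.
have h3 := regdata_tay n sn1 qd0 sq; rewrite -sE in h3.
eexists; eexists; split; first exact: (regdata_axpy (- (d%:C%C ^+ n)) h1 h3).
by rewrite /rem /remPhi /= (reg_axpy hA _ h1 h3) h2 big_ord_recr /=; ring.
Qed.

(** A geometric series in [d / (s - 1)], as [rho - 1 = (s - 1) - d]. *)
Lemma pole_rem n : (rho - 1)^-1 - \sum_(i < n) d%:C%C ^+ i * (s - 1)^-1 ^+ i.+1 =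
  (d%:C%C / (s - 1)) ^+ n / (rho - 1).
Proof.
have a1 : s - 1 != 0 by rewrite subr_eq0.
have a2 : rho - 1 != 0 by rewrite subr_eq0.
elim: n => [|n IH]; first by rewrite big_ord0 subr0 expr0 div1r.
rewrite big_ord_recr /= opprD addrA IH !exprMn !exprS.
have -> : d%:C%C = (s - 1) - (rho - 1) by rewrite sd; ring.
by move: (s - 1) (rho - 1) a1 a2 => u v u0 v0; field; rewrite u0 v0.
Qed.

(** Taking [q = r0 / d] in the remainder bound for the exponential gives [(d / r0)^(n+1) e^(r0 t)]:
    geometric smallness at the price of the rate [r0], with [Re s - r0] still to the right of
    [theta]. *)
Lemma regdata_rem n : regdata (rem n.+1)
  (fun t => d%:C%C * (exprem n (d * t))%:C%C * cexp (- s * t%:C%C) +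
     (exprem n.+1 (d * t))%:C%C * (- s * cexp (- s * t%:C%C)))
  (remPhi n.+1) ((cabs s + r0) * (d / r0) ^+ n.+1) (complex.Re s - r0).
Proof.
have [F' [b [sigma [[_ _ _ _ hPhi] _]]]] := taylor_rem_reg n.+1.
have dr0 : 0 <= d / r0 by rewrite divr_ge0 ?(ltW d0) ?(ltW r00).
split=> //.
- by rewrite mulr_ge0 ?exprn_ge0// addr_ge0 ?cabs_ge0 ?(ltW r00).
- move=> t t0; have d1 : is_derive t (1 : R) (fun y => d * y) d.
    have := is_deriveZ d (is_derive_id t (1 : R)); rewrite [d *: 1]mulr1.
    by rewrite (_ : (fun y => d * y) = d \*: (@id R))//; apply/funext => y; rewrite !fctE.
  have d2 := is_derive1_comp (is_derive_exprem n (d * t)) d1.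
  have d3 := cderivM (cderiv_real d2) (cderiv_cexp (- s) t).
  apply: (cderiv_eq _ _ d3) => [y|]; first by rewrite taylor_remE.
  by rewrite /GRing.scale /= rmorphM /=; ring.
- move=> t t0; have dt0 : 0 <= d * t by rewrite mulr_ge0// ltW.
  have q1 : 1 <= r0 / d by rewrite ler_pdivlMr// mul1r.
  have eE : r0 / d * (d * t) = r0 * t by field; rewrite gt_eqF.
  have e1 := exprem_le n dt0 q1; have e2 := exprem_le n.+1 dt0 q1.
  rewrite eE invf_div in e1 e2.
  apply: le_trans (cabsD _ _) _.
  rewrite !cabsM cabsN !cabs_real cabs_cexpN (gtr0_norm d0) !ger0_norm ?exprem_ge0//.
  have -> : - (complex.Re s - r0) * t = r0 * t + - complex.Re s * t by ring.
  rewrite expRD; move: (expR_ge0 (- complex.Re s * t)) (expR_ge0 (r0 * t)) e1 e2.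
  generalize (expR (- complex.Re s * t)) (expR (r0 * t)) (exprem n (d * t)) (exprem n.+1 (d * t)).
  move=> E E' x x' E0 E'0 e1 e2.
  have f1 : d * x <= r0 * (d / r0) ^+ n.+1 * E'.
    have := ler_wpM2l (ltW d0) e1.
    have -> : r0 * (d / r0) ^+ n.+1 * E' = d * ((d / r0) ^+ n * E').
      by rewrite exprS; field; rewrite gt_eqF ?r00.
    by [].
  have f2 := ler_wpM2r E0 f1; have f3 := ler_wpM2r E0 (ler_wpM2l (cabs_ge0 s) e2).
  lra.
Qed.

(** Linearity of [reg] transfers the pointwise Taylor remainder of [e^(- rho t)] to [Z], and the
    polar part is a geometric series; no contour integral is involved. *)
Lemma Z_taylor n : cabs (zfun rho - \sum_(i < n.+1) zc i s * d%:C%C ^+ i) <=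
  (kappa + regC kappa A * (cabs s + r0) * (1 + (complex.Re s - r0 - theta)^-1)) * (d / r0) ^+ n.+1.
Proof.
have [F' [b [sigma [_ hE]]]] := taylor_rem_reg n.+1.
have [_ hB] := regP hA (regdata_rem n); rewrite hE in hB.
have [k0 _ _ _] := hA.
have -> : zfun rho - \sum_(i < n.+1) zc i s * d%:C%C ^+ i =
   kappa%:C%C * ((d%:C%C / (s - 1)) ^+ n.+1 / (rho - 1)) +
   (reg (tay 0 rho) (tay_prim 0 rho) -
    \sum_(i < n.+1) d%:C%C ^+ i * reg (tay i s) (tay_prim i s)).
  rewrite -pole_rem /Z {1}/zcoef expr1 mulrBr mulr_sumr.
  rewrite (eq_bigr (fun i : 'I_n.+1 => kappa%:C%C * (d%:C%C ^+ i * (s - 1)^-1 ^+ i.+1) +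
    d%:C%C ^+ i * reg (tay i s) (tay_prim i s))).
    by rewrite big_split /=; ring.
  by move=> i _; rewrite /zcoef; ring.
apply: le_trans (cabsD _ _) _.
have p1 : cabs (kappa%:C%C * ((d%:C%C / (s - 1)) ^+ n.+1 / (rho - 1))) <= kappa * (d / r0) ^+ n.+1.
  rewrite cabsM cabs_real gtr0_norm// ler_wpM2l ?(ltW k0)// cabsM cabsX cabsM !cabsV cabs_real gtr0_norm//.
  rewrite -[leRHS]mulr1; apply: ler_pM; rewrite ?exprn_ge0 ?mulr_ge0 ?invr_ge0 ?cabs_ge0 ?(ltW d0)//.
    apply: lerXn2r; rewrite ?nnegrE ?mulr_ge0 ?invr_ge0 ?cabs_ge0 ?(ltW d0) ?(ltW r00)//.
    rewrite ler_wpM2l ?(ltW d0)// lef_pV2 ?posrE ?r00 ?(lt_le_trans ltr01 s1)//.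
    exact: le_trans s1.
  by rewrite invf_le1// (lt_le_trans ltr01).
apply: le_trans (lerD p1 hB) _; rewrite le_eqVlt; apply/orP; left; apply/eqP; ring.
Qed.

End Expansion.

End TaylorRemainder.

(** * Uniform bounds for the coefficients of zeta and of its logarithmic derivative *)

Section CoefficientBounds.
Variables (R : realType) (G : beurlingSystem R) (kappa A theta : R).
Hypothesis hA : axiomA G kappa A theta.
Implicit Types (s : R[i]) (d del c C : R) (n i j k : nat).

Let theta0 : 0 < theta. Proof. by case: hA => _ _ /andP[]. Qed.
Let theta1 : theta < 1. Proof. by case: hA => _ _ /andP[]. Qed.

Local Notation zc := (@zcoef R G kappa).
Local Notation pc := (@pcoef R G).

(** In the recursion each of the [k + 1] terms is at most [cabs (zc 0 s) * b ^+ k.+1], and the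
    factor [k + 1] on the left divides their number out. *)
Lemma zcoef_growth s b : 1 < complex.Re s -> 0 <= b ->
  (forall j, cabs (pc j s) <= b ^+ j.+1) ->
  forall i, cabs (zc i s) <= cabs (zc 0 s) * b ^+ i.
Proof.
move=> s1 b0 hp; elim/ltn_ind => -[|k] IH; first by rewrite expr0 mulr1.
have k0 : 0 < k.+1%:R :> R by rewrite ltr0n.
rewrite -(ler_pM2l k0) -[X in X * cabs _ <= _](cabs_nat R k.+1) -cabsM (pcoef_recursion hA k s1).
apply: le_trans (cabs_sum _ _ _) _.
apply: (@le_trans _ _ (\sum_(i < k.+1) cabs (zc 0 s) * b ^+ k.+1)); last first.
  by rewrite sumr_const card_ord mulr_natl.
apply: ler_sum => i _; rewrite cabsM.
have ik : (i <= k)%N by rewrite -ltnS.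
apply: le_trans (ler_pM (cabs_ge0 _) (cabs_ge0 _) (IH i (ltn_ord i)) (hp (k - i)%N)) _.
by rewrite -mulrA -exprD addnS subnKC.
Qed.

Lemma coef_bounds : exists a0, exists C, exists c, [/\ 0 < a0 <= 1 / 2, 1 <= C, 0 < c &
  forall s del, complex.Re s = 1 + del -> 0 < del <= a0 -> 1 <= cabs (s - 1) ->
  [/\ c * del <= cabs (zc 0 s),
      forall i, cabs (zc i s) <= C * cabs s * ((1 - theta) / 2)^-1 ^+ i,
      forall j, cabs (pc j s) <= (32 / del) ^+ j.+1 &
      forall d n, 0 < d <= (1 - theta) / 2 -> 1 <= cabs (s - d%:C%C - 1) ->
        Z G kappa (s - d%:C%C) = 0 ->
        cabs (\sum_(i < n.+1) zc i s * d%:C%C ^+ i) <= C * cabs s * (d / ((1 - theta) / 2)) ^+ n.+1]].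
Proof.
have [a1 /andP[a10 a11] Hp] := pcoef_le hA.
have [a2 /andP[a20 a21] Hz] := Z_real_near1 hA.
have [x1 x12 Hl] := Z_lower_bound hA.
have [k0 _ _ _] := hA.
have rC0 := regC_gt0 hA.
have zle := zcoef_le hA; have ztay := @Z_taylor R G kappa A theta hA.
move: (regC kappa A) rC0 zle ztay => rC rC0 zle ztay.
have T0 : 0 < 1 - theta by have := theta1; lra.
have T1 : 1 - theta < 1 by have := theta0; lra.
pose r := (1 - theta) / 2; have r0 : 0 < r by rewrite divr_gt0.
have r1 : r <= 1 by rewrite /r; lra.
pose C := 1 + kappa + rC * 2 * (1 + r^-1).
have C1 : 1 <= C.
  have ri : 0 <= r^-1 by rewrite invr_ge0 ltW.
  by have := mulr_ge0 (ltW rC0) ri; rewrite /C; generalize r^-1 => u; lra.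
exists (Num.min (1 / 2) (Num.min a1 a2)), C, (8 * kappa)^-1; split=> //.
- by rewrite !lt_min a10 a20 divr_gt0//= ge_min lexx.
- by rewrite invr_gt0 mulr_gt0.
move=> s del sE /andP[d0]; rewrite !le_min => /and3P[dh d1 d2] s1.
have sn1 : s != 1 by rewrite -subr_eq0 -cabs_eq0 gt_eqF// (lt_le_trans ltr01).
have Re1 : 1 < complex.Re s by rewrite sE; lra.
have cs1 : 1 <= cabs s.
  apply: le_trans (Re_le_cabs s); apply: le_trans (ler_norm _); exact: ltW.
have sr : theta < complex.Re s - r by rewrite sE /r; lra.
have key : rC * (cabs s + r) * (1 + (complex.Re s - r - theta)^-1) + kappa <= C * cabs s.
  have i1 : (complex.Re s - r - theta)^-1 <= r^-1.
    rewrite lef_pV2 ?posrE//; [by rewrite sE /r; lra|by rewrite subr_gt0].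
  have i0 : 0 <= (complex.Re s - r - theta)^-1 by rewrite invr_ge0 subr_ge0 ltW.
  have h1 : rC * (cabs s + r) * (1 + (complex.Re s - r - theta)^-1) <=
     rC * (2 * cabs s) * (1 + r^-1).
    apply: ler_pM; rewrite ?mulr_ge0 ?addr_ge0 ?cabs_ge0 ?(ltW r0) ?(ltW rC0)//.
      by rewrite ler_wpM2l ?(ltW rC0)//; lra.
    by rewrite lerD2l.
  have := ler_wpM2l (ltW k0) cs1; rewrite /C; lra.
have rC' : 0 <= rC * (cabs s + r) * (1 + (complex.Re s - r - theta)^-1).
  by rewrite !mulr_ge0 ?addr_ge0 ?cabs_ge0 ?(ltW r0) ?(ltW rC0)// invr_ge0 subr_ge0 ltW.
split.
- have := Hl s; rewrite sE; have -> : 1 < 1 + del <= x1 by apply/andP; split; lra.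
  move=> /(_ isT) h.
  have := Hz del; rewrite d0 d2 => /(_ isT)/andP[_ h2].
  have Z0 := cabs_ge0 (Z G kappa s).
  have h3 := ler_wpM2r Z0 h2; have h4 := le_trans h h3.
  rewrite mulrC ler_pdivrMr ?mulr_gt0// mulrC.
  have -> : cabs (zc 0 s) = cabs (Z G kappa s) by [].
  have : 1 / 4 * del <= 2 * kappa / del * cabs (Z G kappa s) * del by rewrite ler_wpM2r// ltW.
  have -> : 2 * kappa / del * cabs (Z G kappa s) * del = 2 * kappa * cabs (Z G kappa s).
    by field; rewrite gt_eqF.
  lra.
- move=> i; apply: le_trans (zle i _ _ sn1 r0 sr) _.
  have ri : 1 <= r^-1 ^+ i by rewrite exprn_ege1// invf_ge1.
  have si : (cabs (s - 1))^-1 ^+ i.+1 <= 1.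
    by rewrite exprn_ile1 ?invr_ge0 ?cabs_ge0// invf_le1 ?(lt_le_trans ltr01 s1).
  have ri0 : 0 <= r^-1 ^+ i by exact: le_trans ri.
  apply: le_trans (ler_wpM2r ri0 key); rewrite [leRHS]mulrDl addrC; apply: lerD.
    by rewrite le_eqVlt mulrAC eqxx.
  by rewrite ler_wpM2l ?(ltW k0)// (le_trans si).
- move=> j; have q0 : 0 < del / 2 by rewrite divr_gt0.
  apply: le_trans (Hp j s (del / 2) q0 _) _; first by rewrite sE; apply/andP; split; lra.
  have -> : 16 / (complex.Re s - 1 - del / 2) = 32 / del.
    by rewrite sE; field; rewrite gt_eqF//=; lra.
  rewrite exprSr ler_wpM2r ?divr_ge0 ?(ltW d0)//.
  apply: lerXn2r; rewrite ?nnegrE ?invr_ge0 ?divr_ge0 ?(ltW d0) ?(ltW q0)//.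
  rewrite invf_div ler_wpM2r ?invr_ge0 ?(ltW d0)// ler_nat//.
- move=> d n /andP[dd0 dr] rho1 Z0.
  have sE2 : s = (s - d%:C%C) + d%:C%C by rewrite subrK.
  have := ztay s (s - d%:C%C) d r sE2 dd0 dr r1 s1 rho1 sr n.
  rewrite Z0 sub0r cabsN => h; apply: le_trans h _.
  apply: ler_wpM2r; last by rewrite [leLHS]addrC.
  by apply: exprn_ge0; apply: divr_ge0; exact: ltW.
Qed.

End CoefficientBounds.

(** * Numerical estimates *)

Section Numerics.
Variable R : realType.
Implicit Types (a K sigma tau W U del e d rho l eta cs p D x : R) (j m n : nat).

(** [(1 + e / del)^j <= exp (e j / del)], and [j <= del U] bounds this by [exp (e U)]; for
    [e = 1 - Re rho] that is [X^(1 - Re rho)], the first half of what [omega] minimizes. *)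
Lemma pow_ratio del e tau U j : 0 < del -> 0 <= e -> 0 <= tau -> j%:R <= del * U ->
  ((del + e) * (1 + tau)) ^+ j <= del ^+ j * expR (tau * (del * U) + e * U).
Proof.
move=> d0 e0 t0 jk.
have ed : 0 <= e / del by rewrite divr_ge0// ltW.
have -> : (del + e) * (1 + tau) = del * ((1 + e / del) * (1 + tau)) by field; rewrite gt_eqF.
rewrite exprMn ler_wpM2l ?exprn_ge0 ?(ltW d0)//.
apply: (@le_trans _ _ (expR ((e / del + tau) * j%:R))).
  apply: invX_expR (erefl _); first by rewrite mulr_ge0//; lra.
  by rewrite expRD; apply: ler_pM; rewrite ?expR_ge1Dx//; lra.
rewrite ler_expR; have h : e / del * j%:R <= e * U.
  apply: le_trans (ler_wpM2l ed jk) _; rewrite le_eqVlt; apply/orP; left; apply/eqP.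
  by field; rewrite gt_eqF.
by have := ler_wpM2l t0 jk; lra.
Qed.

(** The peak [j / del] is at least [(1 - 12 a) U], the cutoff about [(1 - 16 a) U]. The gap [4 a]
    leaves [- 2 a^2 K W] in the exponent after the losses of the tilt, and [K a^2 = 40]. *)
Lemma elow_le a K W U del l j : 0 < a <= 1 / 100 -> K * a ^+ 2 = 40 -> 1 <= W -> 0 < del <= 1 ->
  del * U = K * W -> 0 <= l -> l <= (1 - 16 * a) * U + 2 -> (1 - 12 * a) * (K * W) <= j%:R ->
  elow j del a l <= del^-1 ^+ j * expR (2 - 40 * W).
Proof.
move=> /andP[a0 a1] Ka W1 /andP[d0 d1] dU l0 lU hj.
rewrite /elow ler_wpM2l ?exprn_ge0 ?invr_ge0 ?(ltW d0)// ler_expR.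
have a2b : a ^+ 2 <= a by rewrite expr2 ler_piMl ?(ltW a0)//; lra.
have a2p := sqr_ge0 a.
have aa : 0 <= a - a ^+ 2 by lra.
have h1 := ler_wpM2l aa hj.
have h2 : del * l <= (1 - 16 * a) * (K * W) + 2.
  have := ler_wpM2l (ltW d0) lU.
  have -> : del * ((1 - 16 * a) * U + 2) = (1 - 16 * a) * (del * U) + 2 * del by ring.
  by rewrite dU; lra.
have aa' : 0 <= a + a ^+ 2 by lra.
have h3 := ler_wpM2l aa' h2.
have KW : K * W * a ^+ 2 = 40 * W by rewrite mulrAC Ka.
have K3 : 0 <= K * W * a ^+ 3 by rewrite exprSr mulrA KW mulr_ge0 ?mulr_ge0//; lra.
have -> : (a + a ^+ 2) * del * l = (a + a ^+ 2) * (del * l) by rewrite mulrA.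
have e1 : (a + a ^+ 2) * ((1 - 16 * a) * (K * W) + 2) - (a - a ^+ 2) * ((1 - 12 * a) * (K * W)) =
  - 2 * (K * W * a ^+ 2) - 28 * (K * W * a ^+ 3) + 2 * (a + a ^+ 2) by ring.
have a2 : 2 * (a + a ^+ 2) <= 2 by lra.
rewrite KW in e1; lra.
Qed.

(** Above the peak the gap [4 a] leaves [- a^2 K W = - 40 W]. *)
Lemma ehigh_le a K W U del l j : 0 < a <= 1 / 100 -> K * a ^+ 2 = 40 -> 1 <= W -> 0 < del <= 1 ->
  del * U = K * W -> U - 1 <= l -> j%:R <= (1 - 4 * a) * (K * W) ->
  ehigh j del a l <= del^-1 ^+ j * expR (2 - 40 * W).
Proof.
move=> /andP[a0 a1] Ka W1 /andP[d0 d1] dU lU hj.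
rewrite /ehigh ler_wpM2l ?exprn_ge0 ?invr_ge0 ?(ltW d0)// ler_expR.
have a2b : a ^+ 2 <= a by rewrite expr2 ler_piMl ?(ltW a0)//; lra.
have a2p := sqr_ge0 a.
have aa : 0 <= a + 2 * a ^+ 2 by lra.
have h1 := ler_wpM2l aa hj.
have h2 : K * W - 1 <= del * l.
  have := ler_wpM2l (ltW d0) lU.
  by rewrite mulrBr mulr1 dU; lra.
have aa' : 0 <= a - a ^+ 2 by lra.
have h3 := ler_wpM2l aa' h2.
have KW : K * W * a ^+ 2 = 40 * W by rewrite mulrAC Ka.
have K3 : 0 <= K * W * a ^+ 3 by rewrite exprSr mulrA KW mulr_ge0 ?mulr_ge0//; lra.
have -> : (a - a ^+ 2) * del * l = (a - a ^+ 2) * (del * l) by rewrite mulrA.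
have e1 : (a + 2 * a ^+ 2) * ((1 - 4 * a) * (K * W)) - (a - a ^+ 2) * (K * W - 1) =
  - (K * W * a ^+ 2) - 8 * (K * W * a ^+ 3) + (a - a ^+ 2) by ring.
have a2 : a - a ^+ 2 <= 2 by lra.
rewrite KW in e1; lra.
Qed.

(** The Chernoff saving [exp (- 40 W)] pays for [E], which is at most [exp (W + 1)]; the rest is
    spent as fifteen powers of [y]. *)
Lemma tail_term a del D E y W x j : 0 < a -> 0 < del <= 1 -> 0 <= D <= 4 * del -> 0 < y ->
  j.+1%:R <= y -> D ^+ j <= del ^+ j * (y * E) -> E <= expR (W + 1) ->
  0 <= x <= 2 * (del^-1 ^+ j * expR (2 - 40 * W)) -> (8 * y + 128 / a ^+ 2) * expR 3 <= y ^+ 2 ->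
  expR (- 39 * W) <= y^-1 ^+ 15 ->
  D ^+ j.+1 * ((j.+1%:R + 16 / (a ^+ 2 * del)) * x) <= y^-1 ^+ 12.
Proof.
move=> a0 /andP[d0 d1] /andP[D0 D4] y0 jy DE E1 /andP[x0 x1] y1 yW.
have a20 : 0 < a ^+ 2 by rewrite exprn_gt0.
have c0 : 0 <= 16 / (a ^+ 2 * del) by rewrite divr_ge0// mulr_ge0 ?(ltW d0)// ltW.
have j10 : 0 <= j.+1%:R :> R by [].
have D0j : 0 <= D ^+ j by exact: exprn_ge0.
have dj : del ^+ j * del^-1 ^+ j = 1 by rewrite -exprMn divff ?expr1n// gt_eqF.
have b1 : D * (j.+1%:R + 16 / (a ^+ 2 * del)) <= 4 * y + 64 / a ^+ 2.
  apply: le_trans (ler_wpM2r (addr_ge0 j10 c0) D4) _.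
  have -> : 4 * del * (j.+1%:R + 16 / (a ^+ 2 * del)) = 4 * (del * j.+1%:R) + 64 / a ^+ 2.
    by field; rewrite gt_eqF// gt_eqF.
  by rewrite lerD2r ler_wpM2l//; apply: le_trans jy; rewrite ler_piMl.
have b2 : D ^+ j * x <= 2 * (y * expR (3 - 39 * W)).
  apply: le_trans (ler_pM D0j x0 DE x1) _.
  have -> : del ^+ j * (y * E) * (2 * (del^-1 ^+ j * expR (2 - 40 * W))) =
      2 * (y * (E * expR (2 - 40 * W))) * (del ^+ j * del^-1 ^+ j) by ring.
  rewrite dj mulr1 ler_wpM2l// ler_wpM2l ?(ltW y0)//.
  apply: le_trans (ler_wpM2r (expR_ge0 _) E1) _; rewrite -expRD.
  by have -> : W + 1 + (2 - 40 * W) = 3 - 39 * W by ring.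
have -> : D ^+ j.+1 * ((j.+1%:R + 16 / (a ^+ 2 * del)) * x) =
  D * (j.+1%:R + 16 / (a ^+ 2 * del)) * (D ^+ j * x) by rewrite exprS; ring.
apply: le_trans (ler_pM _ _ b1 b2) _; rewrite ?mulr_ge0 ?addr_ge0//.
have -> : (4 * y + 64 / a ^+ 2) * (2 * (y * expR (3 - 39 * W))) =
  (8 * y + 128 / a ^+ 2) * expR 3 * (y * expR (- 39 * W)).
  by rewrite expRD mulNr; field; rewrite gt_eqF.
apply: le_trans (ler_wpM2r _ y1) _; first by rewrite mulr_ge0 ?expR_ge0// ltW.
have -> : y ^+ 2 * (y * expR (- 39 * W)) = y ^+ 3 * expR (- 39 * W) by ring.
apply: le_trans (ler_wpM2l _ yW) _; first by rewrite exprn_ge0// ltW.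
by rewrite le_eqVlt; apply/orP; left; apply/eqP; field; rewrite gt_eqF.
Qed.

(** The decisive balance: [rho] from summation by parts and [E = exp (e U)] combine to at most
    [exp (W + 1)], while [eta] supplies [exp (- W) y^(- 16)]. Three powers of [y] are lost to the
    enlarged radius and the tilt, one to constants. *)
Lemma middle_term del D E y W tau C eta cs rho j : 0 < del <= 1 -> 0 <= D <= 4 * del -> 0 < y ->
  0 < tau < 1 -> D ^+ j <= del ^+ j * (y * E) -> (1 - tau)^-1 ^+ j <= y ^+ 2 ->
  0 < E -> 0 < rho -> rho * E <= expR (W + 1) -> 0 <= C -> 0 <= cs -> cs + 1 <= 3 * rho ->
  eta * expR W = C * y^-1 ^+ 16 -> 60 * C * (4 + 4 / tau) * expR 1 <= y ->
  D ^+ j.+1 * (20 * (eta * (cs + 1) * (1 + (del * tau)^-1) * (del * (1 - tau))^-1 ^+ j)) <= y^-1 ^+ 12.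
Proof.
move=> /andP[d0 d1] /andP[D0 D4] y0 /andP[t0 t1] DE ty E0 rho0 Erho C0 cs0 csr etaE y2.
have dj : del ^+ j * del^-1 ^+ j = 1 by rewrite -exprMn divff ?expr1n// gt_eqF.
have i0 : 0 <= 1 + (del * tau)^-1 by rewrite addr_ge0// invr_ge0 mulr_ge0// ltW.
have X0 : 0 <= (del * (1 - tau))^-1 ^+ j.
  by rewrite exprn_ge0// invr_ge0 mulr_ge0 ?(ltW d0)// subr_ge0 ltW.
have b1 : D * (1 + (del * tau)^-1) <= 4 + 4 / tau.
  apply: le_trans (ler_wpM2r i0 D4) _.
  have -> : 4 * del * (1 + (del * tau)^-1) = 4 * del + 4 / tau by field; rewrite !gt_eqF.
  by rewrite lerD2r ler_piMr.
have b2 : D ^+ j * (del * (1 - tau))^-1 ^+ j <= y ^+ 3 * E.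
  apply: le_trans (ler_wpM2r X0 DE) _; rewrite invfM exprMn.
  have -> : del ^+ j * (y * E) * (del^-1 ^+ j * (1 - tau)^-1 ^+ j) =
     (del ^+ j * del^-1 ^+ j) * (y * E * (1 - tau)^-1 ^+ j) by ring.
  rewrite dj mul1r; have -> : y ^+ 3 * E = y * E * y ^+ 2 by ring.
  by rewrite ler_wpM2l// mulr_ge0 ?(ltW y0) ?(ltW E0).
have eta0 : 0 <= eta.
  have h : 0 <= eta * expR W by rewrite etaE mulr_ge0// exprn_ge0// invr_ge0 ltW.
  by rewrite -(pmulr_lge0 _ (expR_gt0 W)).
have -> : D ^+ j.+1 * (20 * (eta * (cs + 1) * (1 + (del * tau)^-1) * (del * (1 - tau))^-1 ^+ j)) =
   20 * eta * (cs + 1) * ((D * (1 + (del * tau)^-1)) * (D ^+ j * (del * (1 - tau))^-1 ^+ j)).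
  by rewrite exprS; ring.
have e0 : 0 <= 20 * eta by rewrite mulr_ge0.
have c1 : 0 <= cs + 1 by rewrite addr_ge0.
have f1 := ler_wpM2l e0 csr.
have g1 : 0 <= D * (1 + (del * tau)^-1) by exact: mulr_ge0.
have g2 : 0 <= D ^+ j * (del * (1 - tau))^-1 ^+ j by rewrite mulr_ge0// exprn_ge0.
apply: le_trans (ler_pM (mulr_ge0 e0 c1) (mulr_ge0 g1 g2) f1 (ler_pM g1 g2 b1 b2)) _.
have -> : 20 * eta * (3 * rho) * ((4 + 4 / tau) * (y ^+ 3 * E)) =
   60 * (4 + 4 / tau) * y ^+ 3 * eta * (rho * E) by ring.
have q0 : 0 <= 60 * (4 + 4 / tau) * y ^+ 3 * eta.
  by rewrite !mulr_ge0 ?exprn_ge0 ?(ltW y0)// addr_ge0// mulr_ge0// invr_ge0 ltW.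
apply: le_trans (ler_wpM2l q0 Erho) _.
have -> : 60 * (4 + 4 / tau) * y ^+ 3 * eta * expR (W + 1) =
  60 * C * (4 + 4 / tau) * expR 1 * (y ^+ 3 * y^-1 ^+ 16).
  rewrite expRD -mulrA (mulrA eta) etaE; ring.
apply: le_trans (ler_wpM2r _ y2) _; first by rewrite mulr_ge0// exprn_ge0// ?invr_ge0 ltW.
by rewrite le_eqVlt; apply/orP; left; apply/eqP; field; rewrite gt_eqF.
Qed.

Lemma window_term a K sigma tau W U del e rho C l1 l2 eta cs p j :
  0 < a <= 1 / 100 -> K * a ^+ 2 = 40 -> 0 < sigma <= 1 / 32 -> K * tau = sigma -> 0 < tau <= 1 / 2 ->
  1 <= W -> 0 < del <= 1 -> del * U = K * W -> 0 <= e <= del -> 1 <= rho -> 0 <= C -> 0 <= cs ->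
  e * U + ln rho <= W + 1 -> cs + 1 <= 3 * rho -> eta = C * expR (- (1 + 16 * sigma) * W) ->
  0 <= l1 -> l1 <= (1 - 16 * a) * U + 2 -> U - 1 <= l2 ->
  (1 - 12 * a) * (K * W) <= j%:R -> j%:R <= (1 - 4 * a) * (K * W) ->
  let y := expR (sigma * W) in j.+1%:R <= y ->
  (8 * y + 128 / a ^+ 2) * expR 3 <= y ^+ 2 -> 60 * C * (4 + 4 / tau) * expR 1 <= y ->
  p <= (j.+1%:R + 16 / (a ^+ 2 * del)) * (elow j del a l1 + ehigh j del a l2) +
    20 * (eta * (cs + 1) * (1 + (del * tau)^-1) * (del * (1 - tau))^-1 ^+ j) ->
  ((del + e) * (1 + tau)) ^+ j.+1 * p <= 2 * y^-1 ^+ 12.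
Proof.
move=> ha Ka /andP[s0 s1] Kt /andP[t0 t1] W1 hd dU /andP[e0 ed] rho1 C0 cs0 eU csr etaE l10 l1U l2U j1 j2 y jy
  y1 y2 hp.
have [a0 a1] := andP ha; have [d0 d1] := andP hd.
have K0 : 0 < K by rewrite -(pmulr_lgt0 (x := a ^+ 2)) ?exprn_gt0// Ka.
have KW0 : 0 <= K * W by rewrite mulr_ge0 ?(ltW K0)// (le_trans ler01).
have jU : j%:R <= del * U by rewrite dU; apply: le_trans j2 _; have := mulr_ge0 (ltW a0) KW0; clear; lra.
have y0 : 0 < y by exact: expR_gt0.
have El := elow_le ha Ka W1 hd dU l10 l1U j1.
have Eh := ehigh_le ha Ka W1 hd dU l2U j2.
pose D := (del + e) * (1 + tau).
have DD : 0 <= D <= 4 * del.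
  rewrite /D; clear -d0 e0 ed t0 t1; have -> : 4 * del = (2 * del) * 2 by ring.
  by apply/andP; split; [apply: mulr_ge0|apply: ler_pM]; lra.
have [D0 _] := andP DD.
pose E := expR (e * U).
have E0 : 0 < E by exact: expR_gt0.
have rho0 : 0 < rho := lt_le_trans ltr01 rho1.
have Erho : rho * E <= expR (W + 1).
  by rewrite -[rho](@lnK R) ?posrE// -expRD ler_expR addrC.
have E1 : E <= expR (W + 1) by apply: le_trans Erho; rewrite ler_peMl// ltW.
have DE : D ^+ j <= del ^+ j * (y * E).
  apply: le_trans (pow_ratio d0 e0 (ltW t0) jU) _.
  by rewrite dU /y /E -expRD; have -> : tau * (K * W) = sigma * W by rewrite -Kt; ring.
have D0j : 0 <= D ^+ j by exact: exprn_ge0.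
have dj : del ^+ j * del^-1 ^+ j = 1 by rewrite -exprMn divff ?expr1n// gt_eqF.
have part1 : D ^+ j.+1 * ((j.+1%:R + 16 / (a ^+ 2 * del)) * (elow j del a l1 + ehigh j del a l2)) <= y^-1 ^+ 12.
  have EE : 0 <= elow j del a l1 + ehigh j del a l2 <= 2 * (del^-1 ^+ j * expR (2 - 40 * W)).
    apply/andP; split; first by apply: addr_ge0; [exact: elow_ge0|exact: ehigh_ge0].
    by move: (lerD El Eh); clear; lra.
  apply: (tail_term a0 hd DD y0 jy DE E1 EE y1).
  rewrite /y -expRN -expRM_natl ler_expR.
  have : sigma * W <= 1 / 32 * W by rewrite ler_wpM2r// (le_trans ler01).
  clear -W1; lra.
have part2 : D ^+ j.+1 * (20 * (eta * (cs + 1) * (1 + (del * tau)^-1) * (del * (1 - tau))^-1 ^+ j)) <= y^-1 ^+ 12.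
  have tt : 0 < tau < 1 by rewrite t0; clear -t1; lra.
  (* [(1 - tau)^(- j) <= exp (2 tau j)], and [K tau = sigma] makes this at most [y^2]. *)
  have ty : (1 - tau)^-1 ^+ j <= y ^+ 2.
    apply: (@le_trans _ _ (expR (2 * tau * j%:R))).
      apply: invX_expR (erefl _); first by rewrite invr_ge0; clear -t1; lra.
      apply: le_trans (inv1B_le _) _; first by rewrite t1 ltW.
      by rewrite ler_expR; have := ler_wpM2l (ltW t0) t1; rewrite -expr2; clear; lra.
    rewrite -expRM_natl ler_expR -Kt; have := ler_wpM2l (ltW t0) jU; rewrite dU; clear; lra.
  have etaW : eta * expR W = C * y^-1 ^+ 16.
    by rewrite etaE -mulrA -expRD /y -expRN -expRM_natl; congr (_ * expR _); ring.
  exact: (middle_term hd DD y0 tt DE ty E0 rho0 Erho C0 cs0 csr etaW y2).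
have := ler_wpM2l (_ : 0 <= D ^+ j.+1) hp; rewrite exprn_ge0// => /(_ isT).
by rewrite mulrDr -/D; clear -part1 part2; lra.
Qed.

End Numerics.

Section Endgame.
Variable R : realType.
Implicit Types (K W del e d cs c C r h kap y D tau V : R) (i j m n : nat).

Lemma sum_le_const n B (P : pred nat) (F : nat -> R) : 0 <= B ->
  (forall i, (i < n)%N -> P i -> F i <= B) -> \sum_(i < n | P i) F i <= n%:R * B.
Proof.
move=> B0 h; apply: (@le_trans _ _ (\sum_(i < n) B)); last by rewrite sumr_const card_ord mulr_natl.
by rewrite big_mkcond; apply: ler_sum => i _; case: ifP => // /h; apply.
Qed.

(** Every quantity in the criterion excluding small roots is compared with powers of [y]. The Taylor
    tail [h^n] has to beat [128^m], a fixed exponential in [K W]; the indices from [m - n] on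
    contribute [y^(- 12)], which beats [128^n / kap^n <= y^2] and the numbers of terms. *)
Lemma endgame (f p : nat -> R[i]) K W del e cs c C r tau y m n :
  let d := del + e in let D := d * (1 + tau) in let h := 4 * del / r in
  let kap := tau / 8 * expR (-1) in
  (forall k, k.+1%:R * f k.+1 = \sum_(i < k.+1) f i * p (k - i)%N) ->
  0 < del -> 0 <= e <= del -> 0 < tau <= 1 -> 0 < c -> 0 < r -> 0 < cs -> 0 < C -> h <= 1 ->
  c * del <= cabs (f 0%N) ->
  (forall i, cabs (f i) <= C * cs * r^-1 ^+ i) ->
  (forall j, cabs (p j) <= (32 / del) ^+ j.+1) ->
  (forall i, cabs (f i) <= cabs (f 0%N) * (32 / del) ^+ i) ->
  cabs (\sum_(i < n.+1) f i * d%:C%C ^+ i) <= C * cs * (d / r) ^+ n.+1 ->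
  h ^+ n <= expR (- (7 * K + 2) * W) -> cs <= 3 * expR (W + 1) ->
  m%:R <= K * W -> m.+1%:R <= y -> (n <= m)%N -> 128 ^+ n <= y ^+ 2 * kap ^+ n ->
  (forall j, (m - n <= j)%N -> (j < m)%N -> D ^+ j.+1 * cabs (p j) <= 2 * y^-1 ^+ 12) ->
  expR (- W) <= y^-1 ^+ 16 -> 12 * expR 1 * C <= y * (r * c) -> 24 * expR 1 <= y -> False.
Proof.
move=> d D h kap rec del0 /andP[e0 ed] /andP[t0 t1] c0 r0 cs0 C0 h1 fc fC pB fB vB hn csW mK my nm kn pw yW yC y24.
have y1 : 1 <= y.
  apply: le_trans y24; have : 1 <= expR 1 :> R by rewrite -expR0 ler_expR.
  by clear; lra.
have y0 : 0 < y := lt_le_trans ltr01 y1.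
have f00 : 0 < cabs (f 0%N) by apply: lt_le_trans fc; exact: mulr_gt0.
have d0 : 0 < d by rewrite /d ltr_wpDr.
have D4 : D <= 4 * del.
  rewrite /D /d; have -> : 4 * del = (2 * del) * 2 by ring.
  by clear -del0 e0 ed t0 t1; apply: ler_pM; lra.
have D0 : 0 <= D by rewrite mulr_ge0 ?(ltW d0)// addr_ge0// ltW.
have dD : d <= 4 * del by rewrite /d; clear -del0 ed; lra.
have h0 : 0 <= h by rewrite divr_ge0 ?(ltW r0)// mulr_ge0// ltW.
have ratio i x : 0 <= x <= 4 * del -> x ^+ i * r^-1 ^+ i <= h ^+ i.
  move=> /andP[x0 x4]; rewrite -exprMn; apply: lerXn2r.
  - by rewrite nnegrE mulr_ge0// invr_ge0 ltW.
  - by rewrite nnegrE.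
  - by rewrite /h ler_wpM2r// invr_ge0 ltW.
have b0 : 0 <= 32 / del by rewrite divr_ge0// ltW.
have bD : 32 / del * D <= 128.
  apply: le_trans (ler_wpM2l b0 D4) _; rewrite le_eqVlt; apply/orP; left; apply/eqP; field.
  by rewrite gt_eqF.
pose V := C * cs * h ^+ n.+1.
have V0 : 0 <= V by rewrite mulr_ge0 ?exprn_ge0// mulr_ge0// ltW.
have vV : cabs (\sum_(i < n.+1) f i * d%:C%C ^+ i) <= V.
  apply: le_trans vB _; rewrite /V ler_wpM2l ?mulr_ge0 ?(ltW C0) ?(ltW cs0)//.
  by rewrite exprMn; apply: ratio; rewrite (ltW d0).
have N128 : 1 <= 128 ^+ m :> R by rewrite exprn_ege1// ler1n.
(* [128 = 2^7 <= e^7], whence the 7 in the exponent required of [h^n]. *)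
have m128 : 128 ^+ m <= expR (7 * K * W).
  apply: (@le_trans _ _ (expR (7 * m%:R))); last by rewrite ler_expR -mulrA ler_wpM2l.
  rewrite expRM_natr; apply: lerXn2r; rewrite ?nnegrE ?expR_ge0//.
  have e2 : 2 <= expR 1 :> R by have := expR_ge1Dx (1 : R).
  have -> : 128 = 2 ^+ 7 :> R by rewrite -natrX.
  have -> : expR 7 = expR 1 ^+ 7 :> R by rewrite -expRM_natl mulr1.
  by apply: lerXn2r; rewrite ?nnegrE ?expR_ge0.
(* After [128^m] is paid, [h^n] has [exp (- 2 W)] left: half of it covers [cs], the other half gives
   the powers of [y]. The extra factor [h], proportional to [del], matches the lower bound [c del]
   for the constant term. *)
have V128 : V * 128 ^+ m <= cabs (f 0%N) * y^-1 ^+ 15.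
  have s1 : h ^+ n * 128 ^+ m <= expR (- 2 * W).
    apply: le_trans (ler_pM _ _ hn m128) _; rewrite ?exprn_ge0//.
    by rewrite -expRD ler_expR le_eqVlt; apply/orP; left; apply/eqP; ring.
  have -> : V * 128 ^+ m = C * h * (cs * (h ^+ n * 128 ^+ m)) by rewrite /V exprS; ring.
  have Ch : 0 <= C * h by rewrite mulr_ge0// ltW.
  have s2 : cs * (h ^+ n * 128 ^+ m) <= 3 * expR 1 * expR (- W).
    apply: le_trans (ler_pM (ltW cs0) _ csW s1) _.
      by rewrite mulr_ge0// exprn_ge0.
    rewrite -!mulrA ler_wpM2l// -!expRD ler_expR.
    by clear; lra.
  apply: le_trans (ler_wpM2l Ch s2) _.
  have -> : C * h * (3 * expR 1 * expR (- W)) = 12 * expR 1 * C * (del / r * expR (- W)).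
    by rewrite /h; ring.
  have dr : 0 <= del / r by rewrite divr_ge0// ltW.
  apply: le_trans (ler_wpM2r _ yC) _; first by rewrite mulr_ge0 ?expR_ge0.
  have -> : y * (r * c) * (del / r * expR (- W)) = c * del * (y * expR (- W)).
    by field; rewrite gt_eqF.
  apply: ler_pM; rewrite ?mulr_ge0 ?expR_ge0 ?(ltW c0) ?(ltW del0) ?(ltW y0)//.
  apply: le_trans (ler_wpM2l (ltW y0) yW) _.
  by rewrite le_eqVlt; apply/orP; left; apply/eqP; field; rewrite gt_eqF.
have iy0 : 0 <= y^-1 by rewrite invr_ge0 ltW.
have iy1 : y^-1 <= 1 by rewrite invf_le1.
pose S := \sum_(i < m.+1 | (n < i)%N) cabs (f i) * D ^+ i.
have S0 : 0 <= S by apply: sumr_ge0 => i _; rewrite mulr_ge0 ?cabs_ge0// exprn_ge0.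
have SV : S <= y * V.
  have hh i : (i < m.+1)%N -> (n < i)%N -> cabs (f i) * D ^+ i <= V.
    move=> im ni; apply: le_trans (ler_wpM2r _ (fC i)) _; first by rewrite exprn_ge0.
    rewrite -[leLHS]mulrA /V ler_wpM2l ?mulr_ge0 ?(ltW C0) ?(ltW cs0)// mulrC.
    apply: le_trans (ratio i D _) _; first by rewrite D0.
    by rewrite ler_wiXn2l.
  apply: le_trans (@sum_le_const m.+1 V (fun i => (n < i)%N) (fun i => cabs (f i) * D ^+ i) V0 hh) _.
  by rewrite ler_wpM2r.
pose Cc := \sum_(j < m) cabs (p j) * D ^+ j.
have DC : D * Cc <= y * 128 ^+ m.
  rewrite /Cc mulr_sumr; apply: (@le_trans _ _ (m%:R * 128 ^+ m)).
    apply: (@sum_le_const m _ predT (fun j => D * (cabs (p j) * D ^+ j))) => [|j jm _]; first by rewrite exprn_ge0.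
    rewrite mulrCA -exprS.
    apply: le_trans (ler_wpM2r _ (pB j)) _; first by rewrite exprn_ge0.
    rewrite -exprMn; apply: (@le_trans _ _ (128 ^+ j.+1)).
      by apply: lerXn2r; rewrite ?nnegrE//; apply: mulr_ge0.
    by rewrite ler_weXn2l// ler1n.
  rewrite ler_wpM2r ?exprn_ge0//; apply: le_trans my; by rewrite ler_nat.
pose Af := \sum_(i < n.+1) cabs (f i) * D ^+ i.
have AfB : Af <= cabs (f 0%N) * (y * 128 ^+ n).
  apply: (@le_trans _ _ (n.+1%:R * (cabs (f 0%N) * 128 ^+ n))).
    apply: (@sum_le_const n.+1 _ predT (fun i => cabs (f i) * D ^+ i)) => [|i im _].
      by rewrite mulr_ge0 ?(ltW f00)// exprn_ge0.
    apply: le_trans (ler_wpM2r _ (fB i)) _; first by rewrite exprn_ge0.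
    rewrite -[leLHS]mulrA -exprMn ler_wpM2l ?(ltW f00)//; apply: (@le_trans _ _ (128 ^+ i)).
      by apply: lerXn2r; rewrite ?nnegrE//; apply: mulr_ge0.
    by rewrite ler_weXn2l// ?ler1n// -ltnS.
  rewrite mulrCA ler_wpM2l ?(ltW f00)// ler_wpM2r ?exprn_ge0//.
  by apply: le_trans my; rewrite ler_nat ltnS.
pose w := \sum_(j < m | (m - n <= j)%N) cabs (p j) * D ^+ j.
have w0 : 0 <= w by apply: sumr_ge0 => i _; rewrite mulr_ge0 ?cabs_ge0// exprn_ge0.
have Dw : D * w <= y * (2 * y^-1 ^+ 12).
  rewrite /w mulr_sumr; apply: (@le_trans _ _ (m%:R * (2 * y^-1 ^+ 12))).
    apply: (@sum_le_const m _ (fun j => (m - n <= j)%N) (fun j => D * (cabs (p j) * D ^+ j))) => [|j jm hj].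
      by rewrite mulr_ge0// exprn_ge0.
    by rewrite mulrCA -exprS mulrC; exact: pw.
  rewrite ler_wpM2r ?mulr_ge0 ?exprn_ge0//; apply: le_trans my; by rewrite ler_nat.
have kap0 : 0 < kap by rewrite /kap mulr_gt0 ?expR_gt0// divr_gt0.
pose q := kap ^+ n; have q0 : 0 < q by exact: exprn_gt0.
have q1 : y^-1 ^+ 2 <= q.
  have : 1 <= y ^+ 2 * q by apply: le_trans kn; rewrite exprn_ege1// ler1n.
  move=> /(ler_wpM2l (exprn_ge0 2 iy0)); rewrite mulr1 => h2; apply: le_trans h2 _.
  by rewrite le_eqVlt; apply/orP; left; apply/eqP; field; rewrite gt_eqF.
have Af0 : 0 <= Af by apply: sumr_ge0 => i _; rewrite mulr_ge0 ?cabs_ge0// exprn_ge0.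
have P1 : D * (Af * w) <= cabs (f 0%N) * (2 * y^-1 ^+ 8 * q).
  rewrite mulrCA; apply: le_trans (ler_pM Af0 (mulr_ge0 D0 w0) AfB Dw) _.
  rewrite -[leLHS]mulrA ler_wpM2l ?(ltW f00)//.
  have yy : 0 <= y * (y * (2 * y^-1 ^+ 12)) by rewrite !mulr_ge0 ?exprn_ge0// ltW.
  apply: (@le_trans _ _ ((y ^+ 2 * q) * (y * (y * (2 * y^-1 ^+ 12))))).
    have -> : y * 128 ^+ n * (y * (2 * y^-1 ^+ 12)) = 128 ^+ n * (y * (y * (2 * y^-1 ^+ 12))) by ring.
    by rewrite ler_wpM2r.
  by rewrite le_eqVlt; apply/orP; left; apply/eqP; field; rewrite gt_eqF.
pose v := \sum_(i < n.+1) f i * d%:C%C ^+ i.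
have P2 : m%:R * S + (2 * S + cabs v) * (D * Cc) <= cabs (f 0%N) * (4 * y^-1 ^+ 13).
  have my' : m%:R <= y by apply: le_trans my; rewrite ler_nat.
  have y2 : y <= y ^+ 2 by rewrite expr2 ler_peMl// ltW.
  apply: (@le_trans _ _ (4 * y ^+ 2 * (V * 128 ^+ m))).
    have a1 : m%:R * S <= y ^+ 2 * (V * 128 ^+ m).
      have -> : y ^+ 2 * (V * 128 ^+ m) = y * (y * V * 128 ^+ m) by ring.
      apply: ler_pM => //; apply: le_trans SV _; by rewrite ler_peMr// mulr_ge0// (ltW y0).
    have a2 : (2 * S + cabs v) * (D * Cc) <= (3 * y * V) * (y * 128 ^+ m).
      apply: ler_pM => //; first by rewrite addr_ge0 ?cabs_ge0// mulr_ge0.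
        by rewrite mulr_ge0// sumr_ge0// => i _; rewrite mulr_ge0 ?cabs_ge0// exprn_ge0.
      have : V <= y * V by rewrite ler_peMl.
      by move: SV vV; rewrite -/v; clear; lra.
    have -> : 4 * y ^+ 2 * (V * 128 ^+ m) = y ^+ 2 * (V * 128 ^+ m) + 3 * y * V * (y * 128 ^+ m) by ring.
    exact: lerD.
  apply: le_trans (ler_wpM2l _ V128) _; first by rewrite mulr_ge0// exprn_ge0// ltW.
  by rewrite le_eqVlt; apply/orP; left; apply/eqP; field; rewrite gt_eqF.
have ty : tau <= 1 by [].
have iyy k : y^-1 ^+ k.+1 <= y^-1 by rewrite exprS ler_piMr// exprn_ile1.
apply: (@no_small_root _ f p d tau n m nm d0 _ rec) => //.
- by rewrite t0.
- by rewrite -cabs_gt0.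
- apply: le_trans vV _; apply: (@le_trans _ _ (V * 128 ^+ m)); first by rewrite ler_peMr.
  apply: le_trans V128 _; rewrite ler_wpM2l ?(ltW f00)//.
  apply: le_trans (iyy 14) _; rewrite lef_pV2 ?posrE//.
  apply: le_trans y24; have : 1 <= expR 1 :> R by rewrite -expR0 ler_expR.
  by clear; lra.
- rewrite -/D -/Af -/w -/S -/v -/Cc -/kap -/q.
  apply: (@le_trans _ _ (cabs (f 0%N) * (6 * (y^-1 * q)))).
    have g1 : cabs (f 0%N) * (2 * y^-1 ^+ 8 * q) <= cabs (f 0%N) * (2 * (y^-1 * q)).
      by rewrite ler_wpM2l ?(ltW f00)// -mulrA ler_wpM2l// ler_wpM2r ?(ltW q0).
    have g2 : cabs (f 0%N) * (4 * y^-1 ^+ 13) <= cabs (f 0%N) * (4 * (y^-1 * q)).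
      rewrite ler_wpM2l ?(ltW f00)// ler_wpM2l// (exprD _ 11 2).
      by apply: ler_pM; rewrite ?exprn_ge0.
    by move: P1 P2 g1 g2; clear; lra.
  have -> : cabs (f 0%N) / 4 * (expR (-1) * q) = cabs (f 0%N) * (expR (-1) / 4 * q) by ring.
  rewrite ler_wpM2l ?(ltW f00)// mulrA ler_wpM2r ?(ltW q0)//.
  rewrite -(ler_pM2r y0) -mulrA mulVf ?mulr1 ?gt_eqF//.
  have := ler_wpM2l (expR_ge0 (-1 : R)) y24.
  have -> : expR (-1) * (24 * expR 1) = 24 * (expR (-1) * expR 1) :> R by ring.
  rewrite -expRD addNr expR0; clear; lra.
Qed.

End Endgame.

(** * Conclusion *)

Lemma nat_floor (R : realType) (x : R) : 0 <= x -> exists n : nat, n%:R <= x < n%:R + 1.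
Proof.
by move=> x0; exists (Num.truncn x); rewrite natr1; exact: truncn_itv.
Qed.

Lemma ln_theta_le0 (R : realType) (G : beurlingSystem R) (kappa A theta : R) :
  axiomA G kappa A theta -> ln theta <= 0.
Proof. by case=> _ _ /andP[t0 t1] _; rewrite -ln1 ler_ln ?posrE ?ltW. Qed.

(** By concavity [omega] is at least [(1 - eps/4) W + ln theta] from [X^(1 - eps/4)] on, and
    [(1 + eps) (1 - eps/4) >= 1 + eps/2]. The term in [ln theta <= 0] goes into
    [expR (- 2 * ln theta)]. *)
Lemma Delta_window (R : realType) (G : beurlingSystem R) (kappa A theta eps X : R) :
  axiomA G kappa A theta -> theta0 G theta = 1 ->
  0 < eps < 1 / 100 -> 1 < X -> 1 <= omega G theta X -> 8 * omega G theta X <= ln X ->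
  4 <= eps * ln X ->
  (forall y, X `^ (1 - eps) <= y <= X -> `|Delta G y| < y * expR (- (1 + eps) * omega G theta y)) ->
  let eta := expR (- 2 * ln theta) * expR (- (1 + eps / 2) * omega G theta X) in
  exists n1, exists n2, [/\ (0 < n1 <= n2)%N, ln n1%:R <= (1 - eps / 4) * ln X + 2,
    ln X - 1 <= ln n2%:R, 1 <= eta * n1%:R &
    forall n, (n1 <= n <= n2)%N -> `|Delta G n%:R| <= eta * n%:R].
Proof.
move=> hA htheta0 /andP[e0 e1] X1; have X0 : 0 < X := lt_trans ltr01 X1.
have := ln_theta_le0 hA; have := omega_concave hA htheta0 X1.
have XE : X = expR (ln X) by rewrite lnK.
have XpE : X `^ (1 - eps) = expR ((1 - eps) * ln X) by rewrite /powR gt_eqF.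
move: (ln X) XE XpE (omega G theta X) => U XE XpE W conc lt W1 WU eU hyp eta.
have U8 : 8 <= U by clear -W1 WU; lra.
pose v := (1 - eps / 4) * U.
have v4 : 4 * W <= v.
  have : eps / 4 * U <= 1 / 2 * U by rewrite ler_wpM2r//; clear -e1 U8; lra.
  by rewrite /v; clear -WU; lra.
have vU : v + 1 <= U by rewrite /v; clear -eU; lra.
have v0 : 0 <= v by clear -v4 W1; lra.
have e2 : 2 <= expR 1 :> R by have := expR_ge1Dx (1 : R); lra.
have [k /andP[k1 k2]] := nat_floor (expR_ge0 v).
have [n2 /andP[n21 n22]] := nat_floor (ltW X0).
have ev1 : 1 <= expR v by rewrite -[leLHS]expR0 ler_expR.
have k1R : k.+1%:R <= 2 * expR v by rewrite -natr1; clear -k1 ev1; lra.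
have evX : 2 * expR v <= X.
  rewrite XE; apply: (@le_trans _ _ (expR 1 * expR v)); first by rewrite ler_wpM2r ?expR_ge0.
  by rewrite -expRD ler_expR addrC.
have kn2 : (k.+1 <= n2)%N.
  by rewrite -ltnS -(ltr_nat R) -[n2.+1%:R]natr1 (le_lt_trans k1R)// (le_lt_trans evX).
have kR : expR v <= k.+1%:R by rewrite -natr1 ltW.
have C1 : 1 <= expR (- 2 * ln theta) by rewrite -[leLHS]expR0 ler_expR; clear -lt; lra.
(* The first integer above [X^(1 - eps/4)], and the integer part of [X]. *)
exists k.+1, n2; split.
- by rewrite kn2.
- rewrite -[leRHS]expRK ler_ln ?posrE ?expR_gt0// (le_trans k1R)// -/v.
  apply: (@le_trans _ _ (expR 1 * expR v)); first by rewrite ler_wpM2r ?expR_ge0.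
  by rewrite -expRD ler_expR; lra.
- rewrite -[leLHS]expRK ler_ln ?posrE ?expR_gt0// ?ltr0n ?(leq_trans _ kn2)//.
  rewrite -(ler_pM2l (expR_gt0 1)) -expRD.
  have -> : 1 + (U - 1) = U by ring.
  rewrite -XE; have n21' : 1 <= n2%:R :> R by rewrite ler1n (leq_trans _ kn2).
  apply: (@le_trans _ _ (2 * n2%:R)); first by clear -n22 n21'; lra.
  by rewrite ler_wpM2r.
- apply: (@le_trans _ _ (expR (- (1 + eps / 2) * W) * expR v)).
    rewrite -expRD -[leLHS]expR0 ler_expR.
    have : eps / 2 * W <= 1 * W by rewrite ler_wpM2r//; clear -e1 W1; lra.
    by clear -v4 W1; lra.
  apply: ler_pM; rewrite ?expR_ge0// /eta ler_peMl// expR_ge0.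
- move=> n /andP[kn nn2].
  have nR : expR v <= n%:R by apply: le_trans kR _; rewrite ler_nat.
  have n1 : 1 <= n%:R :> R by apply: le_trans nR.
  have n0 : 0 < n%:R :> R by exact: lt_le_trans n1.
  have nX : n%:R <= X by apply: le_trans n21; rewrite ler_nat.
  have Xn : X `^ (1 - eps) <= n%:R.
    rewrite XpE; apply: le_trans nR; rewrite ler_expR /v ler_wpM2r//; first by clear -U8; lra.
    by clear -e0; lra.
  have := hyp n%:R; rewrite Xn nX => /(_ isT)/ltW h; apply: le_trans h _.
  rewrite mulrC ler_wpM2r// /eta -expRD ler_expR.
  have := conc n%:R; rewrite n1 nX => /(_ isT).
  have lnv : v <= ln n%:R by rewrite -[leLHS]expRK ler_ln ?posrE ?expR_gt0.
  have lnU : ln n%:R <= U by rewrite -[leRHS]expRK -XE ler_ln ?posrE.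
  have U0 : 0 < U by clear -U8; lra.
  have u1 : 1 - eps / 4 <= ln n%:R / U by rewrite ler_pdivlMr.
  have u2 : ln n%:R / U <= 1 by rewrite ler_pdivrMr// mul1r.
  move: u1 u2; generalize (ln n%:R / U) => u u1 u2 hom.
  have W0 : 0 <= W by clear -W1; lra.
  have h1 := ler_wpM2r W0 u1.
  have h2 : ln theta <= (1 - u) * ln theta by clear -u1 u2 lt e0 e1; nra.
  have h3 : (1 - eps / 4) * W + ln theta <= omega G theta n%:R by clear -hom h1 h2; lra.
  have ee : 0 <= 1 + eps by clear -e0; lra.
  have h4 := ler_wpM2l ee h3.
  have h5 : eps * ln theta >= ln theta by clear -lt e1; nra.
  have h6 : 0 <= (eps / 4 - eps ^+ 2 / 4) * W.
    have e22 : eps * eps <= eps * 1 by apply: ler_wpM2l; [exact: ltW|clear -e1; lra].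
    by apply: mulr_ge0 => //; rewrite expr2; clear -e22; lra.
  by move: h4 h5 h6; clear; lra.
Qed.


(** The constants are parameters subject to the inequalities they must satisfy, which separates
    their choice from the argument. *)
Lemma contradiction_at (R : realType) (G : beurlingSystem R) (kappa A theta eps X : R)
    (a1 C c a2 eta1 a K sigma tau kap lam nu del : R) :
  axiomA G kappa A theta -> theta0 G theta = 1 ->
  (forall s del, complex.Re s = 1 + del -> 0 < del <= a1 -> 1 <= cabs (s - 1) ->
  [/\ c * del <= cabs (zcoef G kappa 0 s),
      forall i, cabs (zcoef G kappa i s) <= C * cabs s * ((1 - theta) / 2)^-1 ^+ i,
      forall j, cabs (pcoef G j s) <= (32 / del) ^+ j.+1 &
      forall d n, 0 < d <= (1 - theta) / 2 -> 1 <= cabs (s - d%:C%C - 1) ->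
        Z G kappa (s - d%:C%C) = 0 ->
        cabs (\sum_(i < n.+1) zcoef G kappa i s * d%:C%C ^+ i) <= C * cabs s * (d / ((1 - theta) / 2)) ^+ n.+1]) ->
  (forall j s del a tau eta n1 n2,
  complex.Re s = 1 + del -> 0 < del <= a2 -> 1 <= cabs (s - 1) -> 0 < a <= 1 / 2 -> 0 < tau < 1 ->
  (0 < n1 <= n2)%N -> 1 <= eta * n1%:R ->
  (forall n, (n1 <= n <= n2)%N -> `|Delta G n%:R| <= eta * n%:R) ->
  cabs (pcoef G j s) <=
    (j.+1%:R + 16 / (a ^+ 2 * del)) * (elow j del a (ln n1%:R) + ehigh j del a (ln n2%:R)) +
    20 * (eta * (cabs s + 1) * (1 + (del * tau)^-1) * (del * (1 - tau))^-1 ^+ j)) ->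
  (forall rho, zeta_zero G theta rho -> `|complex.Im rho| <= 1 -> eta1 <= 1 - complex.Re rho) ->
  0 < eps < 1 / 100 -> a = eps / 64 -> K * a ^+ 2 = 40 -> sigma = eps / 32 -> K * tau = sigma ->
  kap = tau / 8 * expR (-1) -> expR lam = 128 / kap -> 0 < nu <= 1 -> nu * lam <= sigma ->
  1 <= C -> 0 < c -> a1 <= 1 / 2 -> 1 < X ->
  let W := omega G theta X in let U := ln X in let y := expR (sigma * W) in
  del * U = K * W -> 0 < del -> del <= a1 -> del <= a2 ->
  4 * del / ((1 - theta) / 2) <= expR (- (7 * K + 2) / nu) ->
  1 <= W -> 8 * W <= U -> 4 <= eps * U -> W + 1 - ln theta < eta1 * U ->
  K * W + 1 <= y -> (8 * y + 128 / a ^+ 2) * expR 3 <= y ^+ 2 ->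
  60 * expR (- 2 * ln theta) * (4 + 4 / tau) * expR 1 <= y ->
  12 * expR 1 * C <= y * ((1 - theta) / 2 * c) -> 24 * expR 1 <= y -> 128 / kap <= y ->
  (forall z, X `^ (1 - eps) <= z <= X -> `|Delta G z| < z * expR (- (1 + eps) * omega G theta z)) -> False.
Proof.
move=> hA htheta0 HB HW hgap he aE Ka sE Kt kapE lamE hnu nulam C1 c0 a12 X1.
have X0 : 0 < X := lt_trans ltr01 X1.
have [rho hz hrho] := omega_attained hA htheta0 (ltW X1).
move=> W U y dU d0 da1 da2 dh W1 WU eU gU Ky y1 y2 y3 y4 y5 hyp.
have [n1 [n2 [n12 l1 l2 en hD]]] := Delta_window hA htheta0 he X1 W1 WU eU hyp.
have lt := ln_theta_le0 hA.
have rhoZ := zero_Z hA hz; have rho1 := zero_Re_lt1 hA hz; have rhoT := zero_ln_ge hA hz.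
have gap := hgap rho hz.
move: hrho en hD l1 l2; rewrite /phi -/W -/U.
move: W U @y dU WU eU gU W1 Ky y1 y2 y3 y4 y5 {hyp} => W U y dU WU eU gU W1 Ky y1 y2 y3 y4 y5.
set eta := expR _ * expR _ => hrho en hD l1 l2.
have [e0 e1] := andP he; have [nu0 nu1] := andP hnu.
have a0 : 0 < a by rewrite aE divr_gt0.
have ha : 0 < a <= 1 / 100 by rewrite a0 aE; clear -e1; lra.
have K0 : 0 < K by rewrite -(pmulr_lgt0 (x := a ^+ 2)) ?exprn_gt0// Ka.
have U0 : 0 < U by clear -W1 WU; lra.
have aK : a * K * a = 40 by rewrite -Ka; ring.
have aK4 : 4000 <= K * a.
  rewrite -(ler_pM2r a0) -mulrA -expr2 Ka; clear -ha; case/andP: ha; lra.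
have K4 : 4000 <= K.
  by apply: le_trans aK4 _; rewrite ler_piMr ?(ltW K0)//; clear -ha; case/andP: ha; lra.
have s0 : 0 < sigma by rewrite sE divr_gt0.
have hs : 0 < sigma <= 1 / 32 by rewrite s0 sE; clear -e1; lra.
have tau0 : 0 < tau by rewrite -(pmulr_lgt0 (x := K)) 1?mulrC ?Kt.
have tauh : tau <= 1 / 2.
  rewrite -(ler_pM2l K0) Kt; clear -K4 hs; case/andP: hs; lra.
have ht : 0 < tau <= 1 / 2 by rewrite tau0.
have ht1 : 0 < tau < 1 by rewrite tau0; clear -tauh; lra.
have ht2 : 0 < tau <= 1 by rewrite tau0; clear -tauh; lra.
have y0 : 0 < y by exact: expR_gt0.
(* Since [eta1 U > W + 1 - ln theta], the near-minimizer lies above height 1. *)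
have im1 : 1 <= `|complex.Im rho|.
  rewrite leNgt; apply/negP => /ltW/gap h; have := ler_wpM2r (ltW U0) h.
  by clear -gU hrho rhoT; lra.
pose e := 1 - complex.Re rho; have ee : 0 <= e by rewrite subr_ge0 ltW.
have rhoc : 1 <= cabs rho := le_trans im1 (Im_le_cabs rho).
have rhol : 0 <= ln (cabs rho) by exact: ln_ge0.
have eU1 : e * U + ln (cabs rho) <= W + 1 by [].
(* [e U <= W + 1 <= 2 W], far below [del U = K W]. *)
have ed : e <= del.
  rewrite -(ler_pM2r U0) dU; apply: (@le_trans _ _ (2 * W)); first by clear -eU1 rhol W1; lra.
  by rewrite ler_wpM2r//; clear -W1 K4; lra.
have hed : 0 <= e <= del by rewrite ee.
have hd1 : 0 < del <= 1 by rewrite d0; clear -da1 a12; lra.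
pose d := del + e; pose s := rho + d%:C%C.
have dp : 0 < d by rewrite /d ltr_wpDr.
have sRe : complex.Re s = 1 + del by rewrite ReD /= /d /e; ring.
have sIm z : 1 <= cabs (rho + z%:C%C - 1).
  by apply: le_trans im1 _; apply: le_trans (Im_le_cabs _); rewrite ImB ImD /= addr0 subr0.
have s1 : 1 <= cabs (s - 1) by exact: sIm.
have sd : s - d%:C%C = rho by rewrite addrK.
have da1' : 0 < del <= a1 by rewrite d0.
have rho11 : 1 <= cabs (s - d%:C%C - 1).
  rewrite sd; apply: le_trans im1 _; apply: le_trans (Im_le_cabs _).
  by rewrite ImB /= subr0.
have Z0 : Z G kappa (s - d%:C%C) = 0 by rewrite sd.
have [B1 B2 B3 B4] := HB s del sRe da1' s1.
have cs2 : cabs s <= 2 * cabs rho.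
  apply: le_trans (cabsD _ _) _; rewrite cabs_real gtr0_norm//.
  by rewrite /d; clear -ed da1 a12 rhoc; lra.
have cs0 : 0 < cabs s.
  apply: lt_le_trans ltr01 _; apply: le_trans im1 _; apply: le_trans (Im_le_cabs _).
  by rewrite ImD /= addr0.
have rhoW : cabs rho <= expR (W + 1).
  rewrite -[leLHS](@lnK R) ?posrE ?(lt_le_trans ltr01)// ler_expR.
  by have := mulr_ge0 ee (ltW U0); clear -eU1; lra.
pose r := (1 - theta) / 2.
have r0 : 0 < r by case: hA => _ _ /andP[_ t1] _; rewrite divr_gt0 ?subr_gt0.
have L0 : 0 <= (7 * K + 2) / nu by rewrite divr_ge0 ?(ltW nu0)//; clear -K0; lra.
have h1 : 4 * del / r <= 1.
  by apply: le_trans dh _; rewrite -[leRHS]expR0 ler_expR mulNr oppr_le0.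
have dr : 0 < d <= r.
  rewrite dp /=; move: h1; rewrite ler_pdivrMr// mul1r /d; clear -ed d0; lra.
have s11 : 1 < complex.Re s by rewrite sRe ltrDl.
have b0 : 0 <= 32 / del by rewrite divr_ge0// ltW.
have B5 := zcoef_growth hA s11 b0 B3.
pose k := K * W.
have k0 : 4000 * W <= k by rewrite ler_wpM2r//; clear -W1; lra.
have kp : 0 <= k by clear -k0 W1; lra.
have a4k : 0 <= (1 - 4 * a) * k.
  by apply: mulr_ge0; [clear -ha; case/andP: ha; lra|clear -k0 W1; lra].
(* The index [k = K W] has its peak at [log |g| = U]; [m] stays below it by the relative margin
   [4 a]. *)
have [m /andP[m1 m2]] := nat_floor a4k.
have [n' /andP[n1' n2']] := nat_floor (mulr_ge0 (ltW nu0) (le_trans ler01 W1)).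
(* The successor guarantees [nu W <= n], on which the smallness of [h^n] rests, at the cost of
   [n <= nu W + 1]. *)
pose n := n'.+1.
have nR : n%:R <= W + 1.
  rewrite /n -natr1; have : nu * W <= 1 * W by rewrite ler_wpM2r// (le_trans ler01).
  by clear -n1'; lra.
have nuR : nu * W <= n%:R by rewrite /n -natr1 ltW.
have a4 : a * k <= 1 / 100 * k by rewrite ler_wpM2r; [|clear -k0 W1; lra|case/andP: ha].
have mk : m%:R <= k by apply: le_trans m1 _; have := mulr_ge0 (ltW a0) kp; clear; lra.
have nm : (n <= m)%N.
  by rewrite -(ler_nat R); clear -nR m2 a4 k0 W1; lra.
have ak : 4000 * W <= a * k.
  by rewrite /k mulrA ler_wpM2r ?(le_trans ler01)// mulrC.
apply: (@endgame R (fun i => zcoef G kappa i s) (fun j => pcoef G j s) K W del e (cabs s) c C r tau y m n) => //.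
- by move=> k'; exact: (pcoef_recursion hA).
- by apply: lt_le_trans C1.
- exact: B4 dr rho11 Z0.
- apply: (@le_trans _ _ (expR (- (7 * K + 2) / nu) ^+ n)).
    by apply: lerXn2r; rewrite ?nnegrE ?expR_ge0// divr_ge0 ?(ltW r0)// mulr_ge0// ltW.
  rewrite -expRM_natr ler_expR !mulNr lerN2.
  have -> : (7 * K + 2) / nu * n%:R = (7 * K + 2) / nu * n%:R by [].
  apply: le_trans (ler_wpM2l L0 nuR).
  by rewrite le_eqVlt; apply/orP; left; apply/eqP; field; rewrite gt_eqF.
- by apply: le_trans cs2 _; have := expR_ge0 (W + 1); clear -rhoW; lra.
- by apply: le_trans Ky; rewrite -natr1 lerD2r.
- have kap0 : 0 < kap by rewrite kapE mulr_gt0 ?expR_gt0// divr_gt0.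
  (* [(128 / kap)^n = exp (lam n)], and [n <= nu W + 1] with [nu lam <= sigma] bounds it by
     [y exp lam <= y^2]. *)
  rewrite -kapE -ler_pdivrMr ?exprn_gt0// -expr_div_n -lamE -expRM_natr.
  apply: (@le_trans _ _ (expR (sigma * W + lam))).
    rewrite ler_expR /n -natr1 mulrDr mulr1 lerD2r.
    have lam0 : 0 <= lam.
      rewrite -ler_expR expR0 lamE ler_pdivlMr// mul1r kapE.
      have e11 : expR (-1) <= 1 :> R by rewrite -[leRHS]expR0 ler_expR.
      have : tau / 8 * expR (-1) <= tau / 8 * 1 by rewrite ler_wpM2l// divr_ge0// ltW.
      by clear -tauh; lra.
    apply: le_trans (ler_wpM2l lam0 n1') _.
    have := ler_wpM2r (le_trans ler01 W1) nulam; clear; lra.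
  by rewrite expRD lamE expr2 ler_wpM2l ?(ltW y0).
- move=> j hj jm.
  have jm' : j.+1%:R <= m%:R :> R by rewrite ler_nat.
  have jn : m%:R <= j%:R + n%:R :> R by rewrite -natrD ler_nat addnC -leq_subLR.
  have n10 : (0 < n1)%N by case/andP: n12.
  (* [n] and the rounding cost at most [W + 2], little against the margin [8 a K W], as
     [a K >= 4000]. *)
  have j1 : (1 - 12 * a) * k <= j%:R by clear -jn nR m2 ak W1; lra.
  have j2 : j%:R <= (1 - 4 * a) * k by apply: le_trans m1; rewrite ler_nat ltnW.
  have jy : j.+1%:R <= y by apply: le_trans jm' _; apply: le_trans mk _; apply: le_trans Ky; rewrite lerDl.
  have ha2 : 0 < a <= 1 / 2 by rewrite a0; clear -ha; case/andP: ha; lra.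
  have hda2 : 0 < del <= a2 by rewrite d0.
  have hp := HW j s del a tau eta n1 n2 sRe hda2 s1 ha2 ht1 n12 en hD.
  have l10 : 0 <= ln (n1%:R : R) by rewrite ln_ge0// ler1n.
  have lE : 1 - eps / 4 = 1 - 16 * a by rewrite aE; field.
  rewrite lE in l1.
  have etaE : eta = expR (- 2 * ln theta) * expR (- (1 + 16 * sigma) * W).
    have -> : 16 * sigma = eps / 2 by rewrite sE; clear; lra.
    by [].
  have cs3 : cabs s + 1 <= 3 * cabs rho by clear -cs2 rhoc; lra.
  exact: (window_term ha Ka hs Kt ht W1 hd1 dU hed rhoc (expR_ge0 (- 2 * ln theta)) (ltW cs0) eU1 cs3 etaE
    l10 l1 l2 j1 j2 jy y1 y2 hp).
- apply: le_trans (_ : expR (- (16%:R * (sigma * W))) <= _).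
    rewrite ler_expR lerN2; case/andP: hs => _ h; have := ler_wpM2r (le_trans ler01 W1) h.
    by clear -W1; lra.
  by rewrite expRN expRM_natl exprVn.
Qed.

Theorem theorem11 (R : realType) (G : beurlingSystem R)
    (kappa A theta : R) (hA : axiomA G kappa A theta)
    (htheta0 : theta0 G theta = 1)
    (eps : R) (heps : 0 < eps < 1 / 100 * (1 - theta)) :
  exists x0 : R, forall x : R, x0 < x ->
    exists2 y : R, x `^ (1 - eps) <= y <= x &
      y * expR (- (1 + eps) * omega G theta y) <= `|Delta G y|.
Proof.
have [_ _ /andP[t0 t1] _] := hA; have [e0 e1] := andP heps.
have he : 0 < eps < 1 / 100 by rewrite e0; clear -e1 t0; lra.
have [a1 [C [c [/andP[a10 a1h] C1 c0 HB]]]] := coef_bounds hA.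
have [a2 /andP[a20 _] HW] := pcoef_window hA.
have [eta1 eta10 hgap] := zero_gap hA 1.
have lt := ln_theta_le0 hA.
have r0 : 0 < (1 - theta) / 2 by rewrite divr_gt0 ?subr_gt0.
have [a [a0 aE]] : exists a, 0 < a /\ a = eps / 64 by exists (eps / 64); rewrite divr_gt0.
have a20' : 0 < a ^+ 2 by exact: exprn_gt0.
have [K [K0 Ka]] : exists K, 0 < K /\ K * a ^+ 2 = 40.
  by exists (40 / a ^+ 2); rewrite divr_gt0// divfK// gt_eqF.
have [sigma [s0 sE]] : exists sigma, 0 < sigma /\ sigma = eps / 32.
  by exists (eps / 32); rewrite divr_gt0.
have [tau [tau0 Kt]] : exists tau, 0 < tau /\ K * tau = sigma.
  by exists (sigma / K); rewrite divr_gt0// mulrC divfK// gt_eqF.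
have [kap [kap0 kapE]] : exists kap, 0 < kap /\ kap = tau / 8 * expR (-1).
  by exists (tau / 8 * expR (-1)); rewrite mulr_gt0 ?expR_gt0// divr_gt0.
have lamE : expR (ln (128 / kap)) = 128 / kap by rewrite lnK// posrE divr_gt0.
have [nu [nu0 nu1 nul]] : exists nu, [/\ 0 < nu, nu <= 1 & nu * ln (128 / kap) <= sigma].
  have [l0|l0] := leP (ln (128 / kap)) 0.
    by exists 1; split=> //; rewrite mul1r (le_trans l0)// ltW.
  exists (Num.min 1 (sigma / ln (128 / kap))); split.
  - by rewrite lt_min ltr01 divr_gt0.
  - by rewrite ge_min lexx.
  - by rewrite -ler_pdivlMr// ge_min lexx orbT.
have hnu : 0 < nu <= 1 by rewrite nu0.
pose X := expR (- (7 * K + 2) / nu).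
have X0 : 0 < X by exact: expR_gt0.
(* The size of [del] is fixed after [nu]: since [n >= nu W], this bound yields
   [h^n <= exp (- (7 K + 2) W)]. *)
have [del0 [del00 del1 del2 del3]] : exists del0, [/\ 0 < del0, del0 <= a1, del0 <= a2 &
    4 * del0 / ((1 - theta) / 2) <= X].
  exists (Num.min a1 (Num.min a2 (X * ((1 - theta) / 2) / 4))); split.
  - by rewrite !lt_min a10 a20 divr_gt0// mulr_gt0.
  - by rewrite ge_min lexx.
  - by rewrite !ge_min lexx orbT.
  - rewrite ler_pdivrMr//; set t := Num.min _ _.
    have : t <= X * ((1 - theta) / 2) / 4 by rewrite !ge_min lexx !orbT.
    by clear; lra.
pose q1 := 8 * expR 3 + 128 / a ^+ 2 * expR 3.
pose q2 := 60 * expR (- 2 * ln theta) * (4 + 4 / tau) * expR 1.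
pose q3 := 12 * expR 1 * C / ((1 - theta) / 2 * c).
pose q4 : R := 24 * expR 1.
pose q5 := 128 / kap.
have q10 : 0 <= q1 by rewrite addr_ge0 ?mulr_ge0 ?expR_ge0 ?invr_ge0 ?(ltW a20').
have q20 : 0 <= q2.
  by rewrite !mulr_ge0 ?expR_ge0// addr_ge0// mulr_ge0// invr_ge0 ltW.
have q30 : 0 <= q3.
  rewrite divr_ge0 ?(mulr_ge0 (ltW r0) (ltW c0))//; apply: mulr_ge0; last exact: le_trans C1.
  by rewrite mulr_ge0 ?expR_ge0.
have q40 : 0 <= q4 by rewrite mulr_ge0 ?expR_ge0.
have q50 : 0 <= q5 by rewrite divr_ge0// ltW.
(* [Y] dominates the fixed thresholds demanded of [y]. A value of [omega] above [W0] forces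
   [Y <= sigma W], hence [Y <= y], together with [8 K <= sigma^2 W] and [4 <= eps W]. *)
pose Y := q1 + q2 + q3 + q4 + q5.
pose W0 := 1 + Y / sigma + 8 * K / sigma ^+ 2 + 4 / eps.
(* [W <= eta2 U] has to make [del] at most [del0] and to push the near-minimizing zero above height
   1. *)
have [eta2 [eta20 eta21 eta22 eta23]] : exists eta2, [/\ 0 < eta2, eta2 <= 1 / 8, K * eta2 <= del0 &
    (2 - ln theta) * eta2 < eta1].
  have l2 : 0 < 2 * (2 - ln theta) by clear -lt; lra.
  exists (Num.min (1 / 8) (Num.min (del0 / K) (eta1 / (2 * (2 - ln theta))))); split.
  - by rewrite !lt_min !divr_gt0.
  - by rewrite ge_min lexx.
  - by rewrite mulrC -ler_pdivlMr// !ge_min lexx orbT.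
  - set t := Num.min _ _; have : t <= eta1 / (2 * (2 - ln theta)) by rewrite !ge_min lexx !orbT.
    by rewrite ler_pdivlMr//; clear -eta10; lra.
have [x1 Hx1] := omega_small hA htheta0 eta20.
have [x2 Hx2] := omega_large hA htheta0 W0.
exists (Num.max 1 (Num.max x1 x2)) => x; rewrite !gt_max => /and3P[x1' /Hx1 hs /Hx2 hl].
apply: contrapT => N.
have hyp z : x `^ (1 - eps) <= z <= x -> `|Delta G z| < z * expR (- (1 + eps) * omega G theta z).
  by move=> hz; rewrite ltNge; apply/negP => h; apply: N; exists z.
have Y0 : 0 <= Y by rewrite /Y; clear -q10 q20 q30 q40 q50; lra.
have Ys0 : 0 <= Y / sigma by rewrite divr_ge0// ltW.
have Ks0 : 0 <= 8 * K / sigma ^+ 2 by rewrite divr_ge0 ?sqr_ge0// mulr_ge0// ltW.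
have es0 : 0 <= 4 / eps by rewrite divr_ge0// ltW.
have W1 : 1 <= omega G theta x by apply: le_trans hl; rewrite /W0; clear -Ys0 Ks0 es0; lra.
have WY : Y <= sigma * omega G theta x.
  by rewrite mulrC -ler_pdivrMr//; apply: le_trans hl; rewrite /W0; clear -Ks0 es0; lra.
have WK : 8 * K <= sigma ^+ 2 * omega G theta x.
  rewrite [leRHS]mulrC -ler_pdivrMr ?exprn_gt0//; apply: le_trans hl; rewrite /W0; clear -Ys0 es0; lra.
have We : 4 <= eps * omega G theta x.
  by rewrite mulrC -ler_pdivrMr//; apply: le_trans hl; rewrite /W0; clear -Ys0 Ks0; lra.
have WU : 8 * omega G theta x <= ln x.
  have lx : 0 <= ln x by rewrite ln_ge0// ltW.
  by have := ler_wpM2r lx eta21; clear -hs; lra.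
have U0 : 0 < ln x by clear -WU W1; lra.
have WU1 : omega G theta x <= ln x by clear -WU W1; lra.
have dU : K * omega G theta x / ln x * ln x = K * omega G theta x by rewrite divfK// gt_eqF.
have d0 : 0 < K * omega G theta x / ln x by rewrite divr_gt0// mulr_gt0// (lt_le_trans ltr01).
have dd : K * omega G theta x / ln x <= del0.
  rewrite ler_pdivrMr//; apply: le_trans (ler_wpM2l (ltW K0) hs) _.
  by rewrite mulrA ler_wpM2r// ltW.
have y1 : 1 + sigma * omega G theta x <= expR (sigma * omega G theta x) by exact: expR_ge1Dx.
have yY : Y <= expR (sigma * omega G theta x) by clear -y1 WY; lra.
have y11 : 1 <= expR (sigma * omega G theta x) by clear -y1 WY Y0; lra.
apply: (contradiction_at hA htheta0 HB HW hgap he aE Ka sE Kt kapE lamE hnu nul C1 c0 a1h x1' dU d0 _ _ _ W1 WU) => //.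
- exact: le_trans dd del1.
- exact: le_trans dd del2.
- apply: le_trans del3; rewrite ler_wpM2r ?invr_ge0 ?(ltW r0)//.
  by rewrite ler_wpM2l.
- by apply: le_trans We _; rewrite ler_wpM2l ?(ltW e0).
- apply: le_lt_trans (_ : _ <= (2 - ln theta) * eta2 * ln x) _; last by rewrite ltr_pM2r.
  have l2 : 0 <= 2 - ln theta by clear -lt; lra.
  rewrite -mulrA; apply: le_trans (ler_wpM2l l2 hs).
  have := ler_wpM2l (_ : 0 <= - ln theta) W1; rewrite oppr_ge0 => /(_ lt).
  by clear -W1; lra.
(* [exp (sigma W) >= (1 + sigma W / 2)^2], whose quadratic term is at least [2 K W] by the choice of
   [W0]. *)
- have h2 := expR_ge1Dx (sigma * omega G theta x / 2).
  have hp : 0 <= 1 + sigma * omega G theta x / 2 by clear -WY Y0; lra.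
  have -> : expR (sigma * omega G theta x) =
      expR (sigma * omega G theta x / 2) * expR (sigma * omega G theta x / 2).
    by rewrite -expRD -splitr.
  apply: le_trans (ler_pM hp hp h2 h2).
  have Wp : 0 <= omega G theta x by clear -W1; lra.
  have := ler_wpM2r Wp WK; have := mulr_ge0 (ltW K0) Wp.
  have -> : sigma ^+ 2 * omega G theta x * omega G theta x =
     (sigma * omega G theta x) * (sigma * omega G theta x) by ring.
  by move: (sigma * _) WY Y0; clear => u; lra.
- move: (expR (sigma * omega G theta x)) yY y11 => y yY y11.
  have y0 : 0 <= y by exact: le_trans y11.
  have yq : q1 <= y by move: yY; rewrite /Y; clear -q20 q30 q40 q50; lra.
  apply: (@le_trans _ _ (y * q1)); last by rewrite expr2 ler_wpM2l.
  rewrite mulrDl /q1 mulrDr; apply: lerD; first by rewrite mulrCA mulrA.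
  by rewrite ler_peMl// mulr_ge0 ?expR_ge0// divr_ge0// ltW.
- by apply: le_trans yY; rewrite /Y -/q2; clear -q10 q30 q40 q50; lra.
- rewrite -ler_pdivrMr ?(mulr_gt0 r0 c0)//.
  by apply: le_trans yY; rewrite /Y -/q3; clear -q10 q20 q40 q50; lra.
- by apply: le_trans yY; rewrite /Y -/q4; clear -q10 q20 q30 q50; lra.
- by apply: le_trans yY; rewrite /Y -/q5; clear -q10 q20 q30 q40; lra.
Qed.
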